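(* Let $T>0$, $n=2$ and $r>0$. Let the coefficients $a_{ij}^{\alpha\beta}$ be constant and the relaxed ellipticity condition hold. Let $\mathbf f\in L_\infty(0,T;\dot{\mathbf H}_\#^{r-2})\cap L_2(0,T;\dot{\mathbf H}_\#^{r-1})$ and $\mathbf u^0\in\dot{\mathbf H}_{\#\sigma}^{r}$. Let $\mathbf u$ be a weak solution on $[0,T]$ of the anisotropic Navier-Stokes initial value problem satisfying the strong energy inequality (such a solution is known to exist). Then $\mathbf u$ is of Serrin type and is such that $\mathbf u'\in L_\infty(0,T;\dot{\mathbf H}_{\#\sigma}^{r-2})\cap L_2(0,T;\dot{\mathbf H}_{\#\sigma}^{r-1})$, and the associated pressure satisfies $p\in L_\infty(0,T;\dot H_\#^{r-1})\cap L_2(0,T;\dot H_\#^{r})$.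
   Context: Spaces. $\mathbb T$ is the $n$-dimensional torus (unit cube $[0,1)^n$ with periodicity); functions/distributions on $\mathbb T$ are identified with 1-periodic ones on $\mathbb R^n$ (subscript $\#$). $\hat g(\xi)=\int_{\mathbb T}e^{-2\pi i x\cdot\xi}g(x)\,dx$, $\xi\in\mathbb Z^n$ (extended to distributions). With $\varrho(\xi)=2\pi(1+|\xi|^2)^{1/2}$ and $s\in\mathbb R$, $H^s_\#$ is the space of periodic distributions with $\|g\|_{H^s_\#}^2=\sum_{\xi\in\mathbb Z^n}\varrho(\xi)^{2s}|\hat g(\xi)|^2<\infty$; $\dot H^s_\#=\{g\in H^s_\#:\hat g(0)=0\}$. Bold letters denote $n$-component vector versions; $\dot{\mathbf H}^s_{\#\sigma}=\{\mathbf w\in\dot{\mathbf H}^s_\#:\operatorname{div}\mathbf w=0\}$; $\mathbf L_{2\#}=\mathbf H^0_\#$. The dual product is $\langle g,f\rangle_{\mathbb T}=\sum_\xi\hat g(\xi)\hat f(-\xi)$ (equal to $\int_{\mathbb T}gf$ for $L_2$ functions), summed over components for vectors/matrices. $\mathbb P_\sigma:\dot{\mathbf H}^s_\#\to\dot{\mathbf H}^s_{\#\sigma}$ is the Leray (orthogonal) projector. All functions are real-valued; $'$ is the distributional time derivative; repeated indices are summed from $1$ to $n$. Operator. The viscosity tensor $\mathbb A=\{a_{kj}^{\alpha\beta}\}$ is real (here constant) and satisfies the symmetry conditions $a_{kj}^{\alpha\beta}=a_{\alpha j}^{k\beta}=a_{k\beta}^{\alpha j}$. Relaxed ellipticity condition: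 there is a constant $C_{\mathbb A}>0$ such that $C_{\mathbb A}\,a_{kj}^{\alpha\beta}\zeta_{k\alpha}\zeta_{j\beta}\ge|\zeta|^2=\zeta_{k\alpha}\zeta_{k\alpha}$ for all symmetric $\zeta\in\mathbb R^{n\times n}$ with zero trace. $E_{j\beta}(\mathbf u)=\frac12(\partial_ju_\beta+\partial_\beta u_j)$, $(\boldsymbol{\mathfrak L}\mathbf u)_k=\partial_\alpha(a_{kj}^{\alpha\beta}E_{j\beta}(\mathbf u))$, and $a_{\mathbb T}(\mathbf u,\mathbf v)=\langle a_{ij}^{\alpha\beta}E_{j\beta}(\mathbf u),E_{i\alpha}(\mathbf v)\rangle_{\mathbb T}$. Problem: $\mathbf u'-\boldsymbol{\mathfrak L}\mathbf u+\nabla p+(\mathbf u\cdot\nabla)\mathbf u=\mathbf f$, $\operatorname{div}\mathbf u=0$ in $\mathbb T\times(0,T)$, $\mathbf u(\cdot,0)=\mathbf u^0$. Weak solution on $[0,T]$ (for $\mathbf f\in L_2(0,T;\dot{\mathbf H}^{-1}_\#)$, $\mathbf u^0\in\dot{\mathbf H}^0_{\#\sigma}$): $\mathbf u\in L_\infty(0,T;\dot{\mathbf H}^0_{\#\sigma})\cap L_2(0,T;\dot{\mathbf H}^1_{\#\sigma})$ such that $\langle\mathbf u'(\cdot,t)+\mathbb P_\sigma[(\mathbf u(\cdot,t)\cdot\nabla)\mathbf u(\cdot,t)],\mathbf w\rangle_{\mathbb T}+a_{\mathbb T}(\mathbf u(\cdot,t),\mathbf w)=\langle\mathbf f(\cdot,t),\mathbf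 w\rangle_{\mathbb T}$ for a.e. $t\in(0,T)$ and all $\mathbf w\in\dot{\mathbf H}^1_{\#\sigma}$, and $\langle\mathbf u(\cdot,0),\mathbf w\rangle_{\mathbb T}=\langle\mathbf u^0,\mathbf w\rangle_{\mathbb T}$ for all $\mathbf w\in\dot{\mathbf H}^0_{\#\sigma}$. (Here $\mathbf u$ is identified with its $\dot{\mathbf H}^0_{\#\sigma}$-weakly continuous in time representative, which exists.) A Serrin-type solution is a weak solution belonging to $L_2(0,T;\dot{\mathbf H}^{n/2}_{\#\sigma})$. The associated pressure is the spatially zero-mean distribution $p$ such that the momentum equation holds in the sense of distributions. Strong energy inequality: $\frac12\|\mathbf u(\cdot,t)\|_{\mathbf L_{2\#}}^2+\int_{t_0}^{t}a_{\mathbb T}(\mathbf u,\mathbf u)\,d\tau\le\frac12\|\mathbf u(\cdot,t_0)\|_{\mathbf L_{2\#}}^2+\int_{t_0}^{t}\langle\mathbf f,\mathbf u\rangle_{\mathbb T}\,d\tau$ for any $[t_0,t]\subset[0,T]$. *)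

(* Defs.v *)
From HB Require Import structures.
From mathcomp Require Import all_boot all_order all_algebra.
From mathcomp Require Import complex.
From mathcomp Require Import all_classical all_reals all_analysis.
Set Implicit Arguments.
Unset Strict Implicit.
Unset Printing Implicit Defensive.
Import Order.TTheory GRing.Theory Num.Theory.
Import numFieldNormedType.Exports.
Local Open Scope classical_set_scope.
Local Open Scope ring_scope.

(* Functions on the torus are 1-periodic functions on R^n;                    *)
(* periodic distributions are continuous linear functionals on the real test  *)
(* functions C^oo_#.                                                          *)

Section PeriodicDistributions.
Variables (R : realType) (n : nat).
Implicit Types (phi : 'rV[R]_n -> R) (xi : 'rV[int]_n) (s : R).

Definition partial (j : 'I_n) phi : 'rV[R]_n -> R :=
  fun x => 'D_(delta_mx 0 j) phi x.

(* The list of indices [:: j1; ...; jm] stands for d_j1 ... d_jm. *)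
Definition partials (js : seq 'I_n) phi : 'rV[R]_n -> R := foldr partial phi js.

Definition smooth phi : Prop := forall js,
  continuous (partials js phi) /\
  forall j x, derivable (partials js phi) x (delta_mx 0 j).

Definition periodic phi : Prop := forall x j, phi (x + delta_mx 0 j) = phi x.

Definition test phi : Prop := smooth phi /\ periodic phi.

Definition Cm_bound (m : nat) phi (M : R) : Prop :=
  forall js, (size js <= m)%N -> forall x, `|partials js phi x| <= M.

(* Only the values on test functions are meaningful. *)
Definition functional := ('rV[R]_n -> R) -> R.

Definition pdistr (g : functional) : Prop :=
  (forall (c : R) phi1 phi2, test phi1 -> test phi2 ->
     g (fun x => c * phi1 x + phi2 x) = c * g phi1 + g phi2) /\
  exists (C : R) (m : nat), forall phi M,
    test phi -> Cm_bound m phi M -> `|g phi| <= C * M.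

Definition addd (g h : functional) : functional := fun phi => g phi + h phi.
Definition oppd (g : functional) : functional := fun phi => - g phi.
Definition scaled (c : R) (g : functional) : functional := fun phi => c * g phi.
Definition sumd (I : finType) (g : I -> functional) : functional :=
  fun phi => \sum_i g i phi.
Definition partiald (j : 'I_n) (g : functional) : functional :=
  fun phi => - g (partial j phi).
Definition smulfd phi (g : functional) : functional :=
  fun chi => g (fun x => phi x * chi x).

Definition phase xi (x : 'rV[R]_n) : R :=
  2 * pi * \sum_(j < n) (xi 0 j)%:~R * x 0 j.
Definition cos_wave xi : 'rV[R]_n -> R := fun x => cos (phase xi x).
Definition sin_wave xi : 'rV[R]_n -> R := fun x => sin (phase xi x).

(* The value at x |-> exp(- 2 pi i x.xi) of the C-linear extension of g. *)
Definition fourier (g : functional) xi : R[i] :=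
  Complex (g (cos_wave xi)) (- g (sin_wave xi)).

Definition freq2 xi : R := \sum_(j < n) ((xi 0 j)%:~R ^+ 2).
Definition rho xi : R := 2 * pi * Num.sqrt (1 + freq2 xi).

Definition Hnorm2 s (g : functional) : \bar R :=
  (\esum_(xi in [set: 'rV[int]_n])
     (rho xi `^ (2 * s) * Normc.normc (fourier g xi) ^+ 2)%:E)%E.

Definition Hs s (g : functional) : Prop := pdistr g /\ (Hnorm2 s g < +oo)%E.

Definition Hdot s (g : functional) : Prop := Hs s g /\ fourier g 0 = 0.

(* The sum of an absolutely summable real family over Z^n. *)
Definition Zsum (F : 'rV[int]_n -> R) : R :=
  fine (\esum_(xi in [set: 'rV[int]_n]) (F^\+ xi)%:E) -
  fine (\esum_(xi in [set: 'rV[int]_n]) (F^\- xi)%:E).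

(* The sum defining <g, f> is real because g and f are real distributions:    *)
(* the terms at xi and - xi are conjugate. The same holds for Hinner.         *)
Definition dual (g f : functional) : R :=
  Zsum (fun xi => complex.Re (fourier g xi * fourier f (- xi))).

Definition Hinner s (g f : functional) : R :=
  Zsum (fun xi =>
    rho xi `^ (2 * s) * complex.Re (fourier g xi * conjc (fourier f xi))).

(* The pointwise product of g, h in L_2, as a distribution:                   *)
(* its value at phi is int g h phi = <g, phi h>.                              *)
Definition prodd (g h : functional) : functional :=
  fun phi => dual g (smulfd phi h).

End PeriodicDistributions.

Section VectorDistributions.
Variables (R : realType) (n : nat).

Definition vfunctional := 'I_n -> functional R n.
Implicit Types (w v F : vfunctional) (s : R).

Definition vdual F w : R := \sum_k dual (F k) (w k).
Definition vHinner s F w : R := \sum_k Hinner s (F k) (w k).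
Definition vHnorm2 s w : \bar R := (\sum_k Hnorm2 s (w k))%E.
Definition vadd F w : vfunctional := fun k => addd (F k) (w k).
Definition vsub F w : vfunctional := fun k => addd (F k) (oppd (w k)).

Definition divd w : functional R n := sumd (fun j => partiald j (w j)).

Definition div_free w : Prop := forall phi, test phi -> divd w phi = 0.

Definition vHdot s w : Prop := forall k, Hdot s (w k).

Definition vHdot_sigma s w : Prop := vHdot s w /\ div_free w.

(* v = P_sigma F. The orthogonal projections of the spaces Hdot^s             *)
(* for different s are compatible.                                            *)
Definition leray F v : Prop := exists s,
  [/\ vHdot s F, vHdot_sigma s v &
      forall w, vHdot_sigma s w -> vHinner s (vsub F v) w = 0].

Definition strain w (j b : 'I_n) : functional R n :=
  scaled (2^-1) (addd (partiald j (w b)) (partiald b (w j))).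

Definition convection w : vfunctional :=
  fun k => sumd (fun j => prodd (w j) (partiald j (w k))).

(* a k j alpha beta is the coefficient with lower indices k, j and upper      *)
(* indices alpha, beta.                                                       *)
Definition tensor := 'I_n -> 'I_n -> 'I_n -> 'I_n -> R.

Definition tensor_symmetric (a : tensor) : Prop := forall k j al be,
  a k j al be = a al j k be /\ a k j al be = a k be al j.

Definition relaxed_elliptic (a : tensor) : Prop := exists2 C : R, 0 < C &
  forall z : 'M[R]_n, z^T = z -> \tr z = 0 ->
    C * (\sum_k \sum_j \sum_al \sum_be a k j al be * z k al * z j be) >=
    \sum_k \sum_al z k al ^+ 2.

(* The stress a_kj^{alpha beta} E_{j beta}(w). *)
Definition stress (a : tensor) w (k al : 'I_n) : functional R n :=
  sumd (fun j => sumd (fun be => scaled (a k j al be) (strain w j be))).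

Definition Lop (a : tensor) w : vfunctional :=
  fun k => sumd (fun al => partiald al (stress a w k al)).

Definition aform (a : tensor) w v : R :=
  \sum_i \sum_al dual (stress a w i al) (strain v i al).

End VectorDistributions.

Section TimeDependent.
Variables (R : realType) (n : nat) (T : R).
Local Notation mu := (@lebesgue_measure R).
Implicit Types (g q : R -> functional R n) (u v f : R -> vfunctional R n).

Definition aet (P : R -> Prop) : Prop :=
  {ae mu, forall t, t \in `]0, T[ -> P t}.

(* The spaces H^s_# are separable Hilbert spaces in whose duals the test      *)
(* functions are dense, so that strong measurability is the measurability of  *)
(* t |-> <g(t), phi> for every test function phi.                             *)
Definition time_measurable g : Prop :=
  forall phi, test phi -> measurable_fun `]0, T[ (fun t => g t phi).

Definition Linf_Hdot s g : Prop :=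
  [/\ time_measurable g, aet (fun t => Hdot s (g t)) &
      exists M : R, aet (fun t => (Hnorm2 s (g t) <= (M ^+ 2)%:E)%E)].

Definition L2_Hdot s g : Prop :=
  [/\ time_measurable g, aet (fun t => Hdot s (g t)) &
      (\int[mu]_(t in `]0%R, T[) Hnorm2 s (g t) < +oo)%E].

Definition Linf_vHdot s u : Prop := forall k, Linf_Hdot s (fun t => u t k).
Definition L2_vHdot s u : Prop := forall k, L2_Hdot s (fun t => u t k).
Definition Linf_vHdot_sigma s u : Prop :=
  Linf_vHdot s u /\ aet (fun t => div_free (u t)).
Definition L2_vHdot_sigma s u : Prop :=
  L2_vHdot s u /\ aet (fun t => div_free (u t)).

Definition time_test_on (a b : R) (psi : R -> R) : Prop :=
  (forall m t, derivable (derive1n m psi) t 1) /\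
  (forall t, psi t != 0 -> a <= t <= b).

Definition time_test (psi : R -> R) : Prop :=
  exists a b : R, [/\ 0 < a, b < T & time_test_on a b psi].

(* Distributions on the product of the torus and ]0, T[ are given by their    *)
(* values on the products psi(t) phi(x), on which they are exactly the        *)
(* continuous bilinear forms (kernel theorem).                                *)
Definition stfunctional := (R -> R) -> functional R n.

Definition stdistr (p : stfunctional) : Prop :=
  [/\ forall psi (c : R) phi1 phi2,
        time_test psi -> test phi1 -> test phi2 ->
        p psi (fun x => c * phi1 x + phi2 x) = c * p psi phi1 + p psi phi2,
      forall phi (c : R) psi1 psi2,
        test phi -> time_test psi1 -> time_test psi2 ->
        p (fun t => c * psi1 t + psi2 t) phi = c * p psi1 phi + p psi2 phi
    & forall a b : R, 0 < a -> b < T -> exists (C : R) (m : nat),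
        forall psi phi M N, time_test_on a b psi -> test phi ->
        (forall i t, (i <= m)%N -> `|derive1n i psi t| <= M) -> Cm_bound m phi N ->
        `|p psi phi| <= C * M * N].

Definition st_eq (p q : stfunctional) : Prop :=
  forall psi phi, time_test psi -> test phi -> p psi phi = q psi phi.

Definition st_of g : stfunctional :=
  fun psi phi => \int[mu]_(t in `]0, T[) (psi t * g t phi).

Definition st_dt (p : stfunctional) : stfunctional :=
  fun psi phi => - p (derive1 psi) phi.
Definition st_partial (k : 'I_n) (p : stfunctional) : stfunctional :=
  fun psi => partiald k (p psi).

(* v is the distributional time derivative of u, as a locally integrable      *)
(* distribution-valued function of time.                                      *)
Definition time_derivative u v : Prop := forall k,
  [/\ aet (fun t => pdistr (v t k)),
      forall phi, test phi -> locally_integrable `]0, T[ (fun t => v t k phi) &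
      st_eq (st_dt (st_of (fun t => u t k))) (st_of (fun t => v t k))].

Definition weakly_continuous u : Prop :=
  (forall t, t \in `[0, T] -> vHdot_sigma 0 (u t)) /\
  (forall w, vHdot_sigma 0 w ->
     {within `[0, T], continuous (fun t => vdual (u t) w)}).

(* u is the weakly continuous representative. *)
Definition weak_solution (a : tensor R n) f (u0 : vfunctional R n) u : Prop :=
  [/\ Linf_vHdot_sigma 0 u, L2_vHdot_sigma 1 u, weakly_continuous u,
      exists2 v, time_derivative u v &
        aet (fun t => exists2 c, leray (convection (u t)) c &
          forall w, vHdot_sigma 1 w ->
            vdual (vadd (v t) c) w + aform a (u t) w = vdual (f t) w)
    & forall w, vHdot_sigma 0 w -> vdual (u 0) w = vdual u0 w].

Definition serrin_type (a : tensor R n) f (u0 : vfunctional R n) u : Prop :=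
  weak_solution a f u0 u /\ L2_vHdot_sigma (n%:R / 2) u.

Definition strong_energy_inequality (a : tensor R n) f u : Prop :=
  forall t0 t : R, 0 <= t0 -> t0 <= t -> t <= T ->
    2^-1 * fine (vHnorm2 0 (u t)) +
      \int[mu]_(tau in `[t0, t]) aform a (u tau) (u tau) <=
    2^-1 * fine (vHnorm2 0 (u t0)) +
      \int[mu]_(tau in `[t0, t]) vdual (f tau) (u tau).

Definition associated_pressure (a : tensor R n) f u (p : stfunctional) : Prop :=
  [/\ stdistr p,
      forall psi, time_test psi -> p psi (fun=> 1) = 0 &
      forall k, st_eq
        (fun psi => addd (addd (addd
           (st_dt (st_of (fun t => u t k)) psi)
           (oppd (st_of (fun t => Lop a (u t) k) psi)))
           (st_partial k p psi))
           (st_of (fun t => convection (u t) k) psi))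
        (st_of (fun t => f t k))].

End TimeDependent.

(* Main.v *)
(* In each Fourier mode the weak formulation says that the coefficient of [u'] is
   the Leray projection of that of the net force [f + L u - (u . grad) u]. Test it
   with [m ^ 2 u], where [m = min (rho, N) ^ r]: relaxed ellipticity yields the
   dissipation of [m u] in [H^1], and in the convolution bounding the nonlinear
   term one of the two interacting frequencies is comparable to the output one, so
   that it can carry the weight while the other is estimated in [H^(1/2)]. Half of the
   dissipation absorbs the result up to [kappa * |m u|^2] with [kappa] of order
   [|u|_(H^(1/2))^4 <= |u|_(L_2)^2 |u|_(H^1)^2], which is integrable in time, and
   this is where two dimensions are used. Gronwall's lemma bounds [m u] uniformly
   in [N], whence [u] is in [L_oo H^r] and [L_2 H^(r+1)]. The net force is then in
   [L_oo H^(r-2)] and [L_2 H^(r-1)], hence so are its Leray projection [u'] and its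
   gradient part [grad p]. A periodic distribution is determined by its Fourier
   coefficients because trigonometric convolution kernels approximate every test
   function in all C^m norms; this gives the momentum equation and the uniqueness
   of the pressure. *)
Require Import Defs.
From mathcomp Require Import all_boot all_order all_algebra.
From mathcomp Require Import complex zify ring lra.
From mathcomp Require Import all_classical all_reals all_analysis.
From mathcomp Require Import measurable_realfun.
Set Implicit Arguments.
Unset Strict Implicit.
Unset Printing Implicit Defensive.
Import Order.TTheory GRing.Theory Num.Theory.
Import numFieldNormedType.Exports.
Local Open Scope classical_set_scope.
Local Open Scope ring_scope.

(** * Sums over countable sets and over the lattice *)

(** A weak solution only meets time-independent test fields, so the weighted energy cannot be
    differentiated as a whole. Each Fourier coefficient is therefore treated as an absolutely
    continuous function of time, its square is differentiated, and the modes are summed only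
    afterwards. From that point on coefficients enter through absolute values, so every summand is
    nonnegative and sums and integrals with values in $[0,+\infty]$ may be exchanged freely. The
    truncation of the weight at [N] has two duties. It makes the weighted energy and its dissipation
    finite, so that half of the dissipation can be subtracted and Gronwall's lemma applied; and it
    keeps the doubling property of the weight with a constant independent of [N], so that nothing is
    lost in the limit. Distributions being real functionals, coefficients are taken against real
    cosine and sine waves. The mean over the torus is a limit of dyadic Riemann sums, and the
    smoothing kernel is a product of powers of $\cos^2\pi(x_j-y_j)$, whose mass and concentration
    follow from Wallis' recursion. *)

Section CountableSums.
Variables (R : realType) (T : countType).
Implicit Types (F G : T -> \bar R) (f g : T -> R).

(** Turns an unordered sum into a series over the codes of [T], to which monotone convergence and
    measurability of series apply. Integers that are not codes contribute [0]. *)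
Lemma esum_pickle F : (forall x, 0 <= F x)%E ->
  \esum_(x in [set: T]) F x = (\sum_(k <oo) oapp F 0 (pickle_inv k))%E.
Proof.
move=> F0; have G0 k : (0 <= oapp F 0 (pickle_inv k))%E by case: pickle_inv.
rewrite nneseries_esumT //.
rewrite (esumID (range (@pickle T))) // [X in (_ + X)%E]esum1 ?adde0; last first.
  move=> k [_ /= nk]; case E : (pickle_inv k) => [x|//]; exfalso; apply: nk.
  by exists x => //; have := @pickle_invK T k; rewrite E.
rewrite setTI esum_image; last by move=> x y _ _; exact: (pcan_inj pickleK_inv).
by apply: eq_esum => x _; rewrite pickleK_inv.
Qed.

Lemma esumZl (c : R) F : 0 <= c -> (forall x, 0 <= F x)%E ->
  \esum_(x in [set: T]) (c%:E * F x)%E = (c%:E * \esum_(x in [set: T]) F x)%E.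
Proof.
move=> c0 F0; rewrite !esum_pickle// => [|x]; last by rewrite mule_ge0.
rewrite -nneseriesZl => [|k _]; last by case: pickle_inv.
by apply: eq_eseriesr => k _; case: pickle_inv => //=; rewrite mule0.
Qed.

Lemma esum_ge1 F x : (forall x, 0 <= F x)%E ->
  (F x <= \esum_(x in [set: T]) F x)%E.
Proof.
move=> F0; rewrite -(@esum_set1 _ _ x F) // esum_mkcond.
by apply: le_esum => y _; case: ifP.
Qed.

Lemma esum_pt (c : T) F : (0 <= F c)%E ->
  \esum_(x in [set: T]) (if x == c then F x else 0)%E = F c.
Proof.
move=> F0; rewrite -[RHS](@esum_set1 _ _ c F) // [RHS]esum_mkcond.
by apply: eq_esum => x _; rewrite in_set1.
Qed.

Lemma measurable_esum d (X : measurableType d) (D : set X) (F : T -> X -> \bar R) :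
  measurable D -> (forall x t, 0 <= F x t)%E -> (forall x, measurable_fun D (F x)) ->
  measurable_fun D (fun t => \esum_(x in [set: T]) F x t).
Proof.
move=> mD F0 mF.
rewrite (_ : (fun _ => _) =
  (fun t => (\sum_(k <oo) oapp F (cst 0) (@pickle_inv T k) t)%E)); last first.
  apply/funext => t; rewrite esum_pickle//; apply: eq_eseriesr => k _.
  by case: pickle_inv.
apply: ge0_emeasurable_sum => [k t _ _|k _]; first by case: pickle_inv => /=.
by case: pickle_inv => //=.
Qed.

Lemma integral_esum d (X : measurableType d) (mu : {measure set X -> \bar R})
  (D : set X) (F : T -> X -> \bar R) :
  measurable D -> (forall x t, 0 <= F x t)%E -> (forall x, measurable_fun D (F x)) ->
  (\int[mu]_(t in D) (\esum_(x in [set: T]) F x t) =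
   \esum_(x in [set: T]) (\int[mu]_(t in D) F x t))%E.
Proof.
move=> mD F0 mF; rewrite esum_pickle => [|x]; last exact: integral_ge0.
transitivity (\int[mu]_(t in D) \sum_(k <oo) oapp F (cst 0) (@pickle_inv T k) t)%E.
  apply: eq_integral => t _; rewrite esum_pickle//.
  by apply: eq_eseriesr => k _; case: pickle_inv.
rewrite integral_nneseries// => [|k|k t _]; last 2 first.
- by case: pickle_inv => //=.
- by case: pickle_inv => /=.
by apply: eq_eseriesr => k _; case: pickle_inv => //=; rewrite integral0.
Qed.

(* AM-GM with a free parameter, optimised at the end. *)
Lemma esum_CS f g (a b x : R) : (forall y, 0 <= f y) -> (forall y, 0 <= g y) ->
  (\esum_(y in [set: T]) (f y ^+ 2)%:E <= a%:E)%E ->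
  (\esum_(y in [set: T]) (g y ^+ 2)%:E <= b%:E)%E ->
  0 <= x -> (x%:E <= \esum_(y in [set: T]) (f y * g y)%:E)%E -> x ^+ 2 <= a * b.
Proof.
move=> f0 g0 fa gb x0 xfg.
have a0 : 0 <= a.
  rewrite -lee_fin (le_trans _ fa)//; apply: esum_ge0 => y _.
  by rewrite lee_fin sqr_ge0.
have b0 : 0 <= b.
  rewrite -lee_fin (le_trans _ gb)//; apply: esum_ge0 => y _.
  by rewrite lee_fin sqr_ge0.
have key (d : R) : 0 < d -> 2 * x <= d * a + d^-1 * b.
  move=> d0; have di : 0 < d^-1 by rewrite invr_gt0.
  rewrite -lee_fin.
  apply: (@le_trans _ _ (\esum_(y in [set: T])
      (d%:E * (f y ^+ 2)%:E + d^-1%:E * (g y ^+ 2)%:E))%E); last first.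
    rewrite esumD => [|y _|y _]; rewrite -?EFinM ?lee_fin ?mulr_ge0 ?sqr_ge0 ?(ltW di) ?(ltW d0)//.
    rewrite !esumZl ?(ltW di) ?(ltW d0)// => [|y|y]; rewrite ?lee_fin ?sqr_ge0//.
    by rewrite EFinD !EFinM leeD// lee_pmul2l.
  rewrite EFinM; apply: (@le_trans _ _ (2%:E * \esum_(y in [set: T]) (f y * g y)%:E)%E).
    by rewrite lee_pmul2l.
  rewrite -esumZl// => [|y]; last by rewrite lee_fin mulr_ge0.
  apply: le_esum => y _; rewrite -!EFinM -EFinD lee_fin.
  rewrite -subr_ge0.
  suff -> : d * f y ^+ 2 + d^-1 * g y ^+ 2 - 2 * (f y * g y) = d^-1 * (d * f y - g y) ^+ 2.
    by rewrite mulr_ge0 ?sqr_ge0 ?(ltW di).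
  by field; rewrite gt_eqF.
have [->|xn0] := eqVneq x 0; first by rewrite expr0n mulr_ge0.
have x1 : 0 < x by rewrite lt0r xn0.
have [a1|] := ltP 0 a.
  have := key (x / a) (divr_gt0 x1 a1).
  rewrite divfK ?gt_eqF// invf_div => h.
  have : x <= a / x * b by lra.
  rewrite -(ler_pM2r x1) => /le_trans; apply.
  by rewrite le_eqVlt (_ : a / x * b * x = a * b) ?eqxx//; field; rewrite gt_eqF.
move=> a2; have a3 : a = 0 by apply/eqP; rewrite eq_le a2.
have b1 : 0 < b + 1 by lra.
have := key ((b + 1) / x) (divr_gt0 b1 x1).
rewrite a3 mulr0 add0r invf_div => h; exfalso.
have : x / (b + 1) * b <= x.
  rewrite -mulrA ger_pMr// mulrC ler_pdivrMr//; lra.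
lra.
Qed.

End CountableSums.

Lemma esum_exchange (R : realType) (T1 T2 : choiceType) (F : T1 -> T2 -> \bar R) :
  (forall x y, 0 <= F x y)%E ->
  \esum_(x in [set: T1]) \esum_(y in [set: T2]) F x y =
  \esum_(y in [set: T2]) \esum_(x in [set: T1]) F x y.
Proof.
move=> F0; rewrite !esum_esum//.
rewrite (reindex_esum ([set: T2] `*`` (fun=> [set: T1])) _ (fun x => (x.2, x.1)))//.
split=> //=; first by move=> [i1 i2] [j1 j2] /= _ _ [] -> ->.
by move=> [i1 i2] _ /=; exists (i2, i1).
Qed.

Lemma esum_bij (R : realType) (T : choiceType) (e e' : T -> T) (F : T -> \bar R) :
  cancel e e' -> cancel e' e ->
  \esum_(x in [set: T]) F (e x) = \esum_(x in [set: T]) F x.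
Proof.
move=> K K'; rewrite [RHS](reindex_esum [set: T] [set: T] e)//.
split=> //; first by move=> x y _ _; exact: (can_inj K).
by move=> x _; exists (e' x).
Qed.

Lemma funrpos_split (R : realType) (T : Type) (F : T -> R) x : F x = F^\+ x - F^\- x.
Proof.
by rewrite /funrpos /funrneg /Num.max; case: ltP => h; case: ltP => k; lra.
Qed.

Lemma funrpos_norm (R : realType) (T : Type) (F : T -> R) x : `|F x| = F^\+ x + F^\- x.
Proof.
rewrite /funrpos /funrneg /Num.max; have [h|h] := leP 0 (F x).
  by rewrite ger0_norm//; case: ltP => k; lra.
by rewrite ltr0_norm//; case: ltP => k; lra.
Qed.

Section AbsolutelySummable.
Variables (R : realType) (n : nat).
Local Notation Z := 'rV[int]_n.
Implicit Types (F G : Z -> R).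

(** Finiteness of this sum is the side condition for the linearity of [Zsum], where [fine] would
    send an infinite part to [0]. *)
Definition asum F : \bar R := \esum_(x in [set: Z]) `|F x|%:E.

Lemma asum_ge0 F : (0 <= asum F)%E.
Proof. by apply: esum_ge0 => x _; rewrite lee_fin. Qed.

Lemma Zsum_pos F : (asum F < +oo)%E ->
  \esum_(x in [set: Z]) (F^\+ x)%:E \is a fin_num.
Proof.
move=> sF; rewrite ge0_fin_numE; last first.
  by apply: esum_ge0 => x _; rewrite lee_fin funrpos_ge0.
apply: le_lt_trans sF; apply: le_esum => x _; rewrite lee_fin.
by rewrite /funrpos ge_max normr_ge0 ler_norm.
Qed.

Lemma Zsum_neg F : (asum F < +oo)%E ->
  \esum_(x in [set: Z]) (F^\- x)%:E \is a fin_num.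
Proof.
move=> sF; rewrite ge0_fin_numE; last first.
  by apply: esum_ge0 => x _; rewrite lee_fin funrneg_ge0.
apply: le_lt_trans sF; apply: le_esum => x _; rewrite lee_fin.
by rewrite /funrneg ge_max normr_ge0 -normrN ler_norm.
Qed.

Lemma asumD F G : (asum F < +oo)%E -> (asum G < +oo)%E ->
  (asum (fun x => F x + G x)%R < +oo)%E.
Proof.
move=> sF sG; apply: (@le_lt_trans _ _ (asum F + asum G)%E); last exact: lte_add_pinfty.
rewrite /asum -esumD => [|x _|x _]; rewrite ?lee_fin//.
by apply: le_esum => x _; rewrite -EFinD lee_fin ler_normD.
Qed.

Lemma asumZ c F : (asum F < +oo)%E -> (asum (fun x => c * F x)%R < +oo)%E.
Proof.
move=> sF; rewrite /asum.
under eq_esum do rewrite normrM EFinM.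
by rewrite esumZl// lte_mul_pinfty.
Qed.

Lemma ZsumD F G : (asum F < +oo)%E -> (asum G < +oo)%E ->
  Zsum (fun x => F x + G x) = Zsum F + Zsum G.
Proof.
move=> sF sG; have sFG := asumD sF sG.
have [pF nF] := (Zsum_pos sF, Zsum_neg sF).
have [pG nG] := (Zsum_pos sG, Zsum_neg sG).
have [pFG nFG] := (Zsum_pos sFG, Zsum_neg sFG).
have p0 (H : Z -> R) x : (0 <= (H^\+ x)%:E)%E by rewrite lee_fin funrpos_ge0.
have n0 (H : Z -> R) x : (0 <= (H^\- x)%:E)%E by rewrite lee_fin funrneg_ge0.
set H := (fun x => F x + G x) in pFG nFG sFG *.
(* Positive and negative parts are not additive; the identity $H^++F^-+G^-=H^-+F^++G^+$ has only
   nonnegative terms and can be summed. *)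
have : (\esum_(x in [set: Z]) (H^\+ x)%:E + (\esum_(x in [set: Z]) (F^\- x)%:E
    + \esum_(x in [set: Z]) (G^\- x)%:E) =
  \esum_(x in [set: Z]) (H^\- x)%:E + (\esum_(x in [set: Z]) (F^\+ x)%:E
    + \esum_(x in [set: Z]) (G^\+ x)%:E))%E.
  rewrite -!esumD// => [|x _|x _]; rewrite ?adde_ge0//.
  apply: eq_esum => x _; rewrite -!EFinD; congr EFin.
  have h (K : Z -> R) : K x = K^\+ x - K^\- x by exact: funrpos_split.
  by have := h H; rewrite /H (h F) (h G) => e; lra.
rewrite /Zsum -/H -(fineK pFG) -(fineK nFG) -(fineK pF) -(fineK nF) -(fineK pG) -(fineK nG) /=.
move=> [e]; lra.
Qed.

Lemma ZsumN F : Zsum (fun x => - F x) = - Zsum F.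
Proof.
rewrite /Zsum opprB; congr (fine _ - fine _); apply: eq_esum => x _; congr EFin.
by rewrite /funrpos /funrneg opprK.
Qed.

Lemma ZsumZ c F : (asum F < +oo)%E -> Zsum (fun x => c * F x) = c * Zsum F.
Proof.
move=> sF.
have pos (d : R) : 0 <= d -> Zsum (fun x => d * F x) = d * Zsum F.
  move=> d0; rewrite /Zsum mulrBr.
  rewrite (@eq_esum _ _ _ _ (fun x => d%:E * (F^\+ x)%:E)%E) => [|x _]; last first.
    by rewrite -EFinM /funrpos maxr_pMr// mulr0.
  rewrite [X in _ - fine X](@eq_esum _ _ _ _ (fun x => d%:E * (F^\- x)%:E)%E) => [|x _]; last first.
    by rewrite -EFinM /funrneg maxr_pMr// mulr0 mulrN.
  rewrite !esumZl// => [|x|x]; rewrite ?lee_fin ?funrneg_ge0 ?funrpos_ge0//.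
  by rewrite !fineM//; [exact: Zsum_neg|exact: Zsum_pos].
have [c0|c0] := leP 0 c; first exact: pos.
have := pos (- c); rewrite oppr_ge0 ltW// => /(_ isT) e.
rewrite -[RHS]opprK -mulNr -e -ZsumN; congr Zsum; apply/funext => x.
by rewrite mulNr opprK.
Qed.

Lemma Zsum_le F (B : R) : (asum F <= B%:E)%E -> `|Zsum F| <= B.
Proof.
move=> FB; have sF : (asum F < +oo)%E by rewrite (le_lt_trans FB) ?ltry.
have [pF nF] := (Zsum_pos sF, Zsum_neg sF).
apply: (@le_trans _ _ (fine (asum F))); last first.
  by rewrite -lee_fin fineK// ge0_fin_numE// asum_ge0.
have p0 : 0 <= fine (\esum_(x in [set: Z]) (F^\+ x)%:E).
  by rewrite fine_ge0// esum_ge0// => x _; rewrite lee_fin funrpos_ge0.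
have n0 : 0 <= fine (\esum_(x in [set: Z]) (F^\- x)%:E).
  by rewrite fine_ge0// esum_ge0// => x _; rewrite lee_fin funrneg_ge0.
have -> : asum F = (\esum_(x in [set: Z]) (F^\+ x)%:E + \esum_(x in [set: Z]) (F^\- x)%:E)%E.
  rewrite -esumD => [|x _|x _]; rewrite ?lee_fin ?funrpos_ge0 ?funrneg_ge0//.
  by apply: eq_esum => x _; rewrite -EFinD funrpos_norm.
rewrite fineD// /Zsum ler_norml; apply/andP; split; lra.
Qed.

Lemma Zsum_pt (a : Z) F : (forall x, x != a -> F x = 0) -> Zsum F = F a.
Proof.
move=> F0; rewrite /Zsum.
rewrite (@eq_esum _ _ _ _ (fun x => if x == a then (F^\+ x)%:E else 0%E)); last first.
  by move=> x _; case: eqVneq => // xa; rewrite /funrpos F0// maxxx.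
rewrite [X in _ - fine X](@eq_esum _ _ _ _ (fun x => if x == a then (F^\- x)%:E else 0%E)); last first.
  by move=> x _; case: eqVneq => // xa; rewrite /funrneg F0// oppr0 maxxx.
rewrite !esum_pt ?lee_fin ?funrpos_ge0 ?funrneg_ge0//=.
by rewrite -funrpos_split.
Qed.

Lemma asum_pt (a : Z) F : (forall x, x != a -> F x = 0) -> (asum F < +oo)%E.
Proof.
move=> F0; rewrite /asum (@eq_esum _ _ _ _ (fun x => if x == a then `|F x|%:E else 0%E)).
  by rewrite esum_pt ?ltry// lee_fin.
by move=> x _; case: eqVneq => // xa; rewrite F0// normr0.
Qed.

End AbsolutelySummable.

(** * Lattice points of the plane and sums of powers of $\varrho$ *)

Section LatticeSums.
Variable R : realType.
Local Notation Z := 'rV[int]_2.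
Local Notation rho := (@rho R 2).
Implicit Types (xi eta : Z) (X : R).

Lemma freq2E xi : @freq2 R 2 xi = (xi 0 0)%:~R ^+ 2 + (xi 0 1)%:~R ^+ 2.
Proof. by rewrite /freq2 !big_ord_recl big_ord0 addr0; congr (_ + (xi 0 _)%:~R ^+ 2); apply/val_inj. Qed.

Lemma freq2_ge0 xi : 0 <= @freq2 R 2 xi.
Proof. by rewrite freq2E addr_ge0 ?sqr_ge0. Qed.

Lemma rho_sq xi : rho xi ^+ 2 = 4 * pi ^+ 2 * (1 + freq2 R xi).
Proof.
rewrite /Defs.rho exprMn sqr_sqrtr; last by rewrite addr_ge0 ?freq2_ge0.
by rewrite exprMn; congr (_ * _ * _); ring.
Qed.

Lemma rho_ge4 xi : 4 <= rho xi.
Proof.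
have p : 2 <= pi :> R := pi_ge2 R.
have s : 1 <= Num.sqrt (1 + freq2 R xi).
  by rewrite -[1 in X in X <= _]sqrtr1 ler_sqrt ?lerDl ?freq2_ge0// addr_ge0 ?freq2_ge0.
by rewrite /Defs.rho; nra.
Qed.

Lemma rho_ge1 xi : 1 <= rho xi.
Proof. by have := rho_ge4 xi; lra. Qed.

Lemma rho_gt0 xi : 0 < rho xi.
Proof. by have := rho_ge4 xi; lra. Qed.

Lemma rho_ge0 xi : 0 <= rho xi.
Proof. by rewrite ltW ?rho_gt0. Qed.

Lemma rhoN xi : rho (- xi) = rho xi.
Proof. by rewrite /Defs.rho !freq2E !mxE !rmorphN !sqrrN. Qed.

Lemma ord2P (j : 'I_2) : j = 0 \/ j = 1.
Proof. by case: j => [[|[|//]] i]; [left|right]; apply/val_inj. Qed.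

Lemma rho_coord xi j : 2 * pi * `|(xi 0 j)%:~R| <= rho xi.
Proof.
have p : 2 <= pi :> R := pi_ge2 R.
rewrite /Defs.rho ler_pM2l; last by lra.
rewrite -sqrtr_sqr ler_sqrt ?addr_ge0 ?freq2_ge0// freq2E.
by case: (ord2P j) => ->; have := sqr_ge0 ((xi 0 0)%:~R : R);
  have := sqr_ge0 ((xi 0 1)%:~R : R); lra.
Qed.

(** If two frequencies add up to an output frequency, the larger of them is at least half the output
    in the sense of [rho]. All nonlinear estimates rest on this. *)
Lemma rho_double eta xi : rho eta <= rho xi -> rho (eta + xi) <= 2 * rho xi.
Proof.
have [e0 x0] := (rho_ge0 eta, rho_ge0 xi).
rewrite -ler_sqr ?nnegrE// !rho_sq => h.
suff : rho (eta + xi) ^+ 2 <= (2 * rho xi) ^+ 2.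
  by rewrite ler_pXn2r// nnegrE ?rho_ge0// mulr_ge0.
rewrite [(2 * _) ^+ 2]exprMn !rho_sq.
have p : 0 < 4 * pi ^+ 2 :> R by rewrite mulr_gt0// exprn_gt0// pi_gt0.
rewrite [leRHS]mulrCA ler_pM2l//; move: h; rewrite ler_pM2l// !freq2E !mxE !rmorphD /=.
set a := _%:~R : R; set b := _%:~R : R; set c := _%:~R : R; set d := _%:~R : R.
by move=> h; have := sqr_ge0 (a - c); have := sqr_ge0 (b - d); nra.
Qed.

(** With [n] the integer part of [X], both coordinates lie between [-n] and [n], which leaves
    $(2n+1)^2\le(3X)^2$ points. *)
Lemma ball_count X : 1 <= X ->
  (\esum_(xi in [set: Z]) (if rho xi <= X then 1 else 0)%:E <= (9 * X ^+ 2)%:E)%E.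
Proof.
move=> X1; set n := Num.truncn X.
have /andP[nX Xn] : n%:R <= X < n.+1%:R by apply: Num.Theory.truncn_itv; lra.
pose mk (i j : 'I_(2 * n).+1) : Z :=
  \row_k (if k == 0 then (i : nat)%:Z - n%:Z else (j : nat)%:Z - n%:Z).
apply: (@le_trans _ _ (\esum_(xi in [set: Z])
   (\sum_(i < (2 * n).+1) \sum_(j < (2 * n).+1) (if xi == mk i j then 1 else 0))))%E.
  apply: le_esum => xi _; case: ifP => [h|_]; last first.
    by rewrite sume_ge0// => i _; rewrite sume_ge0// => j _; case: ifP.
  have bd k : (absz (xi 0%R k) <= n)%N.
    rewrite -ltnS -(ltr_nat R); apply: le_lt_trans Xn; apply: le_trans h.
    have := rho_coord xi k; have p : 2 <= pi :> R := pi_ge2 R.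
    rewrite natr_absz intr_norm; have := normr_ge0 ((xi 0%R k)%:~R : R); nra.
  have lt k : (absz (xi 0 k + n%:Z)%R < (2 * n).+1)%N by have := bd k; lia.
  have ek k : (absz (xi 0 k + n%:Z)%R)%:Z - n%:Z = xi 0%R k by have := bd k; lia.
  rewrite (bigD1 (Ordinal (lt 0)))//= (bigD1 (Ordinal (lt 1)))//=.
  rewrite ifT; last first.
    apply/eqP/rowP => k; rewrite mxE /=.
    by case: (ord2P k) => ->; rewrite /= ?eqxx ek.
  rewrite -addeA leeDl// adde_ge0// ?sume_ge0// => i _; last rewrite sume_ge0// => j _.
    by case: ifP.
  by case: ifP.
rewrite esum_sum => [|xi i _ _]; last by rewrite sume_ge0// => j _; case: ifP.
under eq_bigr => i _.
  rewrite esum_sum => [|xi j _ _]; last by case: ifP.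
  under eq_bigr do rewrite (@esum_pt _ _ _ (fun=> 1%E))//.
  over.
have se (x : R) : (\sum_(i < (2 * n).+1) (x%:E : \bar R))%R = ((2 * n).+1%:R * x)%:E.
  transitivity (\sum_(i < (2 * n).+1) x%:E)%E; first by [].
  by rewrite sumEFin sumr_const card_ord mulr_natl.
under eq_bigr do rewrite se.
rewrite se mulr1 lee_fin.
have -> : (2 * n).+1%:R = 2 * n%:R + 1 :> R by rewrite -addn1 natrD natrM.
have : 0 <= n%:R :> R by []. nra.
Qed.

(** The factor serves both signs of [q]: $1$ is enough when $q\ge0$ and $2^{-q}$ when $q<0$. *)
Lemma powR_ratio (q a b : R) : 0 < a -> a <= b -> b <= 2 * a ->
  a `^ q <= (1 + 2 `^ (- q)) * b `^ q.
Proof.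
move=> a0 ab ba; have b0 : 0 < b by lra.
have [q0|q0] := leP 0 q.
  apply: (@le_trans _ _ (b `^ q)).
    by rewrite ge0_ler_powR// nnegrE ltW.
  by rewrite ler_peMl ?powR_ge0// lerDl powR_ge0.
have : b `^ (- q) <= (2 * a) `^ (- q).
  by rewrite ge0_ler_powR ?oppr_ge0 ?nnegrE// ?mulr_ge0// ltW.
rewrite powRM ?(ltW a0)// [b `^ _]powRN [a `^ (- q)]powRN.
have A0 := powR_gt0 q a0; have B0 := powR_gt0 q b0.
rewrite ler_pdivlMr// mulrC ler_pdivrMr// => h.
by apply: (le_trans h); rewrite ler_pM2r//; lra.
Qed.

(** Dyadic induction on [X]: the shell between [X / 2] and [X] has at most $9X^2$ points, each
    contributing at most $KX^{q-2}$, and [C] is the solution of $C=2^{-q}C+9K$. The shift by $2$ is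
    the dimension. *)
Lemma lattice_sum (q : R) : 0 < q -> exists2 C : R, 0 <= C & forall X, 0 <= X ->
  (\esum_(xi in [set: Z]) (if rho xi <= X then rho xi `^ (q - 2) else 0)%:E
     <= (C * X `^ q)%:E)%E.
Proof.
move=> q0; pose K : R := 1 + 2 `^ (- (q - 2)).
have K0 : 0 <= K by rewrite addr_ge0 ?powR_ge0.
have t0 : 0 < 2 `^ (- q) :> R by rewrite powR_gt0.
have h1 : 0 < 1 - 2 `^ (- q) :> R.
  rewrite subr_gt0 powRN invf_lt1 ?powR_gt0//; apply: (@le_lt_trans _ _ (1 `^ q)).
    by rewrite powR1.
  by apply: (gt0_ltr_powR q0); rewrite ?nnegrE// ltr1n.
pose C := 9 * K / (1 - 2 `^ (- q)).
have C0 : 0 <= C by rewrite mulr_ge0 ?mulr_ge0// invr_ge0 ltW.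
exists C => // X X0.
have [k Xk] : exists k : nat, X < 2 ^+ k.
  exists (Num.truncn X).+1; have /andP[_ Xn] := Num.Theory.truncn_itv X0.
  by apply: (lt_le_trans Xn); rewrite -natrX ler_nat ltnW// ltn_expl.
elim: k X X0 Xk => [|k IH] X X0 Xk.
  rewrite esum1 => [|xi _]; first by rewrite lee_fin mulr_ge0// powR_ge0.
  rewrite ifF//; apply/negbTE; rewrite -ltNge; have := rho_ge4 xi.
  by move: Xk; rewrite expr0; lra.
have [X1|X1] := ltP X 1.
  rewrite esum1 => [|xi _]; first by rewrite lee_fin mulr_ge0// powR_ge0.
  by rewrite ifF//; apply/negbTE; rewrite -ltNge; have := rho_ge4 xi; lra.
have Xp : 0 < X by lra.
have X20 : 0 <= X / 2 by rewrite divr_ge0.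
have X2k : X / 2 < 2 ^+ k by rewrite ltr_pdivrMr// -exprSr.
apply: (@le_trans _ _ (\esum_(xi in [set: Z])
   ((if rho xi <= X / 2 then rho xi `^ (q - 2) else 0)%:E +
   ((K * X `^ (q - 2))%:E * (if rho xi <= X then 1 else 0)%:E)))%E).
  apply: le_esum => xi _; rewrite -EFinM -EFinD lee_fin.
  have [h|h] := leP (rho xi) X; last by rewrite mulr0 addr0; case: ifP => // _; rewrite powR_ge0.
  rewrite mulr1; case: (leP (rho xi) (X / 2)) => h2.
    by rewrite lerDl mulr_ge0// powR_ge0.
  rewrite add0r; apply: powR_ratio => //; first exact: rho_gt0.
  by move: h2; rewrite ltr_pdivrMr// mulrC => /ltW.
rewrite esumD => [|xi _|xi _]; last 2 first.
- by rewrite lee_fin; case: ifP => // _; rewrite powR_ge0.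
- by rewrite -EFinM lee_fin !mulr_ge0 ?powR_ge0//; case: ifP.
rewrite esumZl => [||xi]; last 2 first.
- by rewrite mulr_ge0 ?powR_ge0.
- by rewrite lee_fin; case: ifP.
apply: (@le_trans _ _ ((C * (X / 2) `^ q)%:E + (K * X `^ (q - 2))%:E * (9 * X ^+ 2)%:E)%E).
  by rewrite leeD ?IH// lee_wpmul2l ?ball_count// lee_fin mulr_ge0 ?powR_ge0.
rewrite -EFinM -EFinD lee_fin.
have -> : (X / 2) `^ q = X `^ q * 2 `^ (- q).
  by rewrite powRM ?invr_ge0// -powR_inv1// -powRrM mulN1r.
have -> : X `^ q = X `^ (q - 2) * X ^+ 2.
  rewrite -powR_mulrn// -powRD ?gt_eqF ?implybT ?subrK//.
rewrite /C; set Y := X `^ (q - 2); set t := 2 `^ (- q) in t0 h1 *.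
clear C C0 IH.
rewrite le_eqVlt; apply/orP; left; apply/eqP.
by field; rewrite gt_eqF.
Qed.

Lemma esum_exhaust (F : Z -> R) (B : \bar R) : (forall xi, 0 <= F xi) ->
  (forall X, (\esum_(xi in [set: Z]) (if rho xi <= X then F xi else 0)%:E <= B)%E) ->
  (\esum_(xi in [set: Z]) (F xi)%:E <= B)%E.
Proof.
move=> F0 FB; apply: ge_ereal_sup => _ [A [finA _] <-].
rewrite fsbig_finite//=.
(* A crude radius whose ball contains the finite set [A]. *)
pose X : R := \sum_(xi <- finmap.enum_fset (fset_set A)) rho xi.
apply: le_trans (FB X); apply: esum_ge; exists A => //.
rewrite fsbig_finite//= big_seq [leRHS]big_seq; apply: lee_sum => xi xiA.
rewrite ifT// /X (big_rem xi)//= lerDl sumr_ge0// => eta _; exact: rho_ge0.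
Qed.

(** The exponent exceeds the dimension. The dyadic shell of inner radius $c$ contributes at most
    $9(2c)^2/c^3=36/c=72(1/c-1/(2c))$, and these bounds telescope. *)
Lemma lattice_cube : (\esum_(xi in [set: Z]) ((rho xi ^+ 3)^-1)%:E <= 72%:E)%E.
Proof.
have r3 xi : 0 <= (rho xi ^+ 3)^-1 by rewrite invr_ge0 exprn_ge0 ?rho_ge0.
have key (k : nat) : (\esum_(xi in [set: Z])
   (if (rho xi <= 2 ^+ k)%R then (rho xi ^+ 3)^-1%R else 0)%:E <= (72 * (1 - (2 ^+ k)^-1))%:E)%E.
  elim: k => [|k IH].
    rewrite esum1 => [|xi _]; first by rewrite lee_fin expr0; lra.
    by rewrite ifF//; apply/negbTE; rewrite -ltNge expr0; have := rho_ge4 xi; lra.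
  have c0 : 0 < (2 : R) ^+ k by rewrite exprn_gt0.
  set c : R := 2 ^+ k in c0 IH *.
  have c3 : 0 <= (c ^+ 3)^-1 by rewrite invr_ge0 exprn_ge0// ltW.
  apply: (@le_trans _ _ (\esum_(xi in [set: Z])
     ((if rho xi <= c then (rho xi ^+ 3)^-1 else 0)%:E +
     ((c ^+ 3)^-1%:E * (if rho xi <= 2 ^+ k.+1 then 1 else 0)%:E)))%E).
    apply: le_esum => xi _; rewrite -EFinM -EFinD lee_fin.
    have [h|h] := leP (rho xi) c.
      by case: ifP => _; rewrite ?mulr1 ?mulr0 ?lerDl// addr0.
    case: ifP => _; rewrite ?mulr1 ?mulr0 add0r// lef_pV2 ?posrE ?exprn_gt0 ?rho_gt0//.
    by rewrite ler_pXn2r ?nnegrE ?rho_ge0// ltW.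
  rewrite esumD => [|xi _|xi _]; last 2 first.
  - by rewrite lee_fin; case: ifP.
  - by rewrite -EFinM lee_fin mulr_ge0//; case: ifP.
  rewrite esumZl => [||xi]; last 2 first.
  - by [].
  - by rewrite lee_fin; case: ifP.
  apply: (@le_trans _ _ ((72 * (1 - c^-1))%:E + (c ^+ 3)^-1%:E * (9 * (2 ^+ k.+1) ^+ 2)%:E)%E).
    by rewrite leeD// lee_wpmul2l// ball_count// exprn_ege1// ler1n.
  rewrite -EFinM -EFinD lee_fin [2 ^+ k.+1]exprS -/c le_eqVlt; apply/orP; left; apply/eqP.
  by field; rewrite gt_eqF.
apply: esum_exhaust => // X.
have [k Xk] : exists k : nat, X <= 2 ^+ k.
  have [X0|X0] := ltP X 0; first by exists 0%N; rewrite (le_trans (ltW X0)).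
  exists (Num.truncn X).+1; have /andP[_ Xn] := Num.Theory.truncn_itv X0.
  by apply: (le_trans (ltW Xn)); rewrite -natrX ler_nat ltnW// ltn_expl.
apply: (@le_trans _ _ (72 * (1 - (2 ^+ k)^-1))%:E); last first.
  rewrite lee_fin; have : 0 <= ((2 : R) ^+ k)^-1 by rewrite invr_ge0 exprn_ge0.
  lra.
apply: le_trans (key k); apply: le_esum => xi _; rewrite lee_fin.
by case: ifP => [h|_]; [rewrite ifT// (le_trans h)|case: ifP].
Qed.

End LatticeSums.

Ltac nneg := repeat first [done | assumption | exact: sqr_ge0 | exact: normr_ge0 | exact: powR_ge0
  | exact: rho_ge0 | apply: mulr_ge0 | apply: addr_ge0 | apply: exprn_ge0 | apply: divr_ge0
  | rewrite invr_ge0 | apply: ltW; assumption].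

(** * Convolution estimates for nonnegative amplitudes *)

Section ConvolutionEstimates.
Variable R : realType.
Local Notation Z := 'rV[int]_2.
Local Notation rho := (@rho R 2).
Implicit Types (A : Z -> R).

(** Extended-real valued, so that it can be summed and exchanged before its finiteness is known. *)
Definition self_conv A (xi : Z) : \bar R := \esum_(eta in [set: Z]) (A eta * A (xi - eta))%:E.

Lemma esum_flip (xi : Z) (F : Z -> \bar R) :
  \esum_(eta in [set: Z]) F (xi - eta) = \esum_(eta in [set: Z]) F eta.
Proof.
have K : cancel (fun eta : Z => xi - eta) (fun eta => xi - eta) by move=> eta; rewrite subKr.
exact: (esum_bij _ K K).
Qed.

Lemma rho_flip (xi eta : Z) : rho (xi - eta) < rho eta -> rho xi <= 2 * rho eta.
Proof. by move=> /ltW /rho_double; rewrite subrK. Qed.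

(** The symmetry between [eta] and [xi - eta] reduces to the pairs with [rho xi <= 2 * rho eta], at
    the cost of a factor $2$. Cauchy-Schwarz spends [a] on the other factor, and summing over [xi]
    first costs $C(2\varrho(\eta))^q$ by [lattice_sum]. The real minorant [N] stands for the
    convolution so that squares can be taken. *)
Lemma conv_bound (q : R) : 0 < q -> exists2 C : R, 0 <= C &
  forall A a b (N : Z -> R), (forall xi, 0 <= A xi) ->
  (\esum_(xi in [set: Z]) (A xi ^+ 2)%:E <= a%:E)%E ->
  (\esum_(xi in [set: Z]) (rho xi `^ q * A xi ^+ 2)%:E <= b%:E)%E ->
  (forall xi, 0 <= N xi) -> (forall xi, ((N xi)%:E <= self_conv A xi)%E) ->
  (\esum_(xi in [set: Z]) (rho xi `^ (q - 2) * N xi ^+ 2)%:E <= (C * a * b)%:E)%E.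
Proof.
move=> q0; have [C C0 HC] := lattice_sum q0.
exists (4 * C * 2 `^ q) => [|A a b N A0 Aa Ab N0 NA]; first by rewrite !mulr_ge0// powR_ge0.
have a0 : 0 <= a.
  by rewrite -lee_fin (le_trans _ Aa)// esum_ge0// => xi _; rewrite lee_fin sqr_ge0.
pose ind (xi eta : Z) : R := if rho xi <= 2 * rho eta then 1 else 0.
have ind0 xi eta : 0 <= ind xi eta by rewrite /ind; case: ifP.
have ind2 xi eta : ind xi eta ^+ 2 = ind xi eta.
  by rewrite /ind; case: ifP; rewrite ?expr1n ?expr0n.
pose W xi : \bar R := \esum_(eta in [set: Z]) (ind xi eta * A eta ^+ 2)%:E.
have W0 xi : (0 <= W xi)%E.
  by apply: esum_ge0 => eta _; rewrite lee_fin mulr_ge0// sqr_ge0.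
have Wf xi : W xi \is a fin_num.
  rewrite ge0_fin_numE//; apply: (le_lt_trans _ (ltry a)); apply: le_trans Aa.
  apply: le_esum => eta _; rewrite lee_fin /ind; case: ifP => _.
    by rewrite mul1r.
  by rewrite mul0r sqr_ge0.
have NW xi : ((N xi ^+ 2)%:E <= (4 * a)%:E * W xi)%E.
  rewrite -(fineK (Wf xi)) -EFinM lee_fin.
  suff h : (N xi / 2) ^+ 2 <= a * fine (W xi) by move: h; nra.
  apply: (@esum_CS _ _ (fun eta => A (xi - eta)) (fun eta => ind xi eta * A eta)) => //.
  - by move=> eta; rewrite mulr_ge0.
  - by rewrite (esum_flip xi (fun eta => (A eta ^+ 2)%:E)).
  - rewrite fineK//; apply: le_esum => eta _.
    by rewrite exprMn ind2.
  - by rewrite divr_ge0.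
  - suff : ((N xi)%:E <= 2%:E * \esum_(eta in [set: Z]) (A (xi - eta) * (ind xi eta * A eta))%:E)%E.
      by rewrite -lee_pdivrMl// -EFinM mulrC.
    apply: (le_trans (NA xi)).
    rewrite (_ : 2%:E = 1%:E + 1%:E)%E; last by rewrite -EFinD; congr EFin; ring.
    rewrite ge0_muleDl// !mul1e.
    rewrite -[X in (_ + X)%E](esum_flip xi) -esumD => [|eta _|eta _];
      [|by rewrite lee_fin !mulr_ge0..].
    apply: le_esum => eta _; rewrite -EFinD lee_fin subKr.
    have AA : 0 <= A eta * A (xi - eta) by rewrite mulr_ge0.
    rewrite /ind; have [h|h] := leP (rho eta) (rho (xi - eta)).
      rewrite [X in _ <= _ + X](_ : _ = A eta * A (xi - eta)).
        by rewrite lerDr; case: ifP => _; rewrite ?mul1r ?mul0r ?mulr0// mulrC.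
      by rewrite ifT ?mul1r//; have := rho_double h; rewrite addrC subrK.
    rewrite [X in _ <= X + _](_ : _ = A eta * A (xi - eta)).
      by rewrite lerDl; case: ifP => _; rewrite ?mul1r ?mul0r ?mulr0.
    by rewrite ifT; [rewrite mul1r mulrC|exact: rho_flip].
apply: (@le_trans _ _ (\esum_(xi in [set: Z]) ((4 * a)%:E *
  \esum_(eta in [set: Z]) (rho xi `^ (q - 2) * (ind xi eta * A eta ^+ 2))%:E)%E)).
  apply: le_esum => xi _.
  under eq_esum do rewrite EFinM.
  rewrite esumZl ?powR_ge0// => [|eta]; last by rewrite lee_fin mulr_ge0// sqr_ge0.
  by rewrite muleCA [(_ * _ ^+ 2)%:E]EFinM lee_wpmul2l// lee_fin powR_ge0.
have p0 xi eta : (0 <= (rho xi `^ (q - 2) * (ind xi eta * A eta ^+ 2))%:E)%E.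
  by rewrite lee_fin !mulr_ge0 ?powR_ge0 ?sqr_ge0.
rewrite esumZl ?mulr_ge0// => [|xi]; last exact: esum_ge0.
rewrite esum_exchange//.
apply: (@le_trans _ _ ((4 * a)%:E * \esum_(eta in [set: Z])
   ((C * 2 `^ q)%:E * (rho eta `^ q * A eta ^+ 2)%:E))%E).
  rewrite lee_wpmul2l ?lee_fin ?mulr_ge0//; apply: le_esum => eta _.
  have Ae : 0 <= A eta ^+ 2 by rewrite sqr_ge0.
  rewrite (@eq_esum _ _ _ _ (fun xi => (A eta ^+ 2)%:E *
     (if rho xi <= 2 * rho eta then rho xi `^ (q - 2) else 0)%:E)%E); last first.
    move=> xi _; rewrite -EFinM /ind; congr EFin.
    by case: ifP => _; rewrite ?mul1r ?mul0r ?mulr0// mulrC.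
  rewrite esumZl// => [|xi]; last by rewrite lee_fin; case: ifP => // _; rewrite powR_ge0.
  rewrite -EFinM; apply: (@le_trans _ _ ((A eta ^+ 2)%:E * (C * (2 * rho eta) `^ q)%:E)%E).
    by rewrite lee_wpmul2l ?lee_fin// HC// mulr_ge0 ?rho_ge0.
  by rewrite -EFinM lee_fin powRM ?rho_ge0// le_eqVlt; apply/orP; left; apply/eqP; ring.
rewrite esumZl ?mulr_ge0 ?powR_ge0// => [|eta]; last by rewrite lee_fin mulr_ge0 ?powR_ge0 ?sqr_ge0.
apply: (@le_trans _ _ ((4 * a)%:E * ((C * 2 `^ q)%:E * b%:E))%E).
  by rewrite !lee_wpmul2l ?lee_fin ?mulr_ge0 ?powR_ge0.
by rewrite -!EFinM lee_fin le_eqVlt; apply/orP; left; apply/eqP; ring.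
Qed.

(* The low frequency factor carries half a derivative, which leaves room for the
   interpolation that makes the nonlinear term absorbable for large data. *)
Lemma trilinear_bound : exists2 C : R, 0 <= C &
  forall (A m : Z -> R) (K a d : R), (forall xi, 0 <= A xi) -> (forall xi, 0 <= m xi) -> 0 <= K ->
  (forall xi eta, rho xi <= 2 * rho eta -> m xi <= K * m eta) ->
  (\esum_(xi in [set: Z]) (rho xi * A xi ^+ 2)%:E <= a%:E)%E -> 0 < d ->
  (\esum_(xi in [set: Z]) ((m xi ^+ 2 * rho xi * A xi)%:E * self_conv A xi) <=
   (K * d * a)%:E * (\esum_(xi in [set: Z]) (rho xi ^+ 2 * (m xi ^+ 2 * A xi ^+ 2))%:E) +
   (K * C / d)%:E * \esum_(xi in [set: Z]) (rho xi * (m xi ^+ 2 * A xi ^+ 2))%:E)%E.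
Proof.
have [C C0 HC] := @lattice_sum R 1 ltr01.
exists C => // A m K a d A0 m0 K0 Km Aa d0.
have r0 := @rho_ge0 R; have rg := @rho_gt0 R.
have dp : 0 <= d^-1 by rewrite invr_ge0 ltW.
pose ind (eta zeta : Z) : R := if rho eta <= rho zeta then 1 else 0.
have ind0 xi eta : 0 <= ind xi eta by rewrite /ind; case: ifP.
pose w xi := m xi ^+ 2 * rho xi * A xi.
have w0 xi : 0 <= w xi by nneg.
(* [T1] keeps the pairs in which [eta] is the lower frequency; by symmetry this costs a factor
   $2$. *)
pose T1 xi eta := w xi * (ind eta (xi - eta) * (A eta * A (xi - eta))).
have T10 xi eta : (0 <= (T1 xi eta)%:E)%E by rewrite lee_fin; nneg.
apply: (@le_trans _ _ (\esum_(xi in [set: Z]) \esum_(eta in [set: Z]) (2 * T1 xi eta)%:E)%E).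
  apply: le_esum => xi _.
  rewrite /self_conv -esumZl; [|exact: w0|by move=> eta; rewrite lee_fin mulr_ge0].
  rewrite (_ : esum _ (fun eta => (2 * T1 xi eta)%:E) = \esum_(eta in [set: Z]) (T1 xi eta)%:E +
      \esum_(eta in [set: Z]) (T1 xi (xi - eta))%:E)%E; last first.
    rewrite (esum_flip xi (fun eta => (T1 xi eta)%:E)) -esumD//.
    by apply: eq_esum => eta _; rewrite -EFinD; congr EFin; ring.
  rewrite -esumD//; apply: le_esum => eta _; rewrite -EFinM -EFinD lee_fin /T1 subKr.
  have AA : 0 <= A eta * A (xi - eta) by rewrite mulr_ge0.
  have ww : 0 <= w xi * (A eta * A (xi - eta)) by rewrite mulr_ge0.
  rewrite [A (xi - eta) * A eta]mulrC -/(w xi) /ind.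
  have := le_total (rho eta) (rho (xi - eta)).
  by case: ifP => _; case: ifP => _ //= _; rewrite ?mul1r ?mul0r ?mulr0; lra.
pose H xi := m xi * rho xi * A xi.
(* Young's inequality with parameter $d\varrho(\eta)$ bounds [2 * T1] by [T2 + T3]. The sum of [T2]
   over [eta] is the hypothesis on [a]. In [T3] the high frequency [xi - eta] is fixed, and the sum
   of $\varrho(\eta)^{-1}$ over the lower ones is a lattice sum with $q=1$. *)
pose T2 xi eta := (rho xi ^+ 2 * (m xi ^+ 2 * A xi ^+ 2)) * (K * d * (rho eta * A eta ^+ 2)).
pose T3 xi eta := (K / d) * (ind eta (xi - eta) * (rho eta)^-1 * (m (xi - eta) ^+ 2 * A (xi - eta) ^+ 2)).
have T20 xi eta : (0 <= (T2 xi eta)%:E)%E.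
  by rewrite lee_fin; nneg; rewrite ltW.
have T30 xi eta : (0 <= (T3 xi eta)%:E)%E.
  by rewrite lee_fin; nneg; rewrite ltW.
apply: (@le_trans _ _ (\esum_(xi in [set: Z]) \esum_(eta in [set: Z]) ((T2 xi eta)%:E + (T3 xi eta)%:E))%E).
  apply: le_esum => xi _; apply: le_esum => eta _; rewrite -EFinD lee_fin.
  have [h|h] := leP (rho eta) (rho (xi - eta)); last first.
    by rewrite /T1 /ind [rho eta <= _]leNgt h /= mul0r !mulr0 addr_ge0// -lee_fin.
  rewrite /T1 /T2 /T3 /w /ind h !mul1r.
  have := rho_double h; rewrite addrC subrK => /Km.
  have := rg eta; have := A0 eta; have := A0 xi; have := A0 (xi - eta); have := m0 xi; have := m0 (xi - eta).
  have := rg xi.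
  set p := rho xi; set x := m xi; set y := m (xi - eta); set u := A xi; set v := A eta; set z := A (xi - eta).
  set s := rho eta.
  move=> p0 y0 x0 z0 u0 v0 s0 xy.
  apply: (@le_trans _ _ (2 * K * (x * p * u * v * (y * z)))).
    rewrite -subr_ge0 (_ : _ - _ = 2 * ((K * y - x) * (x * p * u * v * z))); last by ring.
    by apply: mulr_ge0 => //; apply: mulr_ge0; [rewrite subr_ge0|nneg].
  have -> : p ^+ 2 * (x ^+ 2 * u ^+ 2) * (K * d * (s * v ^+ 2)) +
     K / d * (s^-1 * (y ^+ 2 * z ^+ 2)) = K * (d * s * (x * p * u * v) ^+ 2 + (d * s)^-1 * (y * z) ^+ 2).
    by field; rewrite !gt_eqF.
  rewrite -subr_ge0 (_ : _ - _ = K * (d * s)^-1 * (d * s * (x * p * u * v) - y * z) ^+ 2); last first.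
    by field; rewrite !gt_eqF.
  by nneg.
under eq_esum do rewrite esumD//.
rewrite esumD => [|xi _|xi _]; [|exact: esum_ge0..].
apply: leeD.
  rewrite -esumZl => [||xi]; last 2 first.
  - rewrite !mulr_ge0 ?(ltW d0)// -lee_fin (le_trans _ Aa)// esum_ge0// => xi _.
    by rewrite lee_fin mulr_ge0// sqr_ge0.
  - by rewrite lee_fin; nneg.
  apply: le_esum => xi _; rewrite /T2.
  under eq_esum do rewrite EFinM.
  rewrite esumZl => [||eta]; last 2 first.
  - by nneg.
  - by rewrite lee_fin; nneg; rewrite ltW.
  rewrite muleC lee_wpmul2r//; first by rewrite lee_fin; nneg.
  under eq_esum do rewrite EFinM.
  rewrite esumZl => [||eta]; [|by nneg|by rewrite lee_fin; nneg].
  by rewrite [(K * d * a)%:E]EFinM lee_wpmul2l// lee_fin; nneg.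
rewrite (@eq_esum _ _ _ _ (fun xi => \esum_(eta in [set: Z]) (T3 xi (xi - eta))%:E)); last first.
  by move=> xi _; rewrite (esum_flip xi (fun eta => (T3 xi eta)%:E)).
rewrite esum_exchange//.
rewrite -esumZl => [||xi]; last 2 first.
- by nneg.
- by rewrite lee_fin; nneg.
apply: le_esum => eta _; rewrite /T3.
pose v := m eta ^+ 2 * A eta ^+ 2.
have v0 : 0 <= v by nneg.
rewrite (@eq_esum _ _ _ _ (fun xi => (K / d * v)%:E *
    (if rho (xi - eta) <= rho eta then rho (xi - eta) `^ (1 - 2) else 0)%:E)%E); last first.
  move=> xi _; rewrite subKr -/v -EFinM /ind; congr EFin.
  have -> : (1 - 2 : R) = -1 by ring.
  by case: ifP => _; rewrite ?powR_inv1//; ring.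
have vK : 0 <= K / d * v by nneg.
rewrite esumZl// => [|xi]; last by rewrite lee_fin; case: ifP => // _; rewrite powR_ge0.
have K1 : cancel (fun xi : Z => xi - eta) (fun xi => xi + eta) by move=> x; rewrite subrK.
have K2 : cancel (fun xi : Z => xi + eta) (fun xi => xi - eta) by move=> x; rewrite addrK.
rewrite (esum_bij (fun xi => (if rho xi <= rho eta then rho xi `^ (1 - 2) else 0)%:E) K1 K2).
apply: (@le_trans _ _ ((K / d * v)%:E * (C * rho eta `^ 1)%:E)%E).
  by rewrite lee_wpmul2l ?lee_fin// HC.
rewrite -!EFinM lee_fin powRr1// le_eqVlt; apply/orP; left; apply/eqP; rewrite -/v; ring.
Qed.

End ConvolutionEstimates.

(** * Smooth and periodic functions *)

Section Smooth.
Variables (R : realType) (n : nat).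
Local Notation V := 'rV[R]_n.
Implicit Types (f g phi : V -> R) (j : 'I_n).

(** Smoothness speaks of all iterated derivatives; exhibiting a class stable under one
    differentiation proves it without computing them. *)
Lemma smooth_coind (P : (V -> R) -> Prop) :
  (forall f, P f -> [/\ continuous f,
     forall j x, derivable f x (delta_mx 0 j) & forall j, P (partial j f)]) ->
  forall f, P f -> smooth f.
Proof.
move=> H f Pf js; have : P (partials js f).
  by elim: js => //= j js /H[_ _]; apply.
by case/H.
Qed.

Lemma partials_rcons js j f : partials (rcons js j) f = partials js (partial j f).
Proof. by rewrite /partials foldr_rcons. Qed.

Lemma smooth_continuous f : smooth f -> continuous f.
Proof. by move=> /(_ [::])[]. Qed.

Lemma smooth_derivable f j x : smooth f -> derivable f x (delta_mx 0 j).
Proof. by move=> /(_ [::])[_]; apply. Qed.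

Lemma smooth_partial f j : smooth f -> smooth (partial j f).
Proof. by move=> sf js; rewrite -partials_rcons; apply: sf. Qed.

Lemma partialD f g j : smooth f -> smooth g ->
  partial j (fun x => f x + g x) = (fun x => partial j f x + partial j g x).
Proof.
move=> sf sg; apply/funext => x; rewrite /partial.
by rewrite -deriveD//; apply: smooth_derivable.
Qed.

Lemma partialM f g j : smooth f -> smooth g ->
  partial j (fun x => f x * g x) = (fun x => f x * partial j g x + g x * partial j f x).
Proof.
move=> sf sg; apply/funext => x; rewrite /partial.
by rewrite (@deriveM _ _ f g)//; apply: smooth_derivable.
Qed.

Lemma partial_cst (c : R) j : partial j (fun _ : V => c) = fun=> 0.
Proof. by apply/funext => x; rewrite /partial derive_cst. Qed.

Lemma smooth_cst (c : R) : smooth (fun _ : V => c).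
Proof.
apply: (@smooth_coind (fun f => exists c, f = fun=> c)); last by exists c.
move=> f [d ->]; split; first exact: cst_continuous.
  by move=> j x; apply: derivable_cst.
by move=> j; exists 0; rewrite partial_cst.
Qed.

(** The derivative of a product is a sum of products, so a class stable under differentiation has to
    be generated by both operations. *)
Inductive smooth_alg : (V -> R) -> Prop :=
| Salg_smooth f : smooth f -> smooth_alg f
| Salg_add f g : smooth_alg f -> smooth_alg g -> smooth_alg (fun x => f x + g x)
| Salg_mul f g : smooth_alg f -> smooth_alg g -> smooth_alg (fun x => f x * g x).

Lemma smooth_algP f : smooth_alg f -> smooth f.
Proof.
apply: smooth_coind => {}f; elim=> {f}[f sf|f g Af [cf df pf] Ag [cg dg pg]|f g Af [cf df pf] Ag [cg dg pg]].
- split; [exact: smooth_continuous|by move=> *; apply: smooth_derivable|].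
  by move=> j; apply/Salg_smooth/smooth_partial.
- split=> [x|j x|j]; first exact: (cvgD (cf x) (cg x)).
    exact: derivableD.
  rewrite (_ : partial j _ = fun x => partial j f x + partial j g x); first exact: Salg_add.
  by apply/funext => x; rewrite /partial -deriveD.
- split=> [x|j x|j]; first exact: (cvgM (cf x) (cg x)).
    exact: derivableM.
  rewrite (_ : partial j _ = fun x => f x * partial j g x + g x * partial j f x).
    by apply: Salg_add; apply: Salg_mul.
  by apply/funext => x; rewrite /partial (@deriveM _ _ f g).
Qed.

Lemma smoothD f g : smooth f -> smooth g -> smooth (fun x => f x + g x).
Proof. by move=> sf sg; apply/smooth_algP/Salg_add; apply: Salg_smooth. Qed.

Lemma smoothM f g : smooth f -> smooth g -> smooth (fun x => f x * g x).
Proof. by move=> sf sg; apply/smooth_algP/Salg_mul; apply: Salg_smooth. Qed.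

Lemma testD f g : test f -> test g -> test (fun x => f x + g x).
Proof.
move=> [sf pf] [sg pg]; split; first exact: smoothD.
by move=> x j; rewrite pf pg.
Qed.

Lemma testM f g : test f -> test g -> test (fun x => f x * g x).
Proof.
move=> [sf pf] [sg pg]; split; first exact: smoothM.
by move=> x j; rewrite pf pg.
Qed.

Lemma test_cst c : test (fun _ : V => c).
Proof. by split=> //; apply: smooth_cst. Qed.

Lemma testZ c f : test f -> test (fun x => c * f x).
Proof. by move=> tf; apply: testM => //; apply: test_cst. Qed.

Lemma testN f : test f -> test (fun x => - f x).
Proof.
by move=> /(testZ (-1)); congr test; apply/funext => x; rewrite mulN1r.
Qed.

Lemma testB f g : test f -> test g -> test (fun x => f x - g x).
Proof. by move=> tf /testN; apply: testD. Qed.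

Lemma testX f k : test f -> test (fun x => f x ^+ k).
Proof.
move=> tf; elim: k => [|k IH]; first exact: test_cst.
rewrite (_ : (fun x => _) = fun x => f x * f x ^+ k); first exact: testM.
by apply/funext => x; rewrite exprS.
Qed.

Lemma test_sum (I : Type) (s : seq I) (F : I -> V -> R) : (forall i, test (F i)) ->
  test (fun x => \sum_(i <- s) F i x).
Proof.
move=> tF; elim: s => [|i s IH].
  rewrite (_ : (fun x => _) = fun=> 0); first exact: test_cst.
  by apply/funext => x; rewrite big_nil.
rewrite (_ : (fun x => _) = fun x => F i x + \sum_(i <- s) F i x); first exact: testD.
by apply/funext => x; rewrite big_cons.
Qed.

Lemma partialZ c f j : smooth f ->
  partial j (fun x => c * f x) = fun x => c * partial j f x.
Proof.
move=> sf; rewrite (partialM j (smooth_cst c) sf).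
by apply/funext => x; rewrite partial_cst mulr0 addr0.
Qed.

Lemma partialX f k j : smooth f ->
  partial j (fun x => f x ^+ k) = fun x => k%:R * f x ^+ k.-1 * partial j f x.
Proof.
move=> sf; apply/funext => x; rewrite /partial.
have -> : (fun x => f x ^+ k) = f ^+ k by apply/funext => y; rewrite fctE.
by rewrite deriveX//; apply: smooth_derivable.
Qed.

Lemma partial_sum (I : Type) (s : seq I) (F : I -> V -> R) j : (forall i, test (F i)) ->
  partial j (fun x => \sum_(i <- s) F i x) = fun x => \sum_(i <- s) partial j (F i) x.
Proof.
move=> tF; elim: s => [|i s IH].
  rewrite (_ : (fun x => _) = fun=> 0) ?partial_cst; apply/funext => x; rewrite big_nil//.
rewrite (_ : (fun x => _) = fun x => F i x + \sum_(i <- s) F i x).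
  rewrite partialD ?IH; last 2 first.
  - by case: (tF i).
  - by case: (test_sum s tF).
  by apply/funext => x; rewrite big_cons.
by apply/funext => x; rewrite big_cons.
Qed.

Lemma line_derive f x j (h : R) : smooth f ->
  is_derive h 1 (fun h => f (h *: delta_mx 0 j + x)) (partial j f (h *: delta_mx 0 j + x)).
Proof.
move=> sf; have := @smooth_derivable _ j (h *: delta_mx 0 j + x) sf.
rewrite /partial /derive /derivable.
have -> : (fun k : R => k^-1 *: ((f \o shift (h *: delta_mx 0 j + x)) (k *: delta_mx 0 j) - f (h *: delta_mx 0 j + x))) =
   (fun k : R => k^-1 *: (((fun h => f (h *: delta_mx 0 j + x)) \o shift h) (k *: (1 : R)) - f (h *: delta_mx 0 j + x))).
  apply/funext => k /=; congr (_ *: (f _ - _)).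
  by rewrite [k *: 1]mulr1 scalerDl addrA.
by move=> d; split.
Qed.

Lemma periodicZ f : Defs.periodic f -> forall x j (k : int), f (x + k%:~R *: delta_mx 0 j) = f x.
Proof.
move=> pf x j.
have pos (m : nat) y : f (y + m%:R *: delta_mx 0 j) = f y.
  elim: m => [|m IH]; first by rewrite scale0r addr0.
  have -> : m.+1%:R = m%:R + 1 :> R by rewrite -natr1.
  by rewrite scalerDl scale1r addrA pf IH.
case=> m; first exact: pos.
have := pos m.+1 (x - m.+1%:R *: delta_mx 0 j); rewrite subrK => ->.
by rewrite NegzE mulrNz scaleNr.
Qed.

Lemma periodic_partial f j : Defs.periodic f -> Defs.periodic (partial j f).
Proof.
move=> pf x i; rewrite /partial /derive.
rewrite (_ : (fun h : R => _) = (fun h => h^-1 *: ((f \o shift x) (h *: delta_mx 0 j) - f x)))//.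
by apply/funext => h /=; rewrite addrA !pf.
Qed.

Lemma test_partial f j : test f -> test (partial j f).
Proof. by move=> [sf pf]; split; [exact: smooth_partial|exact: periodic_partial]. Qed.

(** Subtracting integer parts, one coordinate at a time, moves the point into the compact unit cube
    without changing the value. *)
Lemma test_bounded f : test f -> exists2 B : R, 0 <= B & forall x, `|f x| <= B.
Proof.
move=> [sf pf].
pose K := [set v : V | forall i, `[0, 1]%classic (v ord0 i)].
have cK : compact K by exact: (@rV_compact R n (fun=> `[0, 1]%classic) (fun i => @segment_compact R 0 1)).
have cf : {within K, continuous f} by apply: continuous_subspaceT; apply: smooth_continuous.
have [B [_ HB]] := compact_bounded (continuous_compact cf cK).
have B1 : B < `|B| + 1 by rewrite (le_lt_trans (ler_norm _))// ltrDl.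
exists (`|B| + 1) => [|x]; first by rewrite addr_ge0.
pose y : V := \row_i (x 0 i - (Num.floor (x 0 i))%:~R).
have -> : f x = f y.
  have key (s : seq 'I_n) : f x = f (x + \sum_(i <- s) (- Num.floor (x 0 i))%:~R *: delta_mx 0 i).
    elim: s => [|i s IH]; first by rewrite big_nil addr0.
    by rewrite big_cons [X in _ + X]addrC addrA periodicZ.
  rewrite (key (index_enum _)); congr f; apply/rowP => i; rewrite !mxE summxE.
  rewrite (bigD1 i)//= !mxE !eqxx mulr1 big1 ?addr0 ?rmorphN// => j ji.
  by rewrite !mxE eqxx eq_sym (negbTE ji) mulr0.
apply: (HB _ B1) => /=; exists y => //.
move=> i; rewrite /= in_itv /= mxE.
have /andP[h1 h2] := Num.Theory.floor_itv (x 0 i); rewrite intrD in h2.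
by rewrite subr_ge0 h1 /= lerBlDr addrC ltW.
Qed.

Lemma test_smooth f : test f -> smooth f.
Proof. by case. Qed.

Lemma test_periodic f : test f -> Defs.periodic f.
Proof. by case. Qed.

Lemma testI f : smooth f -> Defs.periodic f -> test f.
Proof. by split. Qed.

End Smooth.

(* Otherwise [done] unfolds these predicates and tries to split them. *)
#[global] Opaque smooth test.

(** * The mean over the torus as a limit of Riemann sums *)

Section Mean.
Variable R : realType.
Local Notation V := 'rV[R]_2.
Implicit Types (phi psi : V -> R).

Definition row2 (s t : R) : V := \row_l (if l == 0 then s else t).

Lemma row2E (x : V) : x = row2 (x 0 0) (x 0 1).
Proof. by apply/rowP => l; rewrite mxE; case: (ord2P l) => ->. Qed.

Lemma row2_0 (s t : R) : row2 s t = s *: delta_mx 0 0 + row2 0 t.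
Proof.
by apply/rowP => l; rewrite !mxE; case: (ord2P l) => -> /=; rewrite ?mulr1 ?mulr0 ?addr0 ?add0r.
Qed.

Lemma row2_1 (s t : R) : row2 s t = t *: delta_mx 0 1 + row2 s 0.
Proof.
by apply/rowP => l; rewrite !mxE; case: (ord2P l) => -> /=; rewrite ?mulr1 ?mulr0 ?addr0 ?add0r.
Qed.

Lemma lip_line (g g' : R -> R) (B s t : R) : (forall h : R, is_derive h 1 g (g' h)) ->
  (forall h, `|g' h| <= B) -> `|g s - g t| <= B * `|s - t|.
Proof.
move=> dg gB.
wlog st : s t / t <= s.
  by move=> H; have [/H//|/ltW/H] := leP t s; rewrite distrC [`|t - s|]distrC.
have [c _ ->] : exists2 c, c \in `[t, s] & g s - g t = g' c * (s - t).
  apply: (@MVT_segment R g g' t s st).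
  by apply: derivable_within_continuous => x _; case: (dg x).
by rewrite normrM ler_wpM2r.
Qed.

Definition lip2 phi (L : R) := forall s t s' t' : R,
  `|phi (row2 s t) - phi (row2 s' t')| <= L * (`|s - s'| + `|t - t'|).

Lemma test_lip phi : test phi -> exists2 L : R, 0 <= L & lip2 phi L.
Proof.
move=> tphi; have sphi := test_smooth tphi.
have [B0 B00 H0] := test_bounded (test_partial 0 tphi).
have [B1 B10 H1] := test_bounded (test_partial 1 tphi).
exists (B0 + B1) => [|s t s' t']; first by rewrite addr_ge0.
have -> : phi (row2 s t) - phi (row2 s' t') =
   (phi (row2 s t) - phi (row2 s' t)) + (phi (row2 s' t) - phi (row2 s' t')) by ring.
apply: le_trans (ler_normD _ _) _.
have h0 : `|phi (row2 s t) - phi (row2 s' t)| <= B0 * `|s - s'|.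
  rewrite row2_0 [row2 s' t]row2_0.
  apply: (lip_line (g := fun h => phi (h *: delta_mx 0 0 + row2 0 t))
     (g' := fun h => partial 0 phi (h *: delta_mx 0 0 + row2 0 t))) => // h.
  exact: line_derive.
have h1 : `|phi (row2 s' t) - phi (row2 s' t')| <= B1 * `|t - t'|.
  rewrite row2_1 [row2 s' t']row2_1.
  apply: (lip_line (g := fun h => phi (h *: delta_mx 0 1 + row2 s' 0))
     (g' := fun h => partial 1 phi (h *: delta_mx 0 1 + row2 s' 0))) => // h.
  exact: line_derive.
have := normr_ge0 (s - s'); have := normr_ge0 (t - t'); nra.
Qed.

Definition grid (k i j : nat) phi : R := phi (row2 (i%:R / 2 ^+ k) (j%:R / 2 ^+ k)).

(** Dyadic grids are nested, so consecutive sums can be compared cell by cell. *)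
Definition rsum phi (k : nat) : R :=
  (4 ^+ k)^-1 * \sum_(i < 2 ^ k) \sum_(j < 2 ^ k) grid k i j phi.

Definition mean phi : R := lim (rsum phi k @[k --> \oo]).

Lemma sum_double (m : nat) (g : nat -> R) :
  \sum_(i < m.*2) g i = \sum_(i < m) (g i.*2 + g i.*2.+1).
Proof.
elim: m => [|m IH]; first by rewrite !big_ord0.
by rewrite doubleS !big_ord_recr /= IH addrA.
Qed.

(** The value at each coarse node is replaced by the average over four fine nodes, at $\ell^1$
    distance at most $2^{-k}$ from it. *)
Lemma rsum_step phi L k : 0 <= L -> lip2 phi L ->
  `|rsum phi k.+1 - rsum phi k| <= L * (2^-1) ^+ k.
Proof.
move=> L0 HL; set c : R := 2 ^+ k.
have c0 : 0 < c by rewrite exprn_gt0.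
have c4 : (4 : R) ^+ k = c * c by rewrite -exprMn; congr (_ ^+ k); ring.
have e1 : rsum phi k.+1 = (c * c)^-1 * (4^-1 * \sum_(i < 2 ^ k) \sum_(j < 2 ^ k)
   ((grid k.+1 i.*2 j.*2 phi + grid k.+1 i.*2 j.*2.+1 phi) +
    (grid k.+1 i.*2.+1 j.*2 phi + grid k.+1 i.*2.+1 j.*2.+1 phi))).
  have e4 : ((4 : R) ^+ k.+1)^-1 = (c * c)^-1 * 4^-1 by rewrite exprS c4 invfM mulrC.
  rewrite /rsum e4 -mulrA; congr (_ * (_ * _)).
  rewrite expnS mul2n (sum_double _ (fun i => \sum_(j < (2 ^ k).*2) grid k.+1 i j phi)).
  apply: eq_bigr => i _; rewrite !(sum_double _ (fun j => grid k.+1 _ j phi)) -big_split /=.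
  by apply: eq_bigr.
rewrite e1 /rsum c4 -mulrBr normrM ger0_norm ?invr_ge0 ?mulr_ge0 ?(ltW c0)//.
rewrite mulrC ler_pdivrMr ?mulr_gt0// mulr_sumr -sumrB.
have -> : L * 2^-1 ^+ k * (c * c) = \sum_(i < 2 ^ k) \sum_(j < 2 ^ k) (L / c).
  rewrite !sumr_const !card_ord -mulrnA -[(L / c) *+ _]mulr_natr natrM natrX -/c exprVn -/c.
  by field; rewrite gt_eqF.
apply: le_trans (ler_norm_sum _ _ _) (ler_sum _ _) => i _.
rewrite mulr_sumr -sumrB.
apply: le_trans (ler_norm_sum _ _ _) (ler_sum _ _) => j _.
have key a b : (a <= 1)%N -> (b <= 1)%N ->
   `|grid k.+1 (i.*2 + a) (j.*2 + b) phi - grid k i j phi| <= L / c.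
  move=> a1 b1; apply: le_trans (HL _ _ _ _) _.
  have h (x y : nat) : (y <= 1)%N -> `|((x.*2 + y)%:R / 2 ^+ k.+1 : R) - x%:R / 2 ^+ k| <= (2 * c)^-1.
    move=> y1; rewrite exprS -/c -muln2 natrD natrM.
    have -> : (x%:R * 2 + y%:R) / (2 * c) - x%:R / c = y%:R / (2 * c) by field; rewrite gt_eqF.
    rewrite normrM normfV [`|2 * c|]ger0_norm; last by rewrite mulr_ge0 ?ltW.
    have yR : y%:R <= 1%:R :> R by rewrite ler_nat.
    by rewrite ler_piMl ?invr_ge0 ?mulr_ge0 ?(ltW c0)// normr_nat.
  rewrite ler_wpM2l//; apply: (@le_trans _ _ ((2 * c)^-1 + (2 * c)^-1)).
    by rewrite lerD// h.
  by rewrite le_eqVlt; apply/orP; left; apply/eqP; field; rewrite gt_eqF.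
have := key 0%N 0%N isT isT; have := key 0%N 1%N isT isT.
have := key 1%N 0%N isT isT; have := key 1%N 1%N isT isT; rewrite !addn0 !addn1.
move: (grid _ _ _ _) (grid _ i.*2.+1 _ _) (grid _ i.*2 j.*2.+1 _) (grid _ i.*2 j.*2 _) (grid k i j phi).
move=> x1 x2 x3 x4 x5; rewrite !ler_norml => /andP[? ?] /andP[? ?] /andP[? ?] /andP[? ?].
apply/andP; split; lra.
Qed.

Lemma mean_cvg phi : test phi -> rsum phi k @[k --> \oo] --> mean phi.
Proof.
move=> /test_lip [L L0 HL]; suff : cvg (rsum phi k @[k --> \oo]) by [].
have : cvgn (series (telescope (rsum phi))).
  apply: normed_cvg; apply: (@series_le_cvg _ _ (geometric L (2^-1))) => [k|k|k|].
  - exact: normr_ge0.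
  - by rewrite /geometric /= mulr_ge0// exprn_ge0// invr_ge0.
  - exact: rsum_step.
  - by apply: is_cvg_geometric_series; rewrite ger0_norm ?invr_ge0// invf_lt1// ltr1n.
rewrite telescopeK => c.
have -> : rsum phi = (fun k => (rsum phi k - rsum phi 0%N) + rsum phi 0%N).
  by apply/funext => k; rewrite subrK.
by apply: is_cvgD => //; apply: is_cvg_cst.
Qed.

Lemma meanD phi psi : test phi -> test psi ->
  mean (fun x => phi x + psi x) = mean phi + mean psi.
Proof.
move=> tp ts; apply: cvg_lim => //.
rewrite (_ : rsum _ = fun k => rsum phi k + rsum psi k).
  by apply: cvgD; apply: mean_cvg.
apply/funext => k; rewrite /rsum -mulrDr -big_split /=; congr (_ * _).
by apply: eq_bigr => i _; rewrite -big_split.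
Qed.

Lemma meanZ c phi : test phi -> mean (fun x => c * phi x) = c * mean phi.
Proof.
move=> tp; apply: cvg_lim => //.
rewrite (_ : rsum _ = fun k => c * rsum phi k).
  by apply: cvgMl_tmp; apply: mean_cvg.
apply/funext => k; rewrite /rsum mulrCA [c * _]mulr_sumr; congr (_ * _).
by apply: eq_bigr => i _; rewrite mulr_sumr.
Qed.

Lemma meanN phi : test phi -> mean (fun x => - phi x) = - mean phi.
Proof.
move=> tp; rewrite -mulN1r -meanZ//; congr mean; apply/funext => x.
by rewrite mulN1r.
Qed.

Lemma meanB phi psi : test phi -> test psi ->
  mean (fun x => phi x - psi x) = mean phi - mean psi.
Proof. by move=> tp ts; rewrite meanD ?meanN//; apply: testN. Qed.

Lemma mean_cst c : mean (fun=> c) = c.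
Proof.
apply: cvg_lim => //; rewrite (_ : rsum _ = fun=> c); first exact: cvg_cst.
apply/funext => k; rewrite /rsum /grid !sumr_const !card_ord -mulrnA -[c *+ _]mulr_natr natrM natrX.
have -> : (4 : R) ^+ k = 2 ^+ k * 2 ^+ k by rewrite -exprMn; congr (_ ^+ k); ring.
by field; rewrite gt_eqF// exprn_gt0.
Qed.

Lemma mean_le phi psi : test phi -> test psi -> (forall x, phi x <= psi x) ->
  mean phi <= mean psi.
Proof.
move=> tp ts h; apply: (ler_cvg_to (mean_cvg tp) (mean_cvg ts)).
apply: nearW => k; rewrite /rsum ler_wpM2l ?invr_ge0 ?exprn_ge0//.
by apply: ler_sum => i _; apply: ler_sum => j _; apply: h.
Qed.

Lemma mean_bound phi B : test phi -> (forall x, `|phi x| <= B) -> `|mean phi| <= B.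
Proof.
move=> tp h; rewrite ler_norml -{1}(mean_cst (- B)) -{2}(mean_cst B).
by apply/andP; split; apply: mean_le => //; try exact: test_cst;
  move=> x; have := h x; rewrite ler_norml => /andP[].
Qed.

Lemma mean_sum (I : Type) (s : seq I) (F : I -> V -> R) : (forall i, test (F i)) ->
  mean (fun x => \sum_(i <- s) F i x) = \sum_(i <- s) mean (F i).
Proof.
move=> tF; elim: s => [|i s IH].
  by rewrite big_nil -[RHS](mean_cst 0); congr mean; apply/funext => x; rewrite big_nil.
rewrite big_cons -IH -meanD//; last exact: test_sum.
by congr mean; apply/funext => x; rewrite big_cons.
Qed.

(* Up to O(1/m) the Riemann sum of the derivative of a periodic function telescopes. *)
Lemma sum_derivative_small (g g' : R -> R) (L : R) (m : nat) : (0 < m)%N ->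
  (forall h : R, is_derive h 1 g (g' h)) -> g 1 = g 0 -> 0 <= L ->
  (forall s t : R, `|g' s - g' t| <= L * `|s - t|) ->
  `|\sum_(i < m) g' (i%:R / m%:R)| <= L.
Proof.
move=> m0 dg g10 L0 gL.
have m1 : 0 < m%:R :> R by rewrite ltr0n.
pose a (i : nat) : R := i%:R / m%:R.
have step (i : nat) : a i <= a i.+1 by rewrite ler_pM2r ?invr_gt0// ler_nat.
have d (i : nat) : a i.+1 - a i = m%:R^-1 by rewrite /a -mulrBl -natrB// subSnn mul1r.
have mvt (i : nat) : `|g' (a i) - m%:R * (g (a i.+1) - g (a i))| <= L / m%:R.
  have [c] : exists2 c, c \in `[a i, a i.+1] & g (a i.+1) - g (a i) = g' c * (a i.+1 - a i).
    apply: (@MVT_segment R g g' _ _ (step i)).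
    by apply: derivable_within_continuous => x _; case: (dg x).
  rewrite in_itv /= => /andP[c1 c2] ->.
  rewrite d mulrCA divff ?gt_eqF// mulr1; apply: le_trans (gL _ _) _.
  rewrite ler_wpM2l// -(d i) distrC ger0_norm ?subr_ge0//; lra.
have -> : \sum_(i < m) g' (i%:R / m%:R) =
    \sum_(i < m) (g' (a i) - m%:R * (g (a i.+1) - g (a i))).
  rewrite sumrB -mulr_sumr -[X in m%:R * X](big_mkord xpredT (fun i => g (a i.+1) - g (a i))).
  by rewrite (telescope_sumr (g \o a))// /= /a divff ?gt_eqF// mul0r g10 subrr mulr0 subr0.
apply: le_trans (ler_norm_sum _ _ _) _.
apply: (@le_trans _ _ (\sum_(i < m) L / m%:R)); first exact: ler_sum.
by rewrite sumr_const card_ord -[(L / _) *+ _]mulr_natr divfK// gt_eqF.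
Qed.

(** Each of the $2^k$ grid lines in direction [j] contributes at most [L] to the sum, by
    [sum_derivative_small], against the normalization $4^{-k}$. *)
Lemma mean_partial phi j : test phi -> mean (partial j phi) = 0.
Proof.
move=> tphi; have [sphi pphi] := (test_smooth tphi, test_periodic tphi).
have [L L0 HL] := test_lip (test_partial j tphi).
apply: cvg_lim => //.
have c0 k : 0 < (2 : R) ^+ k by rewrite exprn_gt0.
have bnd k : `|rsum (partial j phi) k| <= L * (2^-1) ^+ k.
  rewrite /rsum normrM ger0_norm ?invr_ge0 ?exprn_ge0//.
  have -> : (4 : R) ^+ k = 2 ^+ k * 2 ^+ k by rewrite -exprMn; congr (_ ^+ k); ring.
  rewrite mulrC ler_pdivrMr ?mulr_gt0// exprVn mulrA divfK ?gt_eqF//.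
  have -> : L * 2 ^+ k = \sum_(j < 2 ^ k) L.
    by rewrite sumr_const card_ord -[L *+ _]mulr_natr natrX.
  case: (ord2P j) HL => -> HL; first rewrite exchange_big /=;
    apply: le_trans (ler_norm_sum _ _ _) (ler_sum _ _) => i _.
    have := @sum_derivative_small (fun s => phi (s *: delta_mx 0 0 + row2 0 (i%:R / 2 ^+ k)))
      (fun s => partial 0 phi (s *: delta_mx 0 0 + row2 0 (i%:R / 2 ^+ k))) L (2 ^ k).
    rewrite natrX => H; rewrite /grid; under eq_bigr do rewrite row2_0.
    apply: H => //.
    - by rewrite expn_gt0.
    - by move=> h; apply: line_derive.
    - by rewrite scale1r scale0r addrC pphi add0r.
    - move=> s t; rewrite -!row2_0; have := HL s (i%:R / 2 ^+ k) t (i%:R / 2 ^+ k).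
      by rewrite subrr normr0 addr0.
  have := @sum_derivative_small (fun s => phi (s *: delta_mx 0 1 + row2 (i%:R / 2 ^+ k) 0))
    (fun s => partial 1 phi (s *: delta_mx 0 1 + row2 (i%:R / 2 ^+ k) 0)) L (2 ^ k).
  rewrite natrX => H; rewrite /grid; under eq_bigr do rewrite row2_1.
  apply: H => //.
  - by rewrite expn_gt0.
  - by move=> h; apply: line_derive.
  - by rewrite scale1r scale0r addrC pphi add0r.
  - move=> s t; rewrite -!row2_1; have := HL (i%:R / 2 ^+ k) s (i%:R / 2 ^+ k) t.
    by rewrite subrr normr0 add0r.
have g0 : L * (2^-1) ^+ k @[k --> \oo] --> (0 : R).
  rewrite -(mulr0 L); apply: cvgMl_tmp; apply: cvg_expr.
  by rewrite ger0_norm ?invr_ge0// invf_lt1// ltr1n.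
apply/cvgr0Pnorm_le => e e0; have /cvgr0Pnorm_le/(_ e e0) := g0.
apply: filterS => k h; apply: le_trans (bnd k) _; apply: le_trans h.
by rewrite ler_norm.
Qed.

Lemma mean_by_parts phi psi j : test phi -> test psi ->
  mean (fun x => partial j phi x * psi x) = - mean (fun x => phi x * partial j psi x).
Proof.
move=> tp ts; have [sp ss] := (test_smooth tp, test_smooth ts).
have := mean_partial j (testM tp ts).
rewrite (partialM j sp ss).
rewrite (meanD (testM tp (test_partial j ts)) (testM ts (test_partial j tp))).
rewrite addrC => /eqP; rewrite addr_eq0 => /eqP <-.
by congr mean; apply/funext => x; rewrite mulrC.
Qed.

End Mean.

(** * Cosine and sine waves *)

Section Waves.
Variables (R : realType) (n : nat).
Local Notation V := 'rV[R]_n.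
Local Notation Z := 'rV[int]_n.
Implicit Types (xi eta : Z) (x y : V) (j : 'I_n).

Lemma phaseDl xi eta x : phase (xi + eta) x = phase xi x + phase eta x.
Proof.
rewrite /phase -mulrDr -big_split /=; congr (_ * _); apply: eq_bigr => j _.
by rewrite mxE rmorphD mulrDl.
Qed.

Lemma phaseNl xi x : phase (- xi) x = - phase xi x.
Proof.
rewrite /phase -mulrN -sumrN; congr (_ * _); apply: eq_bigr => j _.
by rewrite mxE rmorphN mulNr.
Qed.

Lemma phaseDr xi x y : phase xi (x + y) = phase xi x + phase xi y.
Proof.
rewrite /phase -mulrDr -big_split /=; congr (_ * _); apply: eq_bigr => j _.
by rewrite mxE mulrDr.
Qed.

Lemma phaseNr xi x : phase xi (- x) = - phase xi x.
Proof.
rewrite /phase -mulrN -sumrN; congr (_ * _); apply: eq_bigr => j _.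
by rewrite mxE mulrN.
Qed.

Lemma phaseZ xi j (h : R) : phase xi (h *: delta_mx 0 j) = 2 * pi * (xi 0 j)%:~R * h.
Proof.
rewrite /phase -[RHS]mulrA; congr (_ * _); rewrite (bigD1 j)//= !mxE !eqxx mulr1 big1 ?addr0//.
by move=> i ij; rewrite !mxE eqxx (negbTE ij) !mulr0.
Qed.

Lemma phase0 x : phase (0 : Z) x = 0.
Proof. by rewrite /phase big1 ?mulr0// => j _; rewrite mxE mul0r. Qed.

Lemma cos_wave0 : cos_wave (0 : Z) = fun=> 1 :> R.
Proof. by apply/funext => x; rewrite /cos_wave phase0 cos0. Qed.

Lemma sin_wave0 : sin_wave (0 : Z) = fun=> 0 :> R.
Proof. by apply/funext => x; rewrite /sin_wave phase0 sin0. Qed.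

Lemma cos_waveN xi : cos_wave (- xi) = cos_wave xi :> (V -> R).
Proof. by apply/funext => x; rewrite /cos_wave phaseNl cosN. Qed.

Lemma sin_waveN xi : sin_wave (- xi) = (fun x => - sin_wave xi x) :> (V -> R).
Proof. by apply/funext => x; rewrite /sin_wave phaseNl sinN. Qed.

Lemma cos_cos_wave xi eta x : cos_wave xi x * cos_wave eta x =
  2^-1 * (cos_wave (xi + eta) x + cos_wave (xi - eta) x).
Proof. by rewrite /cos_wave !phaseDl !phaseNl !(cosD, sinD, cosN, sinN); field. Qed.

Lemma sin_sin_wave xi eta x : sin_wave xi x * sin_wave eta x =
  2^-1 * (cos_wave (xi - eta) x - cos_wave (xi + eta) x).
Proof. by rewrite /cos_wave /sin_wave !phaseDl !phaseNl !(cosD, sinD, cosN, sinN); field. Qed.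

Lemma cos_sin_wave xi eta x : cos_wave xi x * sin_wave eta x =
  2^-1 * (sin_wave (xi + eta) x - sin_wave (xi - eta) x).
Proof. by rewrite /cos_wave /sin_wave !phaseDl !phaseNl !(cosD, sinD, cosN, sinN); field. Qed.

Lemma cos_wave_shift xi x y :
  cos_wave xi (x - y) = cos_wave xi x * cos_wave xi y + sin_wave xi x * sin_wave xi y.
Proof. by rewrite /cos_wave phaseDr phaseNr cosB. Qed.

Lemma line_derive_inv (f : V -> R) x j (d : R) :
  is_derive (0 : R) 1 (fun h : R => f (h *: delta_mx 0 j + x)) d ->
  is_derive x (delta_mx 0 j) f d.
Proof.
case; rewrite /derivable /derive.
rewrite (_ : (fun h : R => h^-1 *: (((fun h => f (h *: delta_mx 0 j + x)) \o shift 0) (h *: 1) - f (0 *: delta_mx 0 j + x))) =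
  (fun h : R => h^-1 *: ((f \o shift x) (h *: delta_mx 0 j) - f x))).
  by move=> d1 d2; split.
apply/funext => h /=; rewrite scale0r add0r addr0; congr (_ *: (f (_ *: _ + _) - _)).
exact: mulr1.
Qed.

Lemma is_derive_affine (c d h : R) : is_derive h 1 (fun t : R => c * t + d) c.
Proof.
have -> : (fun t : R => c * t + d) = (c \*: (@id R)) + cst d by apply/funext.
rewrite -[X in is_derive _ _ _ X]addr0 -[c in X in is_derive _ _ _ X]mulr1.
exact: is_deriveD.
Qed.

Lemma is_derive_cos_wave xi x j : is_derive x (delta_mx 0 j) (cos_wave xi)
  (- (2 * pi * (xi 0 j)%:~R) * sin_wave xi x).
Proof.
apply: line_derive_inv; rewrite mulNr mulrC -mulNr.
rewrite (_ : (fun h => _) = cos \o (fun h => 2 * pi * (xi 0 j)%:~R * h + phase xi x)); last first.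
  by apply/funext => h /=; rewrite /cos_wave phaseDr phaseZ.
have -> : sin_wave xi x = sin (2 * pi * (xi 0 j)%:~R * 0 + phase xi x) by rewrite mulr0 add0r.
by apply: is_derive1_comp; apply: is_derive_affine.
Qed.

Lemma is_derive_sin_wave xi x j : is_derive x (delta_mx 0 j) (sin_wave xi)
  (2 * pi * (xi 0 j)%:~R * cos_wave xi x).
Proof.
apply: line_derive_inv; rewrite mulrC.
rewrite (_ : (fun h => _) = sin \o (fun h => 2 * pi * (xi 0 j)%:~R * h + phase xi x)); last first.
  by apply/funext => h /=; rewrite /sin_wave phaseDr phaseZ.
have -> : cos_wave xi x = cos (2 * pi * (xi 0 j)%:~R * 0 + phase xi x) by rewrite mulr0 add0r.
by apply: is_derive1_comp; apply: is_derive_affine.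
Qed.

Lemma partial_cos_wave xi j :
  partial j (cos_wave xi) = fun x => - (2 * pi * (xi 0 j)%:~R) * sin_wave xi x.
Proof. by apply/funext => x; rewrite /partial; case: (is_derive_cos_wave xi x j). Qed.

Lemma partial_sin_wave xi j :
  partial j (sin_wave xi) = fun x => 2 * pi * (xi 0 j)%:~R * cos_wave xi x.
Proof. by apply/funext => x; rewrite /partial; case: (is_derive_sin_wave xi x j). Qed.

Lemma continuous_phase xi : continuous (phase xi : V -> R).
Proof.
have S (s : seq 'I_n) : continuous (fun x : V => \sum_(j <- s) (xi 0 j)%:~R * x 0 j : R).
  elim: s => [|i s IH].
    rewrite (_ : (fun x : V => _) = fun=> 0); first exact: cst_continuous.
    by apply/funext => x; rewrite big_nil.
  rewrite (_ : (fun x : V => _) = fun x : V => (xi 0 i)%:~R * x 0 i + \sum_(j <- s) (xi 0 j)%:~R * x 0 j).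
    move=> x; apply: (cvgD _ (IH x)).
    exact: (cvgM (@cst_continuous _ _ _ x) (@coord_continuous R 1 n 0 i x)).
  by apply/funext => x; rewrite big_cons.
by move=> x; exact: (cvgM (@cst_continuous _ _ _ x) (S _ x)).
Qed.

Lemma trig_2piz (t : R) (k : int) :
  cos (2 * pi * k%:~R + t) = cos t /\ sin (2 * pi * k%:~R + t) = sin t.
Proof.
have pos (m : nat) (u : R) : cos (2 * pi * m%:R + u) = cos u /\ sin (2 * pi * m%:R + u) = sin u.
  have -> : 2 * pi * m%:R + u = u + pi *+ 2 *+ m by rewrite -mulr_natr [pi *+ 2]mulr2n; ring.
  by rewrite (periodicn (@cosD2pi R)) (periodicn (@sinD2pi R)).
case: k => m; first exact: pos.
rewrite NegzE mulrNz mulrN; have := pos m.+1 (- (2 * pi * m.+1%:R) + t).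
by rewrite addNKr => -[-> ->].
Qed.

(** Differentiation exchanges cosine and sine, so the class stable under it consists of the
    combinations of both. *)
Lemma test_wave (a b : R) xi : test (fun x => a * cos_wave xi x + b * sin_wave xi x).
Proof.
apply: testI; last first.
  move=> x j; rewrite /cos_wave /sin_wave -[delta_mx 0 j]scale1r phaseDr phaseZ mulr1 [phase xi x + _]addrC.
  by have [-> ->] := trig_2piz (phase xi x) (xi 0 j).
apply: (@smooth_coind _ _ (fun f => exists a b, f = fun x => a * cos_wave xi x + b * sin_wave xi x));
  last by exists a, b.
move=> f [c [d ->]].
have D x j : is_derive x (delta_mx 0 j) (fun x => c * cos_wave xi x + d * sin_wave xi x)
   (c * (- (2 * pi * (xi 0 j)%:~R) * sin_wave xi x) + d * (2 * pi * (xi 0 j)%:~R * cos_wave xi x)).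
  have h1 := is_derive_cos_wave xi x j; have h2 := is_derive_sin_wave xi x j.
  exact: (@is_deriveD _ _ _ (c \*: cos_wave xi) (d \*: sin_wave xi)).
split.
- move=> x; have c1 := continuous_comp (@continuous_phase xi x) (@continuous_cos R _).
  have c2 := continuous_comp (@continuous_phase xi x) (@continuous_sin R _).
  exact: (cvgD (cvgM (@cst_continuous _ _ c x) c1) (cvgM (@cst_continuous _ _ d x) c2)).
- by move=> j x; case: (D x j).
- move=> j; exists (d * (2 * pi * (xi 0 j)%:~R)), (- (c * (2 * pi * (xi 0 j)%:~R))).
  apply/funext => x; rewrite /partial; case: (D x j) => _ ->; ring.
Qed.

Lemma test_cos_wave xi : test (cos_wave xi : V -> R).
Proof.
have := test_wave 1 0 xi; congr test; apply/funext => x.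
by rewrite mul1r mul0r addr0.
Qed.

Lemma test_sin_wave xi : test (sin_wave xi : V -> R).
Proof.
have := test_wave 0 1 xi; congr test; apply/funext => x.
by rewrite mul1r mul0r add0r.
Qed.

End Waves.

(** * Convolution with trigonometric polynomials *)

Section WaveMeans.
Variable R : realType.
Local Notation V := 'rV[R]_2.
Local Notation Z := 'rV[int]_2.
Implicit Types (xi eta : Z) (phi : V -> R).

Lemma freq_neq0 xi : xi != 0 -> exists j, 2 * pi * (xi 0 j)%:~R != 0 :> R.
Proof.
move=> xi0; have [j xj] : exists j, xi 0 j != 0.
  apply: contrapT => h; move/eqP: xi0; apply; apply/rowP => j; rewrite mxE.
  by apply/eqP/negPn/negP => hj; apply: h; exists j.
by exists j; rewrite !mulf_neq0// ?intr_eq0// gt_eqF// pi_gt0.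
Qed.

Lemma mean_cos_wave xi : xi != 0 -> mean (cos_wave xi : V -> R) = 0.
Proof.
move=> /freq_neq0 [j c0]; have := mean_partial j (test_sin_wave R xi).
rewrite partial_sin_wave meanZ; last exact: test_cos_wave.
by move/eqP; rewrite mulf_eq0 (negbTE c0) => /eqP.
Qed.

Lemma mean_sin_wave xi : mean (sin_wave xi : V -> R) = 0.
Proof.
have [->|/freq_neq0 [j c0]] := eqVneq xi 0; first by rewrite sin_wave0 mean_cst.
have := mean_partial j (test_cos_wave R xi).
rewrite partial_cos_wave meanZ; last exact: test_sin_wave.
by move/eqP; rewrite mulf_eq0 oppr_eq0 (negbTE c0) => /eqP.
Qed.

(** An even trigonometric polynomial as a list of coefficients and frequencies. Repetitions are
    allowed, so that a product is formed by concatenation. *)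
Definition cosine_sum (s : seq (R * Z)) (x : V) : R := \sum_(p <- s) p.1 * cos_wave p.2 x.

Lemma cosine_sumM s s' : exists s'', forall x,
  cosine_sum s x * cosine_sum s' x = cosine_sum s'' x.
Proof.
rewrite /cosine_sum; elim: s => [|p s [t IH]].
  by exists [::] => x; rewrite !big_nil mul0r.
have [u Hu] : exists u, forall x, p.1 * cos_wave p.2 x * (\sum_(q <- s') q.1 * cos_wave q.2 x) =
    \sum_(q <- u) q.1 * cos_wave q.2 x.
  elim: s' {IH} => [|q s' [u Hu]]; first by exists [::] => x; rewrite !big_nil mulr0.
  exists [:: (2^-1 * p.1 * q.1, p.2 + q.2), (2^-1 * p.1 * q.1, p.2 - q.2) & u] => x.
  by rewrite !big_cons mulrDr Hu /= mulrACA cos_cos_wave; ring.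
by exists (u ++ t) => x; rewrite big_cons mulrDl Hu IH big_cat.
Qed.

Lemma cosine_sumX s k : exists s', forall x, cosine_sum s x ^+ k = cosine_sum s' x.
Proof.
elim: k => [|k [t IH]].
  by exists [:: (1, 0)] => x; rewrite /cosine_sum big_seq1 /= cos_wave0 mulr1.
by have [u Hu] := cosine_sumM s t; exists u => x; rewrite exprS IH Hu.
Qed.

(** The convolution of [phi] with the trigonometric polynomial [s]. It is a finite combination of
    waves and commutes with derivatives. *)
Definition smoothing s phi (x : V) : R := mean (fun y => phi y * cosine_sum s (x - y)).

Lemma smoothingE s phi : test phi -> smoothing s phi = fun x => \sum_(p <- s)
  (p.1 * mean (fun y => phi y * cos_wave p.2 y) * cos_wave p.2 x +
   p.1 * mean (fun y => phi y * sin_wave p.2 y) * sin_wave p.2 x).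
Proof.
move=> tp; apply/funext => x; rewrite /smoothing /cosine_sum.
have tc p := testM tp (test_cos_wave R p); have ts p := testM tp (test_sin_wave R p).
rewrite (_ : (fun y => _) = fun y => \sum_(p <- s)
  ((p.1 * cos_wave p.2 x) * (phi y * cos_wave p.2 y) +
   (p.1 * sin_wave p.2 x) * (phi y * sin_wave p.2 y))).
  rewrite mean_sum => [|p]; last by apply: testD; apply: testZ.
  apply: eq_bigr => p _; rewrite meanD; [|exact: testZ..].
  by rewrite !meanZ//; ring.
apply/funext => y; rewrite mulr_sumr; apply: eq_bigr => p _.
by rewrite cos_wave_shift; ring.
Qed.

Lemma test_smoothing s phi : test phi -> test (smoothing s phi).
Proof.
move=> tp; rewrite smoothingE//.
apply: (@test_sum R 2 _ s (fun (p : R * Z) (x : V) => _)) => p; exact: test_wave.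
Qed.

Lemma partial_smoothing s phi j : test phi ->
  partial j (smoothing s phi) = smoothing s (partial j phi).
Proof.
move=> tp; have tj := test_partial j tp; rewrite !smoothingE//.
rewrite (@partial_sum R 2 _ s (fun (p : R * Z) (x : V) => _)); last by move=> p; apply: test_wave.
apply/funext => x; apply: eq_bigr => p _.
have sc := test_smooth (test_cos_wave R p.2); have ss := test_smooth (test_sin_wave R p.2).
rewrite partialD; [|by apply: smoothM; [exact: smooth_cst|]..].
rewrite !partialZ// partial_cos_wave partial_sin_wave.
rewrite !(mean_by_parts j tp); [|exact: test_sin_wave|exact: test_cos_wave].
rewrite partial_cos_wave partial_sin_wave.
set c := 2 * pi * _.
rewrite (_ : (fun y => phi y * (- c * _)) = fun y => (- c) * (phi y * sin_wave p.2 y)); last first.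
  by apply/funext => y; ring.
rewrite (_ : (fun y => phi y * (c * _)) = fun y => c * (phi y * cos_wave p.2 y)); last first.
  by apply/funext => y; ring.
have tc := testM tp (test_cos_wave R p.2); have ts := testM tp (test_sin_wave R p.2).
by rewrite !meanZ//; ring.
Qed.

End WaveMeans.

(** For $\pi s\le\pi/4$ the mean value theorem gives $\sin(\pi s)\ge\pi s\cos(\pi/4)\ge s$, as
    $\pi\ge2$ and $\cos(\pi/4)\ge1/2$. Beyond, $\sin(\pi s)\ge\cos(\pi/4)\ge1/2\ge s$. *)
Lemma sin_pi_ge (R : realType) (s : R) : 0 <= s -> s <= 2^-1 -> s <= sin (pi * s).
Proof.
move=> s0 s1; have p2 := pi_ge2 R; have pp := pi_gt0 R.
have c4 : 2^-1 <= cos (pi / 4 : R).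
  have h : 0 <= cos (pi / 4 : R) by apply: cos_ge0_pihalf; apply/andP; split; lra.
  have : cos (pi / 4 *+ 2 : R) = 0.
    by rewrite -[RHS](cos_pihalf R) mulr2n; congr cos; field.
  rewrite cos_mulr2n mulr2n => e; nra.
have [h|h] := leP (pi * s) (pi / 4).
  have [->|sn0] := eqVneq s 0; first by rewrite mulr0 sin0.
  have sp : 0 < pi * s by rewrite mulr_gt0// lt0r sn0.
  have [c] : exists2 c, c \in `[0, pi * s] & sin (pi * s) - sin 0 = cos c * (pi * s - 0).
    apply: (@MVT_segment R sin cos 0 (pi * s) (ltW sp)).
    by apply: derivable_within_continuous => x _; exact: derivable_sin.
  rewrite in_itv /= sin0 !subr0 => /andP[c0 c1] ->.
  have : cos (pi / 4) <= cos c.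
    by rewrite leNgt ltr_cos ?in_itv /= -?leNgt; [lra|apply/andP; split; lra..].
  by move=> cc; nra.
have : cos (pi / 4) <= cos (pi / 2 - pi * s).
  rewrite leNgt ltr_cos ?in_itv /= -?leNgt; [lra|apply/andP; split; nra..].
rewrite cosB cos_pihalf sin_pihalf; lra.
Qed.

(** The right-hand side is $\sin^2(\pi t)$, which dominates the squared distance from [t] to the
    nearest integer, here [- k]. It turns the defect $1-\cos^2$ of the kernel into a distance on the
    torus. *)
Lemma int_dist (R : realType) (t : R) :
  exists k : int, (t + k%:~R) ^+ 2 <= 1 - 2^-1 * (1 + cos (2 * pi * t)).
Proof.
pose k := Num.floor (t + 2^-1); exists (- k).
have /andP[h1 h2] := Num.Theory.floor_itv (t + 2^-1); rewrite -/k intrD in h1 h2.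
rewrite rmorphN /=; set s := t - k%:~R.
have -> : cos (2 * pi * t) = cos (2 * (pi * `|s|)).
  have -> : cos (2 * (pi * `|s|)) = cos (2 * pi * s).
    rewrite -[RHS]cos_norm normrM [`|2 * pi|]ger0_norm ?mulr_ge0 ?pi_ge0//.
    by congr cos; ring.
  rewrite -(trig_2piz (2 * pi * s) k).1; congr cos; rewrite /s; ring.
have s2 : `|s| <= 2^-1 by rewrite /s ler_norml; apply/andP; split; lra.
have := sin_pi_ge (normr_ge0 s) s2.
have -> : cos (2 * (pi * `|s|)) = 1 - 2 * sin (pi * `|s|) ^+ 2.
  by rewrite (_ : 2 * _ = (pi * `|s|) *+ 2) ?cos_mulr2n ?sin2cos2 ?mulr2n; ring.
rewrite -[s ^+ 2]real_normK ?num_real//; have := normr_ge0 s; set a := `|s|; set b := sin _.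
by move=> a0 ab; nra.
Qed.

(** * Density of trigonometric polynomials *)

Section Kernel.
Variable R : realType.
Local Notation V := 'rV[R]_2.
Local Notation Z := 'rV[int]_2.
Variable x : V.
Local Notation e j := (delta_mx 0 j : Z).

(** This is $\cos^2\pi(x_j-y_j)$, equal to $1$ exactly when $x_j-y_j$ is an integer; high powers of
    it concentrate there. Its derivative is $\pi$ times [sg], which is $\sin2\pi(x_j-y_j)$. *)
Let tau (j : 'I_2) (y : V) : R := 2^-1 * (1 + cos_wave (e j) (x - y)).
Let sg (j : 'I_2) (y : V) : R := sin_wave (e j) (x - y).

Let test_tau j : test (tau j).
Proof.
have := testD (test_cst 2 (2^-1 : R)) (test_wave (2^-1 * cos_wave (e j) x) (2^-1 * sin_wave (e j) x) (e j)).
by congr test; apply/funext => y; rewrite /tau cos_wave_shift; ring.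
Qed.

Let sgE j : sg j = fun y => sin_wave (e j) x * cos_wave (e j) y + - cos_wave (e j) x * sin_wave (e j) y.
Proof. by apply/funext => y; rewrite /sg /sin_wave phaseDr phaseNr sinB mulNr. Qed.

Let test_sg j : test (sg j).
Proof. by rewrite sgE; apply: test_wave. Qed.

Let partial_tau i j : partial i (tau j) = fun y => (i == j)%:R * (pi * sg j y).
Proof.
have sc := test_smooth (test_cos_wave R (e j)); have ss := test_smooth (test_sin_wave R (e j)).
rewrite (_ : tau j = fun y => 2^-1 + (2^-1 * cos_wave (e j) x * cos_wave (e j) y + 2^-1 * sin_wave (e j) x * sin_wave (e j) y)).
  rewrite partialD; [|exact: smooth_cst|exact: (test_smooth (test_wave (2^-1 * cos_wave (e j) x) (2^-1 * sin_wave (e j) x) (e j)))].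
  rewrite partialD; [|by apply: smoothM; [exact: smooth_cst|]..].
  rewrite !partialZ// partial_cst partial_cos_wave partial_sin_wave sgE.
  apply/funext => y; rewrite !mxE eqxx /=.
  by case: eqVneq => _ /=; rewrite ?mulr1z ?mulr0z; field.
by apply/funext => y; rewrite /tau cos_wave_shift; ring.
Qed.

Let partial_sg i j : partial i (sg j) = fun y => - (i == j)%:R * (2 * pi * (2 * tau j y - 1)).
Proof.
have sc := test_smooth (test_cos_wave R (e j)); have ss := test_smooth (test_sin_wave R (e j)).
rewrite sgE partialD; [|by apply: smoothM; [exact: smooth_cst|]..].
rewrite !partialZ// partial_cos_wave partial_sin_wave.
apply/funext => y; rewrite !mxE eqxx /= /tau cos_wave_shift.
by case: eqVneq => _ /=; rewrite ?mulr1z ?mulr0z; field.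
Qed.

Let sg2 j y : sg j y ^+ 2 = 4 * tau j y * (1 - tau j y).
Proof.
by rewrite /sg /tau /sin_wave /cos_wave sin2cos2; field.
Qed.

Let T (i j : 'I_2) a b y := tau i y ^+ a * tau j y ^+ b.

Let test_T i j a b : test (T i j a b).
Proof. by apply: testM; apply: testX. Qed.

(** The derivative of [sg i y * tau i y ^+ a * tau j y ^+ b] along [i] has mean zero. Rewriting the
    square of [sg] by [sg2] makes it $2\pi((2a+2)(1-\tau_i)T-T)$; this is Wallis' recursion. *)
Let mean_T i j a b : i != j ->
  mean (fun y => (1 - tau i y) * T i j a b y) = (2 * a%:R + 2)^-1 * mean (T i j a b).
Proof.
move=> ij; have tt1 := testM (test_sg i) (testX a (test_tau i)).
have := mean_partial i (testM tt1 (testX b (test_tau j))).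
have [s1 s2] := (test_smooth tt1, test_smooth (testX b (test_tau j))).
have [s3 s4] := (test_smooth (test_sg i), test_smooth (testX a (test_tau i))).
have [s5 s6] := (test_smooth (test_tau i), test_smooth (test_tau j)).
rewrite partialM// partialM// !partialX// !partial_tau partial_sg eqxx (negbTE ij).
have tU : test (fun y => (1 - tau i y) * T i j a b y).
  exact: (testM (testB (test_cst 2 1) (test_tau _)) (test_T _ _ _ _)).
rewrite (_ : (fun y => _) = fun y => (2 * pi) * ((2 * a%:R + 2) * ((1 - tau i y) * T i j a b y) - T i j a b y)).
  have tV := testB (testZ (2 * a%:R + 2) tU) (test_T i j a b).
  rewrite (meanZ _ tV) (meanB (testZ _ tU) (test_T i j a b)) (meanZ _ tU) => /eqP; rewrite mulf_eq0 (gt_eqF (mulr_gt0 _ (pi_gt0 R)))//= subr_eq0 => /eqP <-.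
  by rewrite mulKf// gt_eqF// addr_ge0_gt0.
apply/funext => y; rewrite /T mul0r mulr0 mulr0 add0r mul1r mulN1r.
case: a {tt1 s1 s4 tU} => [|a] /=; first by rewrite !expr0; ring.
have := sg2 i y; rewrite -[a.+1%:R]natr1; set s := sg i y; set t := tau i y.
move=> h; rewrite -[LHS]/(_ ^+ b * _).
have -> : s * ((a%:R + 1) * t ^+ a * (pi * s)) = s ^+ 2 * ((a%:R + 1) * t ^+ a * pi) by ring.
by rewrite h exprS; ring.
Qed.

(** The mean of $\cos^{2a}(\pi s)$ over a period, by Wallis' recursion. *)
Fixpoint kernel_mass (a : nat) : R :=
  if a is a'.+1 then (1 - (2 * a'%:R + 2)^-1) * kernel_mass a' else 1.

Lemma kernel_mass_gt0 a : 0 < kernel_mass a.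
Proof.
elim: a => //= a IH; rewrite mulr_gt0// subr_gt0 invf_lt1; have : 0 <= a%:R :> R by []. 
  lra.
lra.
Qed.

Let mean_TE a b : mean (T 0 1 a b) = kernel_mass a * kernel_mass b.
Proof.
have step i j c d : i != j -> mean (T i j c.+1 d) = (1 - (2 * c%:R + 2)^-1) * mean (T i j c d).
  move=> ij; rewrite mulrBl mul1r -mean_T//.
  rewrite -(meanB (test_T i j c d) (testM (testB (test_cst 2 1) (test_tau _)) (test_T _ _ _ _))).
  by congr mean; apply/funext => y; rewrite /T exprS; ring.
have sw c d : T 0 1 c d = T 1 0 d c by apply/funext => y; rewrite /T mulrC.
elim: a => [|a IH]; last by rewrite step// IH /= mulrA.
elim: b => [|b IH]; last by rewrite sw step// -sw IH /= mulrCA.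
by rewrite mulr1 -[RHS](mean_cst 1); congr mean; apply/funext => y; rewrite /T !expr0 mulr1.
Qed.

Lemma kernel_mean N : mean (fun y => tau 0 y ^+ N * tau 1 y ^+ N) = kernel_mass N ^+ 2.
Proof. exact: mean_TE. Qed.

(** Relative to the mass of the kernel, the mean of the defect is $2/(2N+2)$: the kernel
    concentrates at [x] modulo the lattice. *)
Lemma kernel_defect N :
  mean (fun y => ((1 - tau 0 y) + (1 - tau 1 y)) * (tau 0 y ^+ N * tau 1 y ^+ N)) =
    2 * (2 * N%:R + 2)^-1 * kernel_mass N ^+ 2.
Proof.
have tU i j : test (fun y => (1 - tau i y) * T i j N N y).
  exact: (testM (testB (test_cst 2 1) (test_tau _)) (test_T _ _ _ _)).
rewrite (_ : (fun y => _) = fun y => (1 - tau 0 y) * T 0 1 N N y + (1 - tau 1 y) * T 1 0 N N y).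
  rewrite (meanD (tU 0 1) (tU 1 0)) !mean_T// (_ : T 1 0 N N = T 0 1 N N) ?mean_TE; first by ring.
  by apply/funext => y; rewrite /T mulrC.
by apply/funext => y; rewrite /T; ring.
Qed.

Let K N (y : V) := tau 0 y ^+ N * tau 1 y ^+ N.

Let tau01 j y : 0 <= tau j y <= 1.
Proof.
have := cos_le1 (phase (e j) (x - y)); have := cos_geN1 (phase (e j) (x - y)).
by rewrite /tau /cos_wave => h1 h2; apply/andP; split; lra.
Qed.

(** Periodicity and [int_dist] bound $|\varphi(y)-\varphi(x)|$ by $d/2$ plus $L^2/d$ times the
    defect. Averaged against the kernel, the second part is at most $d/2$ of the mass by
    [kernel_defect] and the hypothesis on [N]. *)
Lemma kernel_approx (N : nat) phi (L d : R) : test phi -> 0 <= L -> lip2 phi L -> 0 < d ->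
  L ^+ 2 / d * (2 * (2 * N%:R + 2)^-1) <= d / 2 ->
  `|mean (fun y => phi y * K N y) - phi x * kernel_mass N ^+ 2| <= d * kernel_mass N ^+ 2.
Proof.
move=> tp L0 HL d0 hN; pose D y := (1 - tau 0 y) + (1 - tau 1 y).
have tD : test D by apply: testD; apply: testB; [exact: test_cst|exact: test_tau|exact: test_cst|exact: test_tau].
have tK : test (K N) := test_T 0 1 N N.
have K0 y : 0 <= K N y by rewrite mulr_ge0// exprn_ge0//; case/andP: (tau01 0 y); case/andP: (tau01 1 y).
have tDK := testM tD tK.
have pw y : `|phi y - phi x| <= d / 2 + L ^+ 2 / d * D y.
  have [k0 hk0] := int_dist ((x - y) 0 0); have [k1 hk1] := int_dist ((x - y) 0 1).
  have -> : phi x = phi (x + k0%:~R *: delta_mx 0 0 + k1%:~R *: delta_mx 0 1).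
    by rewrite !(periodicZ (test_periodic tp)).
  have := HL (y 0 0) (y 0 1) (x 0 0 + k0%:~R) (x 0 1 + k1%:~R); rewrite -row2E.
  have -> : row2 (x 0 0 + k0%:~R) (x 0 1 + k1%:~R) = x + k0%:~R *: delta_mx 0 0 + k1%:~R *: delta_mx 0 1.
    apply/rowP => l; rewrite !mxE; case: (ord2P l) => -> /=; rewrite ?mulr1 ?mulr0 ?addr0//.
  move=> /le_trans; apply.
  have pe j : phase (e j) (x - y) = 2 * pi * (x - y) 0 j.
    by rewrite /phase !big_ord_recl big_ord0 addr0; case: (ord2P j) => ->; rewrite !mxE /=
      ?mul0r ?mul1r ?addr0 ?add0r; congr (_ * (x 0 _ - y 0 _)); apply/val_inj.
  rewrite /D /tau /cos_wave !pe; move: hk0 hk1.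
  have dist j (k : int) : `|y 0 j - (x 0 j + k%:~R)| ^+ 2 = ((x - y) 0 j + k%:~R) ^+ 2.
    by rewrite real_normK ?num_real// !mxE; ring.
  rewrite -!dist; move: (normr_ge0 (y 0 0 - (x 0 0 + k0%:~R))) (normr_ge0 (y 0 1 - (x 0 1 + k1%:~R))).
  set a := `|_|; set b := `|_|; set p := 1 - _; set q := 1 - _.
  move=> a0 b0 ap bq.
  (* Young's inequality, a quarter of [d] for each of the two coordinates. *)
  have aux (z : R) : L * z <= d / 4 + L ^+ 2 / d * z ^+ 2.
    rewrite -(ler_pM2l d0) -subr_ge0 (_ : _ - _ = (d / 2 - L * z) ^+ 2) ?sqr_ge0//.
    by field; rewrite gt_eqF.
  have c0 : 0 <= L ^+ 2 / d by rewrite divr_ge0 ?sqr_ge0// ltW.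
  have := aux a; have := aux b; set c := L ^+ 2 / d in c0 *; nra.
have tP := testM tp tK.
rewrite -kernel_mean -/(K N) -(meanZ _ tK) -(meanB tP (testZ _ tK)).
have up : mean (fun y => d / 2 * K N y + L ^+ 2 / d * (D y * K N y)) <= d * kernel_mass N ^+ 2.
  rewrite (meanD (testZ _ tK) (testZ _ tDK)) (meanZ _ tK) (meanZ _ tDK) kernel_mean kernel_defect.
  have := kernel_mass_gt0 N; set M := kernel_mass N => M0.
  have M2 : 0 < M ^+ 2 by rewrite exprn_gt0.
  have -> : d / 2 * M ^+ 2 + L ^+ 2 / d * (2 / (2 * N%:R + 2) * M ^+ 2) =
     (d / 2 + L ^+ 2 / d * (2 / (2 * N%:R + 2))) * M ^+ 2 by ring.
  by rewrite ler_pM2r//; lra.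
rewrite -kernel_mean -/(K N) in up.
have tU := testD (testZ (d / 2) tK) (testZ (L ^+ 2 / d) tDK).
have tV := testB tP (testZ (phi x) tK).
have bnd y : `|phi y * K N y - phi x * K N y| <= d / 2 * K N y + L ^+ 2 / d * (D y * K N y).
  rewrite -mulrBl normrM (ger0_norm (K0 y)); apply: le_trans (ler_wpM2r (K0 y) (pw y)) _.
  by rewrite mulrDl -(mulrA (L ^+ 2 / d)).
rewrite ler_norml; apply/andP; split.
  rewrite lerNl -(meanN tV); apply: le_trans up; apply: (mean_le (testN tV) tU) => y.
  by have := bnd y; rewrite ler_norml => /andP[h _]; rewrite lerNl.
apply: le_trans up; apply: (mean_le tV tU) => y.
by have := bnd y; rewrite ler_norml => /andP[_].
Qed.

End Kernel.

Section Density.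
Variable R : realType.
Local Notation V := 'rV[R]_2.
Local Notation Z := 'rV[int]_2.
Implicit Types (phi : V -> R) (g : functional R 2).

(** [N] is of order $L^2/d^2$. The polynomial [s] depends on the function only through its Lipschitz
    constant, so a single one serves all derivatives up to a given order. *)
Lemma smoothing_approx (L d : R) : 0 <= L -> 0 < d ->
  exists (s : seq (R * Z)) (J : R), 0 < J /\ forall phi, test phi -> lip2 phi L ->
    forall x, `|smoothing s phi x - J * phi x| <= d * J.
Proof.
move=> L0 d0; pose N := Num.truncn (L ^+ 2 / d / (d / 2)).
have c0 : 0 <= L ^+ 2 / d / (d / 2) by rewrite !divr_ge0 ?sqr_ge0// ltW.
have hN : L ^+ 2 / d * (2 * (2 * N%:R + 2)^-1) <= d / 2.
  have /andP[_] := Num.Theory.truncn_itv c0; rewrite -/N -[N.+1%:R]natr1 ltr_pdivrMr ?divr_gt0// => h.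
  have N1 : 0 < N%:R + 1 :> R by rewrite ltr_wpDl.
  rewrite (_ : 2 * (2 * N%:R + 2)^-1 = (N%:R + 1)^-1); last first.
    by field; rewrite !gt_eqF// -[X in _ + X]mulr1 -mulrDr mulr_gt0.
  by rewrite ler_pdivrMr// [d / 2 * _]mulrC ltW.
pose s1 : seq (R * Z) := [:: (2^-1, 0); (2^-1, delta_mx 0 0)].
pose s2 : seq (R * Z) := [:: (2^-1, 0); (2^-1, delta_mx 0 1)].
have [t1 h1] := cosine_sumX s1 N; have [t2 h2] := cosine_sumX s2 N.
have [s hs] := cosine_sumM t1 t2.
exists s, (kernel_mass R N ^+ 2); split; first by rewrite exprn_gt0// kernel_mass_gt0.
move=> phi tp HL x; rewrite [_ * phi x]mulrC.
apply: le_trans (kernel_approx x tp L0 HL d0 hN).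
rewrite le_eqVlt; apply/orP; left; apply/eqP; congr (`|_ - _|).
congr mean; apply/funext => y; rewrite -hs -h1 -h2 /cosine_sum !big_cons !big_nil /= cos_wave0.
by rewrite !addr0 mulr1 !mulrDr mulr1.
Qed.

Lemma partials_smoothing js s phi : test phi ->
  partials js (smoothing s phi) = smoothing s (partials js phi) /\ test (partials js phi).
Proof.
move=> tp; elim: js => [|j js [IH tj]] //=.
by rewrite IH partial_smoothing//; split=> //; apply: test_partial.
Qed.

Lemma partialsDZ js (c : R) phi psi : test phi -> test psi ->
  partials js (fun x => phi x + c * psi x) = fun x => partials js phi x + c * partials js psi x.
Proof.
move=> tp ts; elim: js => [|j js IH] //=.
have [_ tpj] := partials_smoothing js [::] tp; have [_ tsj] := partials_smoothing js [::] ts.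
rewrite IH (partialD j (test_smooth tpj) (test_smooth (testZ c tsj))).
by rewrite (partialZ c j (test_smooth tsj)).
Qed.

Lemma test_lips m phi : test phi -> exists2 L : R, 0 <= L &
  forall js, (size js <= m)%N -> lip2 (partials js phi) L.
Proof.
have mono psi (L L' : R) : L <= L' -> lip2 psi L -> lip2 psi L'.
  move=> LL H s t s' t'; apply: le_trans (H _ _ _ _) _.
  by rewrite ler_wpM2r// addr_ge0.
elim: m phi => [|m IH] phi tp.
  by have [L L0 HL] := test_lip tp; exists L => // js; rewrite leqn0 size_eq0 => /eqP ->.
have [L L0 HL] := test_lip tp.
have [L1 L10 H1] := IH _ (test_partial 0 tp); have [L2 L20 H2] := IH _ (test_partial 1 tp).
exists (L + L1 + L2); first by rewrite !addr_ge0.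
move=> js; case/lastP: js => [|js j]; first by move=> _; apply: mono HL; lra.
rewrite size_rcons ltnS partials_rcons; case: (ord2P j) => -> h.
  by apply: mono (H1 _ h); lra.
by apply: mono (H2 _ h); lra.
Qed.

Lemma pdistr0 g : pdistr g -> g (fun=> 0) = 0.
Proof.
move=> [lin _]; have := lin 1 _ _ (test_cst 2 0) (test_cst 2 (0 : R)).
rewrite (_ : (fun _ : V => 1 * 0 + 0 : R) = fun=> 0); first by move=> h; lra.
by apply/funext => x; rewrite mulr0 addr0.
Qed.

Lemma pdistrD g phi psi : pdistr g -> test phi -> test psi ->
  g (fun x => phi x + psi x) = g phi + g psi.
Proof.
move=> [lin _] tp ts; rewrite -[g phi]mul1r -lin//; congr g.
by apply/funext => x; rewrite mul1r.
Qed.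

Lemma pdistrZ g c phi : pdistr g -> test phi -> g (fun x => c * phi x) = c * g phi.
Proof.
move=> pg tp; have [lin _] := pg; have := lin c _ _ tp (test_cst 2 (0 : R)).
rewrite pdistr0// addr0 => <-; congr g; apply/funext => x; by rewrite addr0.
Qed.

Lemma pdistr_sum g (I : Type) (s : seq I) (F : I -> V -> R) : pdistr g ->
  (forall i, test (F i)) -> g (fun x => \sum_(i <- s) F i x) = \sum_(i <- s) g (F i).
Proof.
move=> pg tF; elim: s => [|i s IH].
  by rewrite big_nil -[RHS](pdistr0 pg); congr g; apply/funext => x; rewrite big_nil.
rewrite big_cons -IH -(pdistrD pg (tF i) (test_sum s tF)).
by congr g; apply/funext => x; rewrite big_cons.
Qed.

Lemma pdistr_waves_eq0 g phi : pdistr g -> (forall xi, g (cos_wave xi) = 0) ->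
  (forall xi, g (sin_wave xi) = 0) -> test phi -> g phi = 0.
Proof.
move=> pg gc gs tp; have [lin [C [m HC]]] := pg.
have [L L0 HL] := test_lips m tp.
have key (d : R) : 0 < d -> `|g phi| <= C * d.
  move=> d0; have [s [J [J0 HJ]]] := smoothing_approx L0 d0.
  have ts := test_smoothing s tp.
  have g0 : g (smoothing s phi) = 0.
    rewrite smoothingE// (pdistr_sum s pg (F := fun (p : R * Z) (x : V) => _)); last first.
      by move=> p; apply: test_wave.
    rewrite big1// => p _.
    have tc := test_cos_wave R p.2; have tsn := test_sin_wave R p.2.
    by rewrite (pdistrD pg (testZ _ tc) (testZ _ tsn)) !pdistrZ// gc gs !mulr0 addr0.
  have <- : g (fun x => phi x + (- J^-1) * smoothing s phi x) = g phi.
    by rewrite (pdistrD pg tp (testZ _ ts)) pdistrZ// g0 mulr0 addr0.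
  apply: HC; first exact: (testD tp (testZ _ ts)).
  move=> js js_m x; rewrite partialsDZ//.
  have [-> tj] := partials_smoothing js s tp.
  rewrite -(ler_pM2r J0); apply: le_trans (HJ _ tj (HL _ js_m) x).
  rewrite -[X in _ * X <= _](gtr0_norm J0) -normrM distrC le_eqVlt; apply/orP; left; apply/eqP.
  by congr `|_|; field; rewrite gt_eqF.
have C0 : 0 <= C.
  by have := key 1 ltr01; rewrite mulr1; apply: le_trans.
apply/eqP; rewrite -normr_le0; apply/ler_addgt0Pl => d d0; rewrite addr0.
have C1 : 0 < C + 1 by lra.
apply: le_trans (key (d / (C + 1)) (divr_gt0 d0 C1)) _.
by rewrite mulrCA ger_pMr// ler_pdivrMr// mul1r; lra.
Qed.

End Density.

(** * Distributions and their Fourier coefficients *)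

Section Coefficients.
Variable R : realType.
Local Notation V := 'rV[R]_2.
Local Notation Z := 'rV[int]_2.
Local Notation rho := (@rho R 2).
Implicit Types (phi psi : V -> R) (g h : functional R 2) (xi eta : Z).

Lemma pdistr_addd g h : pdistr g -> pdistr h -> pdistr (addd g h).
Proof.
move=> [lg [C [m HC]]] [lh [C' [m' HC']]]; split.
  by move=> c p q tp tq; rewrite /addd lg// lh//; ring.
exists (C + C'), (maxn m m') => phi M tp HM; rewrite mulrDl.
apply: le_trans (ler_normD _ _) _; rewrite lerD//.
  by apply: HC => // js h0; apply: HM; rewrite (leq_trans h0)// leq_maxl.
by apply: HC' => // js h0; apply: HM; rewrite (leq_trans h0)// leq_maxr.
Qed.

Lemma pdistr_scaled c g : pdistr g -> pdistr (scaled c g).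
Proof.
move=> [lg [C [m HC]]]; split.
  by move=> d p q tp tq; rewrite /scaled lg//; ring.
exists (`|c| * C), m => phi M tp HM; rewrite normrM -mulrA.
by rewrite ler_wpM2l//; apply: HC.
Qed.

Lemma pdistr_oppd g : pdistr g -> pdistr (oppd g).
Proof.
move=> /(pdistr_scaled (-1)); congr pdistr.
by apply/funext => phi; rewrite /scaled mulN1r.
Qed.

Lemma pdistr_partiald j g : pdistr g -> pdistr (partiald j g).
Proof.
move=> [lg [C [m HC]]]; split.
  move=> c p q tp tq; rewrite /partiald.
  rewrite (partialD j (test_smooth (testZ c tp)) (test_smooth tq)).
  by rewrite (partialZ c j (test_smooth tp)) lg; [ring|exact: test_partial..].
exists C, m.+1 => phi M tp HM; rewrite normrN; apply: HC; first exact: test_partial.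
by move=> js js_m x; rewrite -partials_rcons HM// size_rcons.
Qed.

Lemma pdistr_zero : pdistr (fun _ : V -> R => 0).
Proof.
split; first by move=> *; rewrite mulr0 addr0.
by exists 0, 0%N => *; rewrite normr0 mul0r.
Qed.

Lemma pdistr_sumd (I : finType) (G : I -> functional R 2) :
  (forall i, pdistr (G i)) -> pdistr (sumd G).
Proof.
move=> pG; rewrite /sumd; elim: (index_enum I) => [|i s IH].
  rewrite (_ : (fun phi => _) = fun=> 0); first exact: pdistr_zero.
  by apply/funext => phi; rewrite big_nil.
rewrite (_ : (fun phi => _) = addd (G i) (fun phi => \sum_(i <- s) G i phi)).
  exact: pdistr_addd.
by apply/funext => phi; rewrite big_cons.
Qed.

Lemma pdistrN g phi : pdistr g -> test phi -> g (fun x => - phi x) = - g phi.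
Proof.
move=> pg tp; rewrite -mulN1r -pdistrZ//; congr g.
by apply/funext => x; rewrite mulN1r.
Qed.

Lemma pdistr_sinN g xi : pdistr g -> g (sin_wave (- xi)) = - g (sin_wave xi).
Proof. by move=> pg; rewrite sin_waveN (pdistrN pg (test_sin_wave R xi)). Qed.

Lemma partiald_cos j g xi : pdistr g ->
  partiald j g (cos_wave xi) = 2 * pi * (xi 0 j)%:~R * g (sin_wave xi).
Proof.
by move=> pg; rewrite /partiald partial_cos_wave (pdistrZ _ pg (test_sin_wave R xi)); ring.
Qed.

Lemma partiald_sin j g xi : pdistr g ->
  partiald j g (sin_wave xi) = - (2 * pi * (xi 0 j)%:~R * g (cos_wave xi)).
Proof.
by move=> pg; rewrite /partiald partial_sin_wave (pdistrZ _ pg (test_cos_wave R xi)).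
Qed.

Lemma pdistr_sin0 g : pdistr g -> g (sin_wave 0) = 0.
Proof. by move=> pg; rewrite sin_wave0 pdistr0. Qed.

Definition amp2 g xi : R := g (cos_wave xi) ^+ 2 + g (sin_wave xi) ^+ 2.

Lemma amp2_ge0 g xi : 0 <= amp2 g xi.
Proof. by rewrite addr_ge0 ?sqr_ge0. Qed.

Lemma Hnorm2E (s : R) g :
  Hnorm2 s g = \esum_(xi in [set: Z]) (rho xi `^ (2 * s) * amp2 g xi)%:E.
Proof.
apply: eq_esum => xi _; congr (_ * _)%:E.
by rewrite /fourier /= sqr_sqrtr ?addr_ge0 ?sqr_ge0// sqrrN.
Qed.

(** The hypothesis is oddness of the sine coefficients because the formula is also applied to
    products [smulfd phi h] inside the convection. *)
Lemma dualE g h : (forall xi, h (sin_wave (- xi)) = - h (sin_wave xi)) ->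
  dual g h = Zsum (fun xi => g (cos_wave xi) * h (cos_wave xi) + g (sin_wave xi) * h (sin_wave xi)).
Proof.
move=> hN; congr Zsum; apply/funext => xi.
by rewrite /fourier /= cos_waveN hN; ring.
Qed.

Lemma HinnerE (s : R) g h : Hinner s g h = Zsum (fun xi => rho xi `^ (2 * s) *
  (g (cos_wave xi) * h (cos_wave xi) + g (sin_wave xi) * h (sin_wave xi))).
Proof.
congr Zsum; apply/funext => xi; congr (_ * _).
by rewrite /fourier /=; ring.
Qed.

Lemma fourier0P g : pdistr g -> fourier g 0 = 0 <-> g (cos_wave 0) = 0.
Proof.
move=> pg; rewrite /fourier pdistr_sin0// oppr0; split=> [[->]//|->//].
Qed.

Lemma Hdot_coef0 (s : R) g : Hdot s g -> g (cos_wave 0) = 0 /\ g (sin_wave 0) = 0.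
Proof. by move=> [[pg _] /(fourier0P pg) ->]; rewrite pdistr_sin0. Qed.

Lemma mean_cos_cos xi eta : mean (fun x : V => cos_wave xi x * cos_wave eta x) =
  2^-1 * ((eta == xi)%:R + (eta == - xi)%:R).
Proof.
rewrite (_ : (fun x => _) = fun x => 2^-1 * (cos_wave (xi + eta) x + cos_wave (xi - eta) x)); last first.
  by apply/funext => x; rewrite cos_cos_wave.
have [t1 t2] := (test_cos_wave R (xi + eta), test_cos_wave R (xi - eta)).
have E zeta : mean (cos_wave zeta : V -> R) = (zeta == 0)%:R.
  by have [->|/mean_cos_wave//] := eqVneq zeta 0; rewrite cos_wave0 mean_cst.
rewrite (meanZ _ (testD t1 t2)) (meanD t1 t2) !E addrC; congr (_ * (_%:R + _%:R)).
  by rewrite subr_eq0 eq_sym.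
by rewrite addrC addr_eq0.
Qed.

Lemma mean_sin_sin xi eta : mean (fun x : V => sin_wave xi x * sin_wave eta x) =
  2^-1 * ((eta == xi)%:R - (eta == - xi)%:R).
Proof.
rewrite (_ : (fun x => _) = fun x => 2^-1 * (cos_wave (xi - eta) x - cos_wave (xi + eta) x)); last first.
  by apply/funext => x; rewrite sin_sin_wave.
have [t1 t2] := (test_cos_wave R (xi + eta), test_cos_wave R (xi - eta)).
have E zeta : mean (cos_wave zeta : V -> R) = (zeta == 0)%:R.
  by have [->|/mean_cos_wave//] := eqVneq zeta 0; rewrite cos_wave0 mean_cst.
rewrite (meanZ _ (testB t2 t1)) (meanB t2 t1) !E; congr (_ * (_%:R - _%:R)).
  by rewrite subr_eq0 eq_sym.
by rewrite addrC addr_eq0.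
Qed.

Lemma mean_cos_sin xi eta : mean (fun x : V => cos_wave xi x * sin_wave eta x) = 0.
Proof.
rewrite (_ : (fun x => _) = fun x => 2^-1 * (sin_wave (xi + eta) x - sin_wave (xi - eta) x)); last first.
  by apply/funext => x; rewrite cos_sin_wave.
have [t1 t2] := (test_sin_wave R (xi + eta), test_sin_wave R (xi - eta)).
by rewrite (meanZ _ (testB t1 t2)) (meanB t1 t2) !mean_sin_wave subrr mulr0.
Qed.

Definition mcos phi xi : R := mean (fun x => phi x * cos_wave xi x).
Definition msin phi xi : R := mean (fun x => phi x * sin_wave xi x).

Lemma mcos_partial j phi xi : test phi ->
  mcos (partial j phi) xi = 2 * pi * (xi 0 j)%:~R * msin phi xi.
Proof.
move=> tp; rewrite /mcos (mean_by_parts j tp (test_cos_wave R xi)) partial_cos_wave.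
rewrite -(meanZ _ (testM tp (test_sin_wave R xi))) -meanN; last first.
  by apply: testM => //; apply: testZ; apply: test_sin_wave.
by congr mean; apply/funext => x; ring.
Qed.

Lemma msin_partial j phi xi : test phi ->
  msin (partial j phi) xi = - (2 * pi * (xi 0 j)%:~R * mcos phi xi).
Proof.
move=> tp; rewrite /msin (mean_by_parts j tp (test_sin_wave R xi)) partial_sin_wave.
rewrite -(meanZ _ (testM tp (test_cos_wave R xi))); congr (- mean _).
by apply/funext => x; ring.
Qed.

(** Four integrations by parts along each axis. The constant is $3(16\pi^4+1+1)$, from
    $\varrho^4\le3(16\pi^4+(2\pi\xi_0)^4+(2\pi\xi_1)^4)$. *)
Lemma wave_decay phi M xi : test phi -> Cm_bound 4 phi M ->
  rho xi ^+ 4 * `|mcos phi xi| <= (48 * pi ^+ 4 + 6) * M /\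
  rho xi ^+ 4 * `|msin phi xi| <= (48 * pi ^+ 4 + 6) * M.
Proof.
move=> tp HM.
have b psi (tpsi : test psi) : (forall x, `|psi x| <= M) -> `|mcos psi xi| <= M /\ `|msin psi xi| <= M.
  move=> hM; have M0 : 0 <= M := le_trans (normr_ge0 _) (hM 0).
  split; apply: mean_bound.
  - exact: testM tpsi (test_cos_wave R xi).
  - by move=> x; rewrite normrM -[M]mulr1 ler_pM// cos_max.
  - exact: testM tpsi (test_sin_wave R xi).
  - by move=> x; rewrite normrM -[M]mulr1 ler_pM// sin_max.
have [c0 s0] := b _ tp (HM [::] isT).
have fourth j : (2 * pi * (xi 0 j)%:~R) ^+ 4 * `|mcos phi xi| <= M /\
    (2 * pi * (xi 0 j)%:~R) ^+ 4 * `|msin phi xi| <= M.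
  have t1 := test_partial j tp; have t2 := test_partial j t1.
  have t3 := test_partial j t2; have t4 := test_partial j t3.
  have [h1 h2] := b _ t4 (HM [:: j; j; j; j] isT).
  rewrite (mcos_partial j xi t3) (msin_partial j xi t2) (mcos_partial j xi t1) (msin_partial j xi tp) in h1.
  rewrite (msin_partial j xi t3) (mcos_partial j xi t2) (msin_partial j xi t1) (mcos_partial j xi tp) in h2.
  set c := 2 * pi * _ in h1 h2 *.
  have -> : c ^+ 4 = `|c ^+ 4| by rewrite ger0_norm// exprn_even_ge0.
  rewrite -!normrM; split.
    by apply: le_trans h1; rewrite le_eqVlt; apply/orP; left; apply/eqP; congr `|_|; ring.
  by apply: le_trans h2; rewrite le_eqVlt; apply/orP; left; apply/eqP; congr `|_|; ring.
have r4 : rho xi ^+ 4 <= 3 * (16 * pi ^+ 4 + (2 * pi * (xi 0 0)%:~R) ^+ 4 + (2 * pi * (xi 0 1)%:~R) ^+ 4).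
  rewrite (_ : rho xi ^+ 4 = (rho xi ^+ 2) ^+ 2); last by rewrite -exprM.
  rewrite rho_sq freq2E; set a := (xi 0 0)%:~R; set c := (xi 0 1)%:~R.
  set X := a ^+ 2; set Y := c ^+ 2; set P := pi ^+ 4.
  have -> : (4 * pi ^+ 2 * (1 + (X + Y))) ^+ 2 = 16 * P * (1 + (X + Y)) ^+ 2 by rewrite /P; ring.
  have -> : 3 * (16 * P + (2 * pi * a) ^+ 4 + (2 * pi * c) ^+ 4) = 16 * P * (3 * (1 + X ^+ 2 + Y ^+ 2)).
    by rewrite /P /X /Y; ring.
  apply: ler_wpM2l; first by rewrite mulr_ge0// exprn_even_ge0.
  by have := sqr_ge0 (X - 1); have := sqr_ge0 (Y - 1); have := sqr_ge0 (X - Y); nra.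
have [c1 s1] := fourth 0; have [c2 s2] := fourth 1.
have P0 : 0 <= pi ^+ 4 :> R by rewrite exprn_even_ge0.
split; (apply: le_trans (ler_wpM2r (normr_ge0 _) r4) _).
  by move: c0 c1 c2; set x := `|_|; set y := _ ^+ 4; set z := _ ^+ 4 => c0 c1 c2; nra.
by move: s0 s1 s2; set x := `|_|; set y := _ ^+ 4; set z := _ ^+ 4 => s0 s1 s2; nra.
Qed.

(** The Fourier series with prescribed values on waves. For even [a] and odd [b] its values on the
    cosine and sine of frequency $\xi$ are $a(\xi)$ and $b(\xi)$, each of $\pm\xi$ giving one
    half. *)
Definition dist_of (a b : Z -> R) : functional R 2 :=
  fun phi => Zsum (fun xi => a xi * mcos phi xi + b xi * msin phi xi).

(** Two waves per frequency times the bound $72$ of [lattice_cube], times the constant of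
    [wave_decay]. *)
Definition decay_const : R := 144 * (48 * pi ^+ 4 + 6).

Lemma decay_const_ge0 : 0 <= decay_const.
Proof. by rewrite mulr_ge0// addr_ge0// mulr_ge0// exprn_even_ge0. Qed.

(** Growth of order $1$ of the coefficients against decay of order $4$ of the test function leaves
    the summable $\varrho^{-3}$. *)
Lemma asum_dist_of (a b : Z -> R) (B M : R) phi :
  (forall xi, `|a xi| <= B * rho xi) -> (forall xi, `|b xi| <= B * rho xi) ->
  test phi -> Cm_bound 4 phi M ->
  (asum (fun xi => a xi * mcos phi xi + b xi * msin phi xi)%R <= (decay_const * B * M)%:E)%E.
Proof.
move=> aB bB tp HM; pose K : R := 48 * pi ^+ 4 + 6.
have B0 : 0 <= B.
  by have := le_trans (normr_ge0 _) (aB 0); rewrite pmulr_lge0// rho_gt0.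
have M0 : 0 <= M := le_trans (normr_ge0 _) (HM [::] isT 0).
have K0 : 0 <= K by rewrite addr_ge0// mulr_ge0// exprn_even_ge0.
apply: (@le_trans _ _ (\esum_(xi in [set: Z]) ((2 * B * K * M)%:E * ((rho xi ^+ 3)^-1)%:E))%E).
  apply: le_esum => xi _; rewrite -EFinM lee_fin.
  have [h1 h2] := wave_decay xi tp HM; have r0 := rho_gt0 R xi.
  rewrite ler_pdivlMr ?exprn_gt0//.
  apply: le_trans (ler_wpM2r (exprn_ge0 3 (ltW r0)) (ler_normD _ _)) _.
  rewrite !normrM; have := aB xi; have := bB xi; move: h1 h2; rewrite -/K.
  have := normr_ge0 (mcos phi xi); have := normr_ge0 (msin phi xi).
  set x := `|mcos _ _|; set y := `|msin _ _|; set p := `|a xi|; set q := `|b xi|; set r := rho xi in r0 *.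
  move=> y0 x0 h1 h2 hq hp; rewrite mulrDl.
  have e z t : 0 <= z -> t <= B * r -> r ^+ 4 * z <= K * M -> t * z * r ^+ 3 <= B * (K * M).
    move=> z0 tB hz; apply: (@le_trans _ _ (B * r * z * r ^+ 3)).
      by rewrite ler_wpM2r ?exprn_ge0 ?(ltW r0)// ler_wpM2r.
    have -> : B * r * z * r ^+ 3 = B * (r ^+ 4 * z) by ring.
    exact: ler_wpM2l.
  by have := e x p x0 hp h1; have := e y q y0 hq h2; lra.
rewrite esumZl ?mulr_ge0// => [|xi]; last by rewrite lee_fin invr_ge0 exprn_ge0 ?rho_ge0.
apply: (@le_trans _ _ ((2 * B * K * M)%:E * 72%:E)%E).
  by rewrite lee_wpmul2l ?lattice_cube// lee_fin !mulr_ge0.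
by rewrite -EFinM lee_fin /decay_const -/K; lra.
Qed.

Lemma test_Cm_bound m phi : test phi -> exists M, Cm_bound m phi M.
Proof.
elim: m phi => [|m IH] phi tp.
  have [B B0 HB] := test_bounded tp; exists B => js.
  by rewrite leqn0 size_eq0 => /eqP ->.
have [B B0 HB] := test_bounded tp.
have [M0 H0] := IH _ (test_partial 0 tp); have [M1 H1] := IH _ (test_partial 1 tp).
exists (B + `|M0| + `|M1|) => js; case/lastP: js => [_ x|js j].
  by apply: le_trans (HB x) _; rewrite -addrA lerDl addr_ge0.
rewrite size_rcons ltnS partials_rcons; case: (ord2P j) => -> h x.
  apply: le_trans (H0 _ h x) _; apply: le_trans (ler_norm _) _; have := normr_ge0 M1; lra.
by apply: le_trans (H1 _ h x) _; apply: le_trans (ler_norm _) _; have := normr_ge0 M0; lra.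
Qed.

Lemma dist_of_bound (a b : Z -> R) (B M : R) phi :
  (forall xi, `|a xi| <= B * rho xi) -> (forall xi, `|b xi| <= B * rho xi) ->
  test phi -> Cm_bound 4 phi M -> `|dist_of a b phi| <= decay_const * B * M.
Proof. by move=> aB bB tp HM; apply: Zsum_le; apply: asum_dist_of. Qed.

Lemma pdistr_dist_of (a b : Z -> R) (B : R) :
  (forall xi, `|a xi| <= B * rho xi) -> (forall xi, `|b xi| <= B * rho xi) ->
  pdistr (dist_of a b).
Proof.
move=> aB bB; split; last first.
  by exists (decay_const * B), 4%N => phi M; apply: dist_of_bound.
have sm phi (tp : test phi) : (asum (fun xi => a xi * mcos phi xi + b xi * msin phi xi)%R < +oo)%E.
  have [M HM] := test_Cm_bound 4 tp.
  by apply: le_lt_trans (asum_dist_of aB bB tp HM) _; rewrite ltry.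
move=> c p q tp tq; rewrite /dist_of -(ZsumZ c (sm p tp)) -(ZsumD (asumZ c (sm p tp)) (sm q tq)).
congr Zsum; apply/funext => xi; rewrite /mcos /msin.
have [tc ts] := (test_cos_wave R xi, test_sin_wave R xi).
rewrite (_ : (fun x => (c * p x + q x) * cos_wave xi x) = fun x => c * (p x * cos_wave xi x) + q x * cos_wave xi x); last first.
  by apply/funext => x; ring.
rewrite (_ : (fun x => (c * p x + q x) * sin_wave xi x) = fun x => c * (p x * sin_wave xi x) + q x * sin_wave xi x); last first.
  by apply/funext => x; ring.
rewrite (meanD (testZ c (testM tp tc)) (testM tq tc)) (meanD (testZ c (testM tp ts)) (testM tq ts)).
by rewrite (meanZ _ (testM tp tc)) (meanZ _ (testM tp ts)); ring.
Qed.

Lemma dist_of_cos (a b : Z -> R) xi : (forall eta, a (- eta) = a eta) ->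
  dist_of a b (cos_wave xi) = a xi.
Proof.
move=> ev; rewrite /dist_of.
pose F (zeta eta : Z) := 2^-1 * a eta * (eta == zeta)%:R.
have F0 zeta eta : eta != zeta -> F zeta eta = 0 by rewrite /F => /negbTE ->; rewrite mulr0.
rewrite (_ : (fun eta => _) = fun eta => F xi eta + F (- xi) eta).
  by rewrite (ZsumD (asum_pt (F0 xi)) (asum_pt (F0 (- xi)))) (Zsum_pt (F0 xi)) (Zsum_pt (F0 (- xi))) /F !eqxx ev /= !mulr1; field.
by apply/funext => eta; rewrite /mcos /msin mean_cos_cos mean_cos_sin /F; ring.
Qed.

Lemma dist_of_sin (a b : Z -> R) xi : (forall eta, b (- eta) = - b eta) ->
  dist_of a b (sin_wave xi) = b xi.
Proof.
move=> od; rewrite /dist_of.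
pose F (zeta eta : Z) := 2^-1 * b eta * (eta == zeta)%:R.
have F0 zeta eta : eta != zeta -> F zeta eta = 0 by rewrite /F => /negbTE ->; rewrite mulr0.
rewrite (_ : (fun eta => _) = fun eta => F xi eta + - 1 * F (- xi) eta).
  rewrite (ZsumD (asum_pt (F0 xi)) (asumZ _ (asum_pt (F0 (- xi))))) (ZsumZ _ (asum_pt (F0 _))).
  by rewrite (Zsum_pt (F0 xi)) (Zsum_pt (F0 (- xi))) /F !eqxx od /= !mulr1; field.
apply/funext => eta; rewrite /mcos /msin mean_sin_sin.
rewrite (_ : (fun x => sin_wave xi x * cos_wave eta x) = fun x => cos_wave eta x * sin_wave xi x).
  by rewrite mean_cos_sin /F; ring.
by apply/funext => x; rewrite mulrC.
Qed.

(** A distribution equals the series of its coefficients, as both agree on all waves. Its continuity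
    bound thereby becomes explicit, with a constant and an order governed by coefficient growth
    alone; this is what gives integrability in time. *)
Lemma pdistr_bound g (B M : R) phi : pdistr g ->
  (forall xi, `|g (cos_wave xi)| <= B * rho xi) -> (forall xi, `|g (sin_wave xi)| <= B * rho xi) ->
  test phi -> Cm_bound 4 phi M -> `|g phi| <= decay_const * B * M.
Proof.
move=> pg cB sB tp HM.
pose d := dist_of (fun xi => g (cos_wave xi)) (fun xi => g (sin_wave xi)).
have pd : pdistr d := pdistr_dist_of cB sB.
suff -> : g phi = d phi by apply: dist_of_bound.
apply/eqP; rewrite -subr_eq0; apply/eqP.
apply: (@pdistr_waves_eq0 R (addd g (oppd d))) => //.
- exact: (pdistr_addd pg (pdistr_oppd pd)).
- by move=> xi; rewrite /addd /oppd /d dist_of_cos ?subrr// => eta; rewrite cos_waveN.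
- by move=> xi; rewrite /addd /oppd /d dist_of_sin ?subrr// => eta; rewrite pdistr_sinN.
Qed.

End Coefficients.

(** * The weak equation mode by mode *)

Section Modes.
Variable R : realType.
Local Notation V := 'rV[R]_2.
Local Notation Z := 'rV[int]_2.
Local Notation rho := (@rho R 2).
Local Notation fr xi j := ((xi 0 j)%:~R : R).
Implicit Types (g h : functional R 2) (xi eta : Z) (p q : 'I_2 -> R).

Lemma sum2 (F : 'I_2 -> R) : \sum_(k < 2) F k = F 0 + F 1.
Proof. by rewrite !big_ord_recl big_ord0 addr0; congr (_ + F _); apply/val_inj. Qed.

Lemma neq_oppZ xi : xi != 0 -> xi != - xi.
Proof.
apply: contraNneq => e; apply/eqP/rowP => j; have := congr1 (fun z : Z => z 0 j) e.
by rewrite !mxE => /eqP; rewrite -addr_eq0 -mulr2n mulrn_eq0 /= => /eqP.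
Qed.

Lemma Zsum_pair xi (F : Z -> R) : xi != 0 -> (forall eta, eta != xi -> eta != - xi -> F eta = 0) ->
  F (- xi) = F xi -> Zsum F = 2 * F xi.
Proof.
move=> /neq_oppZ nx F0 FN.
pose G (zeta eta : Z) := F eta * (eta == zeta)%:R.
have G0 zeta eta : eta != zeta -> G zeta eta = 0 by rewrite /G => /negbTE ->; rewrite mulr0.
rewrite (_ : F = fun eta => G xi eta + G (- xi) eta).
  rewrite (ZsumD (asum_pt (G0 xi)) (asum_pt (G0 (- xi)))) (Zsum_pt (G0 xi)) (Zsum_pt (G0 (- xi))).
  by rewrite /G !eqxx (negbTE nx) FN /=; ring.
apply/funext => eta; rewrite /G.
have [->|n1] := eqVneq eta xi; first by rewrite (negbTE nx) /=; ring.
have [->|n2] := eqVneq eta (- xi); first by rewrite /=; ring.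
by rewrite F0//=; ring.
Qed.

Definition supported_at xi h := forall eta, eta != xi -> eta != - xi ->
  h (cos_wave eta) = 0 /\ h (sin_wave eta) = 0.

Lemma dual_supported g h xi : pdistr g -> pdistr h -> xi != 0 -> supported_at xi h ->
  dual g h = 2 * (g (cos_wave xi) * h (cos_wave xi) + g (sin_wave xi) * h (sin_wave xi)).
Proof.
move=> pg ph x0 sh; rewrite dualE => [|eta]; last exact: pdistr_sinN.
apply: Zsum_pair => // [eta n1 n2|].
  by have [-> ->] := sh _ n1 n2; rewrite !mulr0 addr0.
by rewrite !cos_waveN !pdistr_sinN// mulrNN.
Qed.

Lemma Hinner_supported (s : R) g h xi : pdistr g -> pdistr h -> xi != 0 -> supported_at xi h ->
  Hinner s g h = 2 * (rho xi `^ (2 * s) *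
    (g (cos_wave xi) * h (cos_wave xi) + g (sin_wave xi) * h (sin_wave xi))).
Proof.
move=> pg ph x0 sh; rewrite HinnerE.
apply: Zsum_pair => // [eta n1 n2|].
  by have [-> ->] := sh _ n1 n2; rewrite !mulr0 addr0 mulr0.
by rewrite rhoN !cos_waveN !pdistr_sinN// mulrNN.
Qed.

(** The test fields of the weak formulation: cosine coefficients [p] and sine coefficients [q] at
    [xi], extended evenly and oddly to [- xi] as reality demands. *)
Definition mode xi p q : vfunctional R 2 := fun k =>
  dist_of (fun eta => ((eta == xi) || (eta == - xi))%:R * p k)
          (fun eta => ((eta == xi)%:R - (eta == - xi)%:R) * q k).

Let eq_oppZ xi eta : (- eta == xi) = (eta == - xi).
Proof. by rewrite eqr_oppLR. Qed.

Lemma mode_cos xi p q k eta :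
  mode xi p q k (cos_wave eta) = ((eta == xi) || (eta == - xi))%:R * p k.
Proof. by rewrite /mode dist_of_cos// => zeta; rewrite !eq_oppZ opprK orbC. Qed.

Lemma mode_sin xi p q k eta :
  mode xi p q k (sin_wave eta) = ((eta == xi)%:R - (eta == - xi)%:R) * q k.
Proof. by rewrite /mode dist_of_sin// => zeta; rewrite !eq_oppZ opprK; ring. Qed.

Lemma pdistr_mode xi p q k : pdistr (mode xi p q k).
Proof.
apply: (@pdistr_dist_of R _ _ (`|p k| + `|q k|)) => eta; have r1 := rho_ge1 R eta;
  rewrite normrM; apply: (@le_trans _ _ ((`|p k| + `|q k|) * 1)); rewrite ?ler_wpM2l ?addr_ge0// mulr1.
  by case: (_ || _); rewrite ?normr1 ?normr0 ?mul1r ?mul0r ?addr_ge0// lerDl.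
case: (_ == _); case: (_ == _); rewrite /= ?subrr ?subr0 ?sub0r ?normrN ?normr1 ?normr0 ?mul1r ?mul0r ?addr_ge0//;
  by rewrite lerDr.
Qed.

Lemma mode_supported xi p q k : supported_at xi (mode xi p q k).
Proof.
by move=> eta /negbTE n1 /negbTE n2; rewrite mode_cos mode_sin n1 n2 /= subrr !mul0r.
Qed.

Lemma mode_at xi p q k : xi != 0 ->
  mode xi p q k (cos_wave xi) = p k /\ mode xi p q k (sin_wave xi) = q k.
Proof.
by move=> /neq_oppZ /negbTE nx; rewrite mode_cos mode_sin eqxx nx /= subr0 !mul1r.
Qed.

Lemma Hdot_supported (s : R) g xi : pdistr g -> xi != 0 -> supported_at xi g -> Hdot s g.
Proof.
move=> pg x0 sg; split; last first.
  apply/fourier0P => //; have [||? _ //] := sg 0; by rewrite eq_sym ?oppr_eq0.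
split=> //; rewrite Hnorm2E.
set F := fun eta : Z => (rho eta `^ (2 * s) * amp2 g eta)%:E.
have F0 eta : (0 <= F eta)%E by rewrite lee_fin mulr_ge0 ?powR_ge0 ?amp2_ge0.
pose G (zeta eta : Z) : \bar R := if eta == zeta then F eta else 0%E.
apply: (@le_lt_trans _ _ (\esum_(eta in [set: Z]) (G xi eta + G (- xi)%R eta)%E)); rewrite /G.
  apply: le_esum => eta _; have [->|n1] := eqVneq eta xi.
    by rewrite leeDl//; case: ifP.
  have [->|n2] := eqVneq eta (- xi); first by rewrite add0e.
  by rewrite /amp2; have [-> ->] := sg _ n1 n2; rewrite !expr0n /= addr0 mulr0 adde0.
rewrite esumD => [|eta _|eta _]; [|by case: ifP..].
by rewrite !esum_pt// -EFinD ltry.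
Qed.

Lemma mode_div_free xi p q : xi != 0 -> \sum_k fr xi k * p k = 0 -> \sum_k fr xi k * q k = 0 ->
  div_free (mode xi p q).
Proof.
rewrite !sum2 => x0 hp hq phi tp.
have pm k := pdistr_mode xi p q k.
apply: pdistr_waves_eq0 => //; first by apply: pdistr_sumd => k; apply: pdistr_partiald.
- move=> eta; rewrite /divd /sumd sum2 !partiald_cos// !mode_sin.
  have [->|n1] := eqVneq eta xi; first by rewrite (negbTE (neq_oppZ x0)) -[RHS](mulr0 (2 * pi)) -hq /=; ring.
  have [->|n2] := eqVneq eta (- xi); last by rewrite /=; ring.
  by rewrite -[RHS](mulr0 (2 * pi)) -hq !mxE !rmorphN /=; ring.
- move=> eta; rewrite /divd /sumd sum2 !partiald_sin// !mode_cos.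
  have [->|n1] := eqVneq eta xi; first by rewrite -[RHS](mulr0 (- (2 * pi))) -hp /=; ring.
  have [->|n2] := eqVneq eta (- xi); last by rewrite /=; ring.
  by rewrite -[RHS](mulr0 (2 * pi)) -hp !mxE !rmorphN /=; ring.
Qed.

Lemma mode_sigma (s : R) xi p q : xi != 0 -> \sum_k fr xi k * p k = 0 -> \sum_k fr xi k * q k = 0 ->
  vHdot_sigma s (mode xi p q).
Proof.
move=> x0 hp hq; split; last exact: mode_div_free.
by move=> k; apply: (@Hdot_supported _ _ xi) => //; [exact: pdistr_mode|exact: mode_supported].
Qed.

Lemma vdual_mode (F : vfunctional R 2) xi p q : (forall k, pdistr (F k)) -> xi != 0 ->
  vdual F (mode xi p q) = 2 * \sum_k (F k (cos_wave xi) * p k + F k (sin_wave xi) * q k).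
Proof.
move=> pF x0; rewrite /vdual mulr_sumr; apply: eq_bigr => k _.
have [e1 e2] := mode_at p q k x0.
by rewrite (dual_supported (pF k) (pdistr_mode xi p q k) x0 (@mode_supported _ _ _ _)) e1 e2.
Qed.

Lemma pdistr_strain (w : vfunctional R 2) i j : (forall k, pdistr (w k)) -> pdistr (strain w i j).
Proof.
by move=> pw; apply: pdistr_scaled; apply: pdistr_addd; apply: pdistr_partiald.
Qed.

Lemma pdistr_stress (a : tensor R 2) (w : vfunctional R 2) i j : (forall k, pdistr (w k)) ->
  pdistr (stress a w i j).
Proof.
move=> pw; apply: pdistr_sumd => k; apply: pdistr_sumd => l.
by apply: pdistr_scaled; apply: pdistr_strain.
Qed.

Lemma strain_cos (w : vfunctional R 2) i j xi : (forall k, pdistr (w k)) ->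
  strain w i j (cos_wave xi) = pi * (fr xi i * w j (sin_wave xi) + fr xi j * w i (sin_wave xi)).
Proof. by move=> pw; rewrite /strain /scaled /addd !partiald_cos//; field. Qed.

Lemma strain_sin (w : vfunctional R 2) i j xi : (forall k, pdistr (w k)) ->
  strain w i j (sin_wave xi) = - (pi * (fr xi i * w j (cos_wave xi) + fr xi j * w i (cos_wave xi))).
Proof. by move=> pw; rewrite /strain /scaled /addd !partiald_sin//; field. Qed.

Lemma aform_mode (a : tensor R 2) (U : vfunctional R 2) xi p q : (forall k, pdistr (U k)) -> xi != 0 ->
  aform a U (mode xi p q) = 2 * \sum_i \sum_j
    (stress a U i j (cos_wave xi) * (pi * (fr xi i * q j + fr xi j * q i)) -
     stress a U i j (sin_wave xi) * (pi * (fr xi i * p j + fr xi j * p i))).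
Proof.
move=> pU x0; rewrite /aform mulr_sumr; apply: eq_bigr => i _.
rewrite mulr_sumr; apply: eq_bigr => j _; have pm k := pdistr_mode xi p q k.
rewrite (dual_supported (pdistr_stress a i j pU) (pdistr_strain i j pm) x0); last first.
  move=> eta n1 n2; rewrite strain_cos// strain_sin//.
  have [-> ->] := @mode_supported xi p q i _ n1 n2; have [-> ->] := @mode_supported xi p q j _ n1 n2.
  by rewrite !mulr0 addr0 mulr0 oppr0.
rewrite strain_cos// strain_sin//.
have [-> ->] := mode_at p q i x0; have [-> ->] := mode_at p q j x0.
ring.
Qed.

(** Against a single mode the inner product of $H^s$ is that of $L_2$ times $\varrho(\xi)^{2s}$.
    This factor cancels, so the order [s] hidden in [leray] disappears. *)
Lemma leray_mode (N c : vfunctional R 2) xi p q : leray N c -> xi != 0 ->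
  \sum_k fr xi k * p k = 0 -> \sum_k fr xi k * q k = 0 ->
  \sum_k (N k (cos_wave xi) * p k + N k (sin_wave xi) * q k) =
  \sum_k (c k (cos_wave xi) * p k + c k (sin_wave xi) * q k).
Proof.
move=> [s [HN [Hc _] Hw]] x0 hp hq.
have := Hw _ (mode_sigma s x0 hp hq); rewrite /vHinner.
under eq_bigr => k _.
  have [e1 e2] := mode_at p q k x0; have [[pN _] _] := HN k; have [[pc _] _] := Hc k.
  rewrite (Hinner_supported s (pdistr_addd pN (pdistr_oppd pc)) (pdistr_mode xi p q k) x0 (@mode_supported _ _ _ _)).
  rewrite e1 e2; over.
rewrite -!mulr_sumr => /eqP; rewrite !mulf_eq0 (gt_eqF (powR_gt0 _ (rho_gt0 R xi))) pnatr_eq0 /= => /eqP.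
by rewrite !sum2 /vsub /addd /oppd => e; lra.
Qed.

(** All pairings with [mode xi p q] carry the same factor $2$, for $\pm\xi$. As the mode is
    divergence-free, the projected convection may be replaced by the convection itself. *)
Lemma mode_equation (a : tensor R 2) (U W F : vfunctional R 2) xi p q :
  (forall k, pdistr (U k)) -> (forall k, pdistr (W k)) -> (forall k, pdistr (F k)) ->
  (exists2 c, leray (convection U) c & forall w, vHdot_sigma 1 w ->
     vdual (vadd W c) w + aform a U w = vdual F w) ->
  xi != 0 -> \sum_k fr xi k * p k = 0 -> \sum_k fr xi k * q k = 0 ->
  \sum_k ((W k (cos_wave xi) + convection U k (cos_wave xi) - F k (cos_wave xi)) * p k +
          (W k (sin_wave xi) + convection U k (sin_wave xi) - F k (sin_wave xi)) * q k) +
  \sum_i \sum_j (stress a U i j (cos_wave xi) * (pi * (fr xi i * q j + fr xi j * q i)) -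
     stress a U i j (sin_wave xi) * (pi * (fr xi i * p j + fr xi j * p i))) = 0.
Proof.
move=> pU pW pF [c lc eqw] x0 hp hq; have := eqw _ (mode_sigma 1 x0 hp hq).
have pc k : pdistr (c k) by case: lc => s [_ [/(_ k)[[]]]].
have := leray_mode lc x0 hp hq.
rewrite aform_mode// !vdual_mode// => [|k]; last exact: pdistr_addd.
set S := \sum_i _; clearbody S; rewrite !sum2 /vadd /addd.
move: (W 0 _) (W 1 _) (W 0 _) (W 1 _) (F 0 _) (F 1 _) (F 0 _) (F 1 _) (c 0 _) (c 1 _) (c 0 _) (c 1 _).
move: (convection U 0 _) (convection U 1 _) (convection U 0 _) (convection U 1 _).
move=> *; lra.
Qed.

End Modes.

(** * Amplitudes, the convection, and the symbol of the operator *)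

Section Amplitude.
Variable R : realType.
Local Notation V := 'rV[R]_2.
Local Notation Z := 'rV[int]_2.
Local Notation rho := (@rho R 2).
Local Notation fr xi j := ((xi 0 j)%:~R : R).
Implicit Types (g h : functional R 2) (U : vfunctional R 2) (xi eta : Z).

(** The $\ell^1$ norm of the four real coefficients at [xi], within a factor $2$ of the Euclidean
    one; being nonnegative and even, it can be convolved without cancellation. *)
Definition ampl U xi : R :=
  \sum_(k < 2) (`|U k (cos_wave xi)| + `|U k (sin_wave xi)|).

Lemma ampl_ge0 U xi : 0 <= ampl U xi.
Proof. by apply: sumr_ge0 => k _; rewrite addr_ge0. Qed.

Lemma amplN U xi : (forall k, pdistr (U k)) -> ampl U (- xi) = ampl U xi.
Proof.
by move=> pU; apply: eq_bigr => k _; rewrite cos_waveN pdistr_sinN// normrN.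
Qed.

Lemma ampl_cos U xi k : `|U k (cos_wave xi)| <= ampl U xi.
Proof.
rewrite /ampl sum2; case: (ord2P k) => ->; have := normr_ge0 (U 0 (cos_wave xi));
have := normr_ge0 (U 1 (cos_wave xi)); have := normr_ge0 (U 0 (sin_wave xi));
have := normr_ge0 (U 1 (sin_wave xi)); lra.
Qed.

Lemma ampl_sin U xi k : `|U k (sin_wave xi)| <= ampl U xi.
Proof.
rewrite /ampl sum2; case: (ord2P k) => ->; have := normr_ge0 (U 0 (cos_wave xi));
have := normr_ge0 (U 1 (cos_wave xi)); have := normr_ge0 (U 0 (sin_wave xi));
have := normr_ge0 (U 1 (sin_wave xi)); lra.
Qed.

Lemma ampl_sqr_le U xi : ampl U xi ^+ 2 <= 4 * \sum_(k < 2) amp2 (U k) xi.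
Proof.
rewrite /ampl !sum2 /amp2 -![U _ _ ^+ 2](@real_normK R)// ?num_real//.
move: `|U 0 _| `|U 0 _| `|U 1 _| `|U 1 _| => a b c d.
have := sqr_ge0 (a - b); have := sqr_ge0 (a - c); have := sqr_ge0 (a - d).
have := sqr_ge0 (b - c); have := sqr_ge0 (b - d); have := sqr_ge0 (c - d); nra.
Qed.

Lemma amp2_le_ampl U xi : \sum_(k < 2) amp2 (U k) xi <= ampl U xi ^+ 2.
Proof.
rewrite /ampl !sum2 /amp2 -![U _ _ ^+ 2](@real_normK R)// ?num_real//.
move: (normr_ge0 (U 0 (cos_wave xi))) (normr_ge0 (U 0 (sin_wave xi))).
move: (normr_ge0 (U 1 (cos_wave xi))) (normr_ge0 (U 1 (sin_wave xi))).
move: `|U 0 _| `|U 0 _| `|U 1 _| `|U 1 _| => a b c d d0 c0 b0 a0.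
have := mulr_ge0 a0 b0; have := mulr_ge0 a0 c0; have := mulr_ge0 a0 d0.
have := mulr_ge0 b0 c0; have := mulr_ge0 b0 d0; have := mulr_ge0 c0 d0; nra.
Qed.

Lemma div_free_coef U xi : (forall k, pdistr (U k)) -> div_free U ->
  \sum_k fr xi k * U k (cos_wave xi) = 0 /\ \sum_k fr xi k * U k (sin_wave xi) = 0.
Proof.
move=> pU dU; have p2 : 2 * pi != 0 :> R by rewrite mulf_neq0// gt_eqF// pi_gt0.
split.
  have := dU _ (test_sin_wave R xi); rewrite /divd /sumd !sum2 !partiald_sin// => e.
  by apply: (mulfI p2); rewrite mulr0; lra.
have := dU _ (test_cos_wave R xi); rewrite /divd /sumd !sum2 !partiald_cos// => e.
by apply: (mulfI p2); rewrite mulr0; lra.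
Qed.

Lemma conv_fin U (a : R) xi :
  (\esum_(eta in [set: Z]) (ampl U eta ^+ 2)%:E <= a%:E)%E ->
  (self_conv (ampl U) xi <= (2 * a)%:E)%E.
Proof.
move=> Ua; apply: (@le_trans _ _ (\esum_(eta in [set: Z])
   ((ampl U eta ^+ 2)%:E + (ampl U (xi - eta) ^+ 2)%:E))%E).
  apply: le_esum => eta _; rewrite -EFinD lee_fin.
  have := sqr_ge0 (ampl U eta - ampl U (xi - eta)); have := ampl_ge0 U eta.
  have := ampl_ge0 U (xi - eta); nra.
rewrite esumD => [|eta _|eta _]; rewrite ?lee_fin ?sqr_ge0//.
rewrite (esum_flip xi (fun eta => (ampl U eta ^+ 2)%:E)) (_ : 2 * a = a + a); last by ring.
by rewrite EFinD leeD.
Qed.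

Let divergence_bound xi (P Q : 'I_2 -> R) (S1 S2 T : R) : `|S1| <= T -> `|S2| <= T ->
  `|pi * (\sum_j fr xi j * P j) * S1 + pi * (\sum_j fr xi j * Q j) * S2| <=
  2^-1 * rho xi * (\sum_j (`|P j| + `|Q j|)) * T.
Proof.
move=> h1 h2; have T0 := le_trans (normr_ge0 _) h1; rewrite !sum2.
have r j : pi * `|fr xi j| <= 2^-1 * rho xi by have := rho_coord R xi j; lra.
have b (K : 'I_2 -> R) : `|pi * (fr xi 0 * K 0 + fr xi 1 * K 1)| <= 2^-1 * rho xi * (`|K 0| + `|K 1|).
  rewrite mulrDr; apply: le_trans (ler_normD _ _) _; rewrite !normrM (ger0_norm (pi_ge0 R)).
  by rewrite mulrDr lerD// mulrA ler_wpM2r.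
apply: le_trans (ler_normD _ _) _; rewrite !normrM -!normrM [`|_ * S1|]normrM [`|_ * S2|]normrM.
apply: (@le_trans _ _ (2^-1 * rho xi * (`|P 0| + `|P 1|) * T + 2^-1 * rho xi * (`|Q 0| + `|Q 1|) * T)).
  by rewrite lerD// ler_pM.
by rewrite le_eqVlt; apply/orP; left; apply/eqP; ring.
Qed.

Lemma half_bounds (x y p q : R) : `|x| <= p -> `|y| <= q ->
  [/\ `|2^-1 * (x + y)| <= p + q, `|2^-1 * (x - y)| <= p + q & `|2^-1 * (y - x)| <= p + q].
Proof. by rewrite !ler_norml => /andP[? ?] /andP[? ?]; split; apply/andP; split; lra. Qed.

(** The derivative inside the convection acts at the frequencies $\xi\pm\eta$; since
    $\sum_j\eta_jU_j(\eta)=0$, these may be replaced by $\xi$. This is the identity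
    $(u\cdot\nabla)u=\mathrm{div}(u\otimes u)$ read on coefficients, and it puts the weight [rho xi]
    outside the convolution. Product-to-sum formulas yield both signs, each with a factor one
    half. *)
Lemma convection_wave_bound U (a b : R) xi k phi :
  (forall k, pdistr (U k)) -> div_free U ->
  (\esum_(eta in [set: Z]) (ampl U eta ^+ 2)%:E <= a%:E)%E ->
  (\esum_(eta in [set: Z]) (rho eta ^+ 2 * ampl U eta ^+ 2)%:E <= b%:E)%E ->
  phi = cos_wave xi \/ phi = sin_wave xi ->
  (`|convection U k phi|%:E <= (rho xi)%:E * self_conv (ampl U) xi)%E.
Proof.
move=> pU dU Ua Ub hphi.
have tphi : test phi by case: hphi => ->; [exact: test_cos_wave|exact: test_sin_wave].
have cf : self_conv (ampl U) xi \is a fin_num.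
  rewrite ge0_fin_numE; last by apply: esum_ge0 => eta _; rewrite lee_fin mulr_ge0 ?ampl_ge0.
  by rewrite (le_lt_trans (conv_fin xi Ua))// ltry.
pose h j := partiald j (U k).
have ph j : pdistr (h j) by apply: pdistr_partiald.
pose E j eta := U j (cos_wave eta) * smulfd phi (h j) (cos_wave eta) +
  U j (sin_wave eta) * smulfd phi (h j) (sin_wave eta).
have convE : convection U k phi = \sum_j Zsum (E j).
  apply: eq_bigr => j _; rewrite /prodd dualE// => eta.
  rewrite /smulfd sin_waveN -(pdistrN (ph j)); last by apply: testM => //; apply: test_sin_wave.
  by congr (h j _); apply/funext => x; ring.
have hb j zeta : `|h j (cos_wave zeta)| <= rho zeta * ampl U zeta /\
    `|h j (sin_wave zeta)| <= rho zeta * ampl U zeta.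
  rewrite /h partiald_cos// partiald_sin// normrN !normrM [`|2|]ger0_norm// (ger0_norm (pi_ge0 R)).
  by split; apply: ler_pM => //; rewrite ?mulr_ge0 ?pi_ge0 ?rho_coord ?ampl_sin ?ampl_cos.
have hcc j eta : h j (fun x => cos_wave xi x * cos_wave eta x) = 
    2^-1 * (h j (cos_wave (xi + eta)) + h j (cos_wave (xi - eta))).
  have [t1 t2] := (test_cos_wave R (xi + eta), test_cos_wave R (xi - eta)).
  rewrite -(pdistrD (ph j) t1 t2) -(pdistrZ _ (ph j) (testD t1 t2)); congr (h j _).
  by apply/funext => x; rewrite cos_cos_wave.
have hcs j eta : h j (fun x => cos_wave xi x * sin_wave eta x) =
    2^-1 * (h j (sin_wave (xi + eta)) - h j (sin_wave (xi - eta))).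
  have [t1 t2] := (test_sin_wave R (xi + eta), test_sin_wave R (xi - eta)).
  rewrite -(pdistrN (ph j) t2) -(pdistrD (ph j) t1 (testN t2)).
  rewrite -(pdistrZ _ (ph j) (testD t1 (testN t2))); congr (h j _).
  by apply/funext => x; rewrite cos_sin_wave.
have hsc j eta : h j (fun x => sin_wave xi x * cos_wave eta x) =
    2^-1 * (h j (sin_wave (xi + eta)) + h j (sin_wave (xi - eta))).
  have [t1 t2] := (test_sin_wave R (xi + eta), test_sin_wave R (xi - eta)).
  rewrite -(pdistrD (ph j) t1 t2) -(pdistrZ _ (ph j) (testD t1 t2)); congr (h j _).
  by apply/funext => x; rewrite mulrC cos_sin_wave -[eta - xi]opprB sin_waveN [eta + xi]addrC; ring.
have hss j eta : h j (fun x => sin_wave xi x * sin_wave eta x) =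
    2^-1 * (h j (cos_wave (xi - eta)) - h j (cos_wave (xi + eta))).
  have [t1 t2] := (test_cos_wave R (xi + eta), test_cos_wave R (xi - eta)).
  rewrite -(pdistrN (ph j) t1) -(pdistrD (ph j) t2 (testN t1)).
  rewrite -(pdistrZ _ (ph j) (testD t2 (testN t1))); congr (h j _).
  by apply/funext => x; rewrite sin_sin_wave.
have Eb j eta : `|E j eta| <= ampl U eta * (2 * (rho (xi + eta) * ampl U (xi + eta) +
    rho (xi - eta) * ampl U (xi - eta))).
  have [p1 p2] := hb j (xi + eta); have [q1 q2] := hb j (xi - eta).
  set P := rho (xi + eta) * _ in p1 p2 *; set Q := rho (xi - eta) * _ in q1 q2 *.
  have half x y := @half_bounds x y P Q.
  apply: le_trans (ler_normD _ _) _; rewrite !normrM.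
  have [b1 b2] : `|smulfd phi (h j) (cos_wave eta)| <= P + Q /\ `|smulfd phi (h j) (sin_wave eta)| <= P + Q.
    rewrite /smulfd; case: hphi => ->; rewrite ?hcc ?hcs ?hsc ?hss.
      by have [? ? ?] := half _ _ p1 q1; have [? ? ?] := half _ _ p2 q2.
    by have [? ? ?] := half _ _ p1 q1; have [? ? ?] := half _ _ p2 q2.
  have PQ := le_trans (normr_ge0 _) b1.
  have -> : ampl U eta * (2 * (P + Q)) = ampl U eta * (P + Q) + ampl U eta * (P + Q) by ring.
  by rewrite lerD// ler_pM// ?ampl_cos ?ampl_sin.
(* The two series may be added only if they converge absolutely; this is where the $H^1$ bound [b]
   enters. *)
have sE j : (asum (E j) < +oo)%E.
  apply: (@le_lt_trans _ _ (\esum_(eta in [set: Z]) ((2 * ampl U eta ^+ 2)%:E +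
     ((2 * (rho (xi + eta) ^+ 2 * ampl U (xi + eta) ^+ 2))%:E +
      (2 * (rho (xi - eta) ^+ 2 * ampl U (xi - eta) ^+ 2))%:E))%E)).
    apply: le_esum => eta _; rewrite -!EFinD lee_fin; apply: le_trans (Eb _ _) _.
    have -> (p q : R) : p ^+ 2 * q ^+ 2 = (p * q) ^+ 2 by ring.
    have -> (p q : R) : p ^+ 2 * q ^+ 2 = (p * q) ^+ 2 by ring.
    set x := ampl U eta; set y := rho (xi + eta) * _; set z := rho (xi - eta) * _.
    by have := sqr_ge0 (x - y); have := sqr_ge0 (x - z); nra.
  have e2 (F : Z -> R) : (forall eta, 0 <= F eta) ->
      \esum_(eta in [set: Z]) (2 * F eta)%:E = (2%:E * \esum_(eta in [set: Z]) (F eta)%:E)%E.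
    by move=> F0; rewrite -esumZl// => eta; rewrite lee_fin.
  have pos eta : 0 <= rho eta ^+ 2 * ampl U eta ^+ 2 by rewrite mulr_ge0 ?sqr_ge0.
  have pos2 eta : (0 <= (2 * (rho eta ^+ 2 * ampl U eta ^+ 2))%:E)%E by rewrite lee_fin mulr_ge0 ?pos.
  have pos1 eta : (0 <= (2 * ampl U eta ^+ 2)%:E)%E by rewrite lee_fin mulr_ge0 ?sqr_ge0.
  rewrite esumD => [|eta _|eta _]; [|exact: pos1|by apply: adde_ge0; apply: pos2].
  rewrite [in X in (_ + X)%E]esumD => [|eta _|eta _]; [|exact: pos2|exact: pos2].
  pose G (eta : Z) := (2 * (rho eta ^+ 2 * ampl U eta ^+ 2))%:E.
  rewrite -[X in (_ + (X + _))%E]/(\esum_(eta in [set: Z]) G (xi + eta)).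
  rewrite -[X in (_ + (_ + X))%E]/(\esum_(eta in [set: Z]) G (xi - eta)).
  have K1 : cancel (fun eta : Z => xi + eta) (fun eta => eta - xi) by move=> x; rewrite addrAC subrr add0r.
  have K2 : cancel (fun eta : Z => eta - xi) (fun eta => xi + eta) by move=> x; rewrite addrC subrK.
  rewrite (esum_flip xi G) (esum_bij G K1 K2) /G.
  rewrite (e2 (fun i => ampl U i ^+ 2) (fun i => sqr_ge0 _)) !(e2 (fun i => rho i ^+ 2 * ampl U i ^+ 2) pos).
  have f1 : (2%:E * (\esum_(xi in [set: Z]) (ampl U xi ^+ 2)%:E) <= 2%:E * a%:E)%E by rewrite lee_wpmul2l.
  have f2 : (2%:E * (\esum_(xi in [set: Z]) (rho xi ^+ 2 * ampl U xi ^+ 2)%:E) <= 2%:E * b%:E)%E by rewrite lee_wpmul2l.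
  by apply: (le_lt_trans (leeD f1 (leeD f2 f2))); rewrite -!EFinM -!EFinD ltry.
rewrite convE sum2 -ZsumD// -[X in (_ <= _ * X)%E](fineK cf) -EFinM lee_fin.
apply: Zsum_le; rewrite EFinM fineK//.
apply: (@le_trans _ _ (\esum_(eta in [set: Z])
  ((2^-1 * rho xi)%:E * (ampl U eta * ampl U (xi + eta))%:E +
   (2^-1 * rho xi)%:E * (ampl U eta * ampl U (xi - eta))%:E)%E)); last first.
  have p0 : 0 <= 2^-1 * rho xi by apply: mulr_ge0 => //; exact: rho_ge0.
  have q0 z1 z2 : (0 <= (ampl U z1 * ampl U z2)%:E)%E.
    by rewrite lee_fin mulr_ge0 ?ampl_ge0.
  rewrite esumD => [|eta _|eta _]; [|by apply: mule_ge0; [rewrite lee_fin|exact: q0]..].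
  rewrite !esumZl//; try by move=> eta; rewrite lee_fin mulr_ge0 ?ampl_ge0.
  (* The terms at [xi + eta] give the same convolution once [eta] is replaced by [- eta], amplitudes
     being even. *)
  have KN : cancel (fun eta : Z => - eta) (fun eta => - eta) by move=> x; rewrite opprK.
  rewrite -(esum_bij (fun eta => (ampl U eta * ampl U (xi + eta))%:E) KN KN).
  under eq_esum do rewrite amplN//.
  rewrite -/(self_conv (ampl U) xi) -(fineK cf) -!EFinM -EFinD lee_fin.
  by rewrite le_eqVlt; apply/orP; left; apply/eqP; field.
apply: le_esum => eta _; rewrite -!EFinM -EFinD lee_fin -mulrDr.
have [dc ds] := div_free_coef eta pU dU.
have [cp sp] := (ampl_cos U (xi + eta) k, ampl_sin U (xi + eta) k).
have [cm sm] := (ampl_cos U (xi - eta) k, ampl_sin U (xi - eta) k).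
rewrite !sum2 in dc ds.
have key (S1 S2 : R) (e : E 0 eta + E 1 eta = pi * (\sum_j fr xi j * U j (cos_wave eta)) * S1 +
    pi * (\sum_j fr xi j * U j (sin_wave eta)) * S2) :
    `|S1| <= ampl U (xi + eta) + ampl U (xi - eta) -> `|S2| <= ampl U (xi + eta) + ampl U (xi - eta) ->
    `|E 0 eta + E 1 eta| <= 2^-1 * rho xi * (ampl U eta * ampl U (xi + eta) + ampl U eta * ampl U (xi - eta)).
  move=> s1 s2; rewrite e; apply: le_trans (divergence_bound xi _ _ s1 s2) _.
  rewrite -[X in _ * X * _ <= _]/(ampl U eta) -mulrDr [leRHS]mulrA; exact: lexx.
have frD j : fr (xi + eta) j = fr xi j + fr eta j by rewrite mxE rmorphD.
have frB j : fr (xi - eta) j = fr xi j - fr eta j by rewrite !mxE rmorphB.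
have bd (x y : R) : `|x| <= y -> - y <= x /\ x <= y by rewrite ler_norml => /andP[].
have [[? ?] [? ?]] := (bd _ _ cp, bd _ _ sp); have [[? ?] [? ?]] := (bd _ _ cm, bd _ _ sm).
rewrite !sum2 in key; case: hphi => hp; rewrite hp in E Eb sE convE key *.
  apply: (key (U k (sin_wave (xi + eta)) + U k (sin_wave (xi - eta)))
    (U k (cos_wave (xi - eta)) - U k (cos_wave (xi + eta)))); last 2 first.
  - by rewrite ler_norml; apply/andP; split; lra.
  - by rewrite ler_norml; apply/andP; split; lra.
  rewrite /E /smulfd !hcc !hcs /h !partiald_cos// !partiald_sin// !frD !frB.
  (* Multiples of the vanishing divergences [dc] and [ds] are added, which changes the frequencies
     $\xi\pm\eta$ into $\xi$. *)
  rewrite -[RHS]addr0 -{1}(mulr0 (pi * (U k (sin_wave (xi + eta)) - U k (sin_wave (xi - eta))))) -{1}dc.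
  rewrite -[RHS]addr0 -{1}(mulr0 (pi * (- U k (cos_wave (xi + eta)) - U k (cos_wave (xi - eta))))) -{1}ds.
  by field.
apply: (key (- U k (cos_wave (xi + eta)) - U k (cos_wave (xi - eta)))
  (U k (sin_wave (xi - eta)) - U k (sin_wave (xi + eta)))); last 2 first.
- by rewrite ler_norml; apply/andP; split; lra.
- by rewrite ler_norml; apply/andP; split; lra.
rewrite /E /smulfd !hsc !hss /h !partiald_cos// !partiald_sin// !frD !frB.
rewrite -[RHS]addr0 -{1}(mulr0 (pi * (U k (cos_wave (xi - eta)) - U k (cos_wave (xi + eta))))) -{1}dc.
rewrite -[RHS]addr0 -{1}(mulr0 (pi * (- U k (sin_wave (xi - eta)) - U k (sin_wave (xi + eta))))) -{1}ds.
by field.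
Qed.

(** A nonzero integer vector has squared length at least $1$, which absorbs the $1$ in [rho]. *)
Lemma freq2_rho xi : xi != 0 -> rho xi ^+ 2 <= 8 * pi ^+ 2 * freq2 R xi.
Proof.
move=> x0; rewrite rho_sq.
have f1 : 1 <= freq2 R xi.
  rewrite freq2E -!rmorphXn -rmorphD /= -[1]/(1%:~R) ler_int.
  apply: contraNT x0 => h; apply/eqP/rowP => j; rewrite mxE.
  have h0 := sqr_ge0 (xi 0 0); have h1 := sqr_ge0 (xi 0 1).
  move: h; rewrite -ltNge => h.
  case: (ord2P j) => ->; apply/eqP; rewrite -sqrf_eq0; apply/eqP.
    by move: h0 h1 h; move: (xi 0 0 ^+ 2) (xi 0 1 ^+ 2) => *; lia.
  by move: h0 h1 h; move: (xi 0 0 ^+ 2) (xi 0 1 ^+ 2) => *; lia.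
have p0 : 0 <= pi ^+ 2 :> R by rewrite sqr_ge0.
by nra.
Qed.

(* The symbol of the stress contracted with the strain of a divergence-free mode. *)
Lemma elliptic_mode (a : tensor R 2) : relaxed_elliptic a -> exists2 c : R, 0 < c &
  forall U xi, (forall k, pdistr (U k)) -> div_free U -> xi != 0 ->
  c * rho xi ^+ 2 * \sum_(k < 2) amp2 (U k) xi <=
  \sum_i \sum_j (stress a U i j (cos_wave xi) * (pi * (fr xi i * U j (sin_wave xi) + fr xi j * U i (sin_wave xi))) -
     stress a U i j (sin_wave xi) * (pi * (fr xi i * U j (cos_wave xi) + fr xi j * U i (cos_wave xi)))).
Proof.
move=> [C C0 HC]; exists (4 * C)^-1 => [|U xi pU dU x0]; first by rewrite invr_gt0 mulr_gt0.
have [dc ds] := div_free_coef xi pU dU; rewrite !sum2 in dc ds.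
(* The coefficient matrix of the strain. Its trace is $2\pi\,\xi\cdot u$, so for a divergence-free
   mode it is admissible in the relaxed condition, and its squared norm is $2\pi^2|\xi|^2|u|^2$. *)
pose Zm (u : 'I_2 -> R) : 'M[R]_2 := \matrix_(i, j) (pi * (fr xi i * u j + fr xi j * u i)).
pose Q (z : 'M[R]_2) := \sum_i \sum_k \sum_j \sum_l a i k j l * z i j * z k l.
have ell u : fr xi 0 * u 0 + fr xi 1 * u 1 = 0 ->
    2 * pi ^+ 2 * freq2 R xi * (u 0 ^+ 2 + u 1 ^+ 2) <= C * Q (Zm u).
  move=> hu; apply: le_trans (HC (Zm u) _ _).
  - rewrite !sum2 !mxE freq2E.
    have -> : forall x y p q : R, (pi * (x * p + x * p)) ^+ 2 + (pi * (x * q + y * p)) ^+ 2 +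
      ((pi * (y * p + x * q)) ^+ 2 + (pi * (y * q + y * q)) ^+ 2) =
      2 * pi ^+ 2 * (x ^+ 2 + y ^+ 2) * (p ^+ 2 + q ^+ 2) + 2 * pi ^+ 2 * (x * p + y * q) ^+ 2.
      by move=> *; ring.
    by rewrite hu expr0n /= mulr0 addr0.
  - by apply/matrixP => i j; rewrite !mxE addrC.
  - by rewrite /mxtrace sum2 !mxE -[RHS](mulr0 (2 * pi)) -hu; ring.
have -> : \sum_i \sum_j (stress a U i j (cos_wave xi) * (pi * (fr xi i * U j (sin_wave xi) + fr xi j * U i (sin_wave xi))) -
     stress a U i j (sin_wave xi) * (pi * (fr xi i * U j (cos_wave xi) + fr xi j * U i (cos_wave xi)))) =
    Q (Zm (fun k => U k (sin_wave xi))) + Q (Zm (fun k => U k (cos_wave xi))).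
  rewrite /Q -big_split /=; apply: eq_bigr => i _.
  under eq_bigr => j _.
    rewrite /stress /sumd; under eq_bigr do under eq_bigr do rewrite /scaled strain_cos//.
    under [X in _ - X * _]eq_bigr do under eq_bigr do rewrite /scaled strain_sin//.
    over.
  by rewrite !sum2 !mxE; ring.
have := ell (fun k => U k (cos_wave xi)) dc; have := ell (fun k => U k (sin_wave xi)) ds; rewrite sum2 /amp2.
have := freq2_rho x0; have F0 := freq2_ge0 R xi.
set P := pi ^+ 2; set F := freq2 R xi; set r := rho xi ^+ 2.
set u0 := U 0 _ ^+ 2; set u1 := U 1 _ ^+ 2; set u2 := U 0 _ ^+ 2; set u3 := U 1 _ ^+ 2.
move: (Q _) (Q _) => q1 q2 rF h1 h2.
have up : 0 <= u2 + u0 + (u3 + u1) by rewrite !addr_ge0 ?sqr_ge0.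
rewrite -mulrA mulrC ler_pdivrMr ?mulr_gt0//.
have : r * (u2 + u0 + (u3 + u1)) <= 8 * P * F * (u2 + u0 + (u3 + u1)) by rewrite ler_wpM2r.
by lra.
Qed.

Lemma stress_bound (a : tensor R 2) : exists2 C : R, 0 <= C & forall U i j xi,
  (forall k, pdistr (U k)) -> `|stress a U i j (cos_wave xi)| <= C * (rho xi * ampl U xi) /\
  `|stress a U i j (sin_wave xi)| <= C * (rho xi * ampl U xi).
Proof.
exists (\sum_i \sum_j \sum_k \sum_l `|a i k j l|).
  by rewrite !sumr_ge0// => i _; rewrite !sumr_ge0// => j _; rewrite !sumr_ge0// => k _; rewrite sumr_ge0.
move=> U i j xi pU; have rA : 0 <= rho xi * ampl U xi by rewrite mulr_ge0 ?rho_ge0 ?ampl_ge0.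
have sb (x y p q : R) : 2 * pi * `|x| <= rho xi -> 2 * pi * `|y| <= rho xi ->
    `|p| <= ampl U xi -> `|q| <= ampl U xi -> `|pi * (x * p + y * q)| <= rho xi * ampl U xi.
  move=> hx hy hp hq; rewrite normrM (ger0_norm (pi_ge0 R)).
  apply: (@le_trans _ _ (pi * (`|x| * `|p| + `|y| * `|q|))).
    by rewrite ler_wpM2l ?pi_ge0// -!normrM ler_normD.
  have := ler_pM (mulr_ge0 (mulr_ge0 (ler0n R 2) (pi_ge0 R)) (normr_ge0 x)) (normr_ge0 p) hx hp.
  have := ler_pM (mulr_ge0 (mulr_ge0 (ler0n R 2) (pi_ge0 R)) (normr_ge0 y)) (normr_ge0 q) hy hq.
  lra.
have st phi : (forall k l, `|strain U k l phi| <= rho xi * ampl U xi) ->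
    `|stress a U i j phi| <= (\sum_i \sum_j \sum_k \sum_l `|a i k j l|) * (rho xi * ampl U xi).
  move=> hs; apply: (@le_trans _ _ ((\sum_k \sum_l `|a i k j l|) * (rho xi * ampl U xi))).
    rewrite mulr_suml; apply: le_trans (ler_norm_sum _ _ _) (ler_sum _ _) => k _.
    rewrite mulr_suml; apply: le_trans (ler_norm_sum _ _ _) (ler_sum _ _) => l _.
    by rewrite /scaled normrM ler_wpM2l.
  rewrite ler_wpM2r//.
  have nn (F : 'I_2 -> R) m : (forall m, 0 <= F m) -> F m <= \sum_m F m.
    by move=> F0; rewrite (bigD1 m)//= lerDl sumr_ge0.
  apply: le_trans (nn (fun i => \sum_j \sum_k \sum_l `|a i k j l|) i _) => [|m].
    apply: (nn (fun j => \sum_k \sum_l `|a i k j l|)) => m.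
    by rewrite sumr_ge0// => ? _; rewrite sumr_ge0.
  by rewrite sumr_ge0// => ? _; rewrite sumr_ge0// => ? _; rewrite sumr_ge0.
by split; apply: st => k l; rewrite ?strain_cos// ?strain_sin// ?normrN; apply: sb;
  rewrite ?rho_coord ?ampl_sin ?ampl_cos.
Qed.

Lemma Lop_cos (a : tensor R 2) U k xi : (forall k, pdistr (U k)) ->
  Lop a U k (cos_wave xi) = \sum_j 2 * pi * fr xi j * stress a U k j (sin_wave xi).
Proof. by move=> pU; apply: eq_bigr => j _; rewrite partiald_cos//; apply: pdistr_stress. Qed.

Lemma Lop_sin (a : tensor R 2) U k xi : (forall k, pdistr (U k)) ->
  Lop a U k (sin_wave xi) = - \sum_j 2 * pi * fr xi j * stress a U k j (cos_wave xi).
Proof.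
move=> pU; rewrite -sumrN; apply: eq_bigr => j _; rewrite partiald_sin//.
exact: pdistr_stress.
Qed.

Lemma pdistr_Lop (a : tensor R 2) U k : (forall k, pdistr (U k)) -> pdistr (Lop a U k).
Proof. by move=> pU; apply: pdistr_sumd => j; apply: pdistr_partiald; apply: pdistr_stress. Qed.

Lemma Lop_bound (a : tensor R 2) : exists2 C : R, 0 <= C & forall U k xi,
  (forall k, pdistr (U k)) -> `|Lop a U k (cos_wave xi)| <= C * (rho xi ^+ 2 * ampl U xi) /\
  `|Lop a U k (sin_wave xi)| <= C * (rho xi ^+ 2 * ampl U xi).
Proof.
have [C C0 HC] := stress_bound a; exists (2 * C) => [|U k xi pU]; first by rewrite mulr_ge0.
have b (S : 'I_2 -> R) : (forall j, `|S j| <= C * (rho xi * ampl U xi)) ->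
    `|\sum_j 2 * pi * fr xi j * S j| <= 2 * C * (rho xi ^+ 2 * ampl U xi).
  move=> hS; apply: le_trans (ler_norm_sum _ _ _) _.
  have h j : `|2 * pi * fr xi j * S j| <= rho xi * (C * (rho xi * ampl U xi)).
    rewrite !normrM [`|2|]ger0_norm// (ger0_norm (pi_ge0 R)) ler_pM// ?mulr_ge0 ?pi_ge0//.
    exact: rho_coord.
  by rewrite sum2; have := h 0; have := h 1; lra.
rewrite Lop_cos// Lop_sin// normrN.
by split; apply: b => j; have [] := HC U k j xi pU.
Qed.

(** The stress is symmetric by the symmetry of the tensor, so contracting it with the strain of the
    mode amounts to contracting it with the gradient; the rest is integration by parts. *)
Lemma Lop_mode (a : tensor R 2) U xi (p q : 'I_2 -> R) : tensor_symmetric a -> (forall k, pdistr (U k)) ->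
  \sum_i \sum_j (stress a U i j (cos_wave xi) * (pi * (fr xi i * q j + fr xi j * q i)) -
     stress a U i j (sin_wave xi) * (pi * (fr xi i * p j + fr xi j * p i))) =
  - \sum_k (Lop a U k (cos_wave xi) * p k + Lop a U k (sin_wave xi) * q k).
Proof.
move=> sa pU; rewrite !sum2 !Lop_cos// !Lop_sin// !sum2.
have sym phi : stress a U 1 0 phi = stress a U 0 1 phi.
  rewrite /stress /sumd; apply: eq_bigr => j _; apply: eq_bigr => l _.
  by rewrite /scaled; have [-> _] := sa 1 j 0 l.
by rewrite !sym; ring.
Qed.

End Amplitude.

(** * Weak time derivatives *)

Section SmoothStep.
Variable R : realType.
Implicit Types (P : {poly R}) (f g : R -> R) (x y : R).

Lemma poly_le_expR P : exists2 C : R, 0 <= C & forall y, 0 <= y -> `|P.[y]| <= C * expR y.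
Proof.
exists (\sum_(i < size P) `|P`_i| * i`!%:R) => [|y y0].
  by apply: sumr_ge0 => i _; rewrite mulr_ge0.
rewrite horner_coef mulr_suml; apply: le_trans (ler_norm_sum _ _ _) (ler_sum _ _) => i _.
rewrite normrM -mulrA ler_wpM2l// normrX ger0_norm//.
rewrite mulrC -ler_pdivrMr ?ltr0n ?fact_gt0//.
case: (nat_of_ord i) => [|n]; first by rewrite expr0 fact0 divr1 -expR0 ler_expR.
by have := expR_ge1Dxn n y0; apply: le_trans; rewrite lerDr.
Qed.

(** The function $P(1/x)e^{-1/x}$, extended by $0$. Derivatives remain in this class, with $P$
    replaced by $X^2(P-P')$. *)
Definition flat P x : R := if 0 < x then P.[x^-1] * expR (- x^-1) else 0.

Lemma flat_le0 P x : x <= 0 -> flat P x = 0.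
Proof. by rewrite /flat leNgt; case: ifP. Qed.

Lemma flat_bound P : exists2 C : R, 0 <= C & forall x, `|flat P x| <= C * `|x|.
Proof.
have [C C0 HC] := poly_le_expR ('X * P); exists C => // x.
rewrite /flat; case: ifPn => [x0|_]; last by rewrite normr0 mulr_ge0.
have := HC x^-1; rewrite invr_ge0 ltW// => /(_ isT).
rewrite hornerM hornerX !normrM (gtr0_norm (expR_gt0 _)) expRN.
rewrite (gtr0_norm x0) gtr0_norm ?invr_gt0// => h.
by rewrite ler_pdivrMr ?expR_gt0// -mulrA [x * _]mulrC mulrA -ler_pdivrMr// mulrC.
Qed.

Lemma is_derive_flat P x : is_derive x (1 : R) (flat P) (flat ('X^2 * (P - P^`())) x).
Proof.
have nearE h : {near x, flat P =1 h} -> is_derive x (1 : R) h (flat ('X^2 * (P - P^`())) x) ->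
    is_derive x (1 : R) (flat P) (flat ('X^2 * (P - P^`())) x).
  move=> e d; by apply: near_eq_is_derive d; apply: filterS e => y ->.
have [x0|x0|x0] := ltgtP 0 x.
- pose h (y : R) : R := P.[y^-1] * expR (- y^-1).
  apply: (nearE h).
    near=> y; have y0 : 0 < y by near: y; exact: lt_nbhsr.
    by rewrite /flat y0.
  have di : is_derive x (1 : R) (fun y : R => y^-1) (- x ^- 2).
    have := @is_deriveV R id x 1 1 (lt0r_neq0 x0) (is_derive_id _ _).
    by rewrite [_ *: 1]mulr1.
  have dp : is_derive x (1 : R) (fun y : R => P.[y^-1]) (P^`().[x^-1] * (- x ^- 2)).
    exact: (@is_derive1_comp R (horner P) (fun y : R => y^-1) x _ _ (is_derive_poly P x^-1) di).
  have de : is_derive x (1 : R) (fun y : R => expR (- y^-1)) (expR (- x^-1) * - (- x ^- 2)).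
    exact: (@is_derive1_comp R (@expR R) (fun y : R => - y^-1) x _ _ (is_derive_expR _) (is_deriveN di)).
  have := is_deriveM dp de; congr (is_derive _ _ _ _).
  rewrite /flat x0 hornerM hornerXn hornerD hornerN exprVn /GRing.scale /=; ring.
- apply: (nearE (cst 0)).
    near=> y; have y0 : y < 0 by near: y; exact: lt_nbhsl.
    by rewrite flat_le0// ltW.
  by rewrite flat_le0 ?ltW//; exact: is_derive_cst.
- rewrite -x0 flat_le0//.
  suff h : (fun h : R => h^-1 *: ((flat P \o shift 0) (h *: 1) - flat P 0)) @ 0^' --> (0 : R).
    have dv : derivable (flat P) 0 1 by apply/cvg_ex; exists 0.
    by apply: DeriveDef => //; apply/cvg_lim.
  (* The difference quotient of [flat P] at $0$ is [flat ('X * P)], which tends to $0$ by the linear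
     bound. *)
  have [C' C'0 HC'] := flat_bound ('X * P).
  apply/cvgr0Pnorm_le => e e0; near=> y.
  have y0 : y != 0 by near: y; exact: nbhs_dnbhs_neq.
  rewrite /= (flat_le0 P (lexx 0)) subr0 addr0 [y *: 1]mulr1 /GRing.scale /=.
  have -> : y^-1 * flat P y = flat ('X * P) y.
    by rewrite /flat; case: ifP => _; rewrite ?mulr0// hornerM hornerX mulrA.
  have h1 : `|y| * (C' + 1) <= e.
    rewrite -ler_pdivlMr ?ltr_wpDl//; near: y; apply: dnbhs0_le.
    by rewrite divr_gt0// ltr_wpDl.
  by have := HC' y; have := normr_ge0 y; lra.
Unshelve. all: by end_near. Qed.

(* An algebra containing a smooth step and closed under differentiation, which
   makes smoothness a structural induction. *)
Inductive step_fun : (R -> R) -> Prop :=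
| step_flat P : step_fun (flat P)
| step_cst c : step_fun (fun=> c)
| step_add f g : step_fun f -> step_fun g -> step_fun (fun x => f x + g x)
| step_mul f g : step_fun f -> step_fun g -> step_fun (fun x => f x * g x)
| step_aff a b f : step_fun f -> step_fun (fun x => f (a * x + b))
| step_inv : step_fun (fun x => (flat 1 x + flat 1 (1 - x))^-1).

Lemma flat1_ge0 x : 0 <= flat 1 x.
Proof. by rewrite /flat; case: ifP => // _; rewrite hornerC mul1r expR_ge0. Qed.

Lemma flat1_gt0 x : 0 < x -> 0 < flat 1 x.
Proof. by rewrite /flat => ->; rewrite hornerC mul1r expR_gt0. Qed.

Lemma step_den_gt0 x : 0 < flat 1 x + flat 1 (1 - x).
Proof.
have [x0|x0] := ltP 0 x; first by rewrite ltr_pwDl ?flat1_gt0 ?flat1_ge0.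
by rewrite ltr_wpDl ?flat1_ge0// flat1_gt0//; lra.
Qed.

Lemma is_derive_aff (a b : R) f (df x : R) : is_derive (a * x + b) (1 : R) f df ->
  is_derive x (1 : R) (fun x => f (a * x + b)) (a * df).
Proof.
move=> d; rewrite mulrC.
have da : is_derive x (1 : R) (fun x : R => a * x + b) a.
  have := is_deriveD (is_deriveZ a (is_derive_id x (1 : R))) (is_derive_cst b x (1 : R)).
  by rewrite [_ *: 1]mulr1 addr0.
exact: (@is_derive1_comp R f (fun x : R => a * x + b) x _ _ d da).
Qed.

Lemma is_derive_flat1 x : is_derive x (1 : R) (flat 1) (flat 'X^2 x).
Proof. by have := is_derive_flat 1 x; rewrite -polyC1 derivC subr0 polyC1 mulr1. Qed.

Lemma is_derive_flat1_sub x :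
  is_derive x (1 : R) (fun x => flat 1 (1 - x)) (-1 * flat 'X^2 (-1 * x + 1)).
Proof.
have := is_derive_aff (is_derive_flat1 (-1 * x + 1)).
by congr (is_derive _ _ _ _); apply/funext => y; congr (flat _ _); ring.
Qed.

Lemma is_derive_step_den x : is_derive x (1 : R) (fun x => flat 1 x + flat 1 (1 - x))
  (flat 'X^2 x + -1 * flat 'X^2 (-1 * x + 1)).
Proof. exact: (is_deriveD (is_derive_flat1 x) (is_derive_flat1_sub x)). Qed.

Lemma step_fun_derive f : step_fun f ->
  exists2 g, step_fun g & forall x, is_derive x (1 : R) f (g x).
Proof.
elim=> {f} [P|c|f1 f2 _ [g1 s1 d1] _ [g2 s2 d2]|f1 f2 sf1 [g1 s1 d1] sf2 [g2 s2 d2]|a b f _ [g s d]|].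
- by exists (flat ('X^2 * (P - P^`()))) => [|x]; [exact: step_flat|exact: is_derive_flat].
- by exists (fun=> 0) => [|x]; [exact: step_cst|exact: is_derive_cst].
- by exists (fun x => g1 x + g2 x) => [|x]; [exact: step_add|exact: is_deriveD].
- exists (fun x => f1 x * g2 x + f2 x * g1 x) => [|x]; last exact: is_deriveM.
  by apply: step_add; apply: step_mul.
- exists (fun x => a * g (a * x + b)) => [|x]; last exact: is_derive_aff.
  by apply: step_mul; [exact: step_cst|exact: step_aff].
exists (fun x => -1 * ((flat 1 x + flat 1 (1 - x))^-1 * (flat 1 x + flat 1 (1 - x))^-1) *
  (flat 'X^2 x + -1 * flat 'X^2 (-1 * x + 1))) => [|x].
  apply: step_mul; first by apply: step_mul; [exact: step_cst|apply: step_mul; exact: step_inv].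
  apply: step_add; first exact: step_flat.
  by apply: step_mul; [exact: step_cst|exact: (step_aff (-1) 1 (step_flat _))].
have := @is_deriveV R (fun x => flat 1 x + flat 1 (1 - x)) x _ _
  (lt0r_neq0 (step_den_gt0 x)) (is_derive_step_den x).
by congr (is_derive _ _ _ _); rewrite /GRing.scale /= -exprVn; ring.
Qed.

Lemma step_fun_smooth f m : step_fun f -> step_fun (derive1n m f).
Proof.
elim: m f => // m IH f sf; rewrite derive1Sn; have [g sg d] := step_fun_derive sf.
suff -> : derive1 f = g by exact: IH.
by apply/funext => x; rewrite derive1E; have := d x => dx; rewrite derive_val.
Qed.

Lemma step_fun_derivable f m x : step_fun f -> derivable (derive1n m f) x 1.
Proof. by move=> /(step_fun_smooth m)/step_fun_derive [g _ /(_ x) []]. Qed.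

(** The usual quotient, whose denominator is positive because $x$ and $1-x$ are not both
    nonpositive. The derivative [G] is written out so that its sign and support can be read off. *)
Lemma smooth_step : exists H G : R -> R,
  [/\ step_fun H, forall x, is_derive x (1 : R) H (G x), continuous G &
   [/\ forall x, 0 <= G x, forall x, 0 <= H x <= 1, forall x, x <= 0 -> H x = 0 & 
   [/\ forall x, 1 <= x -> H x = 1, forall x, x <= 0 -> G x = 0 & forall x, 1 <= x -> G x = 0]]].
Proof.
pose D x := flat 1 x + flat 1 (1 - x); pose H x := flat 1 x * (D x)^-1.
have sH : step_fun H by apply: step_mul; [exact: step_flat|exact: step_inv].
have D0 : forall x, 0 < D x := step_den_gt0.
pose G x := (flat 'X^2 x * flat 1 (1 - x) + flat 1 x * flat 'X^2 (1 - x)) * ((D x)^-1 * (D x)^-1).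
have dG x : is_derive x (1 : R) H (G x).
  have := is_deriveM (is_derive_flat1 x) 
    (@is_deriveV R D x _ _ (lt0r_neq0 (D0 x)) (is_derive_step_den x)).
  congr (is_derive _ _ _ _); rewrite /G /GRing.scale /= (_ : -1 * x + 1 = 1 - x); last by ring.
  have := lt0r_neq0 (D0 x); rewrite /D; move: (flat _ _) (flat _ _) (flat _ _) (flat _ _) => p q p' q' h.
  by field.
have [G' sG' dG'] := step_fun_derive sH.
have GG' : G' = G by apply/funext => x; have := dG x; have := dG' x => d1 [_ <-]; rewrite derive_val.
have [G2 _ d2] := step_fun_derive sG'.
exists H, G; split=> //.
  move=> x; rewrite -GG'; apply: differentiable_continuous; apply/derivable1_diffP.
  by case: (d2 x).
have X20 x : 0 <= flat 'X^2 x by rewrite /flat; case: ifP => // _; rewrite hornerXn mulr_ge0 ?sqr_ge0 ?expR_ge0.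
split.
- by move=> x; rewrite mulr_ge0 ?addr_ge0 ?mulr_ge0 ?invr_ge0 ?flat1_ge0 ?(ltW (D0 x)).
- move=> x; rewrite mulr_ge0 ?flat1_ge0 ?invr_ge0 ?(ltW (D0 x))//=.
  by rewrite ler_pdivrMr ?D0// mul1r lerDl flat1_ge0.
- by move=> x x0; rewrite /H flat_le0 ?mul0r.
- split=> x hx; rewrite /G /H.
  + rewrite /D (@flat_le0 _ (1 - x)) ?addr0 ?divff ?gt_eqF ?flat1_gt0//; lra.
  + by rewrite !(flat_le0 _ hx) !mul0r addr0 mul0r.
  + by rewrite !(@flat_le0 _ (1 - x)) ?mulr0 ?addr0 ?mul0r//; lra.
Qed.

End SmoothStep.

(* [lra] reifies the whole context. *)
Ltac qlra := repeat match goal with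
  | H : forall _, _ |- _ => clear H | H : _ = _ |- _ => clear H
  | H : is_true (integrable _ _ _) |- _ => clear H end; lra.

(** * From the distributional derivative to the fundamental theorem of calculus *)

Section DuBoisReymond.
Variable R : realType.
Local Notation mu := (@lebesgue_measure R).
Implicit Types (y z f g : R -> R) (s t T : R).

Lemma Rintegral_support (A D : set R) f : A `<=` D -> (forall x, D x -> ~ A x -> f x = 0) ->
  (\int[mu]_(x in D) f x)%R = (\int[mu]_(x in A) f x)%R.
Proof.
move=> AD h; rewrite Rintegral_mkcond [RHS]Rintegral_mkcond; congr (Rintegral _ _ _).
apply/funext => x; rewrite !patchE; case: ifPn => xD; case: ifPn => xA //.
  by rewrite inE in xD; apply: h => // /mem_set; apply/negP.
by move: xD; rewrite mem_set//; apply: AD; rewrite inE in xA.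
Qed.

Lemma integrable_addr d (X : measurableType d) (nu : {measure set X -> \bar R}) D (f g : X -> R) :
  measurable D -> nu.-integrable D (EFin \o f) -> nu.-integrable D (EFin \o g) ->
  nu.-integrable D (EFin \o (fun x => f x + g x)).
Proof. by move=> mD fi gi; have := integrableD mD fi gi; apply: eq_integrable. Qed.

Lemma integrable_subr d (X : measurableType d) (nu : {measure set X -> \bar R}) D (f g : X -> R) :
  measurable D -> nu.-integrable D (EFin \o f) -> nu.-integrable D (EFin \o g) ->
  nu.-integrable D (EFin \o (fun x => f x - g x)).
Proof. by move=> mD fi gi; have := integrableB mD fi gi; apply: eq_integrable. Qed.

Lemma integrable_mulrl d (X : measurableType d) (nu : {measure set X -> \bar R}) D c (f : X -> R) :
  measurable D -> nu.-integrable D (EFin \o f) -> nu.-integrable D (EFin \o (fun x => c * f x)).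
Proof. by move=> mD fi; have := integrableZl mD c fi; apply: eq_integrable. Qed.

(* A one-sided approximate identity. *)
Lemma mollify (G H : R -> R) y s (e d k T : R) :
  (forall x, is_derive x (1 : R) H (G x)) -> continuous G -> (forall x, 0 <= G x) ->
  H 0 = 0 -> H 1 = 1 -> (forall x, x <= 0 -> G x = 0) -> (forall x, 1 <= x -> G x = 0) ->
  0 < s -> {within `[0, T], continuous y} -> 0 < k -> k^-1 < d -> s + d < T ->
  (forall x, s <= x <= s + d -> `|y x - y s| <= e) ->
  `|\int[mu]_(x in `]0, T[) (k * G (k * (x - s)) * y x) - y s| <= e.
Proof.
move=> dH cG G0 H0 H1 Gl Gr s0 cy k0 kd sT hy.
have ki : 0 < k^-1 by rewrite invr_gt0.
have lt1 : s < s + k^-1 by rewrite ltrDl.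
pose I := `[s, s + k^-1]%classic : set R.
rewrite (@Rintegral_support I); last 2 first.
- by move=> x; rewrite /I /= !in_itv /= => /andP[? ?]; apply/andP; split; lra.
- move=> x _; rewrite /I /= in_itv /= => /negP; rewrite negb_and -!ltNge => /orP[] h.
    by rewrite Gl ?mulr0 ?mul0r// mulr_ge0_le0 ?(ltW k0)//; lra.
  rewrite Gr ?mulr0 ?mul0r//.
  have -> : 1 = k * k^-1 by rewrite divff ?gt_eqF.
  by rewrite ler_pM2l//; lra.
have mI : measurable I by exact: measurable_itv.
pose g x := k * G (k * (x - s)).
have cg : continuous g.
  move=> x; apply: cvgM; first exact: cvg_cst.
  apply: (@continuous_comp _ _ _ (fun x : R => k * (x - s)) G); last exact: cG.
  by apply: cvgM; [exact: cvg_cst|apply: cvgB; [exact: cvg_id|exact: cvg_cst]].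
have cgI : {within I, continuous g} by exact: continuous_subspaceT.
have cyI : {within I, continuous y}.
  apply: continuous_subspaceW cy => x; rewrite /I /= !in_itv /= => /andP[? ?].
  by apply/andP; split; lra.
have ci f : {within I, continuous f} -> mu.-integrable I (EFin \o f).
  by move=> cf; apply: continuous_compact_integrable => //; exact: segment_compact.
have g0 x : 0 <= g x by rewrite /g mulr_ge0 ?(ltW k0).
have int1 : \int[mu]_(x in I) g x = 1.
  pose F x := H (k * x + (- k * s)).
  have dF x : is_derive x (1 : R) F (g x).
    rewrite /g (_ : k * (x - s) = k * x + - k * s); last by ring.
    exact: is_derive_aff.
  have F'g : {in `]s, s + k^-1[, derive1 F =1 g}.
    by move=> x _; rewrite derive1E; have := dF x => ?; rewrite derive_val.
  have := @continuous_FTC2 R g F s (s + k^-1) lt1 cgI _ F'g.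
  rewrite /Rintegral => ->; last first.
    split; first by move=> x _; have [] := dF x.
    - by apply: cvg_at_right_filter; apply: differentiable_continuous; apply/derivable1_diffP; have [] := dF s.
    - by apply: cvg_at_left_filter; apply: differentiable_continuous; apply/derivable1_diffP; have [] := dF (s + k^-1).
  rewrite /F -EFinB /=.
  have -> : k * (s + k^-1) + - k * s = 1 by field; rewrite gt_eqF.
  by rewrite (_ : k * s + - k * s = 0) ?H1 ?H0 ?subr0//; ring.
have cgy : {within I, continuous (fun x => g x * y x)}.
  by move=> x; apply: cvgM; [exact: cgI|exact: cyI].
have cgs (c : R) : {within I, continuous (fun x => g x * c)}.
  by move=> x; apply: cvgM; [exact: cgI|exact: cvg_cst].
have -> : \int[mu]_(x in I) (k * G (k * (x - s)) * y x) - y s =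
    \int[mu]_(x in I) (g x * y x - g x * y s).
  rewrite RintegralB//; [|exact: ci..]; congr (_ - _).
  by rewrite RintegralZr ?int1 ?mul1r//; exact: ci.
have cd : {within I, continuous (fun x => g x * y x - g x * y s)}.
  by move=> x; apply: cvgB; [exact: cgy|exact: cgs].
apply: (@le_trans _ _ (\int[mu]_(x in I) `|g x * y x - g x * y s|)).
  by apply: le_normr_Rintegral => //; exact: ci.
rewrite -[leRHS]mul1r -int1 -RintegralZr//; last exact: ci.
apply: le_Rintegral => //.
- by apply: ci => x; apply: cvg_norm; exact: cd.
- exact: ci.
move=> x; rewrite /I /= in_itv /= => /andP[h1 h2].
by rewrite -mulrBr normrM ger0_norm// ler_wpM2l// hy//; apply/andP; split; lra.
Qed.

Definition weak_derivative T y z := [/\ {within `[0, T], continuous y},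
  locally_integrable `]0, T[ z &
  forall psi, time_test T psi ->
    - (\int[mu]_(x in `]0, T[) (derive1 psi x * y x))%R =
    (\int[mu]_(x in `]0, T[) (psi x * z x))%R].

Lemma locally_integrable_itv T z s t : locally_integrable `]0, T[ z -> 0 < s -> t < T ->
  mu.-integrable `[s, t] (EFin \o z).
Proof.
move=> [mz _ iz] s0 tT; have sub : `[s, t] `<=` `]0, T[.
  by move=> x; rewrite /= !in_itv /= => /andP[? ?]; apply/andP; split; lra.
apply/integrableP; split.
  by apply/measurable_EFinP; apply: measurable_funS mz.
by apply: (iz `[s, t]%classic) => //; exact: segment_compact.
Qed.

Lemma within_near T y s (e : R) : {within `[0, T], continuous y} -> 0 < s -> s < T -> 0 < e ->
  exists d : R, [/\ 0 < d, s + d < T & forall x, s <= x <= s + d -> `|y x - y s| <= e].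
Proof.
move=> cy s0 sT e0.
have T0 : 0 < T by apply: lt_trans sT.
have /(continuous_within_itvP _ T0) [ci _ _] := cy.
have /ci : s \in `]0, T[ by rewrite in_itv /= s0.
move=> /cvgrPdist_le /(_ _ e0) /nbhs_ballP [d /= d0 hd].
exists (Num.min (d / 2) ((T - s) / 2)); split.
- by rewrite lt_min; apply/andP; split; lra.
- have : Num.min (d / 2) ((T - s) / 2) <= (T - s) / 2 by rewrite ge_min lexx orbT.
  lra.
move=> x /andP[h1 h2]; rewrite distrC; apply: hd; rewrite /ball /= ltr_norml.
have : Num.min (d / 2) ((T - s) / 2) <= d / 2 by rewrite ge_min lexx.
by move=> ?; apply/andP; split; lra.
Qed.

Let dbr_arith (a b c p q w e : R) : 0 < e -> `|w - c| <= 4 * e -> `|p - b| <= e ->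
  `|q - a| <= e -> - (p - q) = w -> `|a - b - c| = 8 * e -> False.
Proof.
move=> e0; rewrite !ler_norml => /andP[? ?] /andP[? ?] /andP[? ?] ? h.
have : `|a - b - c| <= 6 * e by rewrite ler_norml; apply/andP; split; lra.
by lra.
Qed.

(** The test function rises from $0$ to $1$ just after [s] and falls back just after [t]. Its
    derivative is a difference of two mollifiers, which evaluate [y] at [s] and [t] up to small
    errors by continuity, while the other side is close to the integral over [[s, t]]. A gap [E]
    between the two sides is refuted. *)
Lemma weak_derivativeE T y z s t : weak_derivative T y z -> 0 < s -> s < t -> t < T ->
  y t - y s = \int[mu]_(x in `[s, t]) z x.
Proof.
move=> [cy lz wd] s0 st tT.
have [H [G [sH dH cG [G0 H01 Hl [Hr Gl Gr]]]]] := smooth_step R.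
apply/eqP; rewrite -subr_eq0 -normr_eq0 eq_le normr_ge0 andbT leNgt; apply/negP.
(* The errors sum up to at most $4e+e+e=6e$, below the gap $8e$. *)
set E := `|_|; move=> E0; pose e := E / 8.
have e0 : 0 < e by rewrite divr_gt0.
have [H0 H1] := (Hl _ (lexx 0), Hr _ (lexx 1)).
have [ds [ds0 dsT hs]] := within_near cy s0 (lt_trans st tT) e0.
have [dt [dt0 dtT ht]] := within_near cy (lt_trans s0 st) tT e0.
pose d := Num.min ds dt; pose J := `[s, t + d]%classic : set R.
have d0 : 0 < d by rewrite lt_min ds0.
have [dds ddt] : d <= ds /\ d <= dt by split; rewrite ge_min lexx ?orbT.
have mJ : measurable J by exact: measurable_itv.
have iJ : mu.-integrable J (EFin \o z) by apply: locally_integrable_itv lz _ _ => //; qlra.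
have iJT : mu.-integrable setT (EFin \o (z \_ J)).
  by rewrite -restrict_EFin; apply/integrable_restrict => //=; rewrite setTI.
have [d' [d'0 hd']] := integral_normr_continuous iJT e0.
pose k := (Num.min d d' / 2)^-1.
have m0 : 0 < Num.min d d' by rewrite lt_min d0.
have k0 : 0 < k by rewrite invr_gt0 divr_gt0.
have ki : 0 < k^-1 by rewrite invr_gt0.
have [kd kd'] : k^-1 < d /\ k^-1 < d'.
  have [] : Num.min d d' <= d /\ Num.min d d' <= d' by split; rewrite ge_min lexx ?orbT.
  by rewrite /k invrK; split; qlra.
have kk : k * k^-1 = 1 by rewrite divff ?gt_eqF.
have k1 x : k^-1 <= x -> 1 <= k * x by move=> ?; rewrite -kk ler_pM2l.
have kl x : x <= 0 -> k * x <= 0 by move=> ?; rewrite mulr_ge0_le0 ?(ltW k0).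
pose g c x := k * G (k * (x - c)).
pose psi x := H (k * (x - s)) - H (k * (x - t)).
have dpsi x : is_derive x (1 : R) psi (g s x - g t x).
  have da c : is_derive x (1 : R) (fun x => H (k * (x - c))) (g c x).
    rewrite /g (_ : k * (x - c) = k * x + - k * c); last by ring.
    have -> : (fun x => H (k * (x - c))) = (fun x => H (k * x + - k * c)).
      by apply/funext => ?; congr H; ring.
    exact: is_derive_aff.
  exact: (is_deriveB (da s) (da t)).
have supp x : psi x != 0 -> s <= x <= t + d.
  apply: contraNT; rewrite negb_and -!ltNge /psi => /orP[] h.
    by rewrite !Hl ?subrr// kl//; qlra.
  by rewrite !Hr ?subrr// k1//; qlra.
have tpsi : time_test T psi.
  exists s, (t + d); split=> //; first by qlra.
  split=> [m x|x]; last exact: supp.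
    apply: step_fun_derivable.
    have -> : psi = (fun x => H (k * x + - k * s) + -1 * H (k * x + - k * t)).
      apply/funext => ?; rewrite /psi mulN1r; congr (H _ - H _); ring.
    apply: step_add; first exact: step_aff.
    by apply: step_mul; [exact: step_cst|exact: step_aff].
have cg c : continuous (g c).
  move=> x; apply: cvgM; first exact: cvg_cst.
  apply: (@continuous_comp _ _ _ (fun x : R => k * (x - c)) G); last exact: cG.
  by apply: cvgM; [exact: cvg_cst|apply: cvgB; [exact: cvg_id|exact: cvg_cst]].
have ig c : mu.-integrable `]0, T[ (EFin \o (fun x => g c x * y x)).
  apply: (@integrableS _ _ _ mu `[0, T]%classic) => //; first exact: subset_itv_oo_cc.
  apply: continuous_compact_integrable; first exact: segment_compact.
  by move=> x; apply: cvgM; [exact: (continuous_subspaceT (cg c))|exact: cy].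
have := wd _ tpsi.
under eq_Rintegral => x _.
  rewrite derive1E; have dx := dpsi x; rewrite derive_val mulrBl; over.
rewrite RintegralB// => eq1.
have ms : `|\int[mu]_(x in `]0, T[) (g s x * y x) - y s| <= e.
  apply: (@mollify G H y s e d k T) => //; first by qlra.
  by move=> x /andP[? ?]; apply: hs; apply/andP; split; qlra.
have mt : `|\int[mu]_(x in `]0, T[) (g t x * y x) - y t| <= e.
  apply: (@mollify G H y t e d k T) => //; [by qlra..|].
  by move=> x /andP[? ?]; apply: ht; apply/andP; split; qlra.
pose chi : R -> R := \1_(`[s, t]%classic : set R).
have eq2 : \int[mu]_(x in `]0, T[) (psi x * z x) = \int[mu]_(x in J) (psi x * z x).
  apply: Rintegral_support.
    by move=> x; rewrite /J /= !in_itv /= => /andP[? ?]; apply/andP; split; qlra.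
  move=> x _ nJ; suff -> : psi x = 0 by rewrite mul0r.
  by apply/eqP; apply: contra_notT nJ; rewrite /J /= in_itv /=; exact: supp.
have sJ : `[s, t] `<=` J.
  by move=> x; rewrite /J /= !in_itv /= => /andP[? ?]; apply/andP; split; qlra.
have eq3 : \int[mu]_(x in `[s, t]) z x = \int[mu]_(x in J) (chi x * z x).
  rewrite [RHS](Rintegral_support sJ); last first.
    by move=> x _ nx; rewrite /chi indicE memNset ?mul0r.
  by apply: eq_Rintegral => x xI; rewrite /chi indicE xI mul1r.
have mz : measurable_fun J z by apply/measurable_EFinP; case/integrableP: iJ.
have mpsi : measurable_fun J psi.
  apply: measurable_funTS; apply: continuous_measurable_fun => x.
  by apply: differentiable_continuous; apply/derivable1_diffP; case: (dpsi x).
have p1 x : `|psi x| <= 1.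
  have := H01 (k * (x - s)); have := H01 (k * (x - t)); rewrite /psi => /andP[? ?] /andP[? ?].
  by rewrite ler_norml; apply/andP; split; qlra.
have c1 x : 0 <= chi x <= 1 by rewrite /chi indicE; case: (_ \in _); rewrite /= ler01 lexx.
have iM (h : R -> R) : measurable_fun J h -> (forall x, `|h x| <= 1) ->
    mu.-integrable J (EFin \o (fun x => h x * z x)).
  move=> mh h1; apply: le_integrable iJ => //.
    by apply/measurable_EFinP; exact: measurable_funM.
  by move=> x _ /=; rewrite lee_fin normrM ler_piMl.
have ip := iM _ mpsi p1.
have ic : mu.-integrable J (EFin \o (fun x => chi x * z x)).
  apply: iM => [|x]; first by apply: measurable_funTS; exact: measurable_indic.
  by have /andP[? ?] := c1 x; rewrite ger0_norm.
(* Within [J], [psi] and the indicator [chi] differ only on the windows [A s] and [A t]. There the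
   difference is at most $2$, and the integral of $|z|$ is below [e] by absolute continuity. *)
pose A c := `[c, c + k^-1]%classic : set R.
have iA c : \int[mu]_(x in A c) `|(z \_ J) x| < e.
  have h : (mu (A c) < d'%:E)%E.
    rewrite /A lebesgue_measure_itv /= lte_fin ltrDl invr_gt0 k0 -EFinB lte_fin.
    by rewrite addrAC subrr add0r.
  by apply: hd' h; exact: measurable_itv.
pose B c := (fun x => `|(z \_ J) x|) \_ (A c).
have iB c : mu.-integrable J (EFin \o B c).
  apply: (@integrableS _ _ _ mu setT) => //.
  rewrite /B -restrict_EFin; apply/integrable_restrict => //=; first exact: measurable_itv.
  rewrite setTI; apply: (@integrableS _ _ _ mu setT) => //; first exact: measurable_itv.
  exact: integrable_norm.
have BE c : s <= c -> c <= t -> \int[mu]_(x in J) B c x = \int[mu]_(x in A c) `|(z \_ J) x|.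
  move=> sc ct; rewrite (@Rintegral_support (A c)).
  - by apply: eq_Rintegral => x xA; rewrite /B patchE xA.
  - by move=> x; rewrite /J /A /= !in_itv /= => /andP[? ?]; apply/andP; split; qlra.
  - by move=> x _ nx; rewrite /B patchE memNset.
have key : `|\int[mu]_(x in J) (psi x * z x) - \int[mu]_(x in J) (chi x * z x)| <= 4 * e.
  rewrite -RintegralB//.
  have idiff : mu.-integrable J (EFin \o (fun x => psi x * z x - chi x * z x)).
    exact: integrable_subr.
  apply: (@le_trans _ _ (\int[mu]_(x in J) `|psi x * z x - chi x * z x|)).
    exact: le_normr_Rintegral.
  have iBB : mu.-integrable J (EFin \o (fun x => B s x + B t x)).
    exact: integrable_addr.
  apply: (@le_trans _ _ (\int[mu]_(x in J) (2 * (B s x + B t x)))); last first.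
    rewrite RintegralZl// RintegralD// !BE//; [|by qlra..].
    by rewrite (_ : 4 * e = 2 * (e + e)) ?ler_pM2l ?lerD ?(ltW (iA _))//; ring.
  apply: le_Rintegral => //.
  - exact: integrable_norm idiff.
  - exact: integrable_mulrl.
  move=> x Jx; rewrite -mulrBl normrM.
  have b0 c : 0 <= B c x by rewrite /B patchE; case: ifP.
  have bA c : A c x -> B c x = `|z x| by move=> Ax; rewrite /B !patchE mem_set// mem_set.
  have le2 : `|psi x - chi x| <= 2.
    have := p1 x; have := c1 x; rewrite !ler_norml => /andP[? ?] /andP[? ?].
    by apply/andP; split; qlra.
  have [xs|xs] := leP x (s + k^-1); last have [xt|xt] := ltP x t; last have [xt'|xt'] := leP x (t + k^-1).
  - have As : A s x by move: Jx; rewrite /A /J /= !in_itv /= => /andP[? ?]; apply/andP; split.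
    by rewrite (bA s As) ler_pM// lerDl.
  - suff -> : psi x - chi x = 0 by rewrite normr0 mul0r mulr_ge0 ?addr_ge0.
    rewrite /psi Hr; last by apply: k1; qlra.
    rewrite Hl; last by apply: kl; qlra.
    by rewrite /chi indicE mem_set ?subr0 ?subrr//= in_itv /=; apply/andP; split; qlra.
  - have At : A t x by rewrite /A /= in_itv /= xt.
    by rewrite (bA t At) ler_pM// lerDr.
  - suff -> : psi x - chi x = 0 by rewrite normr0 mul0r mulr_ge0 ?addr_ge0.
    rewrite /psi Hr; last by apply: k1; qlra.
    rewrite Hr; last by apply: k1; qlra.
    rewrite /chi indicE memNset ?subr0 ?subrr//= in_itv /= => /andP[_]; qlra.
apply: (dbr_arith e0 key ms mt _ (_ : `|y t - y s - \int[mu]_(x in J) (chi x * z x)| = _)).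
  by rewrite -eq2.
by rewrite -eq3 -/E /e; field.
Qed.

End DuBoisReymond.

(** * Absolutely continuous functions of time *)

Section Primitive.
Variable R : realType.
Local Notation mu := (@lebesgue_measure R).
Implicit Types (y z f g : R -> R) (s t T : R).

(** Absolute continuity with derivative [z] on the open interval: [z] may fail to be integrable at
    the end points, while [y] is continuous up to them. *)
Definition primitive T y z := [/\ {within `[0, T], continuous y},
  locally_integrable `]0, T[ z &
  forall s t, 0 < s -> s < t -> t < T -> y t - y s = \int[mu]_(x in `[s, t]) z x].

Lemma weak_derivative_primitive T y z : weak_derivative T y z -> primitive T y z.
Proof. by move=> h; have [? ? _] := h; split=> // s t; exact: weak_derivativeE h. Qed.

Lemma locally_integrableZ (D : set R) c z : locally_integrable D z -> locally_integrable D (fun x => c * z x).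
Proof.
move=> [mz oD iz]; split=> //; first exact: measurable_funM.
move=> K KD cK; under eq_integral do rewrite normrM EFinM.
have mK : measurable K by exact: compact_measurable.
rewrite ge0_integralZl//; first by rewrite lte_mul_pinfty// iz.
by apply/measurable_EFinP; apply: measurableT_comp => //; apply: measurable_funS mz => //; exact: open_measurable.
Qed.

Lemma primitiveZ T c y z : primitive T y z -> primitive T (fun x => c * y x) (fun x => c * z x).
Proof.
move=> [cy lz h]; split; first by move=> x; apply: cvgM; [exact: cvg_cst|exact: cy].
  exact: locally_integrableZ.
move=> s t s0 st tT; rewrite RintegralZl// -?h ?mulrBr//; exact: (locally_integrable_itv lz).
Qed.

Lemma primitiveD T y z y' z' : primitive T y z -> primitive T y' z' ->
  primitive T (fun x => y x + y' x) (fun x => z x + z' x).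
Proof.
move=> [cy lz h] [cy' lz' h']; split; first by move=> x; apply: cvgD; [exact: cy|exact: cy'].
  exact: locally_integrableD.
move=> s t s0 st tT; rewrite RintegralD//; [|exact: (locally_integrable_itv lz)|exact: (locally_integrable_itv lz')].
by rewrite -h// -h'//; ring.
Qed.

Lemma eq_primitive T y y' z : {in `[0, T]%classic, y =1 y'} -> primitive T y z -> primitive T y' z.
Proof.
move=> e [cy lz h]; split=> //; first by apply: subspace_eq_continuous cy => x xT; exact: e.
move=> s t s0 st tT; rewrite -h// !e// inE /= in_itv /=; apply/andP; split; lra.
Qed.

(* Lebesgue differentiation on the compact subintervals. *)
Lemma primitive_eq0 T y z : primitive T y z -> {in `[0, T]%classic, y =1 cst 0} ->
  aet T (fun t => z t = 0).
Proof.
move=> [_ lz h] y0.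
pose a n := n.+1%:R^-1 : R.
have a0 n : 0 < a n by rewrite invr_gt0.
have aeN n : {ae mu, forall t, a n < t -> t < T - a n -> z t = 0}.
  have [aT|Ta] := leP (T - a n) (a n).
    by apply/aeW => t h1 h2; have := lt_trans h1 h2; rewrite ltNge aT.
  pose I := `[a n, T - a n]%classic : set R.
  have iI : mu.-integrable I (EFin \o z).
    by apply: (locally_integrable_itv lz) => //; rewrite ltrBlDr ltrDl.
  have mI : measurable I by exact: measurable_itv.
  have iT : mu.-integrable setT (EFin \o (z \_ I)).
    by rewrite -restrict_EFin; apply/integrable_restrict => //=; rewrite setTI.
  have := @FTC1 R (z \_ I) (BLeft (a n)) _ (integrable_locally_restrict mI iI).
  case=> [x|]; first by apply: integrableS iT => //; exact: measurable_itv.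
  move=> N [mN N0 hN]; exists N; split=> // t /= nt; apply: hN => /= hd; apply: nt => h1 h2.
  have [|_] := hd; first by rewrite lte_fin.
  rewrite patchE mem_set /I /=; last by rewrite in_itv /= !ltW.
  move=> <-; rewrite derive1E.
  transitivity ('D_1 (cst 0 : R -> R) t); last by rewrite derive_cst.
  apply: near_eq_derive.
  near=> x.
  have [x1 x2] : a n < x /\ x < T - a n.
    by split; near: x; [exact: lt_nbhsr|exact: lt_nbhsl].
  rewrite -[LHS]/(\int[mu]_(t in `[a n, x]) (z \_ I) t).
  transitivity (\int[mu]_(t in `[a n, x]) z t).
    apply: eq_Rintegral => u; rewrite inE /= in_itv /= => /andP[? ?].
    by rewrite patchE mem_set// /I /= in_itv /=; apply/andP; split; lra.
  have aT : x < T by have := a0 n; lra.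
  by rewrite -h// !y0 ?subrr// inE /= in_itv /=; have := a0 n => ?; apply/andP; split; lra.
have := ae_foralln aeN; apply: filterS => t ht.
rewrite in_itv /= => /andP[t0 tT].
have [n hn] : exists n, a n < Num.min t (T - t).
  have m0 : 0 < Num.min t (T - t) by rewrite lt_min t0 subr_gt0.
  by have [n _ hn] := near_infty_natSinv_lt (PosNum m0); exists n; exact: (hn n (leqnn n)).
by move: hn; rewrite lt_min => /andP[? ?]; apply: (ht n) => //; lra.
Unshelve. all: by end_near. Qed.

(** The integral [W] of [z] is continuous up to the end points. The difference [y - W] is constant
    inside, hence on the closed interval. *)
Lemma primitive_int T y z t : 0 < T -> primitive T y z -> mu.-integrable `]0, T[ (EFin \o z) ->
  0 <= t -> t <= T -> y t = y 0 + \int[mu]_(x in `]0, t[) z x.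
Proof.
move=> T0 [cy lz h] iz t0 tT.
pose z' := z \_ `]0, T[.
have mO : measurable (`]0, T[%classic : set R) by exact: measurable_itv.
have iT : mu.-integrable setT (EFin \o z').
  by rewrite /z' -restrict_EFin; apply/integrable_restrict => //=; rewrite setTI.
have iz' (D : set R) : measurable D -> mu.-integrable D (EFin \o z').
  by move=> mD; apply: integrableS iT.
pose W x : R := \int[mu]_(u in `[0, x]) z' u.
have cW : {within `[0, T], continuous W}.
  by apply: parameterized_integral_continuous; rewrite ?ltW//; apply: iz'; exact: measurable_itv.
have WE x : 0 <= x -> x <= T -> W x = \int[mu]_(u in `]0, x[) z u.
  move=> x0 xT; rewrite /W -Rintegral_itv_obnd_cbnd; last by apply: iz'; exact: measurable_itv.
  rewrite -Rintegral_itv_bndo_bndc; last by apply: iz'; exact: measurable_itv.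
  apply: eq_Rintegral => u; rewrite inE /= in_itv /= => /andP[? ?].
  by rewrite /z' patchE mem_set//= in_itv /=; apply/andP; split; lra.
have cw : {within `[0, T], continuous (fun x => y x - W x)}.
  by move=> x; apply: cvgB; [exact: cy|exact: cW].
pose c := y (T / 2) - W (T / 2).
have wc s u : 0 < s -> s < u -> u < T -> y u - W u = y s - W s.
  move=> s0 su uT; have := h _ _ s0 su uT.
  have : W u - W s = \int[mu]_(x in `[s, u]) z x.
    rewrite /W Rintegral_itvB; [|by apply: iz'; exact: measurable_itv|by rewrite bnd_simp; lra..].
    rewrite Rintegral_itv_obnd_cbnd; last by apply: iz'; exact: measurable_itv.
    apply: eq_Rintegral => x; rewrite inE /= in_itv /= => /andP[? ?].
    by rewrite /z' patchE mem_set//= in_itv /=; apply/andP; split; lra.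
  by move=> <-; lra.
have wc' s : 0 < s -> s < T -> y s - W s = c.
  move=> s0 sT; have [hs|hs|->//] := ltgtP s (T / 2).
    by rewrite /c (wc s)//; lra.
  by rewrite /c -(wc (T / 2) s)//; lra.
have /(continuous_within_itvP _ T0) [_ w0 wT] := cw.
have y0W : y 0 - W 0 = c.
  apply: (cvg_unique _ w0) => //.
  apply: cvg_near_cst; near=> x; apply: wc'; first by near: x; exact: nbhs_right_gt.
  by near: x; exact: nbhs_right_lt.
have yTW : y T - W T = c.
  apply: (cvg_unique _ wT) => //.
  apply: cvg_near_cst; near=> x; apply: wc'; first by near: x; exact: nbhs_left_gt.
  by near: x; exact: nbhs_left_lt.
have yt : y t - W t = c.
  move: t0 tT; rewrite le_eqVlt => /predU1P[<-//|t0]; rewrite le_eqVlt => /predU1P[->//|tT].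
  exact: wc'.
have W0 : W 0 = 0 by rewrite /W set_itv1 Rintegral_set1.
by rewrite -WE//; move: y0W; rewrite W0 -yt; lra.
Unshelve. all: by end_near. Qed.

(* Continuous induction. *)
Lemma chain_itv T (P : R -> R -> Prop) : 0 < T ->
  (forall s t u, 0 <= s -> s <= t -> t <= u -> u <= T -> P s t -> P t u -> P s u) ->
  (forall x, 0 <= x -> x <= T -> exists2 d, 0 < d & forall s t, 0 <= s -> x - d < s -> s <= x -> 
     x <= t -> t < x + d -> t <= T -> P s x /\ P x t) ->
  forall t, 0 <= t -> t <= T -> P 0 t.
Proof.
move=> T0 tr loc t0 t00 t0T.
suff PT t : 0 <= t -> t <= T -> P 0 t by exact: PT.
move=> {t0 t00 t0T} tp tT.
have P00 : P 0 0.
  by have [d d0 /(_ 0 0)] := loc 0 (lexx _) (ltW T0); rewrite sub0r add0r oppr_lt0 => /(_ (lexx _) d0 (lexx _) (lexx _) d0 (ltW T0)) [].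
pose S := [set x | 0 <= x <= T /\ forall v : R, 0 <= v -> v <= x -> P 0 v].
have S0 : S 0.
  by split=> [|v v0 v0']; [rewrite lexx ltW|have -> : v = 0 by apply/eqP; rewrite eq_le v0' v0].
have ubS : ubound S T by move=> x [/andP[]].
have hS : has_sup S by split; [exists 0|exists T].
set c := sup S.
have c0 : 0 <= c by apply: ub_le_sup => //; exists T.
have cT : c <= T by apply: ge_sup => //; exists 0.
have [d d0 hd] := loc c c0 cT.
have [s [/andP[s0 sT] Ps] cs] := sup_adherent d0 hS.
have sc : s <= c by apply: ub_le_sup; [exists T|split=> //; rewrite s0].
have Pc : P 0 c.
  apply: (tr 0 s c) => //; first exact: Ps.
  by have [] := hd s c s0 cs sc (lexx _); rewrite ?ltrDl.
have Pd u : c <= u -> u < c + d -> u <= T -> P 0 u.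
  move=> cu ud uT; apply: (tr 0 c u) => //.
  by have [] := hd c u c0 _ (lexx _) cu ud uT; rewrite ?gtrBl.
have Pcd u : 0 <= u -> u < c + d -> u <= T -> P 0 u.
  move=> u0 ud uT; have [uc|cu] := leP c u; first exact: Pd.
  have e : 0 < c - u by rewrite subr_gt0.
  have [s' [/andP[s0' _] Ps'] cs'] := sup_adherent e hS.
  by apply: Ps' => //; move: cs'; rewrite -/c; lra.
have [Tc|cT'] := leP T (c + d / 2); first by apply: Pcd => //; lra.
have : S (c + d / 2).
  by split=> [|v v0 vc]; [apply/andP; split; lra|apply: Pcd => //; lra].
move/(ub_le_sup (ex_intro _ T ubS)); rewrite -/c; lra.
Qed.

(** Chaining the local bounds gives $|w(t)-w(0)|\le e\,(g(t)-g(0))$ for every [e]. *)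
Lemma small_increments (T : R) (w g : R -> R) : 0 < T ->
  (forall e x, 0 < e -> 0 <= x -> x <= T -> exists2 d, 0 < d & forall s t, 0 <= s -> x - d < s -> s <= x ->
    x <= t -> t < x + d -> t <= T -> `|w x - w s| <= e * (g x - g s) /\ `|w t - w x| <= e * (g t - g x)) ->
  forall t, 0 <= t -> t <= T -> w t = w 0.
Proof.
move=> T0 h t t0 tT; apply/eqP; rewrite -subr_eq0 -normr_le0; apply/ler_addgt0Pl => e e0.
rewrite addr0; set K := `|g t - g 0| + 1; have K0 : 0 < K by rewrite ltr_wpDl.
have e1 : 0 < e / K by rewrite divr_gt0.
apply: (@le_trans _ _ (e / K * (g t - g 0))); last first.
  by rewrite mulrAC ler_pdivrMr// ler_pM2l// ler_wpDr// ler_norm.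
have tr s v u : `|w v - w s| <= e / K * (g v - g s) -> `|w u - w v| <= e / K * (g u - g v) ->
    `|w u - w s| <= e / K * (g u - g s).
  move=> h1 h2; rewrite (_ : w u - w s = (w u - w v) + (w v - w s)); last by ring.
  apply: le_trans (ler_normD _ _) _; rewrite (_ : g u - g s = (g u - g v) + (g v - g s)); last by ring.
  by rewrite mulrDr lerD.
apply: (@chain_itv T (fun s t => `|w t - w s| <= e / K * (g t - g s)) T0 _ _ t t0 tT).
  by move=> s v u _ _ _ _; exact: tr.
by move=> x x0 xT; exact: h.
Qed.

Lemma Rintegral_split (f : R -> R) s t u : s <= t -> t <= u -> mu.-integrable `]s, u[ (EFin \o f) ->
  \int[mu]_(x in `]s, u[) f x = \int[mu]_(x in `]s, t[) f x + \int[mu]_(x in `]t, u[) f x.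
Proof.
move=> st tu fi.
have [->|nst] := eqVneq s t; first by rewrite set_itvoo0 ?Rintegral_set0 ?add0r.
have [<-|ntu] := eqVneq t u; first by rewrite set_itvoo0 ?Rintegral_set0 ?addr0.
have st' : s < t by rewrite lt_neqAle nst.
have tu' : t < u by rewrite lt_neqAle ntu.
rewrite (Rintegral_itv_bndo_bndc (f := f) (a := BRight s) (r := t)); last first.
  apply: integrableS fi; [exact: measurable_itv|exact: measurable_itv|].
  by move=> x; rewrite /= !in_itv /= => /andP[-> h]; rewrite (lt_trans h).
rewrite -(@Rintegral_itvB R f (BRight s) (BLeft u) t) ?bnd_simp//; ring.
Qed.

(** The increments of $w=y^2-\int2yz$ are $\int(y(u)+y(s)-2y(x))z(x)\,dx$. Near each point
    continuity of [y] makes them small multiples of those of $\int|z|$, so [small_increments]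
    applies. *)
Lemma primitive_sqr T y z t : 0 < T -> primitive T y z -> mu.-integrable `]0, T[ (EFin \o z) ->
  0 <= t -> t <= T -> mu.-integrable `]0, t[ (EFin \o (fun x => 2 * (y x * z x))) /\
  y t ^+ 2 = y 0 ^+ 2 + \int[mu]_(x in `]0, t[) (2 * (y x * z x)).
Proof.
move=> T0 py iz t0 tT; have [cy _ _] := py.
have mO s u : measurable (`]s, u[%classic : set (measurableTypeR R)) by exact: measurable_itv.
have sub s u : 0 <= s -> u <= T -> `]s, u[%classic `<=` (`]0, T[%classic : set R).
  by move=> s0 uT x; rewrite /= !in_itv /= => /andP[h1 h2]; rewrite (le_lt_trans s0 h1) (lt_le_trans h2 uT).
have [B hB] : exists B, forall x, 0 <= x <= T -> `|y x| <= B.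
  have := @compact_bounded R _ (y @` `[0, T]%classic).
  have ck : compact (y @` `[0, T]%classic) by apply: continuous_compact => //; exact: segment_compact.
  move=> /(_ ck) [M [_ hM]]; exists (M + 1) => x xT.
  by apply: (hM (M + 1)); [rewrite ltrDl|exists x => //=; rewrite in_itv].
have my : measurable_fun `]0, T[ y.
  have : {within `]0, T[, continuous y} by apply: continuous_subspaceW cy; exact: subset_itv_oo_cc.
  by apply: subspace_continuous_measurable_fun.
have iyz : mu.-integrable `]0, T[ (EFin \o (fun x => 2 * (y x * z x))).
  apply: integrable_mulrl => //; have := integrable_mulrl B (mO 0 T) iz.
  apply: le_integrable => //.
    apply/measurable_EFinP; apply: measurable_funM => //.
    by apply/measurable_EFinP; case/integrableP: iz.
  move=> x /=; rewrite in_itv /= => /andP[? ?]; rewrite lee_fin !normrM ler_wpM2r//.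
  by apply: le_trans (ler_norm _); apply: hB; apply/andP; split; lra.
have iS (f : R -> R) s u : mu.-integrable `]0, T[ (EFin \o f) -> 0 <= s -> u <= T -> mu.-integrable `]s, u[ (EFin \o f).
  by move=> fi s0 uT; apply: integrableS fi => //; exact: sub.
split; first exact: iS.
pose w x := y x ^+ 2 - \int[mu]_(x in `]0, x[) (2 * (y x * z x)).
pose g x := \int[mu]_(x in `]0, x[) `|z x|.
have iN := integrable_norm iz.
have inc s u e x : 0 <= s -> s <= u -> u <= T -> s <= x <= u ->
    (forall v, s <= v <= u -> `|y v - y x| <= e) -> `|w u - w s| <= 4 * e * (g u - g s).
  move=> s0 su uT xs hy; have e0 : 0 <= e by apply: le_trans (hy x xs).
  have dI (f : R -> R) : mu.-integrable `]0, T[ (EFin \o f) ->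
      \int[mu]_(x in `]0, u[) f x - \int[mu]_(x in `]0, s[) f x = \int[mu]_(x in `]s, u[) f x.
    by move=> fi; rewrite (@Rintegral_split f 0 s u)//; [ring|exact: iS].
  have dy : y u - y s = \int[mu]_(x in `]s, u[) z x.
    rewrite (primitive_int T0 py iz (le_trans s0 su) uT) (primitive_int T0 py iz s0 (le_trans su uT)).
    by rewrite -dI//; ring.
  have -> : w u - w s = \int[mu]_(x in `]s, u[) ((y u + y s) * z x - 2 * (y x * z x)).
    rewrite RintegralB//; [|by apply: integrable_mulrl => //; exact: iS|exact: iS].
    rewrite RintegralZl//; last exact: iS.
    by rewrite -dy -dI// /w; ring.
  rewrite /g dI//.
  have id : mu.-integrable `]s, u[ (EFin \o (fun x => (y u + y s) * z x - 2 * (y x * z x))).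
    by apply: integrable_subr => //; [apply: integrable_mulrl => //; exact: iS|exact: iS].
  apply: (@le_trans _ _ (\int[mu]_(x in `]s, u[) `|(y u + y s) * z x - 2 * (y x * z x)|)).
    exact: le_normr_Rintegral.
  rewrite -RintegralZl//; last exact: iS.
  apply: le_Rintegral => //; first exact: integrable_norm.
    by apply: integrable_mulrl => //; exact: iS.
  move=> v; rewrite /= in_itv /= => /andP[? ?].
  rewrite (_ : _ - _ = (y u + y s - 2 * y v) * z v); last by ring.
  rewrite normrM ler_wpM2r//.
  have h1 : `|y u - y x| <= e by apply: hy; rewrite su lexx.
  have h2 : `|y s - y x| <= e by apply: hy; rewrite su lexx.
  have h3 : `|y v - y x| <= e by apply: hy; apply/andP; split; lra.
  move: h1 h2 h3; rewrite !ler_norml => /andP[? ?] /andP[? ?] /andP[? ?]; apply/andP; split; lra.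
have : w t = w 0.
  apply: (small_increments T0 (g := g)) => // e x e0 x0 xT.
  have /subspace_continuousP cy' := cy.
  have e4 : 0 < e / 4 by rewrite divr_gt0.
  have xI : `[0, T]%classic x by rewrite /= in_itv /= x0.
  have /cvgrPdist_le /(_ _ e4) := cy' x xI; rewrite near_withinE => /nbhs_ballP[d /= d0 hd].
  exists d => // s u s0 ds sx xu ud uT.
  have hy v : 0 <= v -> v <= T -> x - d < v -> v < x + d -> `|y v - y x| <= e / 4.
    move=> v0 vT dv vd; rewrite distrC; apply: hd; last by rewrite /= in_itv /= v0.
    by rewrite /ball /= ltr_norml; apply/andP; split; lra.
  rewrite (_ : e = 4 * (e / 4)); last by field.
  split; apply: (@inc _ _ _ x); rewrite ?lexx ?sx ?xu// => v /andP[? ?]; apply: hy; lra.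
rewrite /w [`]0, 0[%classic]set_itvoo0 ?Rintegral_set0 ?subr0// => <-; ring.
Qed.

End Primitive.

(** * Gronwall's lemma *)

Section Gronwall.
Variable R : realType.
Local Notation mu := (@lebesgue_measure R).

(* On intervals with [\int kappa < 1/2] the supremum of [E] is absorbed. *)
Lemma gronwall (T : R) (kappa : R -> R) : 0 < T -> (forall t, 0 <= kappa t) ->
  mu.-integrable `]0, T[ (EFin \o kappa) ->
  exists2 K, 0 <= K & forall (E : R -> R) (A M : R), measurable_fun `]0, T[ E ->
    (forall t, 0 < t -> t < T -> 0 <= E t <= M) -> 0 <= A ->
    (forall t, 0 < t -> t < T -> E t <= A + \int[mu]_(x in `]0, t[) (kappa x * E x)) ->
    forall t, 0 < t -> t < T -> E t <= K * A.
Proof.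
move=> T0 k0 ik; pose D := `]0, T[%classic : set (measurableTypeR R).
have mO s u : measurable (`]s, u[%classic : set (measurableTypeR R)) by exact: measurable_itv.
have iT : mu.-integrable setT (EFin \o (kappa \_ D)).
  by rewrite -restrict_EFin; apply/integrable_restrict => //=; [exact: mO|rewrite setTI].
have half : 0 < 2^-1 :> R by rewrite invr_gt0.
have [d [d0 hd]] := integral_normr_continuous iT half.
have dT : 0 < d / T by rewrite divr_gt0.
have [n _ hn] := near_infty_natSinv_lt (PosNum dT).
pose h := T / n.+1%:R; have h0 : 0 < h by rewrite divr_gt0.
have hlt : h < d.
  by have := hn n (leqnn n); rewrite /= ltr_pdivlMr// mulrC.
(* The bound doubles on each of the [n.+1] intervals of length [h]. It depends on [kappa] only,
   neither on [E] nor on its a priori bound [M], and hence will not depend on the truncation. *)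
exists (2 ^+ n.+1) => [|E A M mE EM A0 gE]; first by rewrite exprn_ge0.
pose f x := kappa x * E x.
have sub s u : 0 <= s -> u <= T -> `]s, u[%classic `<=` (`]0, T[%classic : set R).
  by move=> s0 uT x; rewrite /= !in_itv /= => /andP[h1 h2]; rewrite (le_lt_trans s0 h1) (lt_le_trans h2 uT).
have mk : measurable_fun D kappa by apply/measurable_EFinP; case/integrableP: ik.
have fi : mu.-integrable D (EFin \o f).
  have := integrable_mulrl M (mO 0 T) ik; apply: le_integrable => //.
    by apply/measurable_EFinP; apply: measurable_funM.
  move=> x /=; rewrite in_itv /= => /andP[x0 xT]; rewrite lee_fin /f.
  have /andP[e0 eM] := EM x x0 xT.
  by rewrite !normrM mulrC ler_wpM2r// !ger0_norm// (le_trans e0).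
have iS (g : R -> R) s u : mu.-integrable D (EFin \o g) -> 0 <= s -> u <= T -> mu.-integrable `]s, u[ (EFin \o g).
  by move=> gi s0 uT; apply: integrableS gi; [exact: mO|exact: mO|exact: sub].
have small x t m : 0 <= x -> x <= t -> t <= T -> t - x <= h -> (forall s, x < s -> s < t -> E s <= m) -> 0 <= m ->
    \int[mu]_(s in `]x, t[) f s <= m / 2.
  move=> x0 xt tT txh hm m0.
  apply: (@le_trans _ _ (\int[mu]_(s in `]x, t[) (m * `|(kappa \_ D) s|))).
    have iN : mu.-integrable `]x, t[ (EFin \o (fun s => `|(kappa \_ D) s|)).
      by apply: integrable_norm; apply: integrableS iT.
    apply: le_Rintegral => //; first exact: iS.
      exact: integrable_mulrl.
    move=> s; rewrite /= in_itv /= => /andP[xs st].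
    rewrite patchE mem_set; last by rewrite /D /= in_itv /=; apply/andP; split; lra.
    by rewrite ger0_norm// /f mulrC ler_wpM2r// hm.
  rewrite RintegralZl//; last by apply: integrable_norm; apply: integrableS iT.
  rewrite ler_wpM2l//; apply: ltW; apply: (hd _ (mO x t)).
  have : (mu `]x, t[ < d%:E)%E.
    rewrite lebesgue_measure_itv /= lte_fin; case: ifP => _; last by rewrite lte_fin.
    by rewrite -EFinB lte_fin; lra.
  by [].
have nh : n.+1%:R * h = T by rewrite /h mulrC divfK.
have jh j : (j <= n.+1)%N -> j%:R * h <= T.
  by move=> jn; rewrite -nh ler_pM2r// ler_nat.
have step j : (j <= n.+1)%N -> A + \int[mu]_(x in `]0, j%:R * h[) f x <= 2 ^+ j * A /\
    forall t, 0 < t -> t < T -> t <= j%:R * h -> E t <= 2 ^+ j * A.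
  elim: j => [_|j IH jn].
    rewrite mul0r set_itvoo0 Rintegral_set0 addr0 expr0 mul1r; split=> // t t0 _; lra.
  have [H1 H2] := IH (ltnW jn); rewrite exprS -mulrA.
  set B := 2 ^+ j * A in H1 H2 *; set x := j%:R * h in H1 H2.
  have x0 : 0 <= x by rewrite mulr_ge0// ltW.
  have B0 : 0 <= B by rewrite mulr_ge0// exprn_ge0.
  have x'E : j.+1%:R * h = x + h by rewrite -natr1 mulrDl mul1r.
  have x'T : x + h <= T by rewrite -x'E; exact: jh.
  have le t : x <= t -> t <= T -> A + \int[mu]_(s in `]0, t[) f s <= B + \int[mu]_(s in `]x, t[) f s.
    by move=> xt tT; rewrite (@Rintegral_split R f 0 x t)//; [rewrite addrA lerD2r|exact: iS].
  pose S := [set E s | s in [set s | [/\ x < s, s <= x + h & s < T]]].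
  have S1 : S (E (x + h / 2)) by exists (x + h / 2) => //=; split; lra.
  have ubS : ubound S M by move=> _ [s [xs sx sT] <-]; have /andP[] := EM s (le_lt_trans x0 xs) sT.
  have hS : has_sup S by split; [exists (E (x + h / 2))|exists M].
  have ES s : x < s -> s <= x + h -> s < T -> E s <= sup S.
    by move=> xs sx sT; apply: ub_le_sup; [exists M|exists s].
  have S0 : 0 <= sup S.
    by apply: le_trans (ub_le_sup (ex_intro _ M ubS) S1); have /andP[] := EM (x + h / 2) ltac:(lra) ltac:(lra).
  have S2 : sup S <= 2 * B.
    have : sup S <= B + sup S / 2.
      apply: ge_sup; first by exists (E (x + h / 2)).
      move=> _ [s [xs sx sT] <-]; apply: le_trans (gE s _ sT) _; first exact: le_lt_trans xs.
      apply: le_trans (le s (ltW xs) (ltW sT)) _; rewrite lerD2l.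
      apply: small => //; rewrite ?(ltW xs) ?(ltW sT)//; first by lra.
      by move=> v xv vs; apply: ES => //; lra.
    by lra.
  have E2 s : x < s -> s <= x + h -> s < T -> E s <= 2 * B.
    by move=> xs sx sT; apply: le_trans S2; exact: ES.
  rewrite x'E; split.
    apply: le_trans (le _ _ x'T) _; first by rewrite lerDl ltW.
    have : \int[mu]_(s in `]x, (x + h)[) f s <= 2 * B / 2.
      apply: small => //; rewrite ?lerDl ?(ltW h0) ?mulr_ge0//; first by rewrite addrAC subrr add0r.
      by move=> s xs sx; apply: E2 => //; lra.
    by rewrite mulrAC divff// mul1r => hh; rewrite mulrDl mul1r lerD2l.
  move=> t t0 tT tx; have [xt|xt] := ltP x t; first exact: E2.
  by have := H2 t t0 tT xt; lra.
move=> t t0 tT; have [_] := step n.+1 (leqnn _); apply => //.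
by rewrite nh ltW.
Qed.

End Gronwall.

Lemma sqr_sum3 (R : realFieldType) (x y z : R) : (x + y + z) ^+ 2 <= 3 * (x ^+ 2 + y ^+ 2 + z ^+ 2).
Proof. by have := sqr_ge0 (x - y); have := sqr_ge0 (x - z); have := sqr_ge0 (y - z); nra. Qed.

(** * Regularity of the velocity *)

Section Snapshot.
Variable R : realType.
Local Notation V := 'rV[R]_2.
Local Notation Z := 'rV[int]_2.
Local Notation rho := (@rho R 2).
Local Notation fr xi j := ((xi 0 j)%:~R : R).
Implicit Types (g h : functional R 2) (U W F : vfunctional R 2) (xi eta : Z) (x y p q : 'I_2 -> R).

Lemma freq2_gt0 xi : xi != 0 -> 0 < freq2 R xi.
Proof.
move=> x0; have := freq2_rho R x0; have := rho_ge4 R xi => r4 h.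
rewrite lt0r freq2_ge0 andbT; apply: contraTneq h => ->.
by rewrite mulr0 -ltNge; nra.
Qed.

(* The Leray projector on the Fourier coefficients at [xi]. *)
Definition lproj xi x k : R := x k - fr xi k / freq2 R xi * \sum_j fr xi j * x j.

Lemma lproj_perp xi x : xi != 0 -> \sum_k fr xi k * lproj xi x k = 0.
Proof.
move=> /freq2_gt0 f0; rewrite /lproj !sum2 !mulrBr.
move: f0; rewrite freq2E => /lt0r_neq0 f0; by field.
Qed.

Lemma lproj_id xi x k : \sum_j fr xi j * x j = 0 -> lproj xi x k = x k.
Proof. by move=> h; rewrite /lproj h mulr0 subr0. Qed.

Lemma lproj_adj xi x y : \sum_k x k * lproj xi y k = \sum_k lproj xi x k * y k.
Proof. by rewrite /lproj !sum2; ring. Qed.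

Lemma lproj_bound xi x k : xi != 0 -> `|lproj xi x k| <= 2 * (`|x 0| + `|x 1|).
Proof.
move=> x0; have f0 := freq2_gt0 x0; have fx := freq2E R xi.
have co k' : `|fr xi k'| ^+ 2 <= freq2 R xi.
  by rewrite real_normK ?num_real// fx; case: (ord2P k') => ->; rewrite ?lerDl ?lerDr sqr_ge0.
have n2 : `|x k| <= `|x 0| + `|x 1|.
  by case: (ord2P k) => ->; rewrite ?lerDl ?lerDr.
apply: le_trans (ler_normB _ _) _; rewrite mulr2n mulrDl !mul1r lerD//.
rewrite mulrAC normrM [`|_^-1|]gtr0_norm ?invr_gt0// ler_pdivrMr// normrM sum2.
apply: (@le_trans _ _ (`|fr xi k| * (`|fr xi 0| * `|x 0| + `|fr xi 1| * `|x 1|))).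
  by rewrite ler_wpM2l// -!normrM ler_normD.
have cc k' : `|fr xi k| * `|fr xi k'| <= freq2 R xi.
  by have := co k; have := co k'; have := sqr_ge0 (`|fr xi k| - `|fr xi k'|); nra.
rewrite mulrDr !mulrA mulrDl lerD//.
  by rewrite mulrC [leRHS]mulrC; rewrite mulrC [leRHS]mulrC; rewrite mulrC ler_wpM2l.
by rewrite mulrC ler_wpM2l.
Qed.

(** By self-adjointness of the projector, testing with the projected basis vectors reads off the
    coordinates of the projection. *)
Lemma lproj_unique xi (x x' y y' : 'I_2 -> R) k : xi != 0 ->
  (forall p q, \sum_k fr xi k * p k = 0 -> \sum_k fr xi k * q k = 0 ->
    \sum_k (x k * p k + y k * q k) = \sum_k (x' k * p k + y' k * q k)) ->
  lproj xi x k = lproj xi x' k /\ lproj xi y k = lproj xi y' k.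
Proof.
move=> x0 h; pose e (l : 'I_2) : R := (l == k)%:R.
have pe (z : 'I_2 -> R) : \sum_l z l * lproj xi e l = lproj xi z k.
  by rewrite lproj_adj sum2 /e; case: (ord2P k) => ->; rewrite ?eqxx ?mulr1 ?mulr0 ?addr0 ?add0r.
have p0 : \sum_k fr xi k * (0 : R) = 0 by rewrite big1// => *; rewrite mulr0.
have := h _ _ (lproj_perp e x0) p0; have := h _ _ p0 (lproj_perp e x0).
rewrite -!pe !sum2 => e1 e2; split; lra.
Qed.

Definition momentum (a : tensor R 2) U W F := exists2 c, leray (convection U) c &
  forall w, vHdot_sigma 1 w -> vdual (vadd W c) w + aform a U w = vdual F w.

Variable a : tensor R 2.
Hypotheses (sym : tensor_symmetric a) (ell : relaxed_elliptic a).

Definition force U F k : functional R 2 :=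
  addd (addd (F k) (Lop a U k)) (oppd (convection U k)).

Lemma momentum_perp U W F xi p q : (forall k, pdistr (U k)) -> (forall k, pdistr (W k)) ->
  (forall k, pdistr (F k)) -> momentum a U W F -> xi != 0 ->
  \sum_k fr xi k * p k = 0 -> \sum_k fr xi k * q k = 0 ->
  \sum_k (W k (cos_wave xi) * p k + W k (sin_wave xi) * q k) =
  \sum_k (force U F k (cos_wave xi) * p k + force U F k (sin_wave xi) * q k).
Proof.
move=> pU pW pF mo x0 hp hq; have := mode_equation pU pW pF mo x0 hp hq.
rewrite Lop_mode// !sum2 /force /addd /oppd.
move: (Lop _ _ _ _) (Lop _ _ _ _) (Lop _ _ _ _) (Lop _ _ _ _) => l1 l2 l3 l4.
move: (convection _ _ _) (convection _ _ _) (convection _ _ _) (convection _ _ _) => n1 n2 n3 n4.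
move: (W _ _) (W _ _) (W _ _) (W _ _) (F _ _) (F _ _) (F _ _) (F _ _) => w1 w2 w3 w4 f1 f2 f3 f4.
clear; move: (p _) (p _) (q _) (q _) => p0 p1 q0 q1 h.
by apply/eqP; rewrite -subr_eq0 -h; apply/eqP; ring.
Qed.

Lemma momentum_proj U W F xi k : (forall k, pdistr (U k)) -> (forall k, pdistr (W k)) ->
  (forall k, pdistr (F k)) -> momentum a U W F -> xi != 0 ->
  lproj xi (fun k => W k (cos_wave xi)) k = lproj xi (fun k => force U F k (cos_wave xi)) k /\
  lproj xi (fun k => W k (sin_wave xi)) k = lproj xi (fun k => force U F k (sin_wave xi)) k.
Proof.
move=> pU pW pF mo x0; apply: lproj_unique => // p q hp hq.
exact: momentum_perp pU pW pF mo x0 hp hq.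
Qed.

(** The mode equation is tested with the mode of [U] itself. With [c] from [elliptic_mode] the
    viscous term gains $\frac c2\varrho^2A^2$; half of it pays for the force through Young's
    inequality, and the other half is the stated dissipation. *)
Lemma momentum_rate : exists2 c : R, 0 < c & forall U W F (b b' : R) xi,
  (forall k, pdistr (U k)) -> (forall k, pdistr (W k)) -> (forall k, pdistr (F k)) ->
  div_free U -> momentum a U W F -> xi != 0 ->
  (\esum_(eta in [set: Z]) (ampl U eta ^+ 2)%:E <= b%:E)%E ->
  (\esum_(eta in [set: Z]) (rho eta ^+ 2 * ampl U eta ^+ 2)%:E <= b'%:E)%E ->
  2 * (\sum_k (U k (cos_wave xi) * W k (cos_wave xi) + U k (sin_wave xi) * W k (sin_wave xi))) +
    c * (rho xi ^+ 2 * ampl U xi ^+ 2) <=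
  c^-1 * (rho xi ^- 2 * ampl F xi ^+ 2) + 2 * (rho xi * ampl U xi * fine (self_conv (ampl U) xi)).
Proof.
have [c c0 hc] := elliptic_mode ell; exists (c / 4) => [|U W F b b' xi pU pW pF dU mo x0 Ub Ub'].
  by rewrite divr_gt0.
have [dc ds] := div_free_coef xi pU dU.
have := mode_equation pU pW pF mo x0 dc ds.
have := hc U xi pU dU x0; set S := \sum_i \sum_j _ => hS eqS.
set A := ampl U xi; set s := fine _.
have A0 : 0 <= A by exact: ampl_ge0.
have cb phi k : phi = cos_wave xi \/ phi = sin_wave xi -> `|convection U k phi| <= rho xi * s.
  move=> hphi; rewrite -lee_fin EFinM fineK.
    exact: convection_wave_bound Ub Ub' hphi.
  rewrite ge0_fin_numE; last by apply: esum_ge0 => eta _; rewrite lee_fin mulr_ge0 ?ampl_ge0.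
  by apply: le_lt_trans (conv_fin xi Ub) _; rewrite ltry.
pose X := \sum_k (F k (cos_wave xi) * U k (cos_wave xi) + F k (sin_wave xi) * U k (sin_wave xi)).
pose Y := \sum_k (convection U k (cos_wave xi) * U k (cos_wave xi) +
  convection U k (sin_wave xi) * U k (sin_wave xi)).
have hX : X <= ampl F xi * A.
  apply: le_trans (ler_norm _) _; apply: le_trans (ler_norm_sum _ _ _) _.
  rewrite /A /ampl mulr_sumr; apply: ler_sum => k _.
  by apply: le_trans (ler_normD _ _) _; rewrite !normrM mulrDr lerD// ler_wpM2r// ?ampl_cos ?ampl_sin.
have hY : - Y <= rho xi * s * A.
  apply: le_trans (ler_norm _) _; rewrite normrN; apply: le_trans (ler_norm_sum _ _ _) _.
  rewrite /A /ampl mulr_sumr; apply: ler_sum => k _.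
  apply: le_trans (ler_normD _ _) _; rewrite !normrM mulrDr.
  by rewrite lerD// ler_wpM2r//; apply: cb; [left|right].
have -> : \sum_k (U k (cos_wave xi) * W k (cos_wave xi) + U k (sin_wave xi) * W k (sin_wave xi)) =
    X - Y - S.
  move: eqS; rewrite /X /Y !sum2; move: S {hS} => S; clear.
  move: (convection _ _ _) (convection _ _ _) (convection _ _ _) (convection _ _ _) => n1 n2 n3 n4.
  move: (W _ _) (W _ _) (W _ _) (W _ _) (F _ _) (F _ _) (F _ _) (F _ _) => w1 w2 w3 w4 f1 f2 f3 f4.
  move: (U _ _) (U _ _) (U _ _) (U _ _) => p0 p1 q0 q1 h.
  by apply/eqP; rewrite -subr_eq0 -h; apply/eqP; ring.
have hA := ampl_sqr_le U xi; rewrite -/A in hA.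
have r0 := rho_gt0 R xi.
have young : 2 * (ampl F xi * A) <= c / 4 * (rho xi ^+ 2 * A ^+ 2) + (c / 4)^-1 * (rho xi ^- 2 * ampl F xi ^+ 2).
  have := sqr_ge0 (c / 4 * (rho xi * A) - (rho xi)^-1 * ampl F xi).
  have -> : (c / 4 * (rho xi * A) - (rho xi)^-1 * ampl F xi) ^+ 2 =
     c / 4 * (c / 4 * (rho xi ^+ 2 * A ^+ 2) + (c / 4)^-1 * (rho xi ^- 2 * ampl F xi ^+ 2) - 2 * (ampl F xi * A)).
    by field; rewrite !gt_eqF.
  by rewrite pmulr_rge0 ?subr_ge0// divr_gt0.
have hS' : c / 4 * (rho xi ^+ 2 * A ^+ 2) <= S.
  apply: le_trans hS; rewrite (_ : c / 4 * _ = c * rho xi ^+ 2 * (A ^+ 2 / 4)); last by ring.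
  have cr : 0 <= c * rho xi ^+ 2 by apply: mulr_ge0; [exact: ltW|exact: sqr_ge0].
  by apply: (ler_wpM2l cr); rewrite ler_pdivrMr// mulrC.
move: young hS' hX hY; set P := c / 4 * _; set Q := (c / 4)^-1 * _; set B := ampl F xi * A.
rewrite (_ : rho xi * s * A = rho xi * A * s); last by ring.
move: (rho xi * A * s) => D; lra.
Qed.

Lemma self_conv_fin U xi b : (\esum_(eta in [set: Z]) (ampl U eta ^+ 2)%:E <= b%:E)%E ->
  (fine (self_conv (ampl U) xi))%:E = self_conv (ampl U) xi /\ fine (self_conv (ampl U) xi) <= 2 * b.
Proof.
move=> Ub; have h := conv_fin xi Ub.
have f : self_conv (ampl U) xi \is a fin_num.
  rewrite ge0_fin_numE; last by apply: esum_ge0 => eta _; rewrite lee_fin mulr_ge0 ?ampl_ge0.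
  by apply: le_lt_trans h _; rewrite ltry.
by rewrite -lee_fin fineK.
Qed.

Lemma self_conv_ge0 U xi : (0 <= self_conv (ampl U) xi)%E.
Proof. by apply: esum_ge0 => eta _; rewrite lee_fin mulr_ge0 ?ampl_ge0. Qed.

Lemma force_bound : exists2 C : R, 0 <= C & forall U F (b b' : R) xi k phi,
  (forall k, pdistr (U k)) -> div_free U ->
  (\esum_(eta in [set: Z]) (ampl U eta ^+ 2)%:E <= b%:E)%E ->
  (\esum_(eta in [set: Z]) (rho eta ^+ 2 * ampl U eta ^+ 2)%:E <= b'%:E)%E ->
  phi = cos_wave xi \/ phi = sin_wave xi ->
  `|force U F k phi| <= ampl F xi + C * (rho xi ^+ 2 * ampl U xi) + rho xi * fine (self_conv (ampl U) xi).
Proof.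
have [C C0 hC] := Lop_bound a; exists C => // U F b b' xi k phi pU dU Ub Ub' hphi.
rewrite /force /addd /oppd; apply: le_trans (ler_normB _ _) _; apply: lerD.
  apply: le_trans (ler_normD _ _) _; have [h1 h2] := hC U k xi pU; apply: lerD.
    by case: hphi => ->; [exact: ampl_cos|exact: ampl_sin].
  by case: hphi => ->; [exact: h1|exact: h2].
rewrite -lee_fin EFinM (self_conv_fin xi Ub).1.
exact: convection_wave_bound Ub Ub' hphi.
Qed.

Lemma ampl_force_le : exists2 C : R, 0 <= C & forall U F (b b' : R) xi,
  (forall k, pdistr (U k)) -> div_free U ->
  (\esum_(eta in [set: Z]) (ampl U eta ^+ 2)%:E <= b%:E)%E ->
  (\esum_(eta in [set: Z]) (rho eta ^+ 2 * ampl U eta ^+ 2)%:E <= b'%:E)%E ->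
  ampl (force U F) xi <= C * (ampl F xi + rho xi ^+ 2 * ampl U xi + rho xi * fine (self_conv (ampl U) xi)).
Proof.
have [C C0 hC] := force_bound; exists (4 * (1 + C)) => [|U F b b' xi pU dU Ub Ub'].
  by rewrite mulr_ge0// addr_ge0.
have s0 : 0 <= fine (self_conv (ampl U) xi) by apply: fine_ge0; exact: self_conv_ge0.
set G := _ + _ + _; have G0 : 0 <= G by rewrite /G !addr_ge0 ?ampl_ge0// mulr_ge0 ?sqr_ge0 ?rho_ge0 ?ampl_ge0.
have h k phi : phi = cos_wave xi \/ phi = sin_wave xi -> `|force U F k phi| <= (1 + C) * G.
  move=> hphi; apply: le_trans (hC U F b b' xi k phi pU dU Ub Ub' hphi) _; rewrite /G.
  have x0 := ampl_ge0 F xi; have y0 := mulr_ge0 (sqr_ge0 (rho xi)) (ampl_ge0 U xi).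
  have z0 := mulr_ge0 (rho_ge0 R xi) s0.
  rewrite (_ : (1 + C) * _ = ampl F xi + C * (rho xi ^+ 2 * ampl U xi) + rho xi * fine (self_conv (ampl U) xi) +
    (C * ampl F xi + rho xi ^+ 2 * ampl U xi + C * (rho xi * fine (self_conv (ampl U) xi)))); last by ring.
  by rewrite lerDl; apply: addr_ge0; [apply: addr_ge0 => //; exact: mulr_ge0|exact: mulr_ge0].
rewrite /ampl sum2.
rewrite (_ : 4 * (1 + C) * G = (1 + C) * G + (1 + C) * G + ((1 + C) * G + (1 + C) * G)); last by ring.
apply: lerD; apply: lerD; apply: h; by [left|right].
Qed.

(** The operator costs two derivatives. The convection is [rho] times a convolution, which
    [conv_bound] with exponent [2 * q] bounds by $b$ and $c$. The cases $q=r$ and $q=r+1$ give the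
    uniform and the square-integrable bound in time. *)
Lemma ampl_force_sum (q : R) : 0 < q -> exists2 K : R, 0 <= K & forall U F (b b' c c' : R),
  (forall k, pdistr (U k)) -> div_free U ->
  (\esum_(eta in [set: Z]) (ampl U eta ^+ 2)%:E <= b%:E)%E ->
  (\esum_(eta in [set: Z]) (rho eta ^+ 2 * ampl U eta ^+ 2)%:E <= b'%:E)%E ->
  (\esum_(eta in [set: Z]) (rho eta `^ (2 * q) * ampl U eta ^+ 2)%:E <= c%:E)%E ->
  (\esum_(eta in [set: Z]) (rho eta `^ (2 * (q - 2)) * ampl F eta ^+ 2)%:E <= c'%:E)%E ->
  (\esum_(eta in [set: Z]) (rho eta `^ (2 * (q - 2)) * ampl (force U F) eta ^+ 2)%:E <=
   (K * (c' + (1 + b) * c))%:E)%E.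
Proof.
move=> q0; have [C C0 hC] := ampl_force_le; have q2 : 0 < 2 * q by rewrite mulr_gt0.
have [L L0 hL] := @conv_bound R (2 * q) q2.
exists (3 * C ^+ 2 * (1 + L)) => [|U F b b' c c' pU dU Ub Ub' Uc Fc].
  by rewrite !mulr_ge0 ?sqr_ge0 ?addr_ge0.
have s0 xi : 0 <= fine (self_conv (ampl U) xi) by apply: fine_ge0; exact: self_conv_ge0.
pose P xi := rho xi `^ (2 * (q - 2)).
have P0 xi : 0 <= P xi by exact: powR_ge0.
have b0 : 0 <= b by rewrite -lee_fin (le_trans _ Ub)// esum_ge0// => xi _; rewrite lee_fin sqr_ge0.
have c0 : 0 <= c.
  by rewrite -lee_fin (le_trans _ Uc)// esum_ge0// => xi _; rewrite lee_fin mulr_ge0 ?powR_ge0 ?sqr_ge0.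
have c'0 : 0 <= c'.
  by rewrite -lee_fin (le_trans _ Fc)// esum_ge0// => xi _; rewrite lee_fin mulr_ge0 ?powR_ge0 ?sqr_ge0.
have PE xi : P xi * (rho xi ^+ 2) ^+ 2 = rho xi `^ (2 * q).
  rewrite /P mulrBr powRB ?(gt_eqF (rho_gt0 R xi)) ?implybT// -exprM.
  rewrite (_ : 2 * 2 = (2 * 2)%N%:R); last by rewrite natrM.
  by rewrite powR_mulrn ?rho_ge0// divfK// expf_neq0// gt_eqF ?rho_gt0.
have PE2 xi : P xi * rho xi ^+ 2 = rho xi `^ (2 * q - 2).
  rewrite (_ : 2 * q - 2 = 2 * (q - 2) + 2); last by ring.
  by rewrite powRD ?(gt_eqF (rho_gt0 R xi)) ?implybT// powR_mulrn ?rho_ge0.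
pose N xi := fine (self_conv (ampl U) xi).
have NA xi : ((N xi)%:E <= self_conv (ampl U) xi)%E by rewrite (self_conv_fin xi Ub).1.
have hN := hL (ampl U) b c N (ampl_ge0 U) Ub Uc s0 NA.
have F0 xi : 0 <= P xi * ampl F xi ^+ 2 by apply: mulr_ge0 => //; exact: sqr_ge0.
have U0 xi : 0 <= rho xi `^ (2 * q) * ampl U xi ^+ 2 by apply: mulr_ge0; [exact: powR_ge0|exact: sqr_ge0].
have N0 xi : 0 <= rho xi `^ (2 * q - 2) * N xi ^+ 2 by apply: mulr_ge0; [exact: powR_ge0|exact: sqr_ge0].
have k0 : 0 <= 3 * C ^+ 2 by apply: mulr_ge0 => //; exact: sqr_ge0.
apply: (@le_trans _ _ ((3 * C ^+ 2)%:E * (c'%:E + (c%:E + (L * b * c)%:E)))%E); last first.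
  rewrite -!EFinD -EFinM lee_fin -[leRHS]mulrA ler_wpM2l//.
  rewrite (_ : (1 + L) * _ = (c' + (c + L * b * c)) + (L * c' + b * c + L * c)); last by ring.
  by rewrite lerDl !addr_ge0// mulr_ge0.
apply: (@le_trans _ _ ((3 * C ^+ 2)%:E * (\esum_(xi in [set: Z]) ((P xi * ampl F xi ^+ 2)%:E +
   ((rho xi `^ (2 * q) * ampl U xi ^+ 2)%:E + (rho xi `^ (2 * q - 2) * N xi ^+ 2)%:E))))%E); last first.
  apply: lee_wpmul2l; first by rewrite lee_fin.
  rewrite esumD; [|by move=> xi _; rewrite lee_fin|by move=> xi _; apply: adde_ge0; rewrite lee_fin].
  rewrite esumD; [|by move=> xi _; rewrite lee_fin..].
  by apply: leeD => //; apply: leeD.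
rewrite -esumZl//; last by move=> xi; apply: adde_ge0; [|apply: adde_ge0]; rewrite lee_fin.
apply: le_esum => xi _; rewrite -!EFinD -EFinM lee_fin -PE2 -PE -/(P xi).
have A0 := ampl_ge0 (force U F) xi; have hA := hC U F b b' xi pU dU Ub Ub'; rewrite -/(N xi) in hA.
move: (ampl (force U F) xi) A0 hA => X X0 hX; move: (ampl F xi) (ampl_ge0 F xi) hX => x x0.
move: (ampl U xi) (ampl_ge0 U xi) => y y0; move: (N xi) (s0 xi : 0 <= N xi) => z z0.
move: (rho xi) (rho_ge0 R xi) (P xi) (P0 xi) => p p0 W W0 hX.
have h : X ^+ 2 <= C ^+ 2 * (x + p ^+ 2 * y + p * z) ^+ 2.
  by rewrite -exprMn ler_sqr ?nnegrE// (le_trans X0).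
apply: (@le_trans _ _ (W * (C ^+ 2 * (3 * (x ^+ 2 + (p ^+ 2 * y) ^+ 2 + (p * z) ^+ 2))))).
  by rewrite ler_wpM2l// (le_trans h)// ler_wpM2l ?sqr_ge0// sqr_sum3.
by rewrite le_eqVlt; apply/orP; left; apply/eqP; ring.
Qed.

End Snapshot.

(** * Truncated weights *)

Section Weights.
Variable R : realType.
Local Notation Z := 'rV[int]_2.
Local Notation rho := (@rho R 2).
Local Notation mu := (@lebesgue_measure R).
Implicit Types (A m : Z -> R) (xi eta : Z) (r c N : R).

(** The truncation keeps the weight bounded, so that the weighted energy of a weak solution is
    finite before any regularity is known. *)
Definition weight r N xi : R := (Num.min (rho xi) N) `^ r.

Lemma weight_ge0 r N xi : 0 <= weight r N xi. Proof. exact: powR_ge0. Qed.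

Lemma weight_double r N xi eta : 0 < r -> 0 < N -> rho xi <= 2 * rho eta ->
  weight r N xi <= 2 `^ r * weight r N eta.
Proof.
move=> r0 N0 h; rewrite /weight -powRM//; last by rewrite le_min rho_ge0 ltW.
apply: ge0_ler_powR; rewrite ?nnegrE ?mulr_ge0// ?le_min ?rho_ge0 ?(ltW N0) ?(ltW r0)//.
by have [_|_] := leP (rho eta) N; rewrite ge_min ?h//; apply/orP; right; lra.
Qed.

Lemma powR_sqr (x r : R) : (x `^ r) ^+ 2 = x `^ (2 * r).
Proof. by rewrite mulrC powRrM powR_mulrn ?powR_ge0. Qed.

Lemma weight_le_rho r N xi : 0 < r -> 0 < N -> weight r N xi ^+ 2 <= rho xi `^ (2 * r).
Proof.
move=> r0 N0; rewrite /weight powR_sqr.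
apply: ge0_ler_powR; rewrite ?nnegrE ?le_min ?rho_ge0 ?(ltW N0) ?mulr_ge0 ?(ltW r0)//.
by rewrite ge_min lexx.
Qed.

Lemma weight_le_cst r N xi : 0 < r -> 0 < N -> weight r N xi ^+ 2 <= N `^ (2 * r).
Proof.
move=> r0 N0; rewrite /weight powR_sqr.
apply: ge0_ler_powR; rewrite ?nnegrE ?le_min ?rho_ge0 ?(ltW N0) ?mulr_ge0 ?(ltW r0)//.
by rewrite ge_min lexx orbT.
Qed.

Lemma weight_eq_rho r N xi : rho xi <= N -> weight r N xi ^+ 2 = rho xi `^ (2 * r).
Proof.
by move=> h; rewrite /weight powR_sqr min_l.
Qed.

(** A parameter [d] of order $c/(1+a)$ makes the first term of [trilinear_bound] half of the allowed
    dissipation. The second one, of weight $\varrho$, is interpolated between $\varrho^2$ and $1$;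
    this uses the other half and leaves a constant of order $(1+a)^2$. *)
Lemma weighted_trilinear r c : 0 < r -> 0 < c -> exists2 L, 0 <= L &
  forall A N a, (forall xi, 0 <= A xi) -> 0 < N -> 0 <= a ->
  (\esum_(xi in [set: Z]) (rho xi * A xi ^+ 2)%:E <= a%:E)%E ->
  (\esum_(xi in [set: Z]) ((weight r N xi ^+ 2 * rho xi * A xi)%:E * self_conv A xi) <=
   c%:E * (\esum_(xi in [set: Z]) (rho xi ^+ 2 * (weight r N xi ^+ 2 * A xi ^+ 2))%:E) +
   (L * (1 + a) ^+ 2)%:E * \esum_(xi in [set: Z]) (weight r N xi ^+ 2 * A xi ^+ 2)%:E)%E.
Proof.
move=> r0 c0; have [C C0 HC] := trilinear_bound R.
pose K : R := 2 `^ r; have K0 : 0 < K by exact: powR_gt0.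
pose th := 2 * K ^+ 2 * C / c.
have th0 : 0 <= th.
  by apply: divr_ge0; [apply: mulr_ge0 => //; apply: mulr_ge0 => //; exact: sqr_ge0|exact: ltW].
have L0 : 0 <= th * (th + 1) / (2 * c).
  apply: divr_ge0; last by rewrite mulr_ge0// ltW.
  by apply: mulr_ge0 => //; rewrite addr_ge0.
exists (th * (th + 1) / (2 * c)) => // A N a A0 N0 a0 Aa.
pose w := weight r N.
have w0 xi : 0 <= w xi by exact: weight_ge0.
have d0 : 0 < c / (2 * K * (a + 1)) by rewrite divr_gt0// !mulr_gt0// ltr_wpDl.
have P0 xi : 0 <= w xi ^+ 2 * A xi ^+ 2 by apply: mulr_ge0; exact: sqr_ge0.
have R0 xi : 0 <= rho xi ^+ 2 * (w xi ^+ 2 * A xi ^+ 2) by apply: mulr_ge0 => //; exact: sqr_ge0.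
apply: le_trans (HC A w K a _ A0 w0 (ltW K0) (fun xi eta => weight_double r0 N0) Aa d0) _.
set D := \esum_(xi in _) (rho xi ^+ 2 * _)%:E; set E := \esum_(xi in _) (w xi ^+ 2 * _)%:E.
have D0 : (0 <= D)%E by apply: esum_ge0 => xi _; rewrite lee_fin.
have E0 : (0 <= E)%E by apply: esum_ge0 => xi _; rewrite lee_fin.
have k1 : K * (c / (2 * K * (a + 1))) * a <= c / 2.
  rewrite (_ : _ * a = c / 2 * (a / (a + 1))); last by field; rewrite !gt_eqF// ltr_wpDl.
  by rewrite ler_piMr ?divr_ge0 ?(ltW c0)// ler_pdivrMr ?ltr_wpDl// mul1r lerDl.
pose TH := K * C / (c / (2 * K * (a + 1))).
have THE : TH = th * (1 + a).
  by rewrite /TH /th; field; rewrite !gt_eqF// ltr_wpDl.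
have TH0 : 0 <= TH by rewrite THE mulr_ge0// addr_ge0.
have k2 : (TH%:E * (\esum_(xi in [set: Z]) (rho xi * (w xi ^+ 2 * A xi ^+ 2))%:E) <=
    (c / 2)%:E * D + (th * (th + 1) / (2 * c) * (1 + a) ^+ 2)%:E * E)%E.
  have nn xi : 0 <= rho xi * (w xi ^+ 2 * A xi ^+ 2) by apply: mulr_ge0 => //; exact: rho_ge0.
  have c2 : 0 <= c / 2 by rewrite divr_ge0// ltW.
  have l0 : 0 <= th * (th + 1) / (2 * c) * (1 + a) ^+ 2.
    by apply: mulr_ge0 => //; exact: sqr_ge0.
  rewrite -!esumZl//; try by move=> xi; rewrite lee_fin.
  rewrite -esumD; try by move=> xi _; rewrite mule_ge0// lee_fin.
  apply: le_esum => xi _; rewrite -!EFinM -EFinD lee_fin [TH * _]mulrA.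
  rewrite [X in _ <= X + _]mulrA.
  rewrite -mulrDl ler_wpM2r//.
  have h : TH * rho xi <= c / 2 * rho xi ^+ 2 + TH ^+ 2 / (2 * c).
    have := sqr_ge0 (c * rho xi - TH).
    have -> : (c * rho xi - TH) ^+ 2 = 2 * c * (c / 2 * rho xi ^+ 2 + TH ^+ 2 / (2 * c) - TH * rho xi).
      by field; rewrite gt_eqF.
    by rewrite pmulr_rge0 ?subr_ge0// mulr_gt0.
  apply: le_trans h _; rewrite lerD2l [leRHS]mulrAC ler_wpM2r//; first by rewrite invr_ge0 mulr_ge0// ltW.
  rewrite THE exprMn ler_wpM2r ?sqr_ge0// expr2 ler_wpM2l// lerDl//.
apply: (@le_trans _ _ ((c / 2)%:E * D + ((c / 2)%:E * D + (th * (th + 1) / (2 * c) * (1 + a) ^+ 2)%:E * E))%E).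
  by apply: leeD => //; apply: lee_wpmul2r.
rewrite addeA -ge0_muleDl ?lee_fin ?divr_ge0 ?(ltW c0)// -EFinD.
by rewrite (_ : c / 2 + c / 2 = c)//; field.
Qed.

(** The lower function may change sign and the upper one may be infinite, so the former is first
    replaced by its positive part. *)
Lemma ae_Rintegral_le d (X : measurableType d) (nu : {measure set X -> \bar R}) (D : set X)
  (g : X -> R) (h : X -> \bar R) : measurable D -> nu.-integrable D (EFin \o g) ->
  measurable_fun D h -> (forall x, D x -> (0 <= h x)%E) ->
  {ae nu, forall x, D x -> ((g x)%:E <= h x)%E} ->
  ((Rintegral nu D g)%:E <= \int[nu]_(x in D) h x)%E.
Proof.
move=> mD ig mh h0 gh.
have mg : measurable_fun D g by apply/measurable_EFinP; case/integrableP: ig.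
have igp : nu.-integrable D (EFin \o (fun x => Num.max (g x) 0)).
  apply: le_integrable ig => //.
    by apply/measurable_EFinP; apply: measurable_maxr.
  move=> x _ /=; rewrite lee_fin ger0_norm ?le_max ?lexx ?orbT//.
  by rewrite ge_max ler_norm normr_ge0.
apply: (@le_trans _ _ (\int[nu]_(x in D) (Num.max (g x) 0)%:E)%E).
  rewrite -[leRHS]fineK; last exact: integrable_fin_num igp.
  rewrite lee_fin; apply: le_Rintegral => // x _; by rewrite le_max lexx.
apply: ae_ge0_le_integral => //.
- by move=> x _; rewrite lee_fin le_max lexx orbT.
- by case/integrableP: igp.
- apply: filterS gh => x gh Dx; have := gh Dx; have := h0 x Dx.
  by rewrite EFin_max; move=> ? ?; rewrite ge_max; apply/andP.
Qed.

(** Both sides are nonnegative, so the inequalities of the single modes can be summed with weights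
    and the sum moved under the integral. *)
Lemma weighted_sum d (X : measurableType d) (nu : {measure set X -> \bar R}) (S : set X)
  (w q q0 : Z -> R) (hl hr : Z -> X -> \bar R) : measurable S ->
  (forall xi, 0 <= w xi) -> (forall xi, 0 <= q xi) -> (forall xi, 0 <= q0 xi) ->
  (forall xi x, 0 <= hl xi x)%E -> (forall xi x, 0 <= hr xi x)%E ->
  (forall xi, measurable_fun S (hl xi)) -> (forall xi, measurable_fun S (hr xi)) ->
  (forall xi, (q xi)%:E + \int[nu]_(x in S) hl xi x <= (q0 xi)%:E + \int[nu]_(x in S) hr xi x)%E ->
  (\esum_(xi in [set: Z]) (w xi * q xi)%:E + \int[nu]_(x in S) (\esum_(xi in [set: Z]) ((w xi)%:E * hl xi x)) <=
   \esum_(xi in [set: Z]) (w xi * q0 xi)%:E + \int[nu]_(x in S) (\esum_(xi in [set: Z]) ((w xi)%:E * hr xi x)))%E.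
Proof.
move=> mS w0 q0' q00 hl0 hr0 ml mr h.
have sw (g : Z -> X -> \bar R) : (forall xi x, 0 <= g xi x)%E -> (forall xi, measurable_fun S (g xi)) ->
    (\int[nu]_(x in S) (\esum_(xi in [set: Z]) ((w xi)%:E * g xi x)) =
     \esum_(xi in [set: Z]) ((w xi)%:E * \int[nu]_(x in S) g xi x))%E.
  move=> g0 mg; rewrite integral_esum//.
  - by apply: eq_esum => xi _; rewrite ge0_integralZl// lee_fin.
  - by move=> xi x; rewrite mule_ge0// lee_fin.
  - by move=> xi; apply: measurable_funeM.
rewrite !sw// -!esumD; try by move=> xi _; rewrite ?lee_fin ?mulr_ge0// mule_ge0 ?lee_fin// integral_ge0.
apply: le_esum => xi _; rewrite !EFinM -!muleDr ?ge0_adde_def ?inE ?lee_fin ?integral_ge0//.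
by apply: lee_wpmul2l; rewrite ?lee_fin.
Qed.

Lemma powR_rho_sub s xi : rho xi `^ (2 * (s - 1)) = rho xi `^ (2 * s) * rho xi ^- 2.
Proof.
rewrite mulrBr mulr1 powRB ?powR_mulrn ?rho_ge0//.
by rewrite (gt_eqF (rho_gt0 R xi)) implybT.
Qed.

End Weights.

Section AlmostEvery.
Variables (R : realType) (T : R).
Implicit Types P Q : R -> Prop.

Lemma aetS P Q : (forall t, 0 < t -> t < T -> P t -> Q t) -> aet T P -> aet T Q.
Proof.
by move=> PQ; rewrite /aet; apply: (@filterS _ _ (ae_filter_ringOfSetsType _)) => t h tI; have := tI; rewrite in_itv /= => /andP[t0 tT]; apply: PQ => //; exact: h.
Qed.

Lemma aet_and P Q : aet T P -> aet T Q -> aet T (fun t => P t /\ Q t).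
Proof. by rewrite /aet; apply: (@filterS2 _ _ (ae_filter_ringOfSetsType _)) => t hP hQ tI; split; [exact: hP|exact: hQ]. Qed.

Lemma aet_all2 (P : 'I_2 -> R -> Prop) : (forall k, aet T (P k)) -> aet T (fun t => forall k, P k t).
Proof.
move=> h; apply: aetS (aet_and (h 0) (h 1)) => t _ _ [h0 h1] k.
by case: (ord2P k) => ->.
Qed.

Lemma aet_nat (P : nat -> R -> Prop) : (forall n, aet T (P n)) -> aet T (fun t => forall n, P n t).
Proof. by move=> h; apply: (@filterS _ _ (ae_filter_ringOfSetsType _) _ _ _ (ae_foralln h)) => t ht tI n; exact: ht. Qed.

Lemma aetT P : (forall t, 0 < t -> t < T -> P t) -> aet T P.
Proof. by move=> h; apply: aeW => t; rewrite in_itv /= => /andP[]; exact: h. Qed.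

Lemma aet_sub P (D : set R) : D `<=` `]0, T[ -> aet T P -> {ae @lebesgue_measure R, forall t, D t -> P t}.
Proof. by move=> DT; rewrite /aet; apply: (@filterS _ _ (ae_filter_ringOfSetsType _)) => t h Dt; apply: h; have := DT t Dt. Qed.

End AlmostEvery.

Section AmplitudeNorms.
Variable R : realType.
Local Notation Z := 'rV[int]_2.
Local Notation rho := (@rho R 2).
Implicit Types (U : vfunctional R 2) (s : R).

Lemma Hnorm2_ge0 s (g : functional R 2) : (0 <= Hnorm2 s g)%E.
Proof. by rewrite Hnorm2E; apply: esum_ge0 => xi _; rewrite lee_fin mulr_ge0 ?powR_ge0 ?amp2_ge0. Qed.

Lemma esum_ampl_le s U :
  (\esum_(xi in [set: Z]) (rho xi `^ (2 * s) * ampl U xi ^+ 2)%:E <=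
   4%:E * (Hnorm2 s (U 0%R) + Hnorm2 s (U 1%R)))%E.
Proof.
have p k xi : 0 <= rho xi `^ (2 * s) * amp2 (U k) xi by rewrite mulr_ge0 ?powR_ge0 ?amp2_ge0.
rewrite !Hnorm2E -esumD; try by move=> xi _; rewrite lee_fin.
rewrite -esumZl//; last by move=> xi; rewrite adde_ge0// lee_fin.
apply: le_esum => xi _; rewrite -EFinD -EFinM lee_fin -mulrDr [leRHS]mulrCA ler_wpM2l ?powR_ge0//.
by have := ampl_sqr_le U xi; rewrite sum2.
Qed.

Lemma Hnorm2_ampl_le s U k :
  (Hnorm2 s (U k) <= \esum_(xi in [set: Z]) (rho xi `^ (2 * s) * ampl U xi ^+ 2)%:E)%E.
Proof.
rewrite Hnorm2E; apply: le_esum => xi _; rewrite lee_fin ler_wpM2l ?powR_ge0//.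
apply: le_trans (amp2_le_ampl U xi); rewrite sum2.
by case: (ord2P k) => ->; rewrite ?lerDl ?lerDr amp2_ge0.
Qed.

Lemma Hdot_ampl0 s U : (forall k, Hdot s (U k)) -> ampl U 0 = 0.
Proof.
move=> h; rewrite /ampl big1// => k _; have [-> ->] := Hdot_coef0 (h k).
by rewrite normr0 addr0.
Qed.

Lemma powR_rho2 xi : rho xi `^ (2 * 1) = rho xi ^+ 2.
Proof. by rewrite mulr1 powR_mulrn// rho_ge0. Qed.

Lemma powR_rho0 xi : rho xi `^ (2 * 0) = 1.
Proof. by rewrite mulr0 powRr0. Qed.

End AmplitudeNorms.

Lemma le_1sqr (R : realType) (x : R) : x <= 1 + x ^+ 2.
Proof. by have := sqr_ge0 (x - 1); have := sqr_ge0 (x + 1); nra. Qed.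

(** Subtracting [e] is legitimate because it is finite; for half of the dissipation this is what the
    truncation ensures. *)
Lemma ereal_absorb (R : realType) (x i p J e : \bar R) (A : R) : e \is a fin_num ->
  (x + (e + e) <= i + (p + (e + J)))%E -> (i + p <= A%:E)%E -> (x + e <= A%:E + J)%E.
Proof.
move=> ef h ip; rewrite -(leeD2rE _ _ ef) -addeA (le_trans h)//.
by rewrite [(e + J)%E]addeC !addeA; apply: leeD => //; apply: leeD.
Qed.

(** * The weighted energy inequality for the weak solution *)

Section Solution.
Variables (R : realType) (T r : R) (a : tensor R 2) (f u v : R -> vfunctional R 2) (u0 : vfunctional R 2).
Local Notation mu := (@lebesgue_measure R).
Local Notation Z := 'rV[int]_2.
Local Notation rho := (@rho R 2).
Local Notation fr xi j := ((xi 0 j)%:~R : R).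
Local Notation D := (`]0, T[%classic : set (measurableTypeR R)).
Hypotheses (T0 : 0 < T) (r0 : 0 < r) (sym : tensor_symmetric a) (ell : relaxed_elliptic a).
Hypotheses (fI : Linf_vHdot T (r - 2) f) (f2 : L2_vHdot T (r - 1) f) (hu0 : vHdot_sigma r u0).
Hypotheses (uI : Linf_vHdot_sigma T 0 u) (u2 : L2_vHdot_sigma T 1 u) (uw : weakly_continuous T u).
Hypotheses (vt : time_derivative T u v) (mom : aet T (fun t => momentum a (u t) (v t) (f t))).
Hypothesis (ui : forall w, vHdot_sigma 0 w -> vdual (u 0) w = vdual u0 w).
Implicit Types (xi eta : Z) (t : R) (k : 'I_2).

Lemma measD s t : measurable (`]s, t[%classic : set (measurableTypeR R)).
Proof. exact: measurable_itv. Qed.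

Lemma measurable_ampl (g : R -> vfunctional R 2) xi : (forall k, time_measurable T (fun t => g t k)) ->
  measurable_fun D (fun t => ampl (g t) xi).
Proof.
move=> mg; apply: measurable_sum => k; apply: measurable_funD; apply: measurableT_comp => //.
  by apply: mg; exact: test_cos_wave.
by apply: mg; exact: test_sin_wave.
Qed.

Lemma u_meas k : time_measurable T (fun t => u t k).
Proof. by have [/(_ k)[]] := uI. Qed.

Lemma f_meas k : time_measurable T (fun t => f t k).
Proof. by have [] := f2 k. Qed.

Lemma u_dist t k : 0 <= t -> t <= T -> pdistr (u t k).
Proof.
by move=> t0 tT; have /(_ t) := uw.1; rewrite in_itv /= t0 tT => /(_ isT) [/(_ k) [[]]].
Qed.

Lemma u_div t : 0 <= t -> t <= T -> div_free (u t).
Proof. by move=> t0 tT; have /(_ t) := uw.1; rewrite in_itv /= t0 tT => /(_ isT) []. Qed.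

Lemma u_ampl0 t : 0 <= t -> t <= T -> ampl (u t) 0 = 0.
Proof.
by move=> t0 tT; have /(_ t) := uw.1; rewrite in_itv /= t0 tT => /(_ isT) [h _]; exact: Hdot_ampl0 h.
Qed.

(** What holds at almost every time. The $L_2$ bound [M] is uniform, whereas the $H^1$ bound [b]
    depends on the time. *)
Definition slice M t : Prop := [/\ forall k, pdistr (u t k), forall k, pdistr (v t k),
  forall k, pdistr (f t k), div_free (u t) & [/\ momentum a (u t) (v t) (f t),
  (\esum_(xi in [set: Z]) (ampl (u t) xi ^+ 2)%:E <= M%:E)%E &
  exists b : R, (\esum_(xi in [set: Z]) (rho xi ^+ 2 * ampl (u t) xi ^+ 2)%:E <= b%:E)%E]].

Lemma ae_slice : exists2 M, 0 <= M & aet T (slice M).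
Proof.
have [uI' _] := uI; have [u2' _] := u2.
have [_ _ [M0 h0]] := uI' 0; have [_ _ [M1 h1]] := uI' 1.
exists (4 * (M0 ^+ 2 + M1 ^+ 2)); first by rewrite mulr_ge0// addr_ge0// sqr_ge0.
have ha : aet T (fun t => forall k, Hdot 1 (u t k)) by apply: aet_all2 => k; case: (u2' k).
have hv : aet T (fun t => forall k, pdistr (v t k)) by apply: aet_all2 => k; case: (vt k).
have hf : aet T (fun t => forall k, Hdot (r - 1) (f t k)) by apply: aet_all2 => k; case: (f2 k).
apply: aetS (aet_and (aet_and (aet_and h0 h1) (aet_and ha hv)) (aet_and hf mom)).
move=> t t0 tT [[[b0 b1] [H1 pv]] [Hf mo]].
split=> //; first by move=> k; case: (H1 k) => [[]].
- by move=> k; case: (Hf k) => [[]].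
- by apply: u_div; exact: ltW.
split=> //.
  have := esum_ampl_le 0 (u t); under eq_esum do rewrite powR_rho0 mul1r.
  by move/le_trans; apply; rewrite (EFinM 4) (EFinD (M0 ^+ 2)); apply: lee_wpmul2l (leeD b0 b1).
have h k : Hnorm2 1 (u t k) \is a fin_num.
  by rewrite ge0_fin_numE ?Hnorm2_ge0//; case: (H1 k) => [[]].
exists (fine (4%:E * (Hnorm2 1 (u t 0%R) + Hnorm2 1 (u t 1%R)))%E).
have := esum_ampl_le 1 (u t); under eq_esum do rewrite powR_rho2.
by rewrite fineK// fin_numM// fin_numD !h.
Qed.

Lemma perp0 (F : 'I_2 -> R) : \sum_k F k * (0 : R) = 0.
Proof. by rewrite big1// => *; rewrite mulr0. Qed.

(** A single coefficient of a divergence-free field is a pairing with a divergence-free mode, built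
    from a projected basis vector. In this way weak continuity and the initial condition reach the
    coefficients. *)
Lemma vdual_coef (U : vfunctional R 2) xi k : (forall k, pdistr (U k)) -> div_free U -> xi != 0 ->
  let e := lproj xi (fun l => (l == k)%:R : R) in
  vdual U (mode xi e (fun=> 0)) = 2 * U k (cos_wave xi) /\
  vdual U (mode xi (fun=> 0) e) = 2 * U k (sin_wave xi).
Proof.
move=> pU dU x0 e; have [dc ds] := div_free_coef xi pU dU.
have pe (x : 'I_2 -> R) : \sum_l fr xi l * x l = 0 -> \sum_l x l * e l = x k.
  move=> hx; rewrite lproj_adj sum2 !lproj_id//.
  by case: (ord2P k) => ->; rewrite ?eqxx ?mulr1 ?mulr0 ?addr0 ?add0r.
rewrite !vdual_mode//; split; congr (2 * _).
  by under eq_bigr do rewrite mulr0 addr0; rewrite pe.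
by under eq_bigr do rewrite mulr0 add0r; rewrite (pe (fun k => U k (sin_wave xi))).
Qed.

Lemma u_coef0 t k : 0 <= t -> t <= T -> u t k (cos_wave 0) = 0 /\ u t k (sin_wave 0) = 0.
Proof.
by move=> t0 tT; have /(_ t) := uw.1; rewrite in_itv /= t0 tT => /(_ isT) [/(_ k) h _]; exact: Hdot_coef0 h.
Qed.

Lemma u_cont xi k phi : phi = cos_wave xi \/ phi = sin_wave xi ->
  {within `[0, T], continuous (fun t => u t k phi)}.
Proof.
have [->|x0] := eqVneq xi 0 => hphi.
  have : {within `[0, T], continuous (fun=> 0 : R)} by apply: continuous_subspaceT => x; exact: cvg_cst.
  apply: subspace_eq_continuous => t; rewrite inE /= in_itv /= => /andP[t0 tT]; have [h1 h2] := u_coef0 k t0 tT.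
  by rewrite /from_subspace; case: hphi => ->; rewrite ?h1 ?h2.
pose e := lproj xi (fun l => (l == k)%:R : R).
have pe := lproj_perp (fun l => (l == k)%:R : R) x0; have p0 := perp0 (fun k => fr xi k).
have [w sw hw] : exists2 w, vHdot_sigma 0 w &
    forall t, 0 <= t -> t <= T -> vdual (u t) w = 2 * u t k phi.
  case: hphi => ->; [exists (mode xi e (fun=> 0))|exists (mode xi (fun=> 0) e)]; try exact: mode_sigma;
    move=> t t0 tT; by have [] := vdual_coef k (fun k => u_dist k t0 tT) (u_div t0 tT) x0.
have cw := uw.2 w sw.
have : {within `[0, T], continuous (fun t => 2^-1 * vdual (u t) w)}.
  by move=> t; apply: cvgM; [exact: cvg_cst|exact: cw].
apply: subspace_eq_continuous => t; rewrite inE /= in_itv /= => /andP[t0 tT].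
by rewrite /from_subspace /= hw// mulKf.
Qed.

Lemma u_init xi k : xi != 0 ->
  u 0 k (cos_wave xi) = u0 k (cos_wave xi) /\ u 0 k (sin_wave xi) = u0 k (sin_wave xi).
Proof.
move=> x0; have pe := lproj_perp (fun l => (l == k)%:R : R) x0; have p0 := perp0 (fun k => fr xi k).
have pu0 l : pdistr (u0 l) by case: hu0 => /(_ l) [[]].
have [e1 e2] := vdual_coef k (fun k => u_dist k (lexx 0) (ltW T0)) (u_div (lexx 0) (ltW T0)) x0.
have [e3 e4] := vdual_coef k pu0 hu0.2 x0.
have := ui (mode_sigma 0 x0 pe p0); have := ui (mode_sigma 0 x0 p0 pe).
have n2 : 2 != 0 :> R by [].
by rewrite e1 e2 e3 e4 => /(mulfI n2) -> /(mulfI n2) ->.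
Qed.

Lemma u_weak xi k phi : phi = cos_wave xi \/ phi = sin_wave xi ->
  primitive T (fun t => u t k phi) (fun t => v t k phi).
Proof.
move=> hphi; have tphi : test phi by case: hphi => ->; [exact: test_cos_wave|exact: test_sin_wave].
apply: weak_derivative_primitive; have [_ lv ev] := vt k.
split; [exact: u_cont hphi|exact: lv|].
by move=> psi tpsi; have := ev psi phi tpsi tphi.
Qed.

Lemma u_coef_perp t xi phi : 0 <= t -> t <= T -> phi = cos_wave xi \/ phi = sin_wave xi ->
  \sum_k fr xi k * u t k phi = 0.
Proof.
move=> t0 tT hphi; have [dc ds] := div_free_coef xi (fun k => u_dist k t0 tT) (u_div t0 tT).
by case: hphi => ->.
Qed.

(** The gradient part of the coefficients of [u] vanishes identically, so it may be dropped from the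
    derivative. What remains is the part determined by the momentum equation. *)
Lemma u_weak_proj xi k phi : xi != 0 -> phi = cos_wave xi \/ phi = sin_wave xi ->
  primitive T (fun t => u t k phi) (fun t => lproj xi (fun l => v t l phi) k).
Proof.
move=> x0 hphi; have h l := u_weak l hphi.
pose c := - (fr xi k / freq2 R xi).
have := primitiveD (h k) (primitiveD (primitiveZ (c * fr xi 0) (h 0)) (primitiveZ (c * fr xi 1) (h 1))).
rewrite (_ : (fun x => v x k phi + _) = fun t => lproj xi (fun l => v t l phi) k); last first.
  by apply/funext => t; rewrite /lproj sum2 /c; ring.
apply: eq_primitive => t; rewrite inE /= in_itv /= => /andP[t0 tT].
have := u_coef_perp t0 tT hphi; rewrite sum2 => e.
by rewrite -!mulrA -mulrDr e mulr0 addr0.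
Qed.

Lemma measurable_Hnorm2 s (g : R -> functional R 2) : time_measurable T g ->
  measurable_fun D (fun t => Hnorm2 s (g t)).
Proof.
move=> mg; rewrite (_ : (fun t => _) = fun t => \esum_(xi in [set: Z]) (rho xi `^ (2 * s) * amp2 (g t) xi)%:E).
  apply: measurable_esum; first exact: measD.
    by move=> xi t; rewrite lee_fin mulr_ge0 ?powR_ge0 ?amp2_ge0.
  move=> xi; apply/measurable_EFinP; apply: measurable_funM => //.
  apply: measurable_funD; apply: measurable_funX.
    by apply: mg; exact: test_cos_wave.
  by apply: mg; exact: test_sin_wave.
by apply/funext => t; rewrite Hnorm2E.
Qed.

Definition wnorm s (g : R -> vfunctional R 2) t : \bar R :=
  \esum_(xi in [set: Z]) (rho xi `^ (2 * s) * ampl (g t) xi ^+ 2)%:E.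

Lemma wnorm_ge0 s g t : (0 <= wnorm s g t)%E.
Proof. by apply: esum_ge0 => xi _; rewrite lee_fin mulr_ge0 ?powR_ge0 ?sqr_ge0. Qed.

Lemma measurable_wnorm s g : (forall k, time_measurable T (fun t => g t k)) -> measurable_fun D (wnorm s g).
Proof.
move=> mg; apply: measurable_esum; first exact: measD.
  by move=> xi t; rewrite lee_fin mulr_ge0 ?powR_ge0 ?sqr_ge0.
move=> xi; apply/measurable_EFinP; apply: measurable_funM => //.
by apply: measurable_funX; exact: measurable_ampl.
Qed.

Lemma int_wnorm s g : L2_vHdot T s g -> (\int[mu]_(t in D) wnorm s g t < +oo)%E.
Proof.
move=> hg; have mg k : time_measurable T (fun t => g t k) by have [] := hg k.
have mH k := measurable_Hnorm2 s (mg k).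
have H0 k t : (0 <= Hnorm2 s (g t k))%E by exact: Hnorm2_ge0.
apply: (@le_lt_trans _ _ (\int[mu]_(t in D) (4%:E * (Hnorm2 s (g t 0%R) + Hnorm2 s (g t 1%R))))%E).
  apply: ge0_le_integral => //.
  - by move=> t _; exact: wnorm_ge0.
  - exact: measurable_wnorm.
  - by apply: measurable_funeM; apply: emeasurable_funD.
  - by move=> t _; exact: esum_ampl_le.
rewrite ge0_integralZl//; [|by apply: emeasurable_funD|by move=> t _; rewrite adde_ge0].
rewrite lte_mul_pinfty// ?ge0_integralD//.
by have [_ _ i0] := hg 0; have [_ _ i1] := hg 1; exact: lte_add_pinfty.
Qed.

Lemma wnorm_L2 s g k : (forall k, time_measurable T (fun t => g t k)) ->
  (\int[mu]_(t in D) wnorm s g t < +oo)%E -> (\int[mu]_(t in D) Hnorm2 s (g t k) < +oo)%E.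
Proof.
move=> mg; apply: le_lt_trans; apply: ge0_le_integral => //.
- by move=> t _; exact: Hnorm2_ge0.
- exact: measurable_Hnorm2.
- exact: measurable_wnorm.
- by move=> t _; exact: Hnorm2_ampl_le.
Qed.

Lemma ampl_sqr_int s g xi : L2_vHdot T s g ->
  mu.-integrable D (EFin \o (fun t => ampl (g t) xi ^+ 2)).
Proof.
move=> hg; have mg k : time_measurable T (fun t => g t k) by have [] := hg k.
have p0 : 0 < rho xi `^ (2 * s) by rewrite powR_gt0 ?rho_gt0.
have mA := measurable_ampl xi mg.
have : mu.-integrable D (EFin \o (fun t => rho xi `^ (2 * s) * ampl (g t) xi ^+ 2)).
  apply/integrableP; split.
    by apply/measurable_EFinP; apply: measurable_funM => //; exact: measurable_funX.
  apply: le_lt_trans (int_wnorm hg); apply: ge0_le_integral => //.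
  - apply: measurableT_comp => //; apply/measurable_EFinP.
    by apply: measurable_funM => //; exact: measurable_funX.
  - exact: measurable_wnorm.
  - move=> t _; rewrite /= ger0_norm; last by rewrite mulr_ge0 ?powR_ge0 ?sqr_ge0.
    apply: (@esum_ge1 R Z (fun xi => (rho xi `^ (2 * s) * ampl (g t) xi ^+ 2)%:E) xi).
    by move=> eta; rewrite lee_fin mulr_ge0 ?powR_ge0 ?sqr_ge0.
move=> /(integrable_mulrl (rho xi `^ (2 * s))^-1 (measD 0 T)).
apply: eq_integrable; first exact: measD.
by move=> t _ /=; rewrite mulKf ?gt_eqF.
Qed.

Lemma integrable_cstD (c : R) : mu.-integrable D (EFin \o (fun=> c)).
Proof.
apply: (@integrableS _ _ _ mu `[0, T]%classic) => //; first exact: subset_itv_oo_cc.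
apply: continuous_compact_integrable; first exact: segment_compact.
by apply: continuous_subspaceT => x; exact: cvg_cst.
Qed.

(** [v] is given as locally integrable only. Its projection is that of the net force, whose
    coefficients at a fixed frequency are bounded by a constant plus the squared amplitude of [f];
    this is integrable up to the end points and lets the energy start at time $0$. *)
Lemma v_proj_int xi k phi : xi != 0 -> phi = cos_wave xi \/ phi = sin_wave xi ->
  mu.-integrable D (EFin \o (fun t => lproj xi (fun l => v t l phi) k)).
Proof.
move=> x0 hphi; have [_ [mz _ _] _] := u_weak_proj k x0 hphi.
have [M M0 sl] := ae_slice; have [C C0 hC] := force_bound a.
pose K := C * (rho xi ^+ 2 * (1 + M)) + rho xi * (2 * M).
have K0 : 0 <= K by rewrite /K; nneg.
have iF := ampl_sqr_int xi f2.
have iB : mu.-integrable D (EFin \o (fun t => 4 * (1 + K + ampl (f t) xi ^+ 2))).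
  apply: integrable_mulrl; first exact: measD.
  apply: integrable_addr => //.
  exact: integrable_cstD.
apply/integrableP; split; first exact/measurable_EFinP.
have /integrableP[mB] := iB; apply: le_lt_trans.
apply: ae_ge0_le_integral => //.
- by apply: measurableT_comp => //; exact/measurable_EFinP.
- exact: measurableT_comp.
apply: (aet_sub _ (aetS _ sl)) => // t t0 tT [pU pW pF dU [mo Ub [b' Ub']]].
have [p1 p2] := momentum_proj sym k pU pW pF mo x0.
rewrite /= lee_fin [leRHS]ger0_norm; last by nneg.
have -> : lproj xi (fun l => v t l phi) k = lproj xi (fun l => force a (u t) (f t) l phi) k.
  by case: hphi => ->.
apply: le_trans (lproj_bound _ _ x0) _.
have A0 := ampl_ge0 (u t) xi; have F0 := ampl_ge0 (f t) xi.
have hA : ampl (u t) xi <= 1 + M.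
  have : ampl (u t) xi ^+ 2 <= M.
    rewrite -lee_fin; apply: le_trans Ub.
    apply: (@esum_ge1 R Z (fun xi => (ampl (u t) xi ^+ 2)%:E) xi) => eta.
    by rewrite lee_fin sqr_ge0.
  by move=> h; apply: le_trans (le_1sqr _) _; rewrite lerD2l.
have hb l : `|force a (u t) (f t) l phi| <= 1 + K + ampl (f t) xi ^+ 2.
  apply: le_trans (hC _ _ M b' xi l phi pU dU Ub Ub' hphi) _.
  have h1 : C * (rho xi ^+ 2 * ampl (u t) xi) <= C * (rho xi ^+ 2 * (1 + M)).
    by rewrite ler_wpM2l// ler_wpM2l// sqr_ge0.
  have h2 : rho xi * fine (self_conv (ampl (u t)) xi) <= rho xi * (2 * M).
    by rewrite ler_wpM2l ?rho_ge0// (self_conv_fin xi Ub).2.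
  have h3 := le_1sqr (ampl (f t) xi).
  rewrite (_ : 1 + K + _ = 1 + ampl (f t) xi ^+ 2 + C * (rho xi ^+ 2 * (1 + M)) + rho xi * (2 * M)).
    by rewrite !lerD.
  by rewrite /K; ring.
rewrite (_ : 4 * _ = 2 * (1 + K + ampl (f t) xi ^+ 2 + (1 + K + ampl (f t) xi ^+ 2))); last by ring.
by rewrite ler_pM2l// lerD.
Qed.

Definition energy xi t : R := \sum_(k < 2) amp2 (u t k) xi.

(** The squares of the four coefficients are differentiated by [primitive_sqr]. In the pairing with
    the divergence-free [u] the projector drops out, and the rate bound applies; it is a hypothesis
    so that all modes share one [c]. *)
Lemma mode_energy c : (forall U W F (b b' : R) xi,
  (forall k, pdistr (U k)) -> (forall k, pdistr (W k)) -> (forall k, pdistr (F k)) ->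
  div_free U -> momentum a U W F -> xi != 0 ->
  (\esum_(eta in [set: Z]) (ampl U eta ^+ 2)%:E <= b%:E)%E ->
  (\esum_(eta in [set: Z]) (rho eta ^+ 2 * ampl U eta ^+ 2)%:E <= b'%:E)%E ->
  2 * (\sum_k (U k (cos_wave xi) * W k (cos_wave xi) + U k (sin_wave xi) * W k (sin_wave xi))) +
    c * (rho xi ^+ 2 * ampl U xi ^+ 2) <=
  c^-1 * (rho xi ^- 2 * ampl F xi ^+ 2) + 2 * (rho xi * ampl U xi * fine (self_conv (ampl U) xi))) ->
  0 < c -> forall xi t, xi != 0 -> 0 <= t -> t <= T ->
  ((energy xi t)%:E + \int[mu]_(s in `]0%R, t[) (c * (rho xi ^+ 2 * ampl (u s) xi ^+ 2))%:E <=
   (energy xi 0)%:E + \int[mu]_(s in `]0%R, t[) ((c^-1 * (rho xi ^- 2 * ampl (f s) xi ^+ 2))%:E +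
      2%:E * ((rho xi * ampl (u s) xi)%:E * self_conv (ampl (u s)) xi)))%E.
Proof.
move=> rate c0 xi t x0 t0 tT.
have sub : `]0, t[%classic `<=` D.
  by move=> x; rewrite /= !in_itv /= => /andP[-> h]; rewrite (lt_le_trans h).
have sq k phi (h : phi = cos_wave xi \/ phi = sin_wave xi) :=
  primitive_sqr T0 (u_weak_proj k x0 h) (v_proj_int k x0 h) t0 tT.
have hc : cos_wave xi = cos_wave xi :> ('rV[R]_2 -> R) \/ cos_wave xi = sin_wave xi :> ('rV[R]_2 -> R) by left.
have hs : sin_wave xi = cos_wave xi :> ('rV[R]_2 -> R) \/ sin_wave xi = sin_wave xi :> ('rV[R]_2 -> R) by right.
pose z k phi x := 2 * (u x k phi * lproj xi (fun l => v x l phi) k).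
have [iz00 e00] := sq 0 _ hc; have [iz10 e10] := sq 1 _ hc.
have [iz01 e01] := sq 0 _ hs; have [iz11 e11] := sq 1 _ hs.
pose g x := z 0 (cos_wave xi) x + z 0 (sin_wave xi) x + (z 1 (cos_wave xi) x + z 1 (sin_wave xi) x).
have ig : mu.-integrable `]0, t[ (EFin \o g).
  by apply: integrable_addr; [exact: measD|apply: integrable_addr => //; exact: measD..].
have eQ : energy xi t = energy xi 0 + \int[mu]_(s in `]0, t[) g s.
  rewrite /energy !sum2 /amp2 e00 e10 e01 e11 /g.
  rewrite RintegralD//; [|by apply: integrable_addr..].
  rewrite RintegralD// RintegralD//.
  by rewrite /z; ring.
have iA : mu.-integrable `]0, t[ (EFin \o (fun s => c * (rho xi ^+ 2 * ampl (u s) xi ^+ 2))).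
  apply: integrable_mulrl; first exact: measD.
  apply: integrable_mulrl; first exact: measD.
  apply: integrableS (ampl_sqr_int xi u2.1); [exact: measD|exact: measD|exact: sub].
rewrite -[X in (_ + X <= _)%E]fineK; last exact: integrable_fin_num.
rewrite -EFinD eQ -addrA EFinD leeD2l//.
rewrite -[fine _]/(\int[mu]_(s in `]0, t[) (c * (rho xi ^+ 2 * ampl (u s) xi ^+ 2))).
rewrite -RintegralD//.
have [M M0 sl] := ae_slice.
apply: ae_Rintegral_le.
- exact: measD.
- exact: integrable_addr.
- apply: (measurable_funS (measD 0 T) sub); apply: emeasurable_funD.
    apply/measurable_EFinP; apply: measurable_funM => //; apply: measurable_funM => //.
    by apply: measurable_funX; apply: measurable_ampl; exact: f_meas.
  apply: measurable_funeM; apply: emeasurable_funM.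
    by apply/measurable_EFinP; apply: measurable_funM => //; apply: measurable_ampl; exact: u_meas.
  apply: measurable_esum; first exact: measD.
    by move=> eta s; rewrite lee_fin mulr_ge0 ?ampl_ge0.
  by move=> eta; apply/measurable_EFinP; apply: measurable_funM; apply: measurable_ampl; exact: u_meas.
- move=> s _; rewrite adde_ge0//; first by rewrite lee_fin mulr_ge0 ?invr_ge0 ?(ltW c0)// mulr_ge0 ?invr_ge0 ?sqr_ge0.
  by rewrite mule_ge0// mule_ge0 ?self_conv_ge0// lee_fin mulr_ge0 ?rho_ge0 ?ampl_ge0.
apply: (aet_sub sub (aetS _ sl)) => s s0 sT [pU pW pF dU [mo Ub [b' Ub']]].
rewrite -(self_conv_fin xi Ub).1 -!EFinM -EFinD lee_fin.
apply: le_trans (rate _ _ _ M b' xi pU pW pF dU mo x0 Ub Ub'); rewrite lerD2r le_eqVlt; apply/orP; left; apply/eqP.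
have cp := u_coef_perp (ltW s0) (ltW sT) hc; have sp := u_coef_perp (ltW s0) (ltW sT) hs.
have ad phi : \sum_k fr xi k * u s k phi = 0 ->
    u s 0 phi * lproj xi (fun l => v s l phi) 0 + u s 1 phi * lproj xi (fun l => v s l phi) 1 =
    u s 0 phi * v s 0 phi + u s 1 phi * v s 1 phi.
  move=> h; have := lproj_adj xi (fun l => u s l phi) (fun l => v s l phi); rewrite !sum2 => ->.
  by rewrite !(lproj_id _ h).
have := ad _ cp; have := ad _ sp; rewrite /g /z sum2 => h1 h2.
transitivity (2 * (u s 0 (cos_wave xi) * lproj xi (fun l => v s l (cos_wave xi)) 0 + u s 1 (cos_wave xi) * lproj xi (fun l => v s l (cos_wave xi)) 1) +
  2 * (u s 0 (sin_wave xi) * lproj xi (fun l => v s l (sin_wave xi)) 0 + u s 1 (sin_wave xi) * lproj xi (fun l => v s l (sin_wave xi)) 1)).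
  by ring.
by rewrite h1 h2; ring.
Qed.

Lemma energy_ge0 xi t : 0 <= energy xi t.
Proof. by apply: sumr_ge0 => k _; exact: amp2_ge0. Qed.

Lemma energy0 t : 0 <= t -> t <= T -> energy 0 t = 0.
Proof.
move=> t0 tT; apply/eqP; rewrite eq_le energy_ge0 andbT.
by apply: le_trans (amp2_le_ampl (u t) 0) _; rewrite u_ampl0// expr0n.
Qed.

Definition wenergy N t : \bar R := \esum_(xi in [set: Z]) (weight r N xi ^+ 2 * energy xi t)%:E.

Definition dissipation N t : \bar R :=
  \esum_(xi in [set: Z]) (rho xi ^+ 2 * (weight r N xi ^+ 2 * ampl (u t) xi ^+ 2))%:E.

Lemma wenergy_ge0 N t : (0 <= wenergy N t)%E.
Proof. by apply: esum_ge0 => xi _; rewrite lee_fin mulr_ge0 ?energy_ge0// exprn_ge0 ?weight_ge0. Qed.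

Lemma measurable_u_ampl xi : measurable_fun D (fun t => ampl (u t) xi).
Proof. by apply: measurable_ampl; exact: u_meas. Qed.

Lemma measurable_wenergy N : measurable_fun D (wenergy N).
Proof.
apply: measurable_esum; first exact: measD.
  by move=> xi t; rewrite lee_fin mulr_ge0 ?energy_ge0// exprn_ge0 ?weight_ge0.
move=> xi; apply/measurable_EFinP; apply: measurable_funM => //; apply: measurable_sum => k.
by apply: measurable_funD; apply: measurable_funX; apply: u_meas; [exact: test_cos_wave|exact: test_sin_wave].
Qed.

Lemma measurable_dissipation N : measurable_fun D (dissipation N).
Proof.
apply: measurable_esum; first exact: measD.
  by move=> xi t; rewrite lee_fin; nneg.
move=> xi; apply/measurable_EFinP; apply: measurable_funM => //; apply: measurable_funM => //.
by apply: measurable_funX; exact: measurable_u_ampl.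
Qed.

Lemma dissipation_ge0 N t : (0 <= dissipation N t)%E.
Proof. by apply: esum_ge0 => xi _; rewrite lee_fin; nneg. Qed.

Lemma dissipation_le N t : 0 < N -> (dissipation N t <= (N `^ (2 * r))%:E * wnorm 1 u t)%E.
Proof.
move=> N0; rewrite /wnorm -esumZl ?powR_ge0//; last by move=> xi; rewrite lee_fin; nneg.
apply: le_esum => xi _; rewrite -EFinM lee_fin powR_rho2 mulrCA ler_wpM2r//; first by nneg.
exact: weight_le_cst.
Qed.

(** With [a1] the squared $H^{1/2}$ norm, Cauchy-Schwarz gives $a_1^2\le M S_1$ for the squared
    $H^1$ norm $S_1$. So $(1+a_1)^2$ is dominated by a function integrable in time, whatever [N]
    is. *)
Lemma absorb c L M b' N s : 0 < c -> 0 <= L -> 0 <= M -> 0 < N ->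
  (forall A N a, (forall xi, 0 <= A xi) -> 0 < N -> 0 <= a ->
    (\esum_(xi in [set: Z]) (rho xi * A xi ^+ 2)%:E <= a%:E)%E ->
    (\esum_(xi in [set: Z]) ((weight r N xi ^+ 2 * rho xi * A xi)%:E * self_conv A xi) <=
     (c / 4)%:E * (\esum_(xi in [set: Z]) (rho xi ^+ 2 * (weight r N xi ^+ 2 * A xi ^+ 2))%:E) +
     (L * (1 + a) ^+ 2)%:E * \esum_(xi in [set: Z]) (weight r N xi ^+ 2 * A xi ^+ 2)%:E)%E) ->
  (\esum_(xi in [set: Z]) (ampl (u s) xi ^+ 2)%:E <= M%:E)%E ->
  (\esum_(xi in [set: Z]) (rho xi ^+ 2 * ampl (u s) xi ^+ 2)%:E <= b'%:E)%E ->
  (\esum_(xi in [set: Z]) ((weight r N xi ^+ 2)%:E * ((c^-1 * (rho xi ^- 2 * ampl (f s) xi ^+ 2))%:E +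
      2%:E * ((rho xi * ampl (u s) xi)%:E * self_conv (ampl (u s)) xi))) <=
   c^-1%:E * wnorm (r - 1) f s +
      ((c / 2)%:E * dissipation N s + (16 * L * (1 + M * fine (wnorm 1 u s)))%:E * wenergy N s))%E.
Proof.
move=> c0 L0 M0 N0 hL Ub Ub'; pose w := weight r N; pose A := ampl (u s); pose F := ampl (f s).
have A0 xi : 0 <= A xi by exact: ampl_ge0.
have ci : 0 <= c^-1 by rewrite invr_ge0 ltW.
have rA0 xi : 0 <= rho xi * A xi ^+ 2 by nneg.
have S1E : wnorm 1 u s = \esum_(xi in [set: Z]) (rho xi ^+ 2 * A xi ^+ 2)%:E.
  by rewrite /wnorm; under eq_esum do rewrite powR_rho2.
have S1fin : wnorm 1 u s \is a fin_num.
  by rewrite ge0_fin_numE ?wnorm_ge0// S1E (le_lt_trans Ub')// ltry.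
pose S1 := fine (wnorm 1 u s).
have S10 : 0 <= S1 by rewrite fine_ge0// wnorm_ge0.
pose a1 := fine (\esum_(xi in [set: Z]) (rho xi * A xi ^+ 2)%:E).
have a1fin : \esum_(xi in [set: Z]) (rho xi * A xi ^+ 2)%:E \is a fin_num.
  rewrite ge0_fin_numE; last by apply: esum_ge0 => xi _; rewrite lee_fin.
  apply: (@le_lt_trans _ _ (wnorm 1 u s)); last by rewrite -ge0_fin_numE ?wnorm_ge0.
  rewrite S1E; apply: le_esum => xi _; rewrite lee_fin ler_wpM2r ?sqr_ge0// expr2.
  by rewrite ler_peMl ?rho_ge0 ?rho_ge1.
have a10 : 0 <= a1 by rewrite fine_ge0// esum_ge0// => xi _; rewrite lee_fin.
have a1S : a1 ^+ 2 <= M * S1.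
  apply: (@esum_CS R Z A (fun xi => rho xi * A xi) M S1 a1) => //.
  - by move=> xi; nneg.
  - by rewrite /S1 fineK// S1E; apply: le_esum => xi _; rewrite exprMn.
  - by rewrite fineK//; apply: le_esum => xi _; rewrite lee_fin expr2 mulrCA.
have := hL A N a1 A0 N0 a10; rewrite fineK// => /(_ (lexx _)).
rewrite -/(dissipation N s); set TT := \esum_(xi in _) (_ * self_conv _ _)%E; set W := \esum_(xi in _) (_ * A _ ^+ 2)%:E => hT.
have sc0 xi : (0 <= self_conv A xi)%E by exact: self_conv_ge0.
have w0 xi : 0 <= w xi ^+ 2 * rho xi * A xi by rewrite /w; nneg.
have T0' : (0 <= TT)%E by apply: esum_ge0 => xi _; rewrite mule_ge0// lee_fin.
have W4 : (W <= 4%:E * wenergy N s)%E.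
  rewrite /wenergy -esumZl//; last first.
    by move=> xi; rewrite lee_fin mulr_ge0 ?energy_ge0 ?sqr_ge0.
  apply: le_esum => xi _; rewrite -EFinM lee_fin [leRHS]mulrCA ler_wpM2l ?sqr_ge0//.
  exact: ampl_sqr_le.
have F0 xi : 0 <= rho xi `^ (2 * (r - 1)) * F xi ^+ 2 by rewrite mulr_ge0 ?powR_ge0 ?sqr_ge0.
apply: (@le_trans _ _ (\esum_(xi in [set: Z]) (c^-1%:E * (rho xi `^ (2 * (r - 1)) * F xi ^+ 2)%:E +
     2%:E * ((w xi ^+ 2 * rho xi * A xi)%:E * self_conv A xi)))%E).
  apply: le_esum => xi _; rewrite ge0_muleDr; last 2 first.
  - by rewrite lee_fin mulr_ge0// mulr_ge0 ?sqr_ge0// invr_ge0 sqr_ge0.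
  - by rewrite mule_ge0// mule_ge0// lee_fin mulr_ge0 ?rho_ge0.
  apply: leeD.
    rewrite -!EFinM lee_fin [leLHS]mulrCA ler_wpM2l// powR_rho_sub mulrA ler_wpM2r ?sqr_ge0//.
    by rewrite ler_wpM2r ?invr_ge0 ?sqr_ge0// weight_le_rho.
  by rewrite muleCA lee_wpmul2l// muleA -EFinM mulrA.
rewrite esumD; [|by move=> xi _; rewrite mule_ge0// lee_fin|by move=> xi _; rewrite mule_ge0// mule_ge0// lee_fin].
rewrite !esumZl//; try by move=> xi; rewrite ?mule_ge0// lee_fin.
rewrite -/TT leeD2l//.
apply: (@le_trans _ _ (2%:E * ((c / 4)%:E * dissipation N s + (L * (1 + a1) ^+ 2)%:E * W))%E).
  exact: lee_wpmul2l.
have W0 : (0 <= W)%E by apply: esum_ge0 => xi _; rewrite lee_fin; nneg.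
have l0 : 0 <= L * (1 + a1) ^+ 2 by rewrite mulr_ge0 ?sqr_ge0.
rewrite ge0_muleDr; [|by rewrite mule_ge0 ?dissipation_ge0// lee_fin divr_ge0// ltW|by rewrite mule_ge0// lee_fin].
rewrite muleA -EFinM (_ : 2 * (c / 4) = c / 2); last by field.
rewrite leeD2l//.
apply: (@le_trans _ _ (2%:E * ((L * (1 + a1) ^+ 2)%:E * (4%:E * wenergy N s)))%E).
  by rewrite lee_wpmul2l// lee_wpmul2l// lee_fin.
rewrite !muleA -!EFinM lee_wpmul2r ?wenergy_ge0// lee_fin.
(* The factor $16$ collects the $2$ of the rate, the $4$ between squared amplitude and energy, and
   $(1+a_1)^2\le2(1+a_1^2)$. *)
rewrite (_ : 2 * _ * 4 = 8 * L * (1 + a1) ^+ 2); last by ring.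
rewrite (_ : 16 * L * _ = 8 * L * (2 * (1 + M * S1))); last by rewrite /S1; ring.
rewrite ler_wpM2l ?mulr_ge0//.
move: a1S; move: (M * S1) => q; have := sqr_ge0 (a1 - 1); rewrite sqrrB sqrrD !expr1n !mulr1 !mul1r; lra.
Qed.

(** The mode inequalities are summed with the weights and [absorb] is applied at almost every time.
    It matters that [K] and [M] are chosen before [N]. *)
Lemma energy_balance c (rate : forall U W F (b b' : R) xi,
  (forall k, pdistr (U k)) -> (forall k, pdistr (W k)) -> (forall k, pdistr (F k)) ->
  div_free U -> momentum a U W F -> xi != 0 ->
  (\esum_(eta in [set: Z]) (ampl U eta ^+ 2)%:E <= b%:E)%E ->
  (\esum_(eta in [set: Z]) (rho eta ^+ 2 * ampl U eta ^+ 2)%:E <= b'%:E)%E ->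
  2 * (\sum_k (U k (cos_wave xi) * W k (cos_wave xi) + U k (sin_wave xi) * W k (sin_wave xi))) +
    c * (rho xi ^+ 2 * ampl U xi ^+ 2) <=
  c^-1 * (rho xi ^- 2 * ampl F xi ^+ 2) + 2 * (rho xi * ampl U xi * fine (self_conv (ampl U) xi))) :
  0 < c -> exists K M : R, [/\ 0 <= K, 0 <= M, 
    aet T (fun t => (wnorm 0 u t <= M%:E)%E) &
    forall N t, 0 < N -> 0 <= t -> t <= T ->
   (wenergy N t + c%:E * (\int[mu]_(s in `]0%R, t[) dissipation N s) <=
    wenergy N 0 + \int[mu]_(s in `]0%R, t[) (c^-1%:E * wnorm (r - 1) f s +
      ((c / 2)%:E * dissipation N s + (K * (1 + M * fine (wnorm 1 u s)))%:E * wenergy N s)))%E].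
Proof.
move=> c0; have c4 : 0 < c / 4 by rewrite divr_gt0.
have [L L0 hL] := weighted_trilinear r0 c4.
have [M M0 sl] := ae_slice.
exists (16 * L), M; split=> //; first by rewrite mulr_ge0.
  apply: aetS sl => t t0 tT [_ _ _ _ [_ Ub _]]; apply: le_trans Ub.
  by rewrite /wnorm; under eq_esum do rewrite powR_rho0 mul1r.
move=> N t N0 t0 tT; pose w := weight r N.
have sub : `]0, t[%classic `<=` D.
  by move=> x; rewrite /= !in_itv /= => /andP[-> h]; rewrite (lt_le_trans h).
have subm (g : R -> \bar R) : measurable_fun D g -> measurable_fun `]0, t[ g.
  by apply: measurable_funS => //; exact: measD.
pose hl xi s := (c * (rho xi ^+ 2 * ampl (u s) xi ^+ 2))%:E.
pose hr xi s := ((c^-1 * (rho xi ^- 2 * ampl (f s) xi ^+ 2))%:E +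
      2%:E * ((rho xi * ampl (u s) xi)%:E * self_conv (ampl (u s)) xi))%E.
have w20 xi : 0 <= w xi ^+ 2 by exact: sqr_ge0.
have hl0 xi s : (0 <= hl xi s)%E by rewrite lee_fin mulr_ge0 ?(ltW c0)//; nneg.
have hra xi s : (0 <= (c^-1 * (rho xi ^- 2 * ampl (f s) xi ^+ 2))%:E)%E.
  by rewrite lee_fin mulr_ge0 ?invr_ge0 ?(ltW c0)//; nneg.
have hrb xi s : (0 <= (rho xi * ampl (u s) xi)%:E * self_conv (ampl (u s)) xi)%E.
  by rewrite mule_ge0 ?self_conv_ge0// lee_fin mulr_ge0 ?rho_ge0 ?ampl_ge0.
have hr0 xi s : (0 <= hr xi s)%E by rewrite adde_ge0// mule_ge0.
have ml xi : measurable_fun `]0, t[ (hl xi).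
  apply: subm; apply/measurable_EFinP; apply: measurable_funM => //; apply: measurable_funM => //.
  by apply: measurable_funX; exact: measurable_u_ampl.
have mr xi : measurable_fun `]0, t[ (hr xi).
  apply: subm; apply: emeasurable_funD.
    apply/measurable_EFinP; apply: measurable_funM => //; apply: measurable_funM => //.
    by apply: measurable_funX; apply: measurable_ampl; exact: f_meas.
  apply: measurable_funeM; apply: emeasurable_funM.
    by apply/measurable_EFinP; apply: measurable_funM => //; exact: measurable_u_ampl.
  apply: measurable_esum; first exact: measD.
    by move=> eta s; rewrite lee_fin mulr_ge0 ?ampl_ge0.
  by move=> eta; apply/measurable_EFinP; apply: measurable_funM; exact: measurable_u_ampl.
have base xi : ((energy xi t)%:E + \int[mu]_(x in `]0%R, t[) hl xi x <=
    (energy xi 0)%:E + \int[mu]_(x in `]0%R, t[) hr xi x)%E.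
  (* The equation is tested at nonzero frequencies only; at $0$ both energies vanish, [u] having
     zero mean. *)
  have [->|x0] := eqVneq xi 0; last exact: mode_energy.
  rewrite !energy0 ?(ltW T0)// !add0e; apply: ge0_le_integral => //; [exact: ml|exact: mr|].
  move=> s sI; have := sub s sI; rewrite /= in_itv /= => /andP[s0 sT].
  by rewrite /hl u_ampl0 ?(ltW s0) ?(ltW sT)// expr0n mulr0 mulr0 hr0.
have := weighted_sum (measD 0 t) w20 (energy_ge0^~ t) (energy_ge0^~ 0) hl0 hr0 ml mr base.
rewrite -/(wenergy N t) -/(wenergy N 0).
have rhs_ge0 s : (0 <= c^-1%:E * wnorm (r - 1) f s +
      ((c / 2)%:E * dissipation N s + (16 * L * (1 + M * fine (wnorm 1 u s)))%:E * wenergy N s))%E.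
  apply: adde_ge0; last apply: adde_ge0; apply: mule_ge0.
  - by rewrite lee_fin invr_ge0 ltW.
  - exact: wnorm_ge0.
  - by rewrite lee_fin divr_ge0// ltW.
  - exact: dissipation_ge0.
  - rewrite lee_fin; apply: mulr_ge0; first exact: mulr_ge0.
    by apply: addr_ge0 => //; apply: mulr_ge0 => //; apply: fine_ge0; exact: wnorm_ge0.
  - exact: wenergy_ge0.
have measurable_rhs : measurable_fun D (fun s => c^-1%:E * wnorm (r - 1) f s +
      ((c / 2)%:E * dissipation N s + (16 * L * (1 + M * fine (wnorm 1 u s)))%:E * wenergy N s))%E.
  apply: emeasurable_funD; first by apply: measurable_funeM; apply: measurable_wnorm; exact: f_meas.
  apply: emeasurable_funD; first by apply: measurable_funeM; exact: measurable_dissipation.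
  apply: emeasurable_funM; last exact: measurable_wenergy.
  apply/measurable_EFinP; apply: measurable_funM => //; apply: measurable_funD => //; apply: measurable_funM => //.
  by apply: measurableT_comp; [exact: fine_measurable|apply: measurable_wnorm; exact: u_meas].
have P0 xi s : 0 <= rho xi ^+ 2 * (w xi ^+ 2 * ampl (u s) xi ^+ 2) by nneg.
have -> : (\int[mu]_(x in `]0%R, t[) (\esum_(xi in [set: Z]) ((w xi ^+ 2)%:E * hl xi x)) =
    c%:E * \int[mu]_(s in `]0%R, t[) dissipation N s)%E.
  rewrite -ge0_integralZl ?lee_fin ?(ltW c0)//; [|by apply: subm; exact: measurable_dissipation|by move=> s _; exact: dissipation_ge0].
  apply: eq_integral => s _; rewrite /dissipation -esumZl ?(ltW c0)//; last by move=> xi; rewrite lee_fin.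
  by apply: eq_esum => xi _; rewrite /hl -!EFinM; congr EFin; rewrite /w; ring.
move=> h; apply: le_trans h _; rewrite leeD2l//.
apply: ae_ge0_le_integral.
- exact: measD.
- by move=> s _; apply: esum_ge0 => xi _; rewrite mule_ge0// lee_fin.
- apply: measurable_esum; first exact: measD.
    by move=> xi s; rewrite mule_ge0// lee_fin.
  by move=> xi; apply: measurable_funeM; exact: mr.
- by move=> s _; exact: rhs_ge0.
- apply: subm; exact: measurable_rhs.
apply: (aet_sub sub (aetS _ sl)) => s s0 sT [pU _ pF dU [_ Ub [b' Ub']]].
exact: (absorb c0 L0 M0 N0 hL Ub Ub').
Qed.

Lemma fine_le_self (x : \bar R) : (0 <= x)%E -> ((fine x)%:E <= x)%E.
Proof. by case: x => [y| |]//= _; rewrite leey. Qed.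

Lemma wenergy_init N : 0 < N -> (wenergy N 0 <= Hnorm2 r (u0 0%R) + Hnorm2 r (u0 1%R))%E.
Proof.
move=> N0; have p k xi : 0 <= rho xi `^ (2 * r) * amp2 (u0 k) xi by rewrite mulr_ge0 ?powR_ge0 ?amp2_ge0.
rewrite !Hnorm2E -esumD; try by move=> xi _; rewrite lee_fin.
apply: le_esum => xi _; rewrite -EFinD lee_fin -mulrDr.
have q0 : 0 <= amp2 (u0 0) xi + amp2 (u0 1) xi by rewrite addr_ge0 ?amp2_ge0.
have [->|x0] := eqVneq xi 0.
  by rewrite energy0 ?(ltW T0)// mulr0; apply: mulr_ge0; [exact: powR_ge0|rewrite addr_ge0 ?amp2_ge0].
have -> : energy xi 0 = amp2 (u0 0) xi + amp2 (u0 1) xi.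
  by rewrite /energy sum2 /amp2; have [-> ->] := u_init 0 x0; have [-> ->] := u_init 1 x0.
by rewrite ler_wpM2r// weight_le_rho.
Qed.

(** This bound grows with [N]; it only supplies the a priori finiteness under which Gronwall's lemma
    operates. *)
Lemma wenergy_cap N M t : 0 < N -> (wnorm 0 u t <= M%:E)%E -> (wenergy N t <= (N `^ (2 * r) * M)%:E)%E.
Proof.
move=> N0 hM; rewrite EFinM; apply: le_trans (lee_wpmul2l _ hM); last by rewrite lee_fin powR_ge0.
rewrite /wnorm -esumZl ?powR_ge0//; last by move=> xi; rewrite lee_fin mulr_ge0 ?powR_ge0 ?sqr_ge0.
apply: le_esum => xi _; rewrite -EFinM lee_fin powR_rho0 mul1r.
apply: ler_pM; rewrite ?sqr_ge0 ?energy_ge0//; first exact: weight_le_cst.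
exact: amp2_le_ampl.
Qed.

Lemma integrable_wnorm1 : mu.-integrable D (EFin \o (fun s => fine (wnorm 1 u s))).
Proof.
apply/integrableP; split.
  apply/measurable_EFinP; apply: measurableT_comp; first exact: fine_measurable.
  by apply: measurable_wnorm; exact: u_meas.
apply: le_lt_trans (int_wnorm u2.1); apply: ge0_le_integral => //.
- apply: measurableT_comp => //; apply/measurable_EFinP; apply: measurableT_comp; first exact: fine_measurable.
  by apply: measurable_wnorm; exact: u_meas.
- by apply: measurable_wnorm; exact: u_meas.
- move=> s _; rewrite /= ger0_norm; last by rewrite fine_ge0// wnorm_ge0.
  by rewrite fine_le_self// wnorm_ge0.
Qed.

Lemma dissipation_fin N t : 0 < N -> t <= T ->
  (\int[mu]_(s in `]0%R, t[) dissipation N s)%E \is a fin_num.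
Proof.
move=> N0 tT; rewrite ge0_fin_numE; last by apply: integral_ge0 => s _; exact: dissipation_ge0.
have sub : `]0, t[%classic `<=` D.
  by move=> x; rewrite /= !in_itv /= => /andP[-> h]; rewrite (lt_le_trans h).
apply: (@le_lt_trans _ _ (\int[mu]_(s in D) dissipation N s)%E).
  apply: ge0_subset_integral => //; first exact: measurable_dissipation.
  by move=> s _; exact: dissipation_ge0.
apply: (@le_lt_trans _ _ (\int[mu]_(s in D) ((N `^ (2 * r))%:E * wnorm 1 u s))%E).
  apply: ge0_le_integral => //.
  - by move=> s _; exact: dissipation_ge0.
  - exact: measurable_dissipation.
  - by apply: measurable_funeM; apply: measurable_wnorm; exact: u_meas.
  - by move=> s _; exact: dissipation_le.
rewrite ge0_integralZl//; last by rewrite lee_fin powR_ge0.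
- by rewrite lte_mul_pinfty ?lee_fin ?powR_ge0// (int_wnorm u2.1).
- by apply: measurable_wnorm; exact: u_meas.
- by move=> s _; exact: wnorm_ge0.
Qed.

Lemma uniform_bound : exists2 B : R, 0 <= B & forall N, 0 < N ->
  aet T (fun t => (wenergy N t <= B%:E)%E) /\ (\int[mu]_(s in D) dissipation N s <= B%:E)%E.
Proof.
have [c c0 rate] := momentum_rate ell.
have [K [M [K0 M0 aeM bal]]] := energy_balance rate c0.
pose ka s := K * (1 + M * fine (wnorm 1 u s)).
have ka0 s : 0 <= ka s.
  apply: mulr_ge0 => //; apply: addr_ge0 => //; apply: mulr_ge0 => //; apply: fine_ge0; exact: wnorm_ge0.
have ika : mu.-integrable D (EFin \o ka).
  apply: integrable_mulrl => //; apply: integrable_addr => //; first exact: integrable_cstD.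
  by apply: integrable_mulrl => //; exact: integrable_wnorm1.
have mka : measurable_fun D ka by apply/measurable_EFinP; case/integrableP: ika.
have [G G0 gr] := gronwall T0 ka0 ika.
set Phi := (\int[mu]_(s in D) wnorm (r - 1) f s)%E.
have Phi_fin : Phi \is a fin_num.
  rewrite ge0_fin_numE; first exact: int_wnorm.
  by apply: integral_ge0 => s _; exact: wnorm_ge0.
have Hfin k : Hnorm2 r (u0 k) \is a fin_num.
  by rewrite ge0_fin_numE ?Hnorm2_ge0//; case: hu0 => /(_ k) [[]].
pose A0 := fine (Hnorm2 r (u0 0%R)) + fine (Hnorm2 r (u0 1%R)) + c^-1 * fine Phi.
have A00 : 0 <= A0.
  rewrite !addr_ge0 ?mulr_ge0 ?fine_ge0 ?Hnorm2_ge0 ?invr_ge0 ?(ltW c0)//.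
  by apply: integral_ge0 => s _; exact: wnorm_ge0.
have bal2 N t : 0 < N -> 0 <= t -> t <= T ->
    (wenergy N t + (c / 2)%:E * (\int[mu]_(s in `]0%R, t[) dissipation N s) <=
     A0%:E + \int[mu]_(s in `]0%R, t[) ((ka s)%:E * wenergy N s))%E.
  move=> N0 t0 tT; have := bal N t N0 t0 tT.
  have sub : `]0, t[%classic `<=` D.
    by move=> x; rewrite /= !in_itv /= => /andP[-> h]; rewrite (lt_le_trans h).
  have subm (g : R -> \bar R) : measurable_fun D g -> measurable_fun `]0, t[ g.
    by apply: measurable_funS => //; exact: measD.
  have mW := subm _ (measurable_wnorm (r - 1) f_meas).
  have mDi := subm _ (measurable_dissipation N).
  have mE : measurable_fun `]0, t[ (fun s => (ka s)%:E * wenergy N s)%E.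
    apply: subm; apply: emeasurable_funM; last exact: measurable_wenergy.
    exact/measurable_EFinP.
  have p1 s : (0 <= c^-1%:E * wnorm (r - 1) f s)%E by rewrite mule_ge0 ?wnorm_ge0// lee_fin invr_ge0 ltW.
  have p2 s : (0 <= (c / 2)%:E * dissipation N s)%E by rewrite mule_ge0 ?dissipation_ge0// lee_fin divr_ge0// ltW.
  have p3 s : (0 <= (ka s)%:E * wenergy N s)%E by rewrite mule_ge0 ?wenergy_ge0// lee_fin.
  have -> : (\int[mu]_(s in `]0%R, t[) (c^-1%:E * wnorm (r - 1) f s +
      ((c / 2)%:E * dissipation N s + (K * (1 + M * fine (wnorm 1 u s)))%:E * wenergy N s)) =
    c^-1%:E * \int[mu]_(s in `]0%R, t[) wnorm (r - 1) f s + ((c / 2)%:E * \int[mu]_(s in `]0%R, t[) dissipation N s +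
      \int[mu]_(s in `]0%R, t[) ((ka s)%:E * wenergy N s)))%E.
    rewrite ge0_integralD//; [|exact: measurable_funeM|by move=> s _; apply: adde_ge0; [exact: p2|exact: p3]|
      by apply: emeasurable_funD; [exact: measurable_funeM|exact: mE]].
    rewrite ge0_integralD//; [|exact: measurable_funeM|by move=> s _; exact: p3].
    congr (_ + (_ + _))%E.
      by apply: ge0_integralZl => //; [move=> s _; exact: wnorm_ge0|rewrite lee_fin invr_ge0 ltW].
    by apply: ge0_integralZl => //; [move=> s _; exact: dissipation_ge0|rewrite lee_fin divr_ge0// ltW].
  have Df := dissipation_fin N0 tT; set Dt := (\int[mu]_(s in _) dissipation N s)%E in Df *.
  set J := (\int[mu]_(s in _) ((ka s)%:E * _))%E.
  have Ph : (\int[mu]_(s in `]0%R, t[) wnorm (r - 1) f s <= Phi)%E.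
    apply: ge0_subset_integral => //; first by apply: measurable_wnorm; exact: f_meas.
    by move=> s _; exact: wnorm_ge0.
  have cD : (c%:E * Dt = (c / 2)%:E * Dt + (c / 2)%:E * Dt)%E.
    by rewrite -(fineK Df) -!EFinM -EFinD; congr EFin; field.
  rewrite cD => h; apply: ereal_absorb h _; first by rewrite fin_numM.
  rewrite /A0 EFinD EFinD; apply: leeD.
    by rewrite !fineK//; exact: wenergy_init.
  by rewrite EFinM fineK// lee_wpmul2l// lee_fin invr_ge0 ltW.
have main N : 0 < N -> aet T (fun t => (wenergy N t <= (G * A0)%:E)%E).
  move=> N0; pose cap := N `^ (2 * r) * M.
  (* The cap changes nothing at almost every time, and makes the energy a real function bounded at
     every time, as [gronwall] asks. *)
  pose E t := Num.min (fine (wenergy N t)) cap.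
  have cap0 : 0 <= cap by rewrite mulr_ge0 ?powR_ge0.
  have E0 t : 0 <= E t by rewrite le_min cap0 fine_ge0// wenergy_ge0.
  have Ecap t : E t <= cap by rewrite ge_min lexx orbT.
  have mE : measurable_fun D E.
    apply: measurable_minr => //; apply: measurableT_comp; first exact: fine_measurable.
    exact: measurable_wenergy.
  have aeE : aet T (fun t => (E t)%:E = wenergy N t).
    apply: aetS aeM => t _ _ /(wenergy_cap N0) hcap.
    have fW : wenergy N t \is a fin_num by rewrite ge0_fin_numE ?wenergy_ge0// (le_lt_trans hcap)// ltry.
    by rewrite /E min_l ?fineK// -lee_fin fineK.
  have ikE : mu.-integrable D (EFin \o (fun s => ka s * E s)).
    have := integrable_mulrl cap (measD 0 T) ika; apply: le_integrable => //.
      by apply/measurable_EFinP; apply: measurable_funM.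
    move=> s _; rewrite lee_fin normrM [leRHS]normrM mulrC ler_wpM2r// ger0_norm//.
    exact: le_trans (Ecap s) (ler_norm _).
  have JE t : 0 < t -> t < T -> (\int[mu]_(s in `]0%R, t[) ((ka s)%:E * wenergy N s))%E =
      (\int[mu]_(s in `]0, t[) (ka s * E s))%:E.
    move=> t0 tT.
    have sub : `]0, t[%classic `<=` D.
      by move=> x; rewrite /= !in_itv /= => /andP[-> h]; rewrite (lt_trans h).
    rewrite fineK; last first.
      by apply: integrable_fin_num => //; apply: integrableS ikE.
    apply: ae_eq_integral => //.
    - apply: (measurable_funS (measD 0 T) sub); apply: emeasurable_funM; last exact: measurable_wenergy.
      exact/measurable_EFinP.
    - apply: (measurable_funS (measD 0 T) sub); apply/measurable_EFinP; exact: measurable_funM.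
    - by apply: (aet_sub sub (aetS _ aeE)) => s _ _ <-; rewrite EFinM.
  have Egr t : 0 < t -> t < T -> E t <= A0 + \int[mu]_(s in `]0, t[) (ka s * E s).
    move=> t0 tT; have := bal2 N t N0 (ltW t0) (ltW tT); rewrite JE// -EFinD => h.
    have h2 : (wenergy N t <= (A0 + \int[mu]_(s in `]0, t[) (ka s * E s))%:E)%E.
      apply: le_trans h; rewrite leeDl// mule_ge0//; first by rewrite lee_fin divr_ge0// ltW.
      by apply: integral_ge0 => s _; exact: dissipation_ge0.
    have fW : wenergy N t \is a fin_num by rewrite ge0_fin_numE ?wenergy_ge0// (le_lt_trans h2)// ltry.
    by apply: (@le_trans _ _ (fine (wenergy N t))); [rewrite ge_min lexx|rewrite -lee_fin fineK].
  have Eb t : 0 < t -> t < T -> E t <= G * A0.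
    by apply: (gr E A0 cap) => // s _ _; rewrite E0 Ecap.
  by apply: aetS aeE => t t0 tT <-; rewrite lee_fin Eb.
have ik0 : 0 <= \int[mu]_(s in D) ka s by apply: Rintegral_ge0.
have GA0 : 0 <= G * A0 by exact: mulr_ge0.
(* Comes from [bal2] at time [T], with the energy under the integral replaced by its bound
   [G * A0]. *)
pose B2 := (c / 2)^-1 * (A0 + G * A0 * \int[mu]_(s in D) ka s).
have B20 : 0 <= B2.
  by apply: mulr_ge0; [rewrite invr_ge0 divr_ge0// ltW|apply: addr_ge0 => //; exact: mulr_ge0].
exists (G * A0 + B2) => [|N N0]; first exact: addr_ge0.
split; first by apply: aetS (main N N0) => t _ _ /le_trans; apply; rewrite lee_fin lerDl.
apply: (@le_trans _ _ B2%:E); last by rewrite lee_fin lerDr.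
have c2 : 0 < c / 2 by rewrite divr_gt0.
rewrite /B2 EFinM lee_pdivlMl//.
have := bal2 N T N0 (ltW T0) (lexx T); set Di := (\int[mu]_(s in D) dissipation N s)%E => h.
apply: (@le_trans _ _ (wenergy N T + (c / 2)%:E * Di)%E); first by rewrite leeDr// wenergy_ge0.
apply: le_trans h _; rewrite (EFinD A0) leeD2l// EFinM fineK; last exact: integrable_fin_num.
rewrite -ge0_integralZl//; [|exact/measurable_EFinP|by move=> s _; rewrite lee_fin].
apply: ae_ge0_le_integral => //.
- by move=> s _; rewrite mule_ge0 ?wenergy_ge0// lee_fin.
- by apply: emeasurable_funM; [exact/measurable_EFinP|exact: measurable_wenergy].
- by move=> s _; rewrite mule_ge0// lee_fin.
- by apply: measurable_funeM; exact/measurable_EFinP.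
- apply: (aet_sub _ (aetS _ (main N N0))) => // s _ _ h.
  by rewrite muleC lee_wpmul2r// lee_fin.
Qed.

Lemma nat_above (x : R) : exists n : nat, x <= n.+1%:R.
Proof.
have [x0|x0] := leP x 0; first by exists 0%N; rewrite (le_trans x0).
by exists (Num.truncn x); rewrite ltW// truncnS_gt// ltW.
Qed.

(** On a ball of radius [X] the weight truncated at an integer above [X] is exactly $\varrho^r$.
    Restricting the truncation to integers leaves countably many null sets. *)
Lemma u_regular_inf : exists2 B : R, 0 <= B & aet T (fun t => (wnorm r u t <= B%:E)%E).
Proof.
have [B B0 hB] := uniform_bound; exists (4 * B); first by rewrite mulr_ge0.
apply: aetS (aet_nat (fun n => (hB n.+1%:R (ltr0Sn _ _)).1)) => t t0 tT h.
apply: esum_exhaust => [xi|X]; first by rewrite mulr_ge0 ?powR_ge0 ?sqr_ge0.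
have [n Xn] := nat_above X; rewrite EFinM; apply: le_trans (lee_wpmul2l _ (h n)); last by [].
rewrite /wenergy -esumZl//; last by move=> xi; rewrite lee_fin mulr_ge0 ?energy_ge0 ?sqr_ge0.
apply: le_esum => xi _; rewrite -EFinM lee_fin; case: ifPn => [xX|_]; last first.
  by rewrite mulr_ge0// mulr_ge0 ?energy_ge0 ?sqr_ge0.
rewrite weight_eq_rho; last exact: le_trans Xn.
by rewrite [leRHS]mulrCA ler_wpM2l ?powR_ge0//; exact: ampl_sqr_le.
Qed.

(** Integral and lattice sum are exchanged first, so that the exhaustion by balls acts on the outer
    sum. *)
Lemma u_regular_L2 : (\int[mu]_(s in D) wnorm (r + 1) u s < +oo)%E.
Proof.
have [B B0 hB] := uniform_bound; apply: (@le_lt_trans _ _ B%:E); last exact: ltry.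
pose F xi := rho xi `^ (2 * (r + 1)) * \int[mu]_(s in D) (ampl (u s) xi ^+ 2).
have iA xi := ampl_sqr_int xi u2.1.
have FE xi : (\int[mu]_(s in D) (rho xi `^ (2 * (r + 1)) * ampl (u s) xi ^+ 2)%:E)%E = (F xi)%:E.
  rewrite /F EFinM fineK; last exact: integrable_fin_num (iA xi).
  rewrite -ge0_integralZl//.
  - by case/integrableP: (iA xi).
  - by move=> s _; rewrite lee_fin sqr_ge0.
  - by rewrite lee_fin powR_ge0.
rewrite /wnorm integral_esum//; last 2 first.
- by move=> xi s; rewrite lee_fin mulr_ge0 ?powR_ge0 ?sqr_ge0.
- move=> xi; apply/measurable_EFinP; apply: measurable_funM => //.
  by apply: measurable_funX; exact: measurable_u_ampl.
under eq_esum do rewrite FE.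
apply: esum_exhaust => [xi|X].
  by rewrite mulr_ge0 ?powR_ge0//; apply: Rintegral_ge0 => s _; exact: sqr_ge0.
have [n Xn] := nat_above X; have := (hB n.+1%:R (ltr0Sn _ _)).2; apply: le_trans.
rewrite /dissipation integral_esum//; last 2 first.
- by move=> xi s; rewrite lee_fin; nneg.
- move=> xi; apply/measurable_EFinP; apply: measurable_funM => //; apply: measurable_funM => //.
  by apply: measurable_funX; exact: measurable_u_ampl.
apply: le_esum => xi _; case: ifPn => [xX|_]; last first.
  by apply: integral_ge0 => s _; rewrite lee_fin; nneg.
rewrite -FE le_eqVlt; apply/orP; left; apply/eqP; apply: eq_integral => s _; congr EFin.
rewrite weight_eq_rho; last exact: le_trans Xn.
have := powR_rho_sub (r + 1) xi; rewrite addrK => ->.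
by field; rewrite gt_eqF ?rho_gt0.
Qed.

End Solution.

Section AeCountable.
Variables (R : realType) (T : R).

Lemma aet_count (I : countType) (P : I -> R -> Prop) : (forall i, aet T (P i)) -> aet T (fun t => forall i, P i t).
Proof.
move=> h; have : aet T (fun t => forall n, if (unpickle n : option I) is Some i then P i t else True).
  apply: aet_nat => n; case: unpickle => [i|]; first exact: h.
  by apply: aetT.
by apply: aetS => t _ _ ht i; have := ht (pickle i); rewrite pickleK.
Qed.

End AeCountable.

(** * Regularity of the time derivative and of the pressure *)

Section Regularity.
Variables (R : realType) (T r : R) (a : tensor R 2) (f u v : R -> vfunctional R 2).
Local Notation mu := (@lebesgue_measure R).
Local Notation Z := 'rV[int]_2.
Local Notation rho := (@rho R 2).
Local Notation fr xi j := ((xi 0 j)%:~R : R).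
Local Notation D := (`]0, T[%classic : set (measurableTypeR R)).
Hypotheses (T0 : 0 < T) (r0 : 0 < r) (sym : tensor_symmetric a).
Hypotheses (fI : Linf_vHdot T (r - 2) f) (f2 : L2_vHdot T (r - 1) f).
Hypotheses (uI : Linf_vHdot_sigma T 0 u) (u2 : L2_vHdot_sigma T 1 u) (uw : weakly_continuous T u).
Hypotheses (vt : time_derivative T u v) (mom : aet T (fun t => momentum a (u t) (v t) (f t))).
Hypotheses (uRI : exists2 B : R, 0 <= B & aet T (fun t => (wnorm r u t <= B%:E)%E)).
Hypotheses (uR2 : (\int[mu]_(s in D) wnorm (r + 1) u s < +oo)%E).
Implicit Types (xi eta : Z) (t : R) (k : 'I_2).

Definition forcing t : vfunctional R 2 := force a (u t) (f t).

Lemma measurable_Zsum (F : Z -> R -> R) : (forall xi, measurable_fun D (F xi)) ->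
  measurable_fun D (fun t => Zsum (F^~ t)).
Proof.
move=> mF; apply: measurable_funB; apply: measurableT_comp; try exact: fine_measurable;
  apply: measurable_esum; try exact: measD.
- by move=> xi t; rewrite lee_fin funrpos_ge0.
- by move=> xi; apply/measurable_EFinP; apply: measurable_maxr.
- by move=> xi t; rewrite lee_fin funrneg_ge0.
- by move=> xi; apply/measurable_EFinP; apply: measurable_maxr => //; apply: measurableT_comp.
Qed.

Lemma measurable_dual (g h : R -> functional R 2) :
  (forall xi, measurable_fun D (fun t => g t (cos_wave xi)) /\ measurable_fun D (fun t => g t (sin_wave xi))) ->
  (forall xi, measurable_fun D (fun t => h t (cos_wave xi)) /\ measurable_fun D (fun t => h t (sin_wave xi))) ->
  measurable_fun D (fun t => dual (g t) (h t)).
Proof.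
move=> mg mh; apply: measurable_Zsum => xi; rewrite /fourier /=.
have [g1 g2] := mg xi; have [h1 h2] := mh (- xi).
by apply: measurable_funB; apply: measurable_funM => //; apply: measurableT_comp.
Qed.

Lemma force_meas k : time_measurable T (fun t => forcing t k).
Proof.
move=> phi tphi; have um j := u_meas uI j.
apply: measurable_funB; first apply: measurable_funD.
- exact: (f_meas f2).
- apply: measurable_sum => i; apply: measurableT_comp => //; apply: measurable_sum => j.
  apply: measurable_sum => l; apply: measurable_funM => //; apply: measurable_funM => //.
  by apply: measurable_funD; apply: measurableT_comp => //; apply: um; apply: test_partial; apply: test_partial.
apply: measurable_sum => j; apply: measurable_dual => xi.
  by split; apply: um; [exact: test_cos_wave|exact: test_sin_wave].
by split; apply: measurableT_comp => //; apply: um; apply: test_partial; apply: testM => //;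
  [exact: test_cos_wave|exact: test_sin_wave].
Qed.

Lemma v_meas k : time_measurable T (fun t => v t k).
Proof. by move=> phi tphi; have [_ /(_ phi tphi)[]] := vt k. Qed.

(* The gradient part of [v] vanishes since that of [u] does. *)
Lemma v_perp : aet T (fun t => forall xi, (\sum_k fr xi k * v t k (cos_wave xi) = 0 /\
  \sum_k fr xi k * v t k (sin_wave xi) = 0) /\ forall k, v t k (cos_wave 0) = 0).
Proof.
apply: aet_count => xi.
have h phi : phi = cos_wave xi \/ phi = sin_wave xi -> aet T (fun t => \sum_k fr xi k * v t k phi = 0).
  move=> hphi.
  have := primitiveD (primitiveZ (fr xi 0) (u_weak uw vt 0 hphi)) (primitiveZ (fr xi 1) (u_weak uw vt 1 hphi)).
  move=> /primitive_eq0 hz.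
  have : aet T (fun t => fr xi 0 * v t 0 phi + fr xi 1 * v t 1 phi = 0).
    apply: hz => t; rewrite inE /= in_itv /= => /andP[t0 tT].
    by have := u_coef_perp uw t0 tT hphi; rewrite sum2.
  by apply: aetS => t _ _; rewrite sum2.
have h0 k : aet T (fun t => v t k (cos_wave 0) = 0).
  apply: primitive_eq0 (u_weak uw vt k (or_introl erefl : cos_wave 0 = cos_wave 0 \/ _)) _ => t.
  by rewrite inE /= in_itv /= => /andP[t0 tT]; have [] := u_coef0 uw k t0 tT.
by apply: aet_and; [apply: aet_and; apply: h; [left|right]|apply: aet_all2].
Qed.

Lemma wnorm_fin s g t : (forall k, Hdot s (g t k)) -> wnorm s g t \is a fin_num.
Proof.
move=> h; rewrite ge0_fin_numE ?wnorm_ge0//.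
have hk l : (Hnorm2 s (g t l) < +oo)%E by case: (h l) => [[]].
apply: le_lt_trans (esum_ampl_le s (g t)) _.
by rewrite lte_mul_pinfty// lte_add_pinfty.
Qed.

Lemma ae_wnorm_fin s g : (forall k, time_measurable T (fun t => g t k)) ->
  (\int[mu]_(t in D) wnorm s g t < +oo)%E -> aet T (fun t => wnorm s g t \is a fin_num).
Proof.
move=> mg ig; have : mu.-integrable D (wnorm s g).
  apply/integrableP; split; first exact: measurable_wnorm.
  by under eq_integral do rewrite gee0_abs ?wnorm_ge0//.
move=> /(integrable_ae (measD 0 T)); rewrite /aet.
by apply: (@filterS _ _ (ae_filter_ringOfSetsType _)) => t h tI; apply: h.
Qed.

(** The bounds [M] and [B] are uniform in time; the norms one order higher are merely finite at each
    such time. *)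
Definition good (M B : R) t : Prop := [/\ slice a f u v M t, (wnorm r u t <= B%:E)%E,
  wnorm (r + 1) u t \is a fin_num, wnorm (r - 1) f t \is a fin_num &
  [/\ (wnorm (r - 2) f t <= B%:E)%E, (forall k, pdistr (convection (u t) k)),
  (forall k, forcing t k (cos_wave 0) = 0) & forall xi,
  (\sum_k fr xi k * v t k (cos_wave xi) = 0 /\ \sum_k fr xi k * v t k (sin_wave xi) = 0) /\
    forall k, v t k (cos_wave 0) = 0]].

Lemma ae_good : exists M B : R, [/\ 0 <= M, 0 <= B & aet T (good M B)].
Proof.
have [M M0 sl] := ae_slice f2 uI u2 uw vt mom; have [B B0 hB] := uRI.
have [_ _ [m0 h0]] := fI 0; have [_ _ [m1 h1]] := fI 1.
exists M, (B + 4 * (m0 ^+ 2 + m1 ^+ 2)); split=> //; first by nneg.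
have ff : aet T (fun t => forall k, Hdot (r - 1) (f t k)) by apply: aet_all2 => k; case: (f2 k).
have ufin := ae_wnorm_fin (u_meas uI) uR2.
apply: aetS (aet_and (aet_and (aet_and sl hB) (aet_and h0 h1)) (aet_and (aet_and ff ufin) v_perp)).
move=> t t0 tT [[[sl_t hBt] [f0 f1]] [[fft uf] vp]].
split=> //; first by apply: le_trans hBt _; rewrite lee_fin lerDl; nneg.
  exact: wnorm_fin.
split=> //.
- apply: le_trans (esum_ampl_le (r - 2) (f t)) _.
  apply: (@le_trans _ _ (4 * (m0 ^+ 2 + m1 ^+ 2))%:E); last by rewrite lee_fin lerDr.
  by rewrite (EFinM 4) (EFinD (m0 ^+ 2)); apply: lee_wpmul2l (leeD f0 f1).
- by move=> k; have [_ _ _ _ [[c [s [/(_ k) [[]]]]]]] := sl_t.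
(* At frequency $0$ the operator carries a vanishing factor, while the convection and [f] have zero
   mean as members of [Hdot]. *)
move=> k; have [pU _ _ _ [[c [s [/(_ k) hc _ _] _] _ _]]] := sl_t.
rewrite /forcing /force /addd /oppd Lop_cos// big1 => [|l _]; last by rewrite mxE mulr0 mul0r.
by have [-> _] := Hdot_coef0 hc; have [-> _] := Hdot_coef0 (fft k); rewrite subr0 addr0.
Qed.

(** By [v_perp] the coefficients of [v] are their own projections, hence those of the net force. The
    factor is $2$ from [lproj_bound] for each of two components. *)
Lemma ampl_v_le M B t xi : good M B t -> ampl (v t) xi <= 4 * ampl (forcing t) xi.
Proof.
move=> [[pU pW pF dU [mo _ _]] _ _ _ [_ _ _ vp]].
have [->|x0] := eqVneq xi 0.
  rewrite /ampl big1 ?mulr_ge0 ?ampl_ge0// => k _; rewrite (vp 0).2 pdistr_sin0//.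
  by rewrite normr0 addr0.
have [[cp sp] _] := vp xi.
have hc k : `|v t k (cos_wave xi)| <= 2 * (`|forcing t 0 (cos_wave xi)| + `|forcing t 1 (cos_wave xi)|).
  rewrite -(lproj_id k cp) (momentum_proj sym k pU pW pF mo x0).1.
  exact: (lproj_bound (fun l => forcing t l (cos_wave xi)) k x0).
have hs k : `|v t k (sin_wave xi)| <= 2 * (`|forcing t 0 (sin_wave xi)| + `|forcing t 1 (sin_wave xi)|).
  rewrite -(lproj_id k sp) (momentum_proj sym k pU pW pF mo x0).2.
  exact: (lproj_bound (fun l => forcing t l (sin_wave xi)) k x0).
rewrite {1}/ampl sum2; apply: le_trans (lerD (lerD (hc 0) (hs 0)) (lerD (hc 1) (hs 1))) _.
have E (p q p' q' : R) : 2 * (p + q) + 2 * (p' + q') + (2 * (p + q) + 2 * (p' + q')) = 4 * (p + p' + (q + q')).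
  by ring.
by rewrite E /ampl sum2 lexx.
Qed.

Lemma force_wnorm_inf : exists2 B : R, 0 <= B & aet T (fun t => (wnorm (r - 2) forcing t <= B%:E)%E).
Proof.
have [M [B [M0 B0 hg]]] := ae_good; have [K K0 hK] := ampl_force_sum a r0.
exists (K * (B + (1 + M) * B)); first by nneg.
apply: aetS hg => t t0 tT [[pU _ pF dU [_ Ub [b' Ub']]] hu _ _ [hf _ _ _]].
exact: (hK (u t) (f t) M b' B B).
Qed.

Lemma force_wnorm_bound : exists2 K : R, 0 <= K & aet T (fun t =>
  (wnorm (r - 1) forcing t <= K%:E * (wnorm (r - 1) f t + wnorm (r + 1) u t))%E).
Proof.
have [M [B [M0 B0 hg]]] := ae_good; have rr : 0 < r + 1 by rewrite addr_gt0.
have [K K0 hK] := ampl_force_sum a rr.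
exists (K * (1 + M)); first by nneg.
apply: aetS hg => t t0 tT [[pU _ pF dU [_ Ub [b' Ub']]] _ uf ff _].
have e : r + 1 - 2 = r - 1 by ring.
have := hK (u t) (f t) M b' (fine (wnorm (r + 1) u t)) (fine (wnorm (r - 1) f t)) pU dU Ub Ub'.
rewrite e !fineK// => /(_ (lexx _) (lexx _)) h; apply: le_trans h _.
rewrite -(fineK uf) -(fineK ff) -EFinD -EFinM lee_fin -[leRHS]mulrA ler_wpM2l//.
have p : 0 <= fine (wnorm (r - 1) f t) by rewrite fine_ge0// wnorm_ge0.
by rewrite mulrDr lerD2r mulrDl mul1r lerDl mulr_ge0.
Qed.

Lemma force_wnorm_L2 : (\int[mu]_(t in D) wnorm (r - 1) forcing t < +oo)%E.
Proof.
have [K K0 hK] := force_wnorm_bound.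
have mf := measurable_wnorm (r - 1) (f_meas f2); have mu' := measurable_wnorm (r + 1) (u_meas uI).
apply: (@le_lt_trans _ _ (\int[mu]_(t in D) (K%:E * (wnorm (r - 1) f t + wnorm (r + 1) u t)))%E).
  apply: ae_ge0_le_integral => //.
  - by move=> t _; exact: wnorm_ge0.
  - by apply: measurable_wnorm; exact: force_meas.
  - by move=> t _; rewrite mule_ge0 ?adde_ge0 ?wnorm_ge0.
  - by apply: measurable_funeM; exact: emeasurable_funD.
rewrite ge0_integralZl//; [|exact: emeasurable_funD|by move=> t _; rewrite adde_ge0 ?wnorm_ge0].
rewrite lte_mul_pinfty// ge0_integralD//; try by move=> t _; exact: wnorm_ge0.
by rewrite lte_add_pinfty// int_wnorm.
Qed.

Lemma wnorm_v_le M B s t : good M B t -> (wnorm s v t <= 16%:E * wnorm s forcing t)%E.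
Proof.
move=> g; rewrite /wnorm -esumZl//; last by move=> xi; rewrite lee_fin mulr_ge0 ?powR_ge0 ?sqr_ge0.
apply: le_esum => xi _; rewrite -EFinM lee_fin [leRHS]mulrCA ler_wpM2l ?powR_ge0//.
have -> : 16 * ampl (forcing t) xi ^+ 2 = (4 * ampl (forcing t) xi) ^+ 2 by ring.
by rewrite ler_sqr ?nnegrE ?mulr_ge0 ?ampl_ge0//; exact: ampl_v_le g.
Qed.

Lemma wave_hdot s (g : functional R 2) (b : \bar R) : pdistr g -> g (cos_wave 0) = 0 ->
  (Hnorm2 s g <= b)%E -> (b < +oo)%E -> Hdot s g.
Proof. by move=> pg g0 gb bf; split; [split=> //; exact: le_lt_trans bf|apply/fourier0P]. Qed.

Lemma v_div : aet T (fun t => div_free (v t)).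
Proof.
have [M [B [M0 B0 hg]]] := ae_good.
apply: aetS hg => t _ _ [[_ pW _ _ _] _ _ _ [_ _ _ vp]] phi tphi.
apply: pdistr_waves_eq0 => //; first by apply: pdistr_sumd => k; apply: pdistr_partiald.
- move=> xi; have [[_ sp] _] := vp xi; rewrite /divd /sumd.
  under eq_bigr do rewrite partiald_cos// -mulrA.
  by rewrite -mulr_sumr sp mulr0.
- move=> xi; have [[cp _] _] := vp xi; rewrite /divd /sumd.
  under eq_bigr do rewrite partiald_sin// -mulrA.
  by rewrite sumrN -mulr_sumr cp mulr0 oppr0.
Qed.

Lemma le_sqr_self (x : R) : 0 <= x -> x <= (1 + x) ^+ 2.
Proof. by move=> x0; nra. Qed.

Lemma v_Linf : Linf_vHdot_sigma T (r - 2) v.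
Proof.
split; last exact: v_div.
have [M [B [M0 B0 hg]]] := ae_good; have [B' B'0 hF] := force_wnorm_inf.
have hv k : aet T (fun t => [/\ pdistr (v t k), v t k (cos_wave 0) = 0 & (Hnorm2 (r - 2) (v t k) <= (16 * B')%:E)%E]).
  apply: aetS (aet_and hg hF) => t t0 tT [g hF']; have [[_ pW _ _ _] _ _ _ [_ _ _ vp]] := g.
  split=> //; first by have [_ ->] := vp 0.
  apply: le_trans (Hnorm2_ampl_le (r - 2) (v t) k) _; apply: le_trans (wnorm_v_le (r - 2) g) _.
  by rewrite (EFinM 16) lee_wpmul2l.
move=> k; split; first exact: v_meas.
  by apply: aetS (hv k) => t _ _ [p c h]; apply: wave_hdot p c h _; exact: ltry.
exists (1 + 16 * B'); apply: aetS (hv k) => t _ _ [_ _ h]; apply: le_trans h _.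
by rewrite lee_fin le_sqr_self// mulr_ge0.
Qed.

Lemma v_L2 : L2_vHdot_sigma T (r - 1) v.
Proof.
split; last exact: v_div.
have [M [B [M0 B0 hg]]] := ae_good.
have ffin := ae_wnorm_fin force_meas force_wnorm_L2.
have hv : aet T (fun t => (wnorm (r - 1) v t <= 16%:E * wnorm (r - 1) forcing t)%E).
  by apply: aetS hg => t _ _ g; exact: wnorm_v_le g.
move=> k; split; first exact: v_meas.
  apply: aetS (aet_and hg (aet_and ffin hv)) => t _ _ [[[_ pW _ _ _] _ _ _ [_ _ _ vp]] [ff h]].
  apply: (@wave_hdot _ _ (16%:E * wnorm (r - 1) forcing t)%E) => //; first by have [_ ->] := vp 0.
    exact: le_trans (Hnorm2_ampl_le (r - 1) (v t) k) h.
  by rewrite lte_mul_pinfty// -ge0_fin_numE ?wnorm_ge0.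
apply: wnorm_L2; first exact: v_meas.
apply: (@le_lt_trans _ _ (\int[mu]_(t in D) (16%:E * wnorm (r - 1) forcing t))%E).
  apply: ae_ge0_le_integral => //.
  - by move=> t _; exact: wnorm_ge0.
  - by apply: measurable_wnorm; exact: v_meas.
  - by move=> t _; rewrite mule_ge0 ?wnorm_ge0.
  - by apply: measurable_funeM; apply: measurable_wnorm; exact: force_meas.
rewrite ge0_integralZl//; [|by apply: measurable_wnorm; exact: force_meas|by move=> t _; exact: wnorm_ge0].
by rewrite lte_mul_pinfty// force_wnorm_L2.
Qed.

Lemma integrable_wnorm s g : (forall k, time_measurable T (fun t => g t k)) ->
  (\int[mu]_(t in D) wnorm s g t < +oo)%E -> mu.-integrable D (EFin \o (fun t => 1 + fine (wnorm s g t))).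
Proof.
move=> mg ig; have mf : measurable_fun D (fun t => fine (wnorm s g t)).
  by apply: measurableT_comp; [exact: fine_measurable|exact: measurable_wnorm].
apply: integrable_addr => //; first exact: integrable_cstD.
apply/integrableP; split; first exact/measurable_EFinP.
apply: le_lt_trans ig; apply: ge0_le_integral => //.
- by apply: measurableT_comp => //; exact/measurable_EFinP.
- exact: measurable_wnorm.
- move=> t _; rewrite /= ger0_norm; last by rewrite fine_ge0// wnorm_ge0.
  by rewrite fine_le_self// wnorm_ge0.
Qed.

Lemma ampl_pointwise s (g : R -> vfunctional R 2) t (b : R) xi : 0 <= b -> (wnorm s g t <= b%:E)%E ->
  ampl (g t) xi <= (1 + b) * rho xi `^ (- s).
Proof.
move=> b0 h; have p0 : 0 < rho xi `^ s by rewrite powR_gt0 ?rho_gt0.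
rewrite powRN ler_pdivlMr// mulrC.
have h1 : (rho xi `^ s * ampl (g t) xi) ^+ 2 <= b.
  rewrite exprMn powR_sqr -lee_fin; apply: le_trans h.
  apply: (@esum_ge1 R Z (fun xi => (rho xi `^ (2 * s) * ampl (g t) xi ^+ 2)%:E) xi) => eta.
  by rewrite lee_fin mulr_ge0 ?powR_ge0 ?sqr_ge0.
rewrite -ler_sqr ?nnegrE ?mulr_ge0 ?powR_ge0 ?ampl_ge0 ?addr_ge0//.
exact: le_trans h1 (le_sqr_self b0).
Qed.

Lemma powR_rho_le s xi n : s <= n%:R -> rho xi `^ s <= rho xi ^+ n.
Proof. by move=> h; rewrite -powR_mulrn ?rho_ge0// ler_powR ?rho_ge1. Qed.

Lemma ampl_pointwise_fine s g t xi : wnorm s g t \is a fin_num -> -1 <= s ->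
  ampl (g t) xi <= (1 + fine (wnorm s g t)) * rho xi.
Proof.
move=> fw s1; have w0 : 0 <= fine (wnorm s g t) by rewrite fine_ge0// wnorm_ge0.
apply: le_trans (ampl_pointwise xi w0 _) _; first by rewrite fineK.
by rewrite ler_wpM2l ?addr_ge0// -[leRHS]expr1; apply: powR_rho_le; rewrite lerNl.
Qed.

(** By [pdistr_bound] the value on [phi] is at most a constant times [B t], so integrability of the
    coefficient bound is enough. *)
Lemma int_test (g : R -> functional R 2) (B : R -> R) phi : time_measurable T g ->
  mu.-integrable D (EFin \o B) -> test phi ->
  aet T (fun t => pdistr (g t) /\ forall xi, `|g t (cos_wave xi)| <= B t * rho xi /\ `|g t (sin_wave xi)| <= B t * rho xi) ->
  mu.-integrable D (EFin \o (fun t => g t phi)).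
Proof.
move=> mg iB tphi hg; have [M HM] := test_Cm_bound 4 tphi.
have mgp : measurable_fun D (EFin \o (fun t => g t phi)) by apply/measurable_EFinP; exact: mg.
apply/integrableP; split=> //.
have /integrableP[mC iC] := integrable_mulrl (decay_const R * M) (measD 0 T) iB.
apply: le_lt_trans iC; apply: ae_ge0_le_integral => //.
- exact: measurableT_comp.
- exact: measurableT_comp.
apply: (aet_sub (@subset_refl _ _) (aetS _ hg)) => t t0 tT [pg hb].
rewrite /= lee_fin; apply: le_trans (ler_norm _).
rewrite mulrAC; apply: pdistr_bound HM => // xi; by have [] := hb xi.
Qed.

Lemma force_dist M B t k : good M B t -> pdistr (forcing t k).
Proof.
move=> [[pU _ pF _ _] _ _ _ [_ pc _ _]].
by apply: pdistr_addd; [apply: pdistr_addd; [exact: pF|exact: pdistr_Lop]|exact: pdistr_oppd].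
Qed.

(* The Fourier coefficients of the solution [p] of the Poisson equation
   [Delta p = div G]; at [xi = 0] both are [x / 0 = 0]. *)
Definition pot_cos (G : vfunctional R 2) xi : R := - (\sum_k fr xi k * G k (sin_wave xi)) / (2 * pi * freq2 R xi).
Definition pot_sin (G : vfunctional R 2) xi : R := (\sum_k fr xi k * G k (cos_wave xi)) / (2 * pi * freq2 R xi).

Definition pcos t xi : R := pot_cos (forcing t) xi.
Definition psin t xi : R := pot_sin (forcing t) xi.

Definition pres t : functional R 2 := dist_of (pcos t) (psin t).

Lemma freq2N eta : freq2 R (- eta) = freq2 R eta.
Proof. by rewrite !freq2E !mxE !rmorphN !sqrrN. Qed.

Lemma pot_cosN (G : vfunctional R 2) eta : (forall k, pdistr (G k)) -> pot_cos G (- eta) = pot_cos G eta.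
Proof.
move=> pG; rewrite /pot_cos freq2N; congr (- _ / _); apply: eq_bigr => k _.
by rewrite (pdistr_sinN _ (pG k)) !mxE rmorphN mulrNN.
Qed.

Lemma pot_sinN (G : vfunctional R 2) eta : pot_sin G (- eta) = - pot_sin G eta.
Proof.
rewrite /pot_sin freq2N -mulNr -sumrN; congr (_ / _); apply: eq_bigr => k _.
by rewrite cos_waveN !mxE rmorphN mulNr.
Qed.

(** The inverse gradient has order $-1$: the numerator is at most of order $\varrho$, and
    [freq2_rho] bounds the denominator below by a multiple of $\varrho^2$. *)
Lemma inv_grad_bound xi (x : 'I_2 -> R) (A : R) : `|x 0| + `|x 1| <= A ->
  `|(\sum_k fr xi k * x k) / (2 * pi * freq2 R xi)| <= 2 * ((rho xi)^-1 * A).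
Proof.
move=> hA; have A0 : 0 <= A by apply: le_trans hA; rewrite addr_ge0.
have p0 := pi_gt0 R; have r0' := rho_gt0 R xi.
have [->|x0] := eqVneq xi 0.
  by rewrite big1 ?mul0r ?normr0 ?mulr_ge0 ?invr_ge0 ?rho_ge0// => k _; rewrite mxE mul0r.
have f0 := freq2_gt0 R x0.
have d0 : 0 < 2 * pi * freq2 R xi by rewrite !mulr_gt0.
rewrite normrM normfV (gtr0_norm d0) ler_pdivrMr//.
apply: (@le_trans _ _ ((2 * pi)^-1 * rho xi * A)).
  have h k : `|fr xi k| <= (2 * pi)^-1 * rho xi by rewrite ler_pdivlMl ?mulr_gt0// rho_coord.
  rewrite sum2; apply: le_trans (ler_normD _ _) _; rewrite !normrM.
  apply: (@le_trans _ _ ((2 * pi)^-1 * rho xi * (`|x 0| + `|x 1|))).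
    by rewrite mulrDr lerD// ler_wpM2r.
  by rewrite ler_wpM2l// mulr_ge0 ?invr_ge0 ?mulr_ge0 ?(ltW p0) ?(ltW r0').
have E1 (p q b s : R) : p != 0 -> q != 0 -> 2 * (q^-1 * b) * (2 * p * s) = (2 * p)^-1 * (q^-1 * b) * (8 * p ^+ 2 * s).
  by move=> hp hq; field; rewrite ?hp ?hq.
have E2 (p q b : R) : p != 0 -> q != 0 -> (2 * p)^-1 * q * b = (2 * p)^-1 * (q^-1 * b) * q ^+ 2.
  by move=> hp hq; field; rewrite ?hp ?hq.
rewrite E1 ?gt_eqF// E2 ?gt_eqF//.
by rewrite ler_wpM2l ?freq2_rho// !mulr_ge0 ?invr_ge0 ?mulr_ge0 ?(ltW p0) ?(ltW r0').
Qed.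

Lemma pcoef_bound t xi : `|pcos t xi| <= 2 * ((rho xi)^-1 * ampl (forcing t) xi) /\
  `|psin t xi| <= 2 * ((rho xi)^-1 * ampl (forcing t) xi).
Proof.
split.
  rewrite /pcos /pot_cos mulNr normrN; apply: (@inv_grad_bound xi (fun k => forcing t k (sin_wave xi))).
  by rewrite /ampl sum2; apply: lerD; rewrite lerDr.
apply: (@inv_grad_bound xi (fun k => forcing t k (cos_wave xi))).
by rewrite /ampl sum2; apply: lerD; rewrite lerDl.
Qed.

Lemma pres_meas : time_measurable T pres.
Proof.
move=> phi tphi; apply: measurable_Zsum => xi.
have ms psi : test psi -> measurable_fun D (fun t => \sum_k fr xi k * forcing t k psi).
  by move=> tpsi; apply: measurable_sum => k; apply: measurable_funM => //; exact: force_meas.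
apply: measurable_funD; apply: measurable_funM => //; apply: measurable_funM => //.
  by apply: measurableT_comp => //; apply: ms; exact: test_sin_wave.
by apply: ms; exact: test_cos_wave.
Qed.

Definition tame (B : R) t : Prop := [/\ pdistr (pres t),
  forall xi, pres t (cos_wave xi) = pcos t xi /\ pres t (sin_wave xi) = psin t xi &
  forall xi, `|pcos t xi| <= B * rho xi /\ `|psin t xi| <= B * rho xi].

Lemma ae_tame : exists2 B : R, 0 <= B & aet T (tame B).
Proof.
have [M [B [M0 B0 hg]]] := ae_good; have [B' B'0 hF] := force_wnorm_inf.
exists (2 * (1 + B')); first by nneg.
apply: aetS (aet_and hg hF) => t t0 tT [g hw].
have pb xi : `|pcos t xi| <= 2 * (1 + B') * rho xi /\ `|psin t xi| <= 2 * (1 + B') * rho xi.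
  (* A force bounded in $H^{r-2}$ has coefficients of growth at most $\varrho^{2-r}\le\varrho^2$.
     Inverting the gradient leaves the growth $\varrho$ that [dist_of] can sum. *)
  have h : (rho xi)^-1 * ampl (forcing t) xi <= (1 + B') * rho xi.
    rewrite ler_pdivrMl ?rho_gt0// mulrCA -expr2.
    apply: le_trans (ampl_pointwise xi B'0 hw) _; rewrite ler_wpM2l ?addr_ge0//.
    by apply: powR_rho_le; rewrite opprB lerBlDr lerDl ltW.
  have [h1 h2] := pcoef_bound t xi; rewrite -!mulrA.
  by split; [apply: le_trans h1 _|apply: le_trans h2 _]; rewrite ler_wpM2l.
split=> //; first by apply: (@pdistr_dist_of _ _ _ (2 * (1 + B'))) => xi; have [] := pb xi.
have pcN eta : pcos t (- eta) = pcos t eta := pot_cosN eta (fun k => force_dist k g).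
have psN eta : psin t (- eta) = - psin t eta := pot_sinN (forcing t) eta.
by move=> xi; split; [exact: dist_of_cos|exact: dist_of_sin].
Qed.

Lemma Hnorm2_pres_le B s t : tame B t -> (Hnorm2 s (pres t) <= 8%:E * wnorm (s - 1) forcing t)%E.
Proof.
move=> [_ e _]; rewrite Hnorm2E /wnorm -esumZl//; last by move=> xi; rewrite lee_fin mulr_ge0 ?powR_ge0 ?sqr_ge0.
apply: le_esum => xi _; rewrite -EFinM lee_fin powR_rho_sub.
have [h1 h2] := pcoef_bound t xi; have [e1 e2] := e xi.
rewrite /amp2 e1 e2 -(real_normK (num_real (pcos t xi))) -(real_normK (num_real (psin t xi))).
apply: (@le_trans _ _ (rho xi `^ (2 * s) * (8 * (rho xi ^- 2 * ampl (forcing t) xi ^+ 2)))); last first.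
  by rewrite le_eqVlt; apply/orP; left; apply/eqP; ring.
rewrite ler_wpM2l ?powR_ge0//.
have b0 : 0 <= 2 * ((rho xi)^-1 * ampl (forcing t) xi) by rewrite !mulr_ge0 ?invr_ge0 ?rho_ge0 ?ampl_ge0.
rewrite (_ : 8 * _ = (2 * ((rho xi)^-1 * ampl (forcing t) xi)) ^+ 2 + (2 * ((rho xi)^-1 * ampl (forcing t) xi)) ^+ 2).
  by rewrite lerD// ler_sqr ?nnegrE.
by rewrite -exprVn; ring.
Qed.

Lemma pres_Linf : Linf_Hdot T (r - 1) pres.
Proof.
have [B B0 hB] := ae_tame; have [B' B'0 hF] := force_wnorm_inf.
have hp : aet T (fun t => [/\ pdistr (pres t), pres t (cos_wave 0) = 0 & (Hnorm2 (r - 1) (pres t) <= (8 * B')%:E)%E]).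
  apply: aetS (aet_and hB hF) => t _ _ [tm hw]; have [pp e _] := tm; split=> //.
    by rewrite (e 0).1 /pcos /pot_cos big1 ?oppr0 ?mul0r// => k _; rewrite mxE mul0r.
  apply: le_trans (Hnorm2_pres_le (r - 1) tm) _; rewrite (_ : r - 1 - 1 = r - 2); last by ring.
  by rewrite (EFinM 8) lee_wpmul2l.
split; first exact: pres_meas.
  by apply: aetS hp => t _ _ [p c h]; apply: wave_hdot p c h _; exact: ltry.
exists (1 + 8 * B'); apply: aetS hp => t _ _ [_ _ h]; apply: le_trans h _.
by rewrite lee_fin le_sqr_self// mulr_ge0.
Qed.

Lemma pres_L2 : L2_Hdot T r pres.
Proof.
have [B B0 hB] := ae_tame; have ffin := ae_wnorm_fin force_meas force_wnorm_L2.
have mF := measurable_wnorm (r - 1) force_meas.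
split; first exact: pres_meas.
  apply: aetS (aet_and hB ffin) => t _ _ [tm hw]; have [pp e _] := tm.
  apply: wave_hdot pp _ (Hnorm2_pres_le r tm) _.
    by rewrite (e 0).1 /pcos /pot_cos big1 ?oppr0 ?mul0r// => k _; rewrite mxE mul0r.
  by rewrite lte_mul_pinfty// -ge0_fin_numE ?wnorm_ge0.
apply: (@le_lt_trans _ _ (\int[mu]_(t in D) (8%:E * wnorm (r - 1) forcing t))%E).
  apply: ae_ge0_le_integral => //.
  - by move=> t _; exact: Hnorm2_ge0.
  - by apply: measurable_Hnorm2; exact: pres_meas.
  - by move=> t _; rewrite mule_ge0 ?wnorm_ge0.
  - exact: measurable_funeM.
  - by apply: (aet_sub (@subset_refl _ _) (aetS _ hB)) => t _ _ /Hnorm2_pres_le.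
rewrite ge0_integralZl//; last by move=> t _; exact: wnorm_ge0.
by rewrite lte_mul_pinfty// force_wnorm_L2.
Qed.

End Regularity.

(** * The gradient part of the net force *)

Section PressureBalance.
Variable R : realType.
Local Notation Z := 'rV[int]_2.
Local Notation fr xi j := ((xi 0 j)%:~R : R).

(** On each nonzero mode $\partial_kp$ is the complement of the Leray projection of [G]; at
    frequency $0$ all terms vanish. Agreement on waves gives agreement on all test functions. *)
Lemma gradient_part (V G : vfunctional R 2) (p : functional R 2) k phi :
  (forall k, pdistr (V k)) -> (forall k, pdistr (G k)) -> pdistr p ->
  (forall xi, p (cos_wave xi) = pot_cos G xi /\ p (sin_wave xi) = pot_sin G xi) ->
  (forall k, V k (cos_wave 0) = 0) -> (forall k, G k (cos_wave 0) = 0) ->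
  (forall xi k, xi != 0 -> V k (cos_wave xi) = lproj xi (fun l => G l (cos_wave xi)) k /\
    V k (sin_wave xi) = lproj xi (fun l => G l (sin_wave xi)) k) ->
  test phi -> V k phi + partiald k p phi = G k phi.
Proof.
move=> pV pG pp ep V0 G0 VG tphi.
have pd := pdistr_addd (pV k) (pdistr_addd (pdistr_partiald k pp) (pdistr_oppd (pG k))).
have p0 : pi != 0 :> R by rewrite gt_eqF ?pi_gt0.
have E (c q y S : R) : c != 0 -> q != 0 -> 2 * c * y * (S / (2 * c * q)) = y / q * S.
  by move=> hp hq; field; rewrite ?hp ?hq.
have {pd} : addd (V k) (addd (partiald k p) (oppd (G k))) phi = 0.
  apply: pdistr_waves_eq0 => // xi; rewrite /addd /oppd.
    rewrite partiald_cos//; have [->|x0] := eqVneq xi 0.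
      by rewrite V0 G0 !mxE mulr0 mul0r subr0 addr0.
    have f0 : freq2 R xi != 0 by rewrite gt_eqF ?freq2_gt0.
    rewrite (VG xi k x0).1 (ep xi).2 /pot_sin /lproj.
    by rewrite E//; ring.
  rewrite partiald_sin//; have [->|x0] := eqVneq xi 0.
    by rewrite !pdistr_sin0// !mxE mulr0 mul0r !oppr0 !addr0.
  have f0 : freq2 R xi != 0 by rewrite gt_eqF ?freq2_gt0.
  rewrite (VG xi k x0).2 (ep xi).1 /pot_cos /lproj.
  by rewrite mulNr mulrN opprK E//; ring.
by rewrite /addd /oppd addrA => /eqP; rewrite subr_eq0 => /eqP.
Qed.

End PressureBalance.

Section TimeTest.
Variables (R : realType).
Local Notation mu := (@lebesgue_measure R).

Lemma time_test_continuous (T : R) psi : time_test T psi -> continuous psi.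
Proof. by move=> [a [b [_ _ [d _]]]] t; apply: differentiable_continuous; apply/derivable1_diffP; exact: (d 0%N t). Qed.

Lemma time_test_mul_integrable T psi (g : R -> R) : time_test T psi ->
  mu.-integrable `]0, T[ (EFin \o g) -> mu.-integrable `]0, T[ (EFin \o (fun t => psi t * g t)).
Proof.
move=> tpsi ig; have cpsi := time_test_continuous tpsi.
have mD : measurable (`]0, T[%classic : set (measurableTypeR R)) by exact: measurable_itv.
have mpsi : measurable_fun (`]0, T[%classic : set (measurableTypeR R)) psi.
  by apply: measurable_funTS; exact: continuous_measurable_fun.
have [M HM] : exists M : R, forall t, `[0, T]%classic t -> `|psi t| <= M.
  have := @compact_bounded _ R^o _ (@continuous_compact _ _ psi `[0, T]%classic (@continuous_subspaceT _ _ _ _ cpsi) (@segment_compact R 0 T)).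
  move=> [M [_ HM]]; exists (M + 1) => t tI.
  by apply: (HM (M + 1)); [rewrite ltrDl|exists t].
have /(integrable_mulrl M mD) iM : mu.-integrable `]0, T[ (EFin \o (fun t => `|g t|)).
  exact: integrable_norm.
apply: le_integrable iM => //.
  apply/measurable_EFinP; apply: measurable_funM => //.
  by have /integrableP[/measurable_EFinP] := ig.
move=> t /= tI; rewrite lee_fin normrM; apply: le_trans (ler_norm _); rewrite ler_wpM2r//.
by apply: HM; move: tI; rewrite /= !in_itv /= => /andP[/ltW -> /ltW ->].
Qed.

End TimeTest.

Section TimeTestDerivatives.
Variables (R : realType).

Lemma time_test_derive_off (a b : R) psi m t : time_test_on a b psi -> ~~ (a <= t <= b) -> derive1n m psi t = 0.
Proof.
move=> h; elim: m t => [|m IH] t tn.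
  by apply/eqP; apply: contraNT tn; exact: h.2.
have U : \forall s \near t, derive1n m psi s = (cst 0 : R -> R) s.
  have oC : open (~` `[a, b]%classic : set R) by apply: closed_openC; exact: interval_closed.
  have tC : (~` `[a, b]%classic : set R) t by rewrite /= in_itv; exact/negP.
  apply: filterS (open_nbhs_nbhs (conj oC tC)) => s; rewrite /= in_itv => /negP; exact: IH.
by rewrite derive1nS derive1E (near_eq_derive _ U) ?oner_eq0// derive_cst.
Qed.

Lemma time_test_derive_bound (a b : R) psi m : time_test_on a b psi ->
  exists M : R, forall i t, (i <= m)%N -> `|derive1n i psi t| <= M.
Proof.
move=> h.
have one i : exists M : R, forall t, `|derive1n i psi t| <= M.
  have c : continuous (derive1n i psi).
    by move=> t; apply: differentiable_continuous; apply/derivable1_diffP; exact: h.1.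
  have := @compact_bounded _ R^o _ (@continuous_compact _ _ _ `[a, b]%classic (@continuous_subspaceT _ _ _ _ c) (@segment_compact R a b)).
  move=> [M [_ HM]]; exists `|M + 1| => t.
  have [tI|tn] := boolP (a <= t <= b); last by rewrite (time_test_derive_off i h tn) normr0.
  apply: le_trans (ler_norm _); apply: (HM (M + 1)); first by rewrite ltrDl.
  by exists t => //; rewrite /= in_itv.
elim: m => [|m [M HM]]; first by have [M HM] := one 0%N; exists M => i t; rewrite leqn0 => /eqP ->.
have [M' HM'] := one m.+1; exists (Num.max M M') => i t.
by rewrite leq_eqVlt le_max => /orP[/eqP ->|]; [rewrite HM' orbT|rewrite ltnS => /HM ->].
Qed.

End TimeTestDerivatives.

Section IntegralIdentities.
Variables (R : realType) (T : R).
Local Notation mu := (@lebesgue_measure R).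
Local Notation D := (`]0, T[%classic : set (measurableTypeR R)).

Lemma ae_eq_Rintegral (g h : R -> R) : measurable_fun D g -> measurable_fun D h ->
  aet T (fun t => g t = h t) -> \int[mu]_(t in D) g t = \int[mu]_(t in D) h t.
Proof.
move=> mg mh e; congr fine; apply: ae_eq_integral; try exact/measurable_EFinP.
  exact: measurable_itv.
by apply: (aet_sub (@subset_refl _ _)); apply: aetS e => t _ _ ->.
Qed.

Lemma Rintegral_balance (F L C P : R -> R) :
  mu.-integrable D (EFin \o F) -> mu.-integrable D (EFin \o L) ->
  mu.-integrable D (EFin \o C) -> mu.-integrable D (EFin \o P) ->
  \int[mu]_(t in D) (F t + L t - C t + P t) - \int[mu]_(t in D) L t
    - \int[mu]_(t in D) P t + \int[mu]_(t in D) C t = \int[mu]_(t in D) F t.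
Proof.
have mD : measurable D by exact: measurable_itv.
move=> iF iL iC iP; have iFL := integrable_addr mD iF iL; have iFLC := integrable_subr mD iFL iC.
by rewrite (RintegralD mD iFLC iP) (RintegralB mD iFL iC) (RintegralD mD iF iL); ring.
Qed.

End IntegralIdentities.

(** A wave of nonzero frequency is a nonzero multiple of a partial derivative of its partner, so
    only the constant wave remains, and it is excluded by the zero mean. *)
Lemma gradient_free_eq0 (R : realType) (G : functional R 2) phi : pdistr G ->
  (forall k chi, test chi -> G (partial k chi) = 0) -> G (fun=> 1) = 0 -> test phi -> G phi = 0.
Proof.
move=> pG dG G1 tphi; have pi0 : pi != 0 :> R by rewrite gt_eqF ?pi_gt0.
have nz (xi : 'rV[int]_2) : xi != 0 -> exists k : 'I_2, (xi 0 k)%:~R != 0 :> R.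
  move=> x0; apply/existsP; apply: contraNT x0; rewrite negb_exists => /forallP h.
  by apply/eqP/rowP => j; rewrite mxE; have := h j; rewrite negbK intr_eq0 => /eqP.
apply: pdistr_waves_eq0 => // xi; have [->|x0] := eqVneq xi 0.
- by rewrite cos_wave0.
- have [k k0] := nz xi x0; have := partiald_sin k xi pG.
  rewrite /partiald dG ?oppr0; last exact: test_sin_wave.
  by move=> /esym/eqP; rewrite oppr_eq0 !mulf_eq0 pnatr_eq0 (negbTE pi0) (negbTE k0) /= => /eqP.
- exact: pdistr_sin0.
have [k k0] := nz xi x0; have := partiald_cos k xi pG.
rewrite /partiald dG ?oppr0; last exact: test_cos_wave.
by move=> /esym/eqP; rewrite !mulf_eq0 pnatr_eq0 (negbTE pi0) (negbTE k0) /= => /eqP.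
Qed.

(** * Existence and uniqueness of the associated pressure *)

Section AssociatedPressure.
Variables (R : realType) (T r : R) (a : tensor R 2) (f u v : R -> vfunctional R 2).
Local Notation mu := (@lebesgue_measure R).
Local Notation Z := 'rV[int]_2.
Local Notation rho := (@rho R 2).
Local Notation fr xi j := ((xi 0 j)%:~R : R).
Local Notation D := (`]0, T[%classic : set (measurableTypeR R)).
Hypotheses (T0 : 0 < T) (r0 : 0 < r) (sym : tensor_symmetric a).
Hypotheses (fI : Linf_vHdot T (r - 2) f) (f2 : L2_vHdot T (r - 1) f).
Hypotheses (uI : Linf_vHdot_sigma T 0 u) (u2 : L2_vHdot_sigma T 1 u) (uw : weakly_continuous T u).
Hypotheses (vt : time_derivative T u v) (mom : aet T (fun t => momentum a (u t) (v t) (f t))).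
Hypotheses (uRI : exists2 B : R, 0 <= B & aet T (fun t => (wnorm r u t <= B%:E)%E)).
Hypotheses (uR2 : (\int[mu]_(s in D) wnorm (r + 1) u s < +oo)%E).
Local Notation Fo := (forcing a f u).
Local Notation pres := (pres a f u).
Local Notation good := (good r a f u v).
Local Notation tame := (tame a f u).

Let ag := ae_good fI f2 uI u2 uw vt mom uRI uR2.
Let at_ := ae_tame r0 fI f2 uI u2 uw vt mom uRI uR2.

Lemma rm1 : -1 <= r - 1.
Proof. by rewrite -[leLHS]add0r lerD2r ltW. Qed.

Lemma f_int k phi : test phi -> mu.-integrable D (EFin \o (fun t => f t k phi)).
Proof.
move=> tphi; have [M [B [M0 B0 hg]]] := ag.
apply: (int_test (f_meas f2 k) (integrable_wnorm (f_meas f2) (int_wnorm f2)) tphi).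
apply: aetS hg => t _ _ [[_ _ pF _ _] _ _ ff _]; split=> // xi; have := ampl_pointwise_fine xi ff rm1.
by move=> h; split; apply: le_trans h; [exact: ampl_cos|exact: ampl_sin].
Qed.

Lemma force_int k phi : test phi -> mu.-integrable D (EFin \o (fun t => Fo t k phi)).
Proof.
move=> tphi; have [M [B [M0 B0 hg]]] := ag.
have mF := force_meas a f2 uI; have iF := force_wnorm_L2 r0 fI f2 uI u2 uw vt mom uRI uR2.
apply: (int_test (mF k) (integrable_wnorm mF iF) tphi).
apply: aetS (aet_and hg (ae_wnorm_fin mF iF)) => t _ _ [g ff].
split; first exact: (force_dist k g).
move=> xi; have := ampl_pointwise_fine xi ff rm1.
by move=> h; split; apply: le_trans h; [exact: ampl_cos|exact: ampl_sin].
Qed.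

Lemma pres_int phi : test phi -> mu.-integrable D (EFin \o (fun t => pres t phi)).
Proof.
move=> tphi; have [B B0 hB] := at_.
apply: (int_test (pres_meas a f2 uI) (integrable_cstD T B) tphi).
by apply: aetS hB => t _ _ [pp e b]; split=> // xi; have [-> ->] := e xi.
Qed.

Lemma Lop_meas k : time_measurable T (fun t => Lop a (u t) k).
Proof.
move=> phi tphi; have um j := u_meas uI j.
apply: measurable_sum => i; apply: measurableT_comp => //; apply: measurable_sum => j.
apply: measurable_sum => l; apply: measurable_funM => //; apply: measurable_funM => //.
by apply: measurable_funD; apply: measurableT_comp => //; apply: um; apply: test_partial; apply: test_partial.
Qed.

Lemma Lop_int k phi : test phi -> mu.-integrable D (EFin \o (fun t => Lop a (u t) k phi)).
Proof.
move=> tphi; have [M [B [M0 B0 hg]]] := ag; have [C C0 HC] := Lop_bound a.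
have u2' := u2.1; have mu' := u_meas uI; have iu := int_wnorm u2'.
have iB := integrable_mulrl C (measD 0 T) (integrable_wnorm mu' iu).
apply: (int_test (Lop_meas k) iB tphi).
apply: aetS (aet_and hg (ae_wnorm_fin mu' iu)) => t _ _ [[[pU _ _ _ _] _ _ _ _] fw].
split; first exact: pdistr_Lop.
move=> xi; have w0 : 0 <= fine (wnorm 1 u t) by rewrite fine_ge0// wnorm_ge0.
have h : C * (rho xi ^+ 2 * ampl (u t) xi) <= C * (1 + fine (wnorm 1 u t)) * rho xi.
  rewrite -mulrA ler_wpM2l//.
  have := ampl_pointwise (s := 1) (g := u) (t := t) xi w0; rewrite fineK// => /(_ (lexx _)).
  rewrite powRN powRr1 ?rho_ge0// => h.
  apply: le_trans (ler_wpM2l (sqr_ge0 (rho xi)) h) _.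
  by rewrite mulrCA expr2 mulfK// gt_eqF ?rho_gt0.
have [h1 h2] := HC (u t) k xi pU; split; [exact: (le_trans h1 h)|exact: (le_trans h2 h)].
Qed.

(** Recovered as the difference between [f] plus the viscous term and the net force, all three
    already known to be integrable. *)
Lemma convection_int k phi : test phi -> mu.-integrable D (EFin \o (fun t => convection (u t) k phi)).
Proof.
move=> tphi; have := integrable_subr (measD 0 T) (integrable_addr (measD 0 T) (f_int k tphi) (Lop_int k tphi)) (force_int k tphi).
apply: eq_integrable; first exact: measD.
move=> t _ /=; congr EFin; rewrite /forcing /force /addd /oppd.
by move: (f t k phi) (Lop _ _ _ _) (convection _ _ _) => x y z; ring.
Qed.

Lemma v_eq k phi : test phi -> aet T (fun t => v t k phi = Fo t k phi + pres t (partial k phi)).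
Proof.
move=> tphi; have [M [B [M0 B0 hg]]] := ag; have [B' B'0 hB] := at_.
apply: aetS (aet_and hg hB) => t _ _ [g [pp ep _]].
have [[pU pW pF dU [mo _ _]] _ _ _ [_ _ Fo0 vp]] := g.
have := @gradient_part R (v t) (Fo t) (pres t) k phi pW (fun k => force_dist k g) pp ep (vp 0).2 Fo0.
move=> /(_ _ tphi) <-; first by rewrite /partiald addrNK.
move=> xi l x0; have [[cp sp] _] := vp xi.
have [h1 h2] := momentum_proj sym l pU pW pF mo x0.
by split; [exact: (etrans (esym (lproj_id l cp)) h1)|exact: (etrans (esym (lproj_id l sp)) h2)].
Qed.

Lemma momentum_identity k psi phi : time_test T psi -> test phi ->
  st_dt (st_of T (fun t => u t k)) psi phi - st_of T (fun t => Lop a (u t) k) psi phi +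
  - st_of T pres psi (partial k phi) + st_of T (fun t => convection (u t) k) psi phi =
  st_of T (fun t => f t k) psi phi.
Proof.
move=> tpsi tphi; have [_ lv ->//] := vt k.
have tp := test_partial k tphi.
have im (g : R -> R) (ig : mu.-integrable D (EFin \o g)) := time_test_mul_integrable tpsi ig.
rewrite /st_of -(Rintegral_balance (im _ (f_int k tphi)) (im _ (Lop_int k tphi))
  (im _ (convection_int k tphi)) (im _ (pres_int tp))).
congr (_ - _ - _ + _); apply: ae_eq_Rintegral.
- apply: measurable_funM; last by have [] := lv _ tphi.
  by apply: measurable_funTS; apply: continuous_measurable_fun; exact: time_test_continuous tpsi.
- have mi (g : R -> R) : mu.-integrable D (EFin \o g) -> measurable_fun D g.
    by move=> /integrableP[/measurable_EFinP].
  apply: measurable_funD; last exact: (mi _ (im _ (pres_int tp))).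
  apply: measurable_funB; last exact: (mi _ (im _ (convection_int k tphi))).
  apply: measurable_funD; first exact: (mi _ (im _ (f_int k tphi))).
  exact: (mi _ (im _ (Lop_int k tphi))).
apply: aetS (v_eq k tphi) => t _ _ ->; rewrite /forcing /force /addd /oppd.
by move: (f t k phi) (Lop _ _ _ _) (convection _ _ _) (pres _ _) (psi t) => x y z w q; ring.
Qed.

Lemma pres_stdistr : stdistr T (st_of T pres).
Proof.
have [B B0 hB] := at_.
have im psi phi (tpsi : time_test T psi) (tphi : test phi) := time_test_mul_integrable tpsi (pres_int tphi).
have mD := measD 0 T.
split.
- move=> psi c phi1 phi2 tpsi t1 t2; have i1 := im _ _ tpsi t1; have i2 := im _ _ tpsi t2.
  have t3 : test (fun x => c * phi1 x + phi2 x) by apply: testD => //; exact: testZ.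
  rewrite /st_of -(RintegralZl c mD i1) -(RintegralD mD (integrable_mulrl c mD i1) i2).
  have mi (g : R -> R) : mu.-integrable D (EFin \o g) -> measurable_fun D g.
    by move=> /integrableP[/measurable_EFinP].
  apply: ae_eq_Rintegral; first exact: mi (im _ _ tpsi t3).
    exact: mi (integrable_addr mD (integrable_mulrl c mD i1) i2).
  by apply: aetS hB => t _ _ [[lin _] _ _]; rewrite lin// mulrDr mulrCA.
- move=> phi c psi1 psi2 tphi t1 t2; have i1 := im _ _ t1 tphi; have i2 := im _ _ t2 tphi.
  rewrite /st_of -(RintegralZl c mD i1) -(RintegralD mD (integrable_mulrl c mD i1) i2).
  by apply: eq_Rintegral => t _; rewrite mulrDl mulrA.
move=> b c b0 cT; exists (decay_const R * B * T), 4%N => psi phi M N tt tphi HM HN.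
have tpsi : time_test T psi by exists b, c.
have i := im _ _ tpsi tphi; have K0 : 0 <= decay_const R * B * N.
  have N0 : 0 <= N := le_trans (normr_ge0 _) (HN [::] isT 0).
  by apply: mulr_ge0 => //; apply: mulr_ge0 => //; exact: decay_const_ge0.
have M0 : 0 <= M := le_trans (normr_ge0 _) (HM 0%N 0 isT).
apply: le_trans (le_normr_Rintegral mD i) _.
rewrite -lee_fin.
have /ae_Rintegral_le := integrable_norm i.
move=> /(_ (fun=> (M * (decay_const R * B * N))%:E) mD).
rewrite integral_cst//=.
rewrite lebesgue_measure_itv/= lte_fin T0 oppr0 adde0 -EFinM.
rewrite (_ : decay_const R * B * T * M * N = M * (decay_const R * B * N) * T); last by ring.
apply => //; first by move=> t _; rewrite lee_fin mulr_ge0.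
apply: (aet_sub (@subset_refl _ _)); apply: aetS hB => t _ _ [pp e bd].
rewrite lee_fin /= normrM ler_pM//; first exact: (HM 0%N).
by apply: pdistr_bound HN => // xi; have [e1 e2] := e xi; have [b1 b2] := bd xi; rewrite ?e1 ?e2.
Qed.

Lemma pres_mean0 psi : time_test T psi -> st_of T pres psi (fun=> 1) = 0.
Proof.
move=> tpsi; have [B B0 hB] := at_; have t1 := test_cst 2 (1 : R).
have im := time_test_mul_integrable tpsi (pres_int t1).
have -> : st_of T pres psi (fun=> 1) = \int[mu]_(t in D) 0.
  apply: ae_eq_Rintegral => //; first by have /integrableP[/measurable_EFinP] := im.
  apply: aetS hB => t _ _ [_ e _]; rewrite -cos_wave0 (e 0).1.
  by rewrite /pcos /pot_cos big1 ?oppr0 ?mul0r ?mulr0// => k _; rewrite mxE mul0r.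
by rewrite /Rintegral integral0.
Qed.

Lemma pres_associated : associated_pressure T a f u (st_of T pres).
Proof.
split; [exact: pres_stdistr|exact: pres_mean0|].
by move=> k psi phi tpsi tphi; exact: momentum_identity.
Qed.

(** For a fixed [psi] the two momentum equations differ only in the pressure, so the difference of
    the pressures is a distribution in space with zero gradient and zero mean. *)
Lemma associated_unique p : associated_pressure T a f u p -> st_eq T p (st_of T pres).
Proof.
move=> [dp p1 mp] psi phi tpsi tphi.
have [dq q1 mq] := pres_associated.
pose G : functional R 2 := fun chi => p psi chi - st_of T pres psi chi.
(* Continuity in space for fixed [psi] needs a bound on finitely many derivatives of [psi], to be
   put into the joint estimate. *)
have fixed (q : stfunctional R 2) : stdistr T q -> pdistr (q psi).
  move=> [lq _ hq]; split; first by move=> c phi1 phi2; exact: lq.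
  have [b [c [b0 cT tt]]] := tpsi; have [C [m HC]] := hq b c b0 cT.
  have [M HM] := time_test_derive_bound m tt.
  by exists (C * M), m => chi N tchi HN; exact: HC.
have pG : pdistr G.
  by apply: pdistr_addd; [apply: fixed|apply: pdistr_oppd; exact: fixed].
have dG k chi : test chi -> G (partial k chi) = 0.
  move=> tchi; have := mp k psi chi tpsi tchi; rewrite -(mq k psi chi tpsi tchi).
  rewrite /st_partial /partiald /addd /G.
  by move=> /addIr /addrI /oppr_inj ->; rewrite subrr.
have /eqP : G phi = 0 by apply: (gradient_free_eq0 pG dG _ tphi); rewrite /G p1// q1// subrr.
by rewrite subr_eq0 => /eqP.
Qed.

End AssociatedPressure.

Theorem theorem4p14 (R : realType) (T r : R) (a : tensor R 2)
  (f u : R -> vfunctional R 2) (u0 : vfunctional R 2)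
  (hT : 0 < T) (hr : 0 < r)
  (ha_sym : tensor_symmetric a) (ha_ell : relaxed_elliptic a)
  (hf_inf : Linf_vHdot T (r - 2) f) (hf_2 : L2_vHdot T (r - 1) f)
  (hu0 : vHdot_sigma r u0)
  (hu : weak_solution T a f u0 u)
  (hu_energy : strong_energy_inequality T a f u) :
  [/\ serrin_type T a f u0 u,
      exists v : R -> vfunctional R 2,
        [/\ time_derivative T u v,
            Linf_vHdot_sigma T (r - 2) v & L2_vHdot_sigma T (r - 1) v],
      exists p : stfunctional R 2, associated_pressure T a f u p
    & forall p : stfunctional R 2, associated_pressure T a f u p ->
        exists q : R -> functional R 2,
          [/\ st_eq T p (st_of T q),
              Linf_Hdot T (r - 1) q & L2_Hdot T r q]].
Proof.
have [uI u2 uw [v vt mom] ui] := hu.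
have uRI := u_regular_inf hT hr ha_sym ha_ell hf_2 hu0 uI u2 uw vt mom ui.
have uR2 := u_regular_L2 hT hr ha_sym ha_ell hf_2 hu0 uI u2 uw vt mom ui.
split.
- split; first exact: hu.
  (* In dimension two the Serrin exponent $n/2$ is $1$, so the required class is that of the weak
     solution itself. *)
  have -> : 2%:R / 2 = 1 :> R by rewrite divff ?pnatr_eq0.
  exact: u2.
- exists v; split; first exact: vt.
    exact: v_Linf hr ha_sym hf_inf hf_2 uI u2 uw vt mom uRI uR2.
  exact: v_L2 hr ha_sym hf_inf hf_2 uI u2 uw vt mom uRI uR2.
- exists (st_of T (pres a f u)).
  exact: pres_associated hT hr ha_sym hf_inf hf_2 uI u2 uw vt mom uRI uR2.
move=> p hp; exists (pres a f u); split.
- exact: associated_unique hT hr ha_sym hf_inf hf_2 uI u2 uw vt mom uRI uR2 _ hp.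
- exact: pres_Linf hr hf_inf hf_2 uI u2 uw vt mom uRI uR2.
exact: pres_L2 hr hf_inf hf_2 uI u2 uw vt mom uRI uR2.
Qed.
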